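(* Let $N\ge2$ and let $m_0$ be a Lipschitz function on $\mathbb{T}$ such that $R_{m_0}1=1$, $m_0$ has finitely many zeros, and there is at least one $m_0$-cycle. Let $C_1,\dots,C_m$ be all the (distinct) $m_0$-cycles, $C_i=\{z_{i1},\dots,z_{ip_i}\}$ in cyclic order, $z_{ij}=e^{-i\theta_{ij}}$, put $\alpha_{ij}:=m_0(z_{ij})/\sqrt N$, $\alpha_i=(\alpha_{i1},\dots,\alpha_{ip_i})$, and define $\varphi_{C_i}=(\varphi_{C_i,1},\dots,\varphi_{C_i,p_i})$ by $$\widehat{\varphi}_{C_i,k}(x)=\prod_{l=1}^\infty\frac{\overline{\alpha_{i,k-l}}\;m_0\!\left(\frac{x}{N^l}+\theta_{i,k-l}\right)}{\sqrt N},\qquad x\in\mathbb{R},$$ second subscripts of $\alpha$ and $\theta$ being read modulo $p_i$. Let $m_1,\dots,m_{N-1}\in L^\infty(\mathbb{T})$ be such that, with $\rho=e^{2\pi i/N}$, the matrix $\frac1{\sqrt N}\big(m_i(\rho^jz)\big)_{0\le i,j\le N-1}$ is unitary for a.e. $z\in\mathbb{T}$. Let $1\le n<m$. Let $(\mathcal H,\mathcal U,\Pi)=\mathfrak{R}_{C_1,\alpha_1}\oplus\dots\oplus\mathfrak{R}_{C_m,\alpha_m}$ and $(H,U,\pi)=\mathfrak{R}_{C_1,\alpha_1}\oplus\dots\oplus\mathfrak{R}_{C_n,\alpha_n}$, with $H$ regarded as a closed subspace of $\mathcal H$ in the obvious way, and let $P$ be the orthogonal projection of $\mathcal H$ onto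 $H$. Put $$\Psi_i:=\mathcal U^{-1}\Pi(m_i)(\varphi_{C_1}\oplus\dots\oplus\varphi_{C_m}),\qquad \psi_i:=U^{-1}\pi(m_i)(\varphi_{C_1}\oplus\dots\oplus\varphi_{C_n}),\qquad i\in\{1,\dots,N-1\}.$$ Then $\{\mathcal U^j\Pi(z)^k\Psi_i: i\in\{1,\dots,N-1\},\,j,k\in\mathbb{Z}\}$ is an orthonormal basis of $\mathcal H$, the projection $P$ commutes with $\mathcal U$ and with $\Pi(f)$ for all $f\in L^\infty(\mathbb{T})$, and $P\Psi_i=\psi_i$ for all $i$; thus the normalized tight frame $\{U^j\pi(z)^k\psi_i\}$ of $H$ is the image under $P$ of this orthonormal basis.
   Context: Conventions: $\widehat f(\xi)=\int_{\mathbb{R}} f(x)e^{-i\xi x}\,dx$; $\mathbb{T}$ is the unit circle; functions on $\mathbb{T}$ are identified with $2\pi$-periodic functions on $\mathbb{R}$ by $f(\theta)=f(z)$, $z=e^{-i\theta}$. In $\Pi(z)$ and $\pi(z)$, $z$ denotes the identity function on $\mathbb{T}$. The transfer operator is $R_{m_0}f(z)=\frac1N\sum_{w^N=z}|m_0(w)|^2f(w)$. A cycle of length $p$ is a set $\{z_1,\dots,z_p\}$ of distinct points of $\mathbb{T}$ with $z_1^N=z_2,\dots,z_{p-1}^N=z_p,\ z_p^N=z_1$ (cyclic order). It is an $m_0$-cycle if $|m_0(z_k)|=\sqrt N$ for all $k$. The classical operators on $L^2(\mathbb{R})$ are $U_0\xi(x)=\frac1{\sqrt N}\xi(x/N)$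 and, for $f\in L^\infty(\mathbb{T})$, $\pi_0(f)$, which on the Fourier transform side is multiplication by the $2\pi$-periodic function $x\mapsto f(e^{-ix})$. For a cycle $C=\{z_1,\dots,z_p\}$ and $\alpha=(\alpha_1,\dots,\alpha_p)\in\mathbb{T}^p$, $\mathfrak{R}_{C,\alpha}=(L^2(\mathbb{R})^p,U_{C,\alpha},\pi_{C,\alpha})$ with $$U_{C,\alpha}(\xi_1,\dots,\xi_p)=(\alpha_1U_0\xi_2,\alpha_2U_0\xi_3,\dots,\alpha_{p-1}U_0\xi_p,\alpha_pU_0\xi_1),$$ $$\pi_{C,\alpha}(f)(\xi_1,\dots,\xi_p)=(\pi_0(f(z_1z))\xi_1,\dots,\pi_0(f(z_pz))\xi_p).$$ Direct sums of such triples are taken componentwise (Hilbert spaces, unitaries and representations of $L^\infty(\mathbb{T})$). A normalized tight frame for $H$ is a family $(e_k)$ in $H$ with $\sum_k|\langle v\,|\,e_k\rangle|^2=\|v\|^2$ for all $v\in H$. *)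

(* Defs.v *)
From HB Require Import structures.
From mathcomp Require Import all_boot all_order all_algebra ring_quotient.
From mathcomp Require Import complex.
From mathcomp Require Import all_classical all_reals all_analysis.

Set Implicit Arguments.
Unset Strict Implicit.
Unset Printing Implicit Defensive.

Import Order.TTheory GRing.Theory Num.Theory numFieldNormedType.Exports.

Local Open Scope classical_set_scope.
Local Open Scope ring_scope.
Local Open Scope complex_scope.
Local Open Scope quotient_scope.

Record circle (R : realType) := Circle {
  cval :> R[i];
  _ : `|cval| == 1
}.

HB.instance Definition _ (R : realType) := [isSub for @cval R].
HB.instance Definition _ (R : realType) := [Choice of circle R by <:].

Section CircleGroup.
Context {R : realType}.
Implicit Types z w : circle R.

Lemma circle_norm z : `|cval z| = 1.
Proof. exact/eqP/(valP z). Qed.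

Lemma circle_neq0 z : cval z != 0.
Proof. by rewrite -normr_eq0 circle_norm oner_eq0. Qed.

Fact circle_one_subproof : `|1 : R[i]| == 1.
Proof. by rewrite normr1. Qed.

Fact circle_mul_subproof z w : `|cval z * cval w| == 1.
Proof. by rewrite normrM !circle_norm mulr1. Qed.

Fact circle_inv_subproof z : `|(cval z)^-1| == 1.
Proof. by rewrite normfV circle_norm invr1. Qed.

Definition circle_one := Circle circle_one_subproof.
Definition circle_mul z w := Circle (circle_mul_subproof z w).
Definition circle_inv z := Circle (circle_inv_subproof z).

Fact circle_mulA : associative circle_mul.
Proof. by move=> x y z; apply: val_inj; rewrite /= mulrA. Qed.

Fact circle_mul1 : left_id circle_one circle_mul.
Proof. by move=> x; apply: val_inj; rewrite /= mul1r. Qed.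

Fact circle_mulr1 : right_id circle_one circle_mul.
Proof. by move=> x; apply: val_inj; rewrite /= mulr1. Qed.

Fact circle_mulV : left_inverse circle_one circle_inv circle_mul.
Proof. by move=> x; apply: val_inj; rewrite /= mulVf ?circle_neq0. Qed.

Fact circle_mulrV : right_inverse circle_one circle_inv circle_mul.
Proof. by move=> x; apply: val_inj; rewrite /= mulfV ?circle_neq0. Qed.

HB.instance Definition _ := isGroup.Build (circle R)
  circle_mulA circle_mul1 circle_mulr1 circle_mulV circle_mulrV.

Fact cis_subproof (t : R) : `|cos t +i* sin t| == 1.
Proof. by rewrite normc_def /= cos2Dsin2 sqrtr1. Qed.

(* e^{it} *)
Definition cis (t : R) : circle R := Circle (cis_subproof t).

(* the function on the line identified with f, via z = e^{-it} *)
Definition unroll (f : circle R -> R[i]) (t : R) : R[i] := f (cis (- t)).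

End CircleGroup.

Section Filters.
Context {R : realType}.
Implicit Types (N : nat) (f g : circle R -> R[i]).

Definition lipschitz_circle f : Prop :=
  exists L : R[i], forall z w : circle R,
    `|f z - f w| <= L * `|cval z - cval w|.

Definition transfer N f g (z : circle R) : R[i] :=
  N%:R^-1 * \sum_(w \in [set w : circle R | (w ^+ N)%g = z]) `|f w| ^+ 2 * g w.

(* a cycle {z_1, ..., z_p} is given by an enumeration in cyclic order, so the
   set itself is [range z]; [ordS] is the cyclic successor on ['I_p] *)
Definition is_cycle N (p : nat) (z : 'I_p -> circle R) : Prop :=
  [/\ (0 < p)%N, injective z & forall k, (z k ^+ N)%g = z (ordS k)].

Definition sqrtN N : R[i] := (Num.sqrt (N%:R : R))%:C.

Definition is_filter_cycle N f (p : nat) (z : 'I_p -> circle R) : Prop :=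
  is_cycle N z /\ forall k, `|f (z k)| = sqrtN N.

(* k - l modulo p *)
Definition ord_sub (p : nat) (k : 'I_p) (l : nat) : 'I_p :=
  iter l (@ord_pred p) k.

Definition phi_hat N f (p : nat) (alpha : 'I_p -> R[i]) (theta : 'I_p -> R)
    (k : 'I_p) (x : R) : R[i] :=
  lim ((\prod_(1 <= l < L.+1)
          ((alpha (ord_sub k l))^* *
           unroll f (x / N%:R ^+ l + theta (ord_sub k l)) / sqrtN N)
        : R[i]^o) @[L --> \oo]).

End Filters.

Section ComplexLp.
Context {d : measure_display} {T : measurableType d} {R : realType}.
Variables (mu : {measure set T -> \bar R}) (p : \bar R).

Definition cLfun : {pred T -> R[i]} :=
  [pred f : T -> R[i] | (@complex.Re R \o f \in Lfun mu p) &&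
                        (@complex.Im R \o f \in Lfun mu p)].

Lemma cLfun_submod_closed : (1 <= p)%E -> submod_closed cLfun.
Proof.
move=> p1; have [L0 LD] := Lfun_submod_closed mu p1.
have LZ a (f : T -> R) : f \in Lfun mu p -> a *: f \in Lfun mu p.
  by move=> /(LD a f 0)/(_ L0); rewrite addr0.
have LA (f g : T -> R) : f \in Lfun mu p -> g \in Lfun mu p ->
    f + g \in Lfun mu p.
  by move=> /(LD 1 f g)/[apply]; rewrite scale1r.
split; first by rewrite inE; apply/andP; split; exact: L0.
move=> a f g /andP[fr fi] /andP[gr gi]; rewrite inE; apply/andP; split.
  rewrite (_ : _ \o _ = complex.Re a *: (@complex.Re R \o f) +
    ((- complex.Im a) *: (@complex.Im R \o f) + (@complex.Re R \o g))).
    by apply: (LA); rewrite ?LZ// LA// LZ.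
  apply/funext => x /=; rewrite !fctE /=.
  case: a (f x) (g x) => [a b] [u v] [s t] /=.
  by rewrite /GRing.scale/= mulNr addrA.
rewrite (_ : _ \o _ = complex.Re a *: (@complex.Im R \o f) +
  (complex.Im a *: (@complex.Re R \o f) + (@complex.Im R \o g))).
  by apply: (LA); rewrite ?LZ// LA// LZ.
apply/funext => x /=; rewrite !fctE /=.
by case: a (f x) (g x) => [a b] [u v] [s t] /=; rewrite /GRing.scale/= addrA.
Qed.

End ComplexLp.

Section L2.
Context {R : realType}.
Local Notation mu := (@lebesgue_measure R).

Definition sqint : {pred measurableTypeR R -> R[i]} := cLfun mu 2%:E.

Fact sqint_submod_closed : submod_closed sqint.
Proof. by apply: cLfun_submod_closed; rewrite lee_fin ler1n. Qed.

HB.instance Definition _ := GRing.isSubmodClosed.Build R[i]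
  (measurableTypeR R -> R[i]) sqint sqint_submod_closed.

Record L2fun := MkL2fun {
  L2fun_val :> measurableTypeR R -> R[i];
  _ : L2fun_val \in sqint
}.

HB.instance Definition _ := [isSub for L2fun_val].
HB.instance Definition _ := [Choice of L2fun by <:].
HB.instance Definition _ := [SubChoice_isSubLmodule of L2fun by <:].

Definition ae_zero : {pred L2fun} :=
  fun f => `[< {ae mu, forall x, f x = 0} >].

Fact ae_zero_submod_closed : submod_closed ae_zero.
Proof.
split; first by apply/asboolP; exact: aeW.
move=> a f g /asboolP f0 /asboolP g0; apply/asboolP.
apply: filterS2 f0 g0 => x f0 g0.
have -> : (a *: f + g) x = a * f x + g x by [].
by rewrite f0 g0 mulr0 addr0.
Qed.

HB.instance Definition _ := GRing.isSubmodClosed.Build R[i] L2fun ae_zero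
  ae_zero_submod_closed.

(* L^2(R) with complex values; measurability is with respect to the Borel
   sets, which changes nothing up to almost everywhere equality *)
Definition L2 : Type := Quotient.quot (ae_zero : zmodClosed L2fun).

HB.instance Definition _ := GRing.Zmodule.on L2.
HB.instance Definition _ := Quotient.on L2.

Lemma L2E (u : L2) : exists f : L2fun, u = \pi_L2 f.
Proof. by exists (repr u); rewrite reprK. Qed.

Lemma L2_piD (f g : L2fun) : \pi_L2 (f + g) = \pi_L2 f + \pi_L2 g.
Proof. exact: Quotient.pi_add. Qed.

Definition L2_scale (a : R[i]) (u : L2) : L2 := \pi_L2 (a *: repr u).

Lemma L2_scale_pi (a : R[i]) (f : L2fun) :
  L2_scale a (\pi_L2 f) = \pi_L2 (a *: f).
Proof.
apply/eqP; rewrite -Quotient.idealrBE -scalerBr rpredZ//.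
by rewrite Quotient.idealrBE reprK.
Qed.

Fact L2_scaleA a b u : L2_scale a (L2_scale b u) = L2_scale (a * b) u.
Proof. by case: (L2E u) => f ->; rewrite !L2_scale_pi scalerA. Qed.

Fact L2_scale1 : left_id 1 L2_scale.
Proof. by move=> u; case: (L2E u) => f ->; rewrite L2_scale_pi scale1r. Qed.

Fact L2_scaleDr : right_distributive L2_scale +%R.
Proof.
move=> a u v; case: (L2E u) => f ->; case: (L2E v) => g ->.
by rewrite -L2_piD !L2_scale_pi scalerDr L2_piD.
Qed.

Fact L2_scaleDl u : {morph L2_scale^~ u : a b / a + b}.
Proof.
move=> a b; case: (L2E u) => f ->.
by rewrite !L2_scale_pi scalerDl L2_piD.
Qed.

HB.instance Definition _ := GRing.Zmodule_isLmodule.Build R[i] L2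
  L2_scaleA L2_scale1 L2_scaleDr L2_scaleDl.

Definition L2_fun (u : L2) : R -> R[i] := repr u.
Coercion L2_fun : L2 >-> Funclass.

(* the class of f if f is square integrable, and 0 otherwise *)
Definition to_L2 (f : R -> R[i]) : L2 :=
  if insub (f : measurableTypeR R -> R[i]) is Some g then \pi_L2 (g : L2fun)
  else 0.

Definition cintegral (D : set R) (f : R -> R[i]) : R[i] :=
  (\int[mu]_(x in D) complex.Re (f x)) +i* (\int[mu]_(x in D) complex.Im (f x)).

Definition L2_dot (u v : L2) : R[i] := cintegral setT (fun x => u x * (v x)^*).

(* The Fourier transform on L^2(R) is the limit in L^2(R), for n tending to
   infinity, of the integrals of f(x) e^{-i xi x} over [-n, n]. *)
Definition truncated_fourier (f : R -> R[i]) (n : nat) (xi : R) : R[i] :=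
  cintegral `[- n%:R, n%:R] (fun x => f x * cis (- (xi * x))).

Definition fourier (u : L2) : L2 := xget 0 [set v : L2 |
  (\int[mu]_xi
     (complex.Re (`|truncated_fourier u n xi - v xi| ^+ 2))%:E)%E @[n --> \oo]
  --> 0%E].

End L2.
Arguments L2 : clear implicits.

(* the inverse of a bijective operator *)
Definition op_inv {V : zmodType} (A : V -> V) : V -> V :=
  'pinv_(fun=> 0) setT A.

Definition op_pow {V : zmodType} (A : V -> V) (k : int) : V -> V :=
  match k with
  | Posz n => iter n A
  | Negz n => iter n.+1 (op_inv A)
  end.

Section InnerProduct.
Context {R : realType} {V : lmodType R[i]} (dot : V -> V -> R[i]).

Definition sqnorm (v : V) : R := complex.Re (dot v v).

Definition orthonormal_basis {I : choiceType} (e : I -> V) : Prop :=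
  (forall i j, dot (e i) (e j) = (i == j)%:R) /\
  (forall v (eps : R), 0 < eps -> exists (s : seq I) (c : I -> R[i]),
     sqnorm (v - \sum_(i <- s) c i *: e i) < eps).

Definition normalized_tight_frame {I : choiceType} (e : I -> V) : Prop :=
  forall v, (\esum_(i in [set: I]) (complex.Re (`|dot v (e i)| ^+ 2))%:E =
    (sqnorm v)%:E)%E.

Definition orth_proj (S : set V) (v : V) : V :=
  xget 0 [set h | S h /\ forall s, S s -> dot (v - h) s = 0].

End InnerProduct.

(* Hilbert space, unitary, representation of L^infinity(T) *)
Record triple (R : realType) := Triple {
  space :> lmodType R[i];
  dot : space -> space -> R[i];
  opU : space -> space;
  opPi : (circle R -> R[i]) -> space -> space
}.

Section Triples.
Context {R : realType}.
Local Notation mu := (@lebesgue_measure R).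

(* The normalized Haar measure of T and Lebesgue measure on the line have the
   same null sets under the identification of functions on T with periodic
   functions. *)
Definition Linf_circle : set (circle R -> R[i]) :=
  [set f | (unroll f : measurableTypeR R -> R[i]) \in cLfun mu +oo].

Definition U0 (N : nat) (u : L2 R) : L2 R :=
  to_L2 (fun x => (sqrtN N)^-1 * u (x / N%:R)).

Definition pi0 (f : circle R -> R[i]) (u : L2 R) : L2 R :=
  op_inv fourier (to_L2 (fun x => unroll f x * fourier u x)).

Definition cycle_triple (N p : nat) (z : 'I_p -> circle R)
    (alpha : 'I_p -> R[i]) : triple R :=
  @Triple R ('I_p -> L2 R)
    (fun u v => \sum_(k < p) L2_dot (u k) (v k))
    (fun u k => alpha k *: U0 N (u (ordS k)))
    (fun f u k => pi0 (fun w => f (z k * w)%g) (u k)).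

Definition phi_cycle (N : nat) (f : circle R -> R[i]) (p : nat)
    (alpha : 'I_p -> R[i]) (theta : 'I_p -> R) : 'I_p -> L2 R :=
  fun k => op_inv fourier (to_L2 (phi_hat N f alpha theta k)).

End Triples.

Section DirectSum.
Context {R : realType} (T : nat -> triple R) (n : nat).

Definition dsum_space : Type := forall i : 'I_n, T i.

HB.instance Definition _ := gen_eqMixin dsum_space.
HB.instance Definition _ := gen_choiceMixin dsum_space.

Implicit Types u v : dsum_space.

Definition dsum_zero : dsum_space := fun=> 0.
Definition dsum_add u v : dsum_space := fun i => u i + v i.
Definition dsum_opp u : dsum_space := fun i => - u i.
Definition dsum_scale (a : R[i]) u : dsum_space := fun i => a *: u i.

Lemma dsumP u v : (forall i, u i = v i) -> u = v.
Proof. exact: functional_extensionality_dep. Qed.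

Fact dsum_addA : associative dsum_add.
Proof. by move=> u v w; apply: dsumP => i; exact: addrA. Qed.
Fact dsum_addC : commutative dsum_add.
Proof. by move=> u v; apply: dsumP => i; exact: addrC. Qed.
Fact dsum_add0 : left_id dsum_zero dsum_add.
Proof. by move=> u; apply: dsumP => i; exact: add0r. Qed.
Fact dsum_addN : left_inverse dsum_zero dsum_opp dsum_add.
Proof. by move=> u; apply: dsumP => i; exact: addNr. Qed.

HB.instance Definition _ := GRing.isZmodule.Build dsum_space
  dsum_addA dsum_addC dsum_add0 dsum_addN.

Fact dsum_scaleA a b u : dsum_scale a (dsum_scale b u) = dsum_scale (a * b) u.
Proof. by apply: dsumP => i; exact: scalerA. Qed.
Fact dsum_scale1 : left_id 1 dsum_scale.
Proof. by move=> u; apply: dsumP => i; exact: scale1r. Qed.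
Fact dsum_scaleDr : right_distributive dsum_scale +%R.
Proof. by move=> a u v; apply: dsumP => i; exact: scalerDr. Qed.
Fact dsum_scaleDl u : {morph dsum_scale^~ u : a b / a + b}.
Proof. by move=> a b; apply: dsumP => i; exact: scalerDl. Qed.

HB.instance Definition _ := GRing.Zmodule_isLmodule.Build R[i] dsum_space
  dsum_scaleA dsum_scale1 dsum_scaleDr dsum_scaleDl.

(* T 0 (+) ... (+) T (n - 1) *)
Definition dsum : triple R :=
  @Triple R dsum_space
    (fun u v => \sum_(i < n) dot (u i) (v i))
    (fun u i => opU (u i))
    (fun f u i => opPi f (u i)).

End DirectSum.

(* For n <= m, the inclusion of the direct sum of the first n triples into that
   of the first m ones: extension by 0. *)
Definition dsum_incl {R : realType} (T : nat -> triple R) (n m : nat)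
    (u : dsum T n) : dsum T m :=
  fun i => if boolP (i < n)%N is AltTrue lt_in then u (Ordinal lt_in) else 0.

(* Main.v *)
(** On the Fourier side the points z_ij of the cycles index a family of functions
phi_a in which the dilation shifts a along its cycle and multiplies x by N, and f
acts by multiplication with the 2 pi-periodic function t |-> f(e^{-it}) translated
by theta_a.

The key identity is h(t) := sum_a sum_l |phi_a (t - theta_a + 2 pi l)|^2 = 1 for
all t.  The truncated products give h <= 1.  If h had a minimum below 1, the set K
where it is attained would be compact, and would contain every N-th root w of its
points with m0 w <> 0.  If some point of K has no zero of m0 among its iterated N-th
roots, then all these roots lie in K, and they are dense.  Otherwise K lies in the
forward orbits of the finitely many zeros; its points are then periodic with a single
N-th root outside the zeros, which makes their orbits m0-cycles.  In both cases K
meets a cycle, where h = 1: a contradiction.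

For v in the big space, G_v(t) := sum_a sum_l v_a conj(phi_a) (t - theta_a + 2 pi l)
is the periodic function whose Fourier coefficients are the coefficients of v
against the integer translates of phi.  By the unitarity of the filter matrix
and Parseval on the circle, the coefficients against the wavelets of one scale have
square sum Q(U v) - Q(v), where Q(v) is the normalized square norm of G_v on a
period.  This telescopes over the scales: on bounded functions with support away
from 0, Q(U^j v) tends to |v|^2 for j -> +oo, because phi_a is continuous with
|phi_a(0)| = 1, and to 0 for j -> -oo, because h <= 1.  So the Parseval identity
holds on a dense set, hence everywhere; and h = 1 makes every wavelet a unit
vector, so that the family is orthonormal.  Projecting onto the first n summands
gives the tight frame. *)

Require Import Defs.
From HB Require Import structures.
From mathcomp Require Import all_boot all_order all_algebra.
From mathcomp Require Import complex.
From mathcomp Require Import all_classical all_reals all_analysis measurable_realfun.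
From mathcomp Require Import ring lra zify.

Set Implicit Arguments.
Unset Strict Implicit.
Unset Printing Implicit Defensive.

Import Order.TTheory GRing.Theory Num.Theory numFieldNormedType.Exports.

Local Open Scope classical_set_scope.
Local Open Scope ring_scope.
Local Open Scope complex_scope.

(** * Complex-valued functions on the line *)

Section Complex.
Context {R : realType}.
Implicit Types (z w : R[i]) (t : R).

(** Orthogonality is never computed. Parseval applied to a member of the family, itself of norm 1,
    leaves nothing for its coefficients against the other members, so only norms and sums of squares
    have to be found. These are taken in [\bar R], where nonnegative sums and integrals may be
    interchanged freely. The bracket series is infinite in general, so Parseval is proved first on
    bounded test functions supported in an annulus, for which it is a finite sum. The outer radius
    lets positive powers of U push the support to where |phi_a|^2 is close to 1; the inner radius
    lets negative powers push it out to where phi_a has a small tail. A wavelet carries U^{-1}.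
    Moving U^{1-j} to the other side of the inner product turns every coefficient into an integral
    against e^{-iNkt} m_i(t); these are the Fourier coefficients of a function folded N times.
    [fourier] and its inverse are chosen objects, so Plancherel and surjectivity come first. The
    high-pass filters obey their relations only almost everywhere and are replaced by periodic
    representatives bounded by sqrt N at every point; m_0 satisfies R_{m_0}1 = 1 at every point,
    which h = 1 relies on. *)

Definition nsq z : R := complex.Re z ^+ 2 + complex.Im z ^+ 2.

Lemma nsqE z : (nsq z)%:C = `|z| ^+ 2.
Proof. exact: add_Re2_Im2. Qed.

Lemma Re_sqr_norm z : complex.Re (`|z| ^+ 2) = nsq z.
Proof. by rewrite -nsqE. Qed.

Lemma nsq_ge0 z : 0 <= nsq z.
Proof. by rewrite addr_ge0 ?sqr_ge0. Qed.

Lemma nsq0 : nsq 0 = 0.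
Proof. by rewrite /nsq /= !expr0n addr0. Qed.

Lemma nsq1 : nsq 1 = 1.
Proof. by rewrite /nsq /= expr0n expr1n addr0. Qed.

Lemma nsq_eq0 z : nsq z = 0 -> z = 0.
Proof.
move=> /eqP; rewrite paddr_eq0 ?sqr_ge0// !sqrf_eq0 => /andP[/eqP a /eqP b].
by apply/eqP; rewrite eq_complex a b !eqxx.
Qed.

Lemma nsqM z w : nsq (z * w) = nsq z * nsq w.
Proof. by case: z w => [a b] [c d]; rewrite /nsq /=; ring. Qed.

Lemma nsqJ z : nsq z^* = nsq z.
Proof. by case: z => [a b]; rewrite /nsq /=; ring. Qed.

Lemma nsqN z : nsq (- z) = nsq z.
Proof. by case: z => [a b]; rewrite /nsq /=; ring. Qed.

Lemma nsqR t : nsq t%:C = t ^+ 2.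
Proof. by rewrite /nsq /= expr0n addr0. Qed.

Lemma nsqV z : nsq z^-1 = (nsq z)^-1.
Proof.
have [->|z0] := eqVneq z 0; first by rewrite invr0 nsq0 invr0.
have n0 : nsq z != 0 by apply: contra z0 => /eqP/nsq_eq0 ->.
by apply: (mulfI n0); rewrite -nsqM !mulfV// nsq1.
Qed.

Lemma nsqD_le z w : nsq (z + w) <= 2 * nsq z + 2 * nsq w.
Proof.
case: z w => [a b] [c d]; rewrite /nsq /=.
have := sqr_ge0 (a - c); have := sqr_ge0 (b - d); nra.
Qed.

Lemma nsq_conjM z : z * z^* = (nsq z)%:C.
Proof. by case: z => [a b]; apply/eqP; rewrite eq_complex /nsq /=; apply/andP; split; apply/eqP; ring. Qed.

Lemma nsq_norm1 z : `|z| = 1 -> nsq z = 1.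
Proof. by move=> z1; rewrite -Re_sqr_norm z1 expr1n. Qed.

Lemma nsq_circle (c : circle R) : nsq (cval c) = 1.
Proof. by rewrite nsq_norm1// circle_norm. Qed.

Lemma Re_sqr_le z : complex.Re z ^+ 2 <= nsq z.
Proof. by rewrite lerDl sqr_ge0. Qed.

Lemma Im_sqr_le z : complex.Im z ^+ 2 <= nsq z.
Proof. by rewrite lerDr sqr_ge0. Qed.

(** The modulus as a real number: the norm of [R[i]] takes values in [R[i]], so it can neither be
    integrated nor passed to [lra]. *)
Definition cabs z : R := Num.sqrt (nsq z).

Lemma cabsE z : `|z| = (cabs z)%:C.
Proof. exact: normc_def. Qed.

Lemma cabs_ge0 z : 0 <= cabs z. Proof. exact: sqrtr_ge0. Qed.

Lemma cabs_sqr z : cabs z ^+ 2 = nsq z.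
Proof. by rewrite sqr_sqrtr// nsq_ge0. Qed.

Lemma cabsM z w : cabs (z * w) = cabs z * cabs w.
Proof. by rewrite /cabs nsqM sqrtrM// nsq_ge0. Qed.

Lemma cabsD z w : cabs (z + w) <= cabs z + cabs w.
Proof. by rewrite -lecR rmorphD /= -!cabsE ler_normD. Qed.

Lemma cabsN z : cabs (- z) = cabs z. Proof. by rewrite /cabs nsqN. Qed.
Lemma cabsJ z : cabs z^* = cabs z. Proof. by rewrite /cabs nsqJ. Qed.
Lemma cabs0 : cabs 0 = 0. Proof. by rewrite /cabs nsq0 sqrtr0. Qed.
Lemma cabs1 : cabs 1 = 1. Proof. by rewrite /cabs nsq1 sqrtr1. Qed.
Lemma cabsR t : cabs t%:C = `|t|. Proof. by rewrite /cabs nsqR sqrtr_sqr. Qed.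
Lemma cabs_circle (c : circle R) : cabs (cval c) = 1.
Proof. by rewrite /cabs nsq_circle sqrtr1. Qed.

Lemma Re_le_cabs z : `|complex.Re z| <= cabs z.
Proof. by rewrite -sqrtr_sqr ler_wsqrtr// Re_sqr_le. Qed.

Lemma Im_le_cabs z : `|complex.Im z| <= cabs z.
Proof. by rewrite -sqrtr_sqr ler_wsqrtr// Im_sqr_le. Qed.

Lemma cabs_le_ReIm z : cabs z <= `|complex.Re z| + `|complex.Im z|.
Proof.
rewrite -(ler_pXn2r (n := 2)) ?nnegrE ?cabs_ge0 ?addr_ge0//.
rewrite cabs_sqr /nsq -(real_normK (num_real (complex.Re z))).
rewrite -(real_normK (num_real (complex.Im z))) sqrrD lerD2r lerDl.
by rewrite mulrn_wge0// mulr_ge0.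
Qed.

Lemma cabs_eq0 z : cabs z = 0 -> z = 0.
Proof. by move=> z0; apply: nsq_eq0; rewrite -cabs_sqr z0 expr0n. Qed.

Lemma ReD z w : complex.Re (z + w) = complex.Re z + complex.Re w.
Proof. by case: z w => [a b] [c d]. Qed.
Lemma ImD z w : complex.Im (z + w) = complex.Im z + complex.Im w.
Proof. by case: z w => [a b] [c d]. Qed.
Lemma ReN z : complex.Re (- z) = - complex.Re z. Proof. by case: z. Qed.
Lemma ImN z : complex.Im (- z) = - complex.Im z. Proof. by case: z. Qed.
Lemma cReM z w : complex.Re (z * w) =
  complex.Re z * complex.Re w - complex.Im z * complex.Im w.
Proof. by case: z w => [a b] [c d]. Qed.
Lemma cImM z w : complex.Im (z * w) =
  complex.Re z * complex.Im w + complex.Im z * complex.Re w.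
Proof. by case: z w => [a b] [c d]. Qed.
Lemma cReRM t z : complex.Re (t%:C * z) = t * complex.Re z.
Proof. by rewrite cReM /= mul0r subr0. Qed.
Lemma cImRM t z : complex.Im (t%:C * z) = t * complex.Im z.
Proof. by rewrite cImM /= mul0r addr0. Qed.
Lemma ReJ z : complex.Re z^* = complex.Re z. Proof. by case: z. Qed.
Lemma ImJ z : complex.Im z^* = - complex.Im z. Proof. by case: z. Qed.
(** The two conjugation notations are convertible but print and match differently; this lemma
    switches between them before a rewrite. *)
Lemma NconjE z : (z^*)%R = (z^*)%C.
Proof. by []. Qed.
Lemma conjCM z w : ((z * w)^*)%C = (z^*)%C * (w^*)%C.
Proof. exact: rmorphM. Qed.
Lemma conjCR t : (t%:C)^* = t%:C :> R[i].
Proof. by rewrite /= /conjc /= oppr0. Qed.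
Lemma ReIm_inj z w : complex.Re z = complex.Re w -> complex.Im z = complex.Im w ->
  z = w.
Proof. by case: z w => [a b] [c d] /= -> ->. Qed.
Lemma Re_sum I (r : seq I) (P : pred I) (F : I -> R[i]) :
  complex.Re (\sum_(i <- r | P i) F i) = \sum_(i <- r | P i) complex.Re (F i).
Proof. exact: (big_morph _ ReD). Qed.
Lemma Im_sum I (r : seq I) (P : pred I) (F : I -> R[i]) :
  complex.Im (\sum_(i <- r | P i) F i) = \sum_(i <- r | P i) complex.Im (F i).
Proof. exact: (big_morph _ ImD). Qed.

Lemma cisD t u : cval (cis (t + u)) = cval (cis t) * cval (cis u).
Proof. by apply: ReIm_inj; rewrite /= ?cReM ?cImM /= (cosD, sinD)//; ring. Qed.

Lemma cisN t : cval (cis (- t)) = (cval (cis t))^*.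
Proof. by apply: ReIm_inj; rewrite /= ?cosN ?sinN. Qed.

Lemma cis0 : cval (cis 0) = 1 :> R[i].
Proof. by apply: ReIm_inj; rewrite /= ?cos0 ?sin0. Qed.

Lemma cisD_circle t u : cis (t + u) = (cis t * cis u)%g.
Proof. by apply: val_inj; exact: cisD. Qed.

Lemma cis_circleX t n : (cis t ^+ n)%g = cis (n%:R * t).
Proof.
elim: n => [|n IH]; first by rewrite expg0 mul0r; apply: val_inj; rewrite /= cos0 sin0.
by rewrite expgS IH -cisD_circle -[n.+1]add1n natrD mulrDl mul1r.
Qed.

Lemma cis_2pi (k : int) t : cis (t + k%:~R * (2 * pi)) = cis t.
Proof.
have H (n : nat) (s : R) : cis (s + n%:R * (2 * pi)) = cis s.
  elim: n s => [|n IH] s; first by rewrite mul0r addr0.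
  rewrite -[n.+1]addn1 natrD mulrDl mul1r addrA -[RHS](IH s).
  have -> : 2 * pi = pi *+ 2 :> R by rewrite mulr_natl.
  by apply: val_inj; apply: ReIm_inj; rewrite /= ?cosD2pi ?sinD2pi.
case: k => n; first exact: H.
by rewrite -[LHS](H n.+1); congr cis; rewrite NegzE mulrNz mulNr addrNK.
Qed.

(** Reducing modulo 2 pi leaves [u] in [0, 2 pi[ with cos u = 1. Injectivity of cos on [0, pi],
    applied to [u] or to 2 pi - u, gives u = 0; the second case is contradictory. *)
Lemma cis_eq1 t : cis t = cis 0 -> exists k : int, t = k%:~R * (2 * pi).
Proof.
pose k := Num.floor (t / (2 * pi)).
have p0 : 0 < 2 * pi :> R by rewrite mulr_gt0 ?pi_gt0.
pose u := t - k%:~R * (2 * pi).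
have [u0 u2] : 0 <= u /\ u < 2 * pi.
  have /real_floor_itv := num_real (t / (2 * pi)).
  rewrite -/k ler_pdivlMr// ltr_pdivrMr// intrD mulrDl mul1r /u => /andP[h1 h2].
  by split; lra.
move=> h; exists k; suff : u = 0 by rewrite /u; lra.
have : cis u = cis 0.
  by rewrite -h /u -[in RHS](cis_2pi (- k) t); congr cis; rewrite mulrNz; ring.
move=> /(congr1 (fun c => complex.Re (cval c))) /=; rewrite cos0 => cu.
case: (leP u pi) => [upi|upi].
  by rewrite -(@cosK _ u) ?in_itv/= ?u0// cu -cos0 cosK// in_itv/= lexx pi_ge0.
have cv : cos (2 * pi - u) = 1.
  by rewrite -cosN opprB -[RHS]cu -(cosD2pi (u - _)) -mulr_natl; congr cos; ring.
suff : 2 * pi - u = 0 by lra.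
by rewrite -(@cosK _ (2 * pi - u)) ?in_itv/=; [rewrite cv -cos0 cosK// in_itv/= lexx pi_ge0|lra].
Qed.

Lemma cis_eq t u : cis t = cis u -> exists k : int, t = u + k%:~R * (2 * pi).
Proof.
move=> h; have /cis_eq1[k hk] : cis (t - u) = cis 0.
  by rewrite cisD_circle h -cisD_circle subrr.
by exists k; lra.
Qed.

Lemma cis_surj (c : circle R) : exists t, c = cis t.
Proof.
have := nsq_circle c; case: c => [[a b] ab] /=; rewrite /nsq /= => e.
have a1 : -1 <= a <= 1 by have := sqr_ge0 b; nra.
have [/andP[c0 cpi] ca] := acos_def a1.
have sb : (sin (acos a)) ^+ 2 = b ^+ 2 by have := cos2Dsin2 (acos a); rewrite ca; lra.
have [b0|b0] := leP 0 b.
  exists (acos a); apply: val_inj; apply: ReIm_inj; rewrite /= ?ca//.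
  apply/esym/(@pexpIrn _ 2) => //; rewrite ?nnegrE//.
  by apply: sin_ge0_pi; rewrite c0.
exists (- acos a); apply: val_inj; apply: ReIm_inj; rewrite /= ?cosN ?ca ?sinN//.
apply/esym/(canLR (opprK)); apply/(@pexpIrn _ 2) => //; rewrite ?nnegrE ?sqrrN//.
  by apply: sin_ge0_pi; rewrite c0.
by rewrite oppr_ge0 ltW.
Qed.

End Complex.

(** * Measurability, integrals and square integrals of complex functions *)

Section ComplexIntegral.
Context {d : measure_display} {T : measurableType d} {R : realType}.
Variable mu : {measure set T -> \bar R}.
Implicit Types f g : T -> R[i].

Definition cmeas f : Prop :=
  measurable_fun setT (fun x => complex.Re (f x)) /\
  measurable_fun setT (fun x => complex.Im (f x)).

Lemma cmeas_cst (c : R[i]) : cmeas (fun=> c).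
Proof. by split; exact: measurable_cst. Qed.

Lemma cmeasD f g : cmeas f -> cmeas g -> cmeas (fun x => f x + g x).
Proof.
move=> [f1 f2] [g1 g2]; split.
  by under eq_fun do rewrite ReD; exact: measurable_funD.
by under eq_fun do rewrite ImD; exact: measurable_funD.
Qed.

Lemma cmeasN f : cmeas f -> cmeas (fun x => - f x).
Proof.
move=> [f1 f2]; split.
  by under eq_fun do rewrite ReN; exact: measurableT_comp (@oppr_measurable _ _) _.
by under eq_fun do rewrite ImN; exact: measurableT_comp (@oppr_measurable _ _) _.
Qed.

Lemma cmeasB f g : cmeas f -> cmeas g -> cmeas (fun x => f x - g x).
Proof. by move=> mf mg; apply: cmeasD => //; exact: cmeasN. Qed.

Lemma cmeasM f g : cmeas f -> cmeas g -> cmeas (fun x => f x * g x).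
Proof.
move=> [f1 f2] [g1 g2]; split.
  under eq_fun do rewrite cReM.
  by apply: measurable_funB; exact: measurable_funM.
under eq_fun do rewrite cImM.
by apply: measurable_funD; exact: measurable_funM.
Qed.

Lemma cmeasJ f : cmeas f -> cmeas (fun x => (f x)^*).
Proof.
move=> [f1 f2]; split.
  by under eq_fun do rewrite ReJ.
by under eq_fun do rewrite ImJ; exact: measurableT_comp (@oppr_measurable _ _) _.
Qed.

Lemma cmeas_real (h : T -> R) : measurable_fun setT h -> cmeas (fun x => (h x)%:C).
Proof. by move=> mh; split. Qed.

Lemma cmeas_sum I (r : seq I) (P : pred I) (F : I -> T -> R[i]) :
  (forall i, P i -> cmeas (F i)) -> cmeas (fun x => \sum_(i <- r | P i) F i x).
Proof.
move=> mF; elim: r => [|i r IH].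
  by under eq_fun do rewrite big_nil; exact: cmeas_cst.
under eq_fun do rewrite big_cons.
by case: (P i) (mF i) => // mFi; apply: cmeasD => //; exact: mFi.
Qed.

Lemma cmeas_indic (A : set T) : measurable A -> cmeas (fun x => (\1_A x)%:C).
Proof. by move=> mA; apply: cmeas_real; exact: measurable_indic. Qed.

Lemma measurable_nsq f : cmeas f -> measurable_fun setT (fun x => nsq (f x)).
Proof.
by move=> [f1 f2]; apply: measurable_funD; exact: measurable_funX.
Qed.

Lemma measurable_cabs f : cmeas f -> measurable_fun setT (fun x => cabs (f x)).
Proof.
by move=> mf; apply: measurableT_comp (measurable_nsq mf) => //;
  exact: continuous_measurable_fun (@sqrt_continuous R).
Qed.

(** Over Lebesgue measure this is [cintegral] on the whole line by conversion; keeping [mu]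
    arbitrary lets the notions around it serve product measures and restrictions to a period as
    well. *)
Definition cint f : R[i] :=
  (\int[mu]_x complex.Re (f x)) +i* (\int[mu]_x complex.Im (f x)).

Definition cintegrable f : Prop :=
  mu.-integrable setT (fun x => (complex.Re (f x))%:E) /\
  mu.-integrable setT (fun x => (complex.Im (f x))%:E).

Lemma cintegrable_meas f : cintegrable f -> cmeas f.
Proof.
by move=> [/measurable_int/measurable_EFinP f1 /measurable_int/measurable_EFinP f2].
Qed.

Lemma cintegrable_le f (h : T -> R) : cmeas f ->
  mu.-integrable setT (fun x => (h x)%:E) ->
  (forall x, cabs (f x) <= h x) -> cintegrable f.
Proof.
move=> [f1 f2] ih fh; split; apply: (le_integrable _ _ _ ih) => //.
- exact/measurable_EFinP.
- move=> x _ /=; rewrite lee_fin (le_trans (Re_le_cabs _))//.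
  by rewrite (le_trans (fh x))// ler_norm.
- exact/measurable_EFinP.
- move=> x _ /=; rewrite lee_fin (le_trans (Im_le_cabs _))//.
  by rewrite (le_trans (fh x))// ler_norm.
Qed.

Lemma integrable_cabs f : cintegrable f ->
  mu.-integrable setT (fun x => (cabs (f x))%:E).
Proof.
move=> /[dup] /cintegrable_meas mf [f1 f2].
have := integrableD measurableT (integrable_abse f1) (integrable_abse f2).
apply: le_integrable => //; first exact/measurable_EFinP/measurable_cabs.
move=> x _ /=; rewrite lee_fin (ger0_norm (cabs_ge0 _)).
by rewrite (le_trans (cabs_le_ReIm _))// ler_norm.
Qed.

Lemma cintegrableD f g : cintegrable f -> cintegrable g ->
  cintegrable (fun x => f x + g x).
Proof.
move=> [f1 f2] [g1 g2]; split.
  by under eq_fun do rewrite ReD EFinD; exact: integrableD.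
by under eq_fun do rewrite ImD EFinD; exact: integrableD.
Qed.

Lemma integrable_EFinZ (k : R) (h : T -> R) :
  mu.-integrable setT (fun x => (h x)%:E) ->
  mu.-integrable setT (fun x => (k * h x)%:E).
Proof. by move=> ih; under eq_fun do rewrite EFinM; exact: integrableZl. Qed.

Lemma cintegrableZ (c : R[i]) f : cintegrable f -> cintegrable (fun x => c * f x).
Proof.
move=> [f1 f2]; split.
  under eq_fun do rewrite cReM EFinB !EFinM.
  by apply: integrableB => //; exact: integrableZl.
under eq_fun do rewrite cImM EFinD !EFinM.
by apply: integrableD => //; exact: integrableZl.
Qed.

Lemma cintegrableN f : cintegrable f -> cintegrable (fun x => - f x).
Proof.
by move=> fi; under eq_fun do rewrite -mulN1r; exact: cintegrableZ.
Qed.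

Lemma cintegrableJ f : cintegrable f -> cintegrable (fun x => (f x)^*).
Proof.
move=> [f1 f2]; split; first by under eq_fun do rewrite ReJ.
by under eq_fun do rewrite ImJ EFinN; exact: integrableN.
Qed.

Lemma cintegrable0 : cintegrable (fun=> 0).
Proof. by split; exact: integrable0. Qed.

Lemma cintegrable_sum I (r : seq I) (F : I -> T -> R[i]) :
  (forall i, cintegrable (F i)) -> cintegrable (fun x => \sum_(i <- r) F i x).
Proof.
move=> mF; elim: r => [|i r IH].
  by under eq_fun do rewrite big_nil; exact: cintegrable0.
under eq_fun do rewrite big_cons.
by apply: cintegrableD => //; exact: mF.
Qed.

Lemma cintD f g : cintegrable f -> cintegrable g ->
  cint (fun x => f x + g x) = cint f + cint g.
Proof.
move=> [f1 f2] [g1 g2]; rewrite /cint; apply: ReIm_inj => /=.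
  by under eq_Rintegral do rewrite ReD; exact: RintegralD.
by under eq_Rintegral do rewrite ImD; exact: RintegralD.
Qed.

Lemma cintZ (c : R[i]) f : cintegrable f -> cint (fun x => c * f x) = c * cint f.
Proof.
move=> [f1 f2]; rewrite /cint; apply: ReIm_inj; rewrite ?cReM ?cImM /=.
  under eq_Rintegral do rewrite cReM.
  rewrite RintegralB ?RintegralZl//.
    exact: integrable_EFinZ.
  exact: integrable_EFinZ.
under eq_Rintegral do rewrite cImM.
rewrite RintegralD ?RintegralZl//.
  exact: integrable_EFinZ.
exact: integrable_EFinZ.
Qed.

Lemma cint0 : cint (fun=> 0) = 0.
Proof. by apply: ReIm_inj; rewrite /= Rintegral_cst// mul0r. Qed.

Lemma cintJ f : cintegrable f -> cint (fun x => (f x)^*) = (cint f)^*.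
Proof.
move=> [f1 f2]; rewrite /cint; apply: ReIm_inj; rewrite ?ReJ ?ImJ /=.
  by under eq_Rintegral do rewrite ReJ.
under eq_Rintegral do rewrite ImJ -mulN1r.
by rewrite RintegralZl// mulN1r.
Qed.

Lemma cint_sum I (r : seq I) (F : I -> T -> R[i]) :
  (forall i, cintegrable (F i)) ->
  cint (fun x => \sum_(i <- r) F i x) = \sum_(i <- r) cint (F i).
Proof.
move=> mF; elim: r => [|i r IH].
  by under eq_fun do rewrite big_nil; rewrite cint0 big_nil.
under eq_fun do rewrite big_cons.
by rewrite cintD ?IH ?big_cons//; exact: cintegrable_sum.
Qed.

Lemma eq_cint f g : f =1 g -> cint f = cint g.
Proof. by move=> /funext ->. Qed.

Lemma ae_eq_cint f g : cmeas f -> cmeas g ->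
  {ae mu, forall x, f x = g x} -> cint f = cint g.
Proof.
move=> [f1 f2] [g1 g2] fg; apply: ReIm_inj => /=; congr fine.
  apply: ae_eq_integral => //; [exact/measurable_EFinP|exact/measurable_EFinP|].
  by apply: filterS fg => x -> _.
apply: ae_eq_integral => //; [exact/measurable_EFinP|exact/measurable_EFinP|].
by apply: filterS fg => x -> _.
Qed.

(** Kept in [\bar R], so that identities between sums and integrals of squares can be stated before
    any finiteness is known. *)
Definition nsqint f : \bar R := (\int[mu]_x (nsq (f x))%:E)%E.

Definition sqi f : Prop := cmeas f /\ (nsqint f < +oo)%E.

Lemma nsqint_ge0 f : (0 <= nsqint f)%E.
Proof. by apply: integral_ge0 => x _; rewrite lee_fin nsq_ge0. Qed.

Lemma measurable_EFin_nsq f : cmeas f ->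
  measurable_fun setT (fun x => (nsq (f x))%:E).
Proof. by move=> mf; exact/measurable_EFinP/measurable_nsq. Qed.

Lemma sqi_integrable f : sqi f -> mu.-integrable setT (fun x => (nsq (f x))%:E).
Proof.
move=> [mf fi]; apply/integrableP; split; first exact: measurable_EFin_nsq.
by under eq_integral do rewrite gee0_abs ?lee_fin ?nsq_ge0//.
Qed.

Lemma sqiD f g : sqi f -> sqi g -> sqi (fun x => f x + g x).
Proof.
move=> [mf fi] [mg gi]; have m := cmeasD mf mg; split=> //.
apply: (@le_lt_trans _ _ (2%:E * nsqint f + 2%:E * nsqint g)%E).
  have mf' := measurable_EFin_nsq mf; have mg' := measurable_EFin_nsq mg.
  have f0 x : (0 <= (nsq (f x))%:E)%E by rewrite lee_fin nsq_ge0.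
  have g0 x : (0 <= (nsq (g x))%:E)%E by rewrite lee_fin nsq_ge0.
  rewrite /nsqint -!ge0_integralZl// -ge0_integralD//; last 4 first.
  - by move=> x _; rewrite mule_ge0.
  - exact: measurable_funeM.
  - by move=> x _; rewrite mule_ge0.
  - exact: measurable_funeM.
  apply: ge0_le_integral => //.
  - by move=> x _; rewrite lee_fin nsq_ge0.
  - exact: measurable_EFin_nsq.
  - by apply: emeasurable_funD; exact: measurable_funeM.
  - by move=> x _; rewrite -!EFinM -EFinD lee_fin nsqD_le.
by rewrite lte_add_pinfty// lte_mul_pinfty// ?ge0_fin_numE ?nsqint_ge0.
Qed.

Lemma nsqintZ (c : R[i]) f : cmeas f ->
  nsqint (fun x => c * f x) = ((nsq c)%:E * nsqint f)%E.
Proof.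
move=> mf; rewrite /nsqint -ge0_integralZl//; first by under eq_integral do rewrite nsqM EFinM.
- exact: measurable_EFin_nsq.
- by move=> x _; rewrite lee_fin nsq_ge0.
- by rewrite lee_fin nsq_ge0.
Qed.

Lemma sqiZ (c : R[i]) f : sqi f -> sqi (fun x => c * f x).
Proof.
move=> [mf fi]; split; first by apply: cmeasM => //; exact: cmeas_cst.
by rewrite nsqintZ// lte_mul_pinfty// ?lee_fin ?nsq_ge0.
Qed.

Lemma sqiN f : sqi f -> sqi (fun x => - f x).
Proof. by move=> fi; under eq_fun do rewrite -mulN1r; exact: sqiZ. Qed.

Lemma sqiB f g : sqi f -> sqi g -> sqi (fun x => f x - g x).
Proof. by move=> fi gi; apply: sqiD => //; exact: sqiN. Qed.

Lemma sqiJ f : sqi f -> sqi (fun x => (f x)^*).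
Proof.
move=> [mf fi]; split; first exact: cmeasJ.
by rewrite /nsqint; under eq_integral do rewrite nsqJ.
Qed.

Lemma sqi0 : sqi (fun=> 0).
Proof.
split; first exact: cmeas_cst.
by rewrite /nsqint; under eq_integral do rewrite nsq0; rewrite integral0.
Qed.

Lemma sqi_sum I (r : seq I) (F : I -> T -> R[i]) :
  (forall i, sqi (F i)) -> sqi (fun x => \sum_(i <- r) F i x).
Proof.
move=> mF; elim: r => [|i r IH].
  by under eq_fun do rewrite big_nil; exact: sqi0.
by under eq_fun do rewrite big_cons; exact: sqiD.
Qed.

Lemma nsqint_le f g : cmeas f -> cmeas g -> (forall x, nsq (f x) <= nsq (g x)) ->
  (nsqint f <= nsqint g)%E.
Proof.
move=> mf mg fg; apply: ge0_le_integral => //.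
- by move=> x _; rewrite lee_fin nsq_ge0.
- exact: measurable_EFin_nsq.
- exact: measurable_EFin_nsq.
- by move=> x _; rewrite lee_fin.
Qed.

Lemma sqi_le f g : cmeas f -> sqi g -> (forall x, nsq (f x) <= nsq (g x)) -> sqi f.
Proof.
move=> mf [mg gi] fg; split=> //; exact: le_lt_trans (nsqint_le mf mg fg) gi.
Qed.

Lemma ae_eq_nsqint f g : cmeas f -> cmeas g ->
  {ae mu, forall x, f x = g x} -> nsqint f = nsqint g.
Proof.
move=> mf mg fg; apply: ae_eq_integral => //.
- exact: measurable_EFin_nsq.
- exact: measurable_EFin_nsq.
- by apply: filterS fg => x -> _.
Qed.

Lemma sqi_ae f g : cmeas f -> sqi g -> {ae mu, forall x, f x = g x} -> sqi f.
Proof. by move=> mf [mg gi] fg; split=> //; rewrite (ae_eq_nsqint mf mg fg). Qed.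

Lemma sqiM_bounded f g (B : R) : cmeas f -> sqi g -> (forall x, nsq (f x) <= B) ->
  sqi (fun x => f x * g x).
Proof.
move=> mf sg fB; have B0 : 0 <= B by exact: le_trans (nsq_ge0 _) (fB point).
apply: (@sqi_le _ (fun x => (Num.sqrt B)%:C * g x)).
- by apply: cmeasM => //; case: sg.
- exact: sqiZ.
- by move=> x; rewrite !nsqM ler_wpM2r ?nsq_ge0// nsqR sqr_sqrtr.
Qed.

(** The product is dominated by |f|^2 + |g|^2. *)
Lemma sqiM f g : sqi f -> sqi g -> cintegrable (fun x => f x * g x).
Proof.
move=> sf sg; have [[mf _] [mg _]] := (sf, sg).
apply: (@cintegrable_le _ (fun x => nsq (f x) + nsq (g x))).
- exact: cmeasM.
- under eq_fun do rewrite EFinD.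
  by apply: integrableD => //; exact: sqi_integrable.
- move=> x; rewrite cabsM -!cabs_sqr.
  by have := cabs_ge0 (f x); have := cabs_ge0 (g x); nra.
Qed.

Lemma nsqint_cint f : sqi f -> cint (fun x => f x * (f x)^*) = (fine (nsqint f))%:C.
Proof.
move=> sf; apply: ReIm_inj => /=.
  by congr fine; apply: eq_integral => x _; rewrite nsq_conjM.
under eq_Rintegral do rewrite nsq_conjM/=.
by rewrite Rintegral_cst// mul0r.
Qed.

Lemma nsqint_eq0 f : cmeas f -> nsqint f = 0%E -> {ae mu, forall x, f x = 0}.
Proof.
move=> mf f0; have := (ae_eq_integral_abs mu measurableT (measurable_EFin_nsq mf)).1.
have -> : (\int[mu]_x `|(nsq (f x))%:E| = 0)%E.
  by rewrite -f0; apply: eq_integral => x _; rewrite gee0_abs// lee_fin nsq_ge0.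
by move=> /(_ erefl); apply: filterS => x /(_ I) [] /nsq_eq0.
Qed.

End ComplexIntegral.

(** * Sums of nonnegative families over countable types *)

Section Esum.
Context {R : realType}.
Local Open Scope ereal_scope.

(** Enumerating the type by [pickle_inv], with 0 at the numbers that code nothing, makes the
    monotone convergence theorem for series available for families over any countable type. *)
Lemma esum_countType (I : countType) (a : I -> \bar R) : (forall i, 0 <= a i) ->
  \esum_(i in [set: I]) a i = \sum_(n <oo) (if pickle_inv n is Some i then a i else 0).
Proof.
move=> a0; pose b (n : nat) := if @pickle_inv I n is Some i then a i else 0.
have b0 n : 0 <= b n by rewrite /b; case: pickle_inv.
rewrite nneseries_esumT//.
rewrite (eq_esum (b := fun i => b (@choice.pickle I i))); last first.
  by move=> i _; rewrite /b pickleK_inv.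
rewrite -(esum_image _ _ b); last first.
  by move=> i j _ _; exact: (pcan_inj choice.pickleK).
rewrite esum_mkcond; apply: eq_esum => n _.
case: ifPn => //; rewrite notin_setE /b => h.
case E: (pickle_inv n) => [i|//]; exfalso; apply: h; exists i => //=.
by have := @pickle_invK I n; rewrite E.
Qed.

Lemma integral_esum d (T : measurableType d) (mu : {measure set T -> \bar R})
    (I : countType) (f : I -> T -> \bar R) :
  (forall i, measurable_fun setT (f i)) -> (forall i x, 0 <= f i x) ->
  \int[mu]_x (\esum_(i in [set: I]) f i x) = \esum_(i in [set: I]) (\int[mu]_x f i x).
Proof.
move=> mf f0.
under eq_integral do rewrite esum_countType//.
rewrite esum_countType; last by move=> i; exact: integral_ge0.
rewrite integral_nneseries//.
- apply: eq_eseriesr => n _; case: pickle_inv => //; exact: integral0.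
- by move=> n; case: pickle_inv.
- by move=> n x _; case: pickle_inv.
Qed.

Lemma measurable_esum d (T : measurableType d)
    (I : countType) (f : I -> T -> \bar R) :
  (forall i, measurable_fun setT (f i)) -> (forall i x, 0 <= f i x) ->
  measurable_fun setT (fun x => \esum_(i in [set: I]) f i x).
Proof.
move=> mf f0; under eq_fun do rewrite esum_countType//.
apply: ge0_emeasurable_sum => n.
  by move=> x _ _; case: pickle_inv.
by move=> _; case: pickle_inv.
Qed.

(** Only one inequality is proved, for every positive factor; the converse is the same inequality
    for the inverse factor. *)
Lemma esumZl (I : choiceType) (k : R) (a : I -> \bar R) : (0 <= k)%R ->
  (forall i, 0 <= a i) ->
  \esum_(i in [set: I]) (k%:E * a i) = k%:E * \esum_(i in [set: I]) a i.
Proof.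
move=> k0 a0; have [->|kn0] := eqVneq k 0%R.
  by rewrite mul0e esum1// => i _; rewrite mul0e.
have kp : (0 < k)%R by rewrite lt_neqAle eq_sym kn0.
have le (c : R) (b : I -> \bar R) : (0 < c)%R -> (forall i, 0 <= b i) ->
    \esum_(i in [set: I]) (c%:E * b i) <= c%:E * \esum_(i in [set: I]) b i.
  move=> c0 b0; apply: ge_ereal_sup => _ [X [finX _] <-].
  rewrite -ge0_mule_fsumr//; apply: lee_pmul => //.
  - by rewrite lee_fin ltW.
  - exact: fsume_ge0.
  - by apply: ereal_sup_ubound; exists X => //; split.
apply/eqP; rewrite eq_le le//=.
rewrite -(@lee_pmul2l _ k^-1%:E) ?lte_fin ?invr_gt0//.
rewrite muleA -EFinM mulVf// mul1e.
apply: le_trans (le _ _ _ _) => //; rewrite ?invr_gt0//.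
- by apply: le_esum => i _; rewrite muleA -EFinM mulVf// mul1e.
- by move=> i; rewrite mule_ge0// lee_fin.
Qed.

End Esum.

Section RestrictedMeasure.
Context {d : measure_display} {T : measurableType d} {R : realType}.
Variables (mu : {measure set T -> \bar R}) (D : set T) (mD : measurable D).
Local Open Scope ereal_scope.

(** On the complement of [D] the restricted measure agrees with [mzero], so that part of the
    integral vanishes. *)
Lemma ge0_integral_mrestr (f : T -> \bar R) : measurable_fun setT f ->
  (forall x, 0 <= f x) ->
  \int[mrestr mu mD]_x f x = \int[mu]_(x in D) f x.
Proof.
move=> mf f0.
rewrite -(setUv D) ge0_integral_setU//; last 3 first.
- exact: measurableC.
- by rewrite setUv.
- by apply/disj_setPS; rewrite setICr.
rewrite [X in _ + X](_ : _ = 0) ?adde0.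
  by apply: eq_measure_integral => A mA AD /=; rewrite /mrestr; congr (mu _); exact: setIidl.
rewrite (@eq_measure_integral _ _ _ _ mzero); first exact: integral_measure_zero.
move=> A mA AD; transitivity (mu set0); last exact: measure0.
by congr (mu _); rewrite -subset0 => x [/AD].
Qed.

End RestrictedMeasure.

(** * Affine substitutions in Lebesgue integrals *)

Section Affine.
Context {R : realType}.
Local Notation mu := (@lebesgue_measure R).
Implicit Types (a b : R).

Lemma measurable_affine a b :
  measurable_fun [set: measurableTypeR R] (fun x : R => a * x + b : measurableTypeR R).
Proof.
by apply: measurable_funD => //; exact: mulrl_measurable.
Qed.

(** Both sides are measures in [A], so agreement on half-open intervals is enough. For a < 0 the
    preimage is half-open at the other end, which leaves its length unchanged. *)
Lemma lebesgue_affine a b (A : set (measurableTypeR R)) : a != 0 -> measurable A ->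
  (mu A = `|a|%:E * mu ((fun x : R => (a * x + b)%R) @^-1` A))%E.
Proof.
move=> a0 mA.
have p0 : 0 <= `|a| by [].
pose phi : measurableTypeR R -> measurableTypeR R := fun x => a * x + b.
have mphi : measurable_fun setT phi by exact: measurable_affine.
pose nu0 : {measure set (measurableTypeR R) -> \bar R} :=
  mscale (NngNum p0) (pushforward mu phi).
pose nu' := nu0 mphi.
suff H : forall X, ocitv X -> mu X = nu' X by rewrite (lebesgue_measure_unique H).
move=> X [[c d] cd <-]; rewrite -[RHS]/(`|a|%:E * mu ((fun x : R => (a * x + b)%R) @^-1` `]c, d]))%E.
have [an|ap|/eqP] := ltgtP a 0; last by rewrite (negPf a0).
- rewrite (_ : _ @^-1` _ = `[(d - b) / a, (c - b) / a[%classic); last first.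
    apply/seteqP; split => x /=; rewrite !in_itv/= ler_ndivrMr// ltr_ndivlMr//.
      by move=> /andP[h1 h2]; apply/andP; split; lra.
    by move=> /andP[h1 h2]; apply/andP; split; lra.
  rewrite !lebesgue_measure_itv/= !lte_fin.
  have -> : ((d - b) / a < (c - b) / a) = (c < d).
    by rewrite ltr_ndivrMr// -mulrA mulVf ?mulr1// ltrD2r.
  case: ifPn => // _; last by rewrite mule0.
  by rewrite -!EFinD -EFinM ltr0_norm//; congr EFin; field.
- rewrite (_ : _ @^-1` _ = `](c - b) / a, (d - b) / a]%classic); last first.
    apply/seteqP; split => x /=; rewrite !in_itv/= ler_pdivlMr// ltr_pdivrMr//.
      by move=> /andP[h1 h2]; apply/andP; split; lra.
    by move=> /andP[h1 h2]; apply/andP; split; lra.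
  rewrite !lebesgue_measure_itv/= !lte_fin.
  have -> : ((c - b) / a < (d - b) / a) = (c < d).
    by rewrite ltr_pdivrMr// -mulrA mulVf ?mulr1// ltrD2r.
  case: ifPn => // _; last by rewrite mule0.
  by rewrite -!EFinD -EFinM gtr0_norm//; congr EFin; field.
Qed.

Lemma ge0_integral_affine a b (f : measurableTypeR R -> \bar R) : a != 0 ->
  measurable_fun setT f -> (forall x, 0 <= f x)%E ->
  (\int[mu]_x f (a * x + b)%R = `|a|^-1%:E * \int[mu]_x f x)%E.
Proof.
move=> a0 mf f0.
have p0 : 0 <= `|a| by [].
pose phi : measurableTypeR R -> measurableTypeR R := fun x => a * x + b.
have mphi : measurable_fun setT phi by exact: measurable_affine.
pose nu0 : {measure set (measurableTypeR R) -> \bar R} :=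
  mscale (NngNum p0) (pushforward mu phi).
pose nu' := nu0 mphi.
rewrite [in RHS](@eq_measure_integral _ _ _ _ nu'); last first.
  by move=> A mA _; exact: lebesgue_affine.
rewrite ge0_integral_mscale//.
rewrite (ge0_integral_pushforward mphi mu measurableT)//.
by rewrite muleA -EFinM /= mulVf ?normr_eq0// mul1e preimage_setT.
Qed.

Lemma integrable_affine a b (f : measurableTypeR R -> R) : a != 0 ->
  mu.-integrable setT (fun x => (f x)%:E) ->
  mu.-integrable setT (fun x => (f (a * x + b))%:E).
Proof.
move=> a0 /integrableP[/measurable_EFinP mf fi]; apply/integrableP; split.
  by apply/measurable_EFinP; exact: measurableT_comp mf (measurable_affine a b).
rewrite (ge0_integral_affine b (f := fun x => (`|(f x)%:E|)%E))//.
  by rewrite lte_mul_pinfty// lee_fin invr_ge0.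
by apply: measurableT_comp => //; exact/measurable_EFinP.
Qed.

Lemma Rintegral_affine a b (f : measurableTypeR R -> R) : a != 0 ->
  mu.-integrable setT (fun x => (f x)%:E) ->
  \int[mu]_x f (a * x + b) = `|a|^-1 * \int[mu]_x f x.
Proof.
move=> a0 fi; have mf : measurable_fun setT (fun x => (f x)%:E) by case/integrableP: fi.
have ka : 0 <= `|a|^-1 by rewrite invr_ge0.
have ip := integrable_funepos measurableT fi.
have im := integrable_funeneg measurableT fi.
rewrite /Rintegral (integralE mu setT (fun x => (f (a * x + b))%:E)).
rewrite (integralE mu setT (fun x => (f x)%:E)).
have -> : (\int[mu]_x ((fun x => (f (a * x + b)%R)%:E)^\+ x) =
  `|a|^-1%:E * \int[mu]_x ((fun x => (f x)%:E)^\+ x))%E.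
  transitivity (\int[mu]_x ((fun x => (f x)%:E)^\+ (a * x + b)%R))%E.
    by apply: eq_integral => x _; rewrite !funeposE.
  by apply: (@ge0_integral_affine a b ((fun x => (f x)%:E)^\+)%E) => //; exact: measurable_funepos.
have -> : (\int[mu]_x ((fun x => (f (a * x + b)%R)%:E)^\- x) =
  `|a|^-1%:E * \int[mu]_x ((fun x => (f x)%:E)^\- x))%E.
  transitivity (\int[mu]_x ((fun x => (f x)%:E)^\- (a * x + b)%R))%E.
    by apply: eq_integral => x _; rewrite !funenegE.
  by apply: (@ge0_integral_affine a b ((fun x => (f x)%:E)^\-)%E) => //; exact: measurable_funeneg.
have fp := integrable_fin_num measurableT ip.
have fm := integrable_fin_num measurableT im.
by rewrite -(fineK fp) -(fineK fm) -!EFinM -!EFinB /= mulrBr.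
Qed.

Lemma cmeas_affine a b (f : measurableTypeR R -> R[i]) :
  cmeas f -> cmeas (fun x : measurableTypeR R => f (a * x + b)).
Proof.
move=> [f1 f2]; split.
  exact: measurableT_comp f1 (measurable_affine a b).
exact: measurableT_comp f2 (measurable_affine a b).
Qed.

Lemma cintegrable_affine a b (f : measurableTypeR R -> R[i]) : a != 0 ->
  cintegrable mu f -> cintegrable mu (fun x => f (a * x + b)).
Proof.
move=> a0 [f1 f2]; split.
  exact: (@integrable_affine a b (fun x => complex.Re (f x))).
exact: (@integrable_affine a b (fun x => complex.Im (f x))).
Qed.

Lemma cint_affine a b (f : measurableTypeR R -> R[i]) : a != 0 ->
  cintegrable mu f ->
  cint mu (fun x => f (a * x + b)) = `|a|^-1%:C * cint mu f.
Proof.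
move=> a0 [f1 f2]; apply: ReIm_inj; rewrite ?cReM ?cImM /= mul0r ?subr0 ?addr0.
  exact: (@Rintegral_affine a b (fun x => complex.Re (f x))).
exact: (@Rintegral_affine a b (fun x => complex.Im (f x))).
Qed.

Lemma nsqint_affine a b (f : measurableTypeR R -> R[i]) : a != 0 -> cmeas f ->
  (nsqint mu (fun x => f (a * x + b)%R) = `|a|^-1%:E * nsqint mu f)%E.
Proof.
move=> a0 mf; apply: (@ge0_integral_affine a b (fun x => (nsq (f x))%:E)) => //.
  exact: measurable_EFin_nsq.
by move=> x; rewrite lee_fin nsq_ge0.
Qed.

Lemma sqi_affine a b (f : measurableTypeR R -> R[i]) : a != 0 ->
  sqi mu f -> sqi mu (fun x => f (a * x + b)).
Proof.
move=> a0 [mf fi]; split; first exact: cmeas_affine.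
by rewrite nsqint_affine// lte_mul_pinfty// lee_fin invr_ge0.
Qed.

Lemma ae_affine a b (P : R -> Prop) : a != 0 ->
  {ae mu, forall x, P x} -> {ae mu, forall x, P (a * x + b)}.
Proof.
move=> a0 [A [mA A0 PA]]; exists ((fun x : R => a * x + b) @^-1` A); split.
- have := measurable_affine a b; move=> /(_ measurableT A mA); by rewrite setTI.
- have := lebesgue_affine b a0 mA; rewrite A0 => /esym/eqP.
  by rewrite mule_eq0 eqe normr_eq0 (negPf a0) => /eqP.
- by move=> x /= nP; apply: PA.
Qed.

End Affine.

(** * Cutting the line into periods *)

Section Periodization.
Context {R : realType}.
Local Notation mu := (@lebesgue_measure R).
Implicit Types (c x t : R).

Definition circm c : {measure set (measurableTypeR R) -> \bar R} :=
  mrestr mu (@measurable_itv R `[0, c[).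

Lemma itv_translates c x : 0 < c ->
  exists! k : int, (x - k%:~R * c) \in `[0, c[.
Proof.
move=> c0; exists (Num.floor (x / c)); split.
  have /real_floor_itv := num_real (x / c).
  rewrite ler_pdivlMr// ltr_pdivrMr// intrD mulrDl mul1r in_itv/= => /andP[h1 h2].
  by apply/andP; split; lra.
move=> k; rewrite in_itv/= => /andP[h1 h2].
apply: floor_def; rewrite intrD ler_pdivlMr// ltr_pdivrMr// mulrDl mul1r.
by apply/andP; split; lra.
Qed.

Lemma ge0_integral_circm c (f : measurableTypeR R -> \bar R) :
  measurable_fun setT f -> (forall x, 0 <= f x)%E ->
  (\int[circm c]_x f x = \int[mu]_x (f x * (\1_(`[0, c[%classic) x)%:E))%E.
Proof.
move=> mf f0; rewrite ge0_integral_mrestr// integral_mkcond.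
apply: eq_integral => x _; rewrite patchE indicE.
by case: ifPn => _; rewrite ?mule1 ?mule0.
Qed.

(** Exactly one integer translate of [0, c[ contains a given point, so the indicators of the
    translates sum to 1. Tonelli then exchanges sum and integral, once on each side of the
    substitution. *)
Lemma ge0_integral_periodize c (f : measurableTypeR R -> \bar R) : 0 < c ->
  measurable_fun setT f -> (forall x, 0 <= f x)%E ->
  (\int[mu]_x f x = \int[circm c]_t (\esum_(k in [set: int]) f (t + k%:~R * c)%R))%E.
Proof.
move=> c0 mf f0.
have mfk (k : int) : measurable_fun [set: measurableTypeR R]
    (fun t : R => f (t + k%:~R * c)%R).
  apply: measurableT_comp mf _.
  by have := measurable_affine 1 (k%:~R * c); under eq_fun do rewrite mul1r.
have mfi (k : int) : measurable_fun [set: measurableTypeR R]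
    (fun t : R => f t * (\1_(`[0, c[%classic) (t - k%:~R * c)%R)%:E)%E.
  apply: emeasurable_funM => //; apply/measurable_EFinP.
  apply: (measurableT_comp (measurable_indic _)) => //.
  by have := measurable_affine 1 (- (k%:~R * c)); under eq_fun do rewrite mul1r.
rewrite (integral_esum _ mfk)//.
rewrite (eq_esum (b := fun k : int => \int[mu]_t (f t * (\1_(`[0, c[%classic) (t - k%:~R * c)%R)%:E)))%E.
  rewrite -(integral_esum _ mfi)//; last by move=> k x; rewrite mule_ge0// lee_fin.
  apply: eq_integral => x _.
  have [k [kx ku]] := itv_translates x c0.
  rewrite (esumID [set k])//; last by move=> i _; rewrite mule_ge0// lee_fin.
  rewrite setTI esum_set1; last by rewrite mule_ge0// lee_fin.
  rewrite indicE mem_set//= mule1 esum1 ?adde0// => i [_ /= ik].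
  by rewrite indicE memNset ?mule0//= => /ku/esym/ik.
move=> k _; rewrite ge0_integral_circm//.
have := @ge0_integral_affine R 1 (k%:~R * c)
  (fun t : R => f t * (\1_(`[0, c[%classic) (t - k%:~R * c)%R)%:E)%E (oner_neq0 _) (mfi k).
rewrite normr1 invr1 mul1e => <-; last by move=> x; rewrite mule_ge0// lee_fin.
by apply: eq_integral => x _; rewrite mul1r addrK.
Qed.

Lemma circm_setT c : 0 <= c -> circm c setT = c%:E.
Proof.
move=> c0; rewrite /circm/= /mrestr setTI lebesgue_measure_itv/= lte_fin.
by case: ltP => [_|h]; rewrite ?sube0//; congr EFin; apply/le_anti/andP.
Qed.

(** Integrals over a period are mostly written on the whole line with this cut-off, so that affine
    substitutions apply to them directly. *)
Definition chi c x : R := \1_(`[0, c[%classic) x.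

Lemma chiE c x : chi c x = (0 <= x < c)%R%:R.
Proof.
by rewrite /chi indicE mem_setE in_itv.
Qed.

Lemma chi_sqr c x : chi c x * chi c x = chi c x.
Proof. by rewrite chiE; case: (_ && _); rewrite /= ?mulr1n ?mulr1 ?mulr0. Qed.

Lemma measurable_chi c : measurable_fun [set: measurableTypeR R] (chi c).
Proof. exact: measurable_indic. Qed.

Lemma cmeas_chi c (f : measurableTypeR R -> R[i]) : cmeas f ->
  cmeas (fun x => (chi c x)%:C * f x).
Proof. by apply: cmeasM; apply: cmeas_real; exact: measurable_chi. Qed.

Lemma nsqint_circm c (f : measurableTypeR R -> R[i]) : cmeas f ->
  nsqint (circm c) f = nsqint mu (fun x => (chi c x)%:C * f x).
Proof.
move=> mf; rewrite /nsqint ge0_integral_circm//; first last.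
- by move=> x; rewrite lee_fin nsq_ge0.
- exact: measurable_EFin_nsq.
apply: eq_integral => x _; rewrite -/(chi c x) nsqM nsqR expr2 chi_sqr.
by rewrite -EFinM mulrC.
Qed.

Lemma chiS c (M : nat) x : 0 < c ->
  chi (M.+1%:R * c) x = chi (M%:R * c) x + chi c (x - M%:R * c).
Proof.
move=> c0; rewrite !chiE -natr1 mulrDl mul1r.
have m0 : 0 <= M%:R * c by rewrite mulr_ge0// ltW.
have [h|h] := ltP x (M%:R * c).
  have -> : (0 <= x - M%:R * c < c) = false by apply/negP => /andP[]; lra.
  by rewrite (_ : x < _) ?addr0 ?andbT//; lra.
have -> : (0 <= x) by lra.
by rewrite /= add0r; congr (nat_of_bool _)%:R; apply/idP/andP => [|[]]; [split|]; lra.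
Qed.

(** Induction on the number of tiles, removing the last one. Integrability of each tile is part of
    the conclusion because it is obtained along the way, as that of a difference of two integrable
    cut-offs. *)
Lemma cint_tile c (M : nat) (f : measurableTypeR R -> R[i]) : 0 < c ->
  cmeas f -> cintegrable mu (fun x => (chi (M%:R * c) x)%:C * f x) ->
  (forall j, (j < M)%N -> cintegrable mu (fun x => (chi c x)%:C * f (x + j%:R * c))) /\
  cint mu (fun x => (chi (M%:R * c) x)%:C * f x) =
  \sum_(j < M) cint mu (fun x => (chi c x)%:C * f (x + j%:R * c)).
Proof.
move=> c0 mf; elim: M => [|M IH] fi.
  split=> //; rewrite big_ord0 -[RHS](cint0 mu); apply: eq_cint => x.
  by rewrite mul0r chiE; case: ltP => // h; rewrite ?andbF ?mul0r// leNgt h mul0r.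
have i1 : cintegrable mu (fun x => (chi (M%:R * c) x)%:C * f x).
  apply: (cintegrable_le _ (integrable_cabs fi)); first exact: cmeas_chi.
  move=> x; rewrite !cabsM ler_wpM2r ?cabs_ge0// !cabsR !chiE !ger0_norm// ler_nat.
  case: (x < M%:R * c) / ltP; rewrite ?andbF// => h; rewrite leq_eqVlt; apply/orP; left.
  rewrite !andbT (_ : x < M.+1%:R * c) ?andbT//.
  by rewrite -natr1 mulrDl mul1r; lra.
have i2 : cintegrable mu (fun x => (chi c (x - M%:R * c))%:C * f x).
  have := cintegrableD fi (cintegrableN i1).
  by under eq_fun do rewrite chiS// rmorphD mulrDl addrC addKr.
have i3 : cintegrable mu (fun x => (chi c x)%:C * f (x + M%:R * c)).
  have := cintegrable_affine (M%:R * c) (oner_neq0 _) i2.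
  by under eq_fun do rewrite mul1r addrK.
have [j1 j2] := IH i1; split.
  by move=> j; rewrite ltnS leq_eqVlt => /predU1P[->|/j1].
rewrite big_ord_recr/= -j2.
under eq_fun do rewrite chiS// rmorphD mulrDl.
rewrite cintD//; congr (_ + _).
have := cint_affine (M%:R * c) (oner_neq0 _) i2.
under eq_fun do rewrite mul1r addrK.
by rewrite normr1 invr1 mul1r.
Qed.

End Periodization.

(** * Inner products and square integrable functions *)

Section SemiInner.
Context {R : realType} {V : lmodType R[i]}.
Implicit Types (dot : V -> V -> R[i]) (u v w : V).

(** A positive form that may be degenerate, so that the truncated Parseval forms [partial_dot] are
    covered by the same Cauchy-Schwarz and triangle inequalities. *)
Definition semi_inner dot : Prop :=
  [/\ forall a u v w, dot (a *: u + v) w = a * dot u w + dot v w,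
      forall u v, dot v u = (dot u v)^* & forall u, 0 <= sqnorm dot u].

Variables (dot : V -> V -> R[i]) (hd : semi_inner dot).
Local Notation sqn := (sqnorm dot).

Lemma dotP a u v w : dot (a *: u + v) w = a * dot u w + dot v w.
Proof. by case: hd. Qed.
Lemma dotC u v : dot v u = (dot u v)^*. Proof. by case: hd. Qed.
Lemma sqnorm_ge0 u : 0 <= sqn u. Proof. by case: hd. Qed.

Lemma dotDl u v w : dot (u + v) w = dot u w + dot v w.
Proof. by rewrite -[u]scale1r dotP mul1r scale1r. Qed.
Lemma dot0l w : dot 0 w = 0.
Proof. by apply: (addrI (dot 0 w)); rewrite -dotDl !addr0. Qed.
Lemma dotZl a u w : dot (a *: u) w = a * dot u w.
Proof. by rewrite -[a *: u]addr0 dotP dot0l addr0. Qed.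
Lemma dotNl u w : dot (- u) w = - dot u w.
Proof. by rewrite -scaleN1r dotZl mulN1r. Qed.
Lemma dotBl u v w : dot (u - v) w = dot u w - dot v w.
Proof. by rewrite dotDl dotNl. Qed.
Lemma dotDr u v w : dot w (u + v) = dot w u + dot w v.
Proof. by rewrite dotC dotDl rmorphD /= -!dotC. Qed.
Lemma dot0r w : dot w 0 = 0. Proof. by rewrite dotC dot0l conjc0. Qed.
Lemma dotZr a u w : dot w (a *: u) = a^* * dot w u.
Proof. by rewrite dotC dotZl rmorphM /= -dotC. Qed.
Lemma dotNr u w : dot w (- u) = - dot w u.
Proof. by rewrite dotC dotNl rmorphN /= -dotC. Qed.
Lemma dotBr u v w : dot w (u - v) = dot w u - dot w v.
Proof. by rewrite dotDr dotNr. Qed.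
Lemma dot_suml I (r : seq I) (P : pred I) (F : I -> V) w :
  dot (\sum_(i <- r | P i) F i) w = \sum_(i <- r | P i) dot (F i) w.
Proof. exact: (big_morph (dot^~ w) (fun u v => dotDl u v w) (dot0l w)). Qed.
Lemma dot_sumr I (r : seq I) (P : pred I) (F : I -> V) w :
  dot w (\sum_(i <- r | P i) F i) = \sum_(i <- r | P i) dot w (F i).
Proof. exact: (big_morph (dot w) (fun u v => dotDr u v w) (dot0r w)). Qed.

Lemma dotvv u : dot u u = (sqn u)%:C.
Proof.
apply: ReIm_inj => //=; have /(congr1 (@complex.Im R)) := dotC u u.
by rewrite ImJ; lra.
Qed.

Lemma sqnorm0 : sqn 0 = 0.
Proof. by rewrite /sqnorm dot0l. Qed.

Lemma sqnormD u v : sqn (u + v) = sqn u + sqn v + 2 * complex.Re (dot u v).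
Proof.
rewrite {1}/sqnorm dotDl !dotDr !ReD (dotC u v) ReJ -/(sqn u) -/(sqn v).
by ring.
Qed.

Lemma sqnormZ a u : sqn (a *: u) = nsq a * sqn u.
Proof. by rewrite {1}/sqnorm dotZl dotZr mulrA nsq_conjM cReRM. Qed.

Lemma sqnormN u : sqn (- u) = sqn u.
Proof. by rewrite -scaleN1r sqnormZ nsqN nsq1 mul1r. Qed.

Lemma sqnormB u v : sqn (u - v) = sqn u + sqn v - 2 * complex.Re (dot u v).
Proof. by rewrite sqnormD sqnormN dotNr ReN; ring. Qed.

Lemma sqnormBC u v : sqn (u - v) = sqn (v - u).
Proof. by rewrite -sqnormN opprB. Qed.

Lemma cauchy_schwarz u v : nsq (dot u v) <= sqn u * sqn v.
Proof.
set q := nsq _; have q0 : 0 <= q by exact: nsq_ge0.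
(* The squared norm of u + t <u,v> v for real [t], a quadratic polynomial in [t]. *)
have H t : 0 <= sqn u + 2 * t * q + t ^+ 2 * q * sqn v.
  have := sqnorm_ge0 (u + (t%:C * dot u v) *: v).
  rewrite sqnormD sqnormZ dotZr nsqM nsqR -/q.
  have -> : complex.Re ((t%:C * dot u v)^* * dot u v) = t * q.
    by rewrite /q; case: (dot u v) => [x y]; rewrite /nsq /=; ring.
  by congr (0 <= _); ring.
have u0 := sqnorm_ge0 u; have v0 := sqnorm_ge0 v.
have [vp|] := ltP 0 (sqn v).
  have := H (- (sqn v)^-1).
  have -> : sqn u + 2 * - (sqn v)^-1 * q + (- (sqn v)^-1) ^+ 2 * q * sqn v =
    sqn u - q / sqn v by field; exact: lt0r_neq0.
  by rewrite subr_ge0 ler_pdivrMr.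
move=> v1; have {}v0 : sqn v = 0 by apply/le_anti/andP.
rewrite v0 mulr0 leNgt; apply/negP => qp.
(* When [v] has norm 0 the polynomial is affine in [t]; this [t] gives it the value -1. *)
have := H (- ((sqn u + 1) / (2 * q))); rewrite v0 mulr0 addr0.
have -> : sqn u + 2 * - ((sqn u + 1) / (2 * q)) * q = -1.
  by field; exact: lt0r_neq0.
by rewrite ler0N1.
Qed.

Definition nrm u := Num.sqrt (sqn u).

Lemma nrm_ge0 u : 0 <= nrm u. Proof. exact: sqrtr_ge0. Qed.
Lemma nrm_sqr u : nrm u ^+ 2 = sqn u. Proof. by rewrite sqr_sqrtr// sqnorm_ge0. Qed.

Lemma nrmD u v : nrm (u + v) <= nrm u + nrm v.
Proof.
have := nrm_ge0 u; have := nrm_ge0 v => v0 u0.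
rewrite -(ler_pXn2r (n := 2)) ?nnegrE ?nrm_ge0 ?addr_ge0//.
rewrite sqrrD !nrm_sqr sqnormD.
have h : complex.Re (dot u v) <= nrm u * nrm v.
  apply: le_trans (le_trans (ler_norm _) (Re_le_cabs _)) _.
  rewrite -(ler_pXn2r (n := 2)) ?nnegrE ?cabs_ge0 ?mulr_ge0//.
  by rewrite cabs_sqr exprMn !nrm_sqr cauchy_schwarz.
by rewrite -mulr_natl; lra.
Qed.

Lemma nrmBC u v : nrm (u - v) = nrm (v - u). Proof. by rewrite /nrm sqnormBC. Qed.

Lemma nrm_le_add u v : nrm u <= nrm v + nrm (u - v).
Proof. by rewrite -[in leLHS](subrK v u) addrC nrmD// addrC. Qed.

Lemma nrm_lt_sqn u (e : R) : 0 < e -> sqn u < e ^+ 2 -> nrm u < e.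
Proof.
move=> e0 h; rewrite -(ltr_pXn2r (n := 2)) ?nnegrE ?nrm_ge0 ?(ltW e0)//.
by rewrite nrm_sqr.
Qed.

End SemiInner.

(** The closing estimate of [parseval_limit]: [a] and [b] are the norms of the vector and of its
    approximant, [p] and [x] their partial Parseval norms, and [d] bounds the distance of the two
    vectors. *)
Lemma parseval_arith (R : realType) (eps d p x b a : R) : 0 < eps -> 0 < d ->
  8 * (a + eps + 1) * d = eps -> x <= p + d -> a <= b + d -> b <= a + d ->
  b ^+ 2 - d < x ^+ 2 -> p <= a -> 0 <= p -> 0 <= x -> 0 <= b -> 0 <= a ->
  a ^+ 2 <= p ^+ 2 + eps.
Proof.
move=> e0 d0 dE xp ab ba h2 h5 p0 x0 b0 a0.
have a1d : 0 <= (a + 1) * d by rewrite mulr_ge0//; lra.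
have d1 : 8 * d <= 1.
  rewrite leNgt; apply/negP => d1; have : 0 < eps * (8 * d - 1) by rewrite mulr_gt0//; lra.
  by lra.
have : x ^+ 2 <= (p + d) ^+ 2 by rewrite ler_pXn2r ?nnegrE//; lra.
have : a ^+ 2 <= (b + d) ^+ 2 by rewrite ler_pXn2r ?nnegrE//; lra.
have : p * d <= a * d by rewrite ler_wpM2r//; lra.
have : b * d <= (a + d) * d by rewrite ler_wpM2r//; lra.
have : d * (8 * d) <= d * 1 by rewrite ler_wpM2l//; lra.
have : 0 <= eps * d by rewrite mulr_ge0//; lra.
have : 0 <= a * d by rewrite mulr_ge0//; lra.
by lra.
Qed.

(** * Parseval identities and their passage to the closure *)

Section Parseval.
Context {R : realType} {V : lmodType R[i]}.
Variables (dot : V -> V -> R[i]) (hd : semi_inner dot).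
Local Notation sqn := (sqnorm dot).
Local Notation nr := (nrm dot).

Definition partial_dot {I : Type} (e : I -> V) (s : seq I) (u v : V) : R[i] :=
  \sum_(i <- s) dot u (e i) * (dot v (e i))^*.

Lemma partial_dotvv {I : Type} (e : I -> V) (s : seq I) u :
  sqnorm (partial_dot e s) u = \sum_(i <- s) nsq (dot u (e i)).
Proof.
rewrite /sqnorm /partial_dot Re_sum; apply: eq_bigr => i _.
by rewrite nsq_conjM.
Qed.

Lemma semi_inner_partial {I : Type} (e : I -> V) (s : seq I) :
  semi_inner (partial_dot e s).
Proof.
split=> [a u v w|u v|u].
- rewrite /partial_dot mulr_sumr -big_split/=; apply: eq_bigr => i _.
  by rewrite (dotP hd) mulrDl mulrA.
- rewrite /partial_dot rmorph_sum/=; apply: eq_bigr => i _.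
  by rewrite rmorphM/= conjcK mulrC.
- by rewrite partial_dotvv sumr_ge0// => i _; exact: nsq_ge0.
Qed.

Lemma le_nsq_esum {I : choiceType} (e : I -> V) (s : seq I) v : uniq s ->
  ((\sum_(i <- s) nsq (dot v (e i)))%:E <=
    \esum_(i in [set: I]) (nsq (dot v (e i)))%:E)%E.
Proof.
move=> us; apply: esum_ge; exists [set` s] => //.
by rewrite -fsbig_seq// sumEFin.
Qed.

(** Bessel's inequality makes every partial Parseval seminorm 1-Lipschitz for the norm, so the
    identity survives approximation from [D]. *)
Lemma parseval_limit {I : choiceType} (e : I -> V) (D : set V) v :
  (forall (s : seq I) u, uniq s -> nrm (partial_dot e s) u <= nr u) ->
  (forall (eps : R), 0 < eps -> exists2 w, D w & sqn (v - w) < eps) ->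
  (forall w, D w -> \esum_(i in [set: I]) (nsq (dot w (e i)))%:E = (sqn w)%:E)%E ->
  (\esum_(i in [set: I]) (nsq (dot v (e i)))%:E = (sqn v)%:E)%E.
Proof.
move=> BV dD PD.
have near (eps : R) : 0 < eps -> exists2 w, D w & nr (v - w) < eps.
  move=> e0; have [w Dw h] := dD (eps ^+ 2) (exprn_gt0 2 e0).
  by exists w => //; exact: nrm_lt_sqn.
apply/eqP; rewrite eq_le; apply/andP; split.
  apply: ge_ereal_sup => _ [X [finX _] <-].
  rewrite fsbig_finite// sumEFin lee_fin.
  have us := finmap.fset_uniq (fset_set X).
  rewrite -partial_dotvv -(nrm_sqr (semi_inner_partial _ _)) -(nrm_sqr hd).
  by rewrite ler_pXn2r ?nnegrE ?nrm_ge0// BV.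
have vp := nrm_ge0 dot v.
apply/lee_addgt0Pr => eps e0.
pose d := eps / (8 * (nr v + eps + 1)).
have d0 : 0 < d by rewrite divr_gt0// mulr_gt0//; lra.
have dE : 8 * (nr v + eps + 1) * d = eps.
  by rewrite /d mulrC divfK// mulf_neq0//; lra.
have [w Dw wv] := near d d0.
have h1 := nrm_le_add hd v w.
have [X [finX _]] : exists2 X, fsets [set: I] X &
   ((sqn w - d)%:E < \sum_(i \in X) (nsq (dot w (e i)))%:E)%E.
  have := PD w Dw; rewrite /esum => Pw.
  have : ((sqn w - d)%:E < (sqn w)%:E)%E by rewrite lte_fin; lra.
  rewrite -Pw => /ereal_sup_gt[_ [X hX <-] h]; by exists X.
rewrite fsbig_finite// sumEFin lte_fin.
have us := finmap.fset_uniq (fset_set X).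
move: (finmap.enum_fset (fset_set X)) us => s us.
rewrite -partial_dotvv => h2.
have hs := semi_inner_partial e s.
have h3 := nrm_le_add hs w v.
have h4 := BV s (w - v) us.
rewrite (nrmBC hd) in h4.
apply: le_trans (_ : _ <= (sqnorm (partial_dot e s) v)%:E + eps%:E)%E _; last first.
  by rewrite leeD2r// partial_dotvv le_nsq_esum.
rewrite -EFinD lee_fin.
rewrite -(nrm_sqr hd) -(nrm_sqr hs).
rewrite -(nrm_sqr hd) -(nrm_sqr hs) in h2.
have p0 := nrm_ge0 (partial_dot e s) v; have x0 := nrm_ge0 (partial_dot e s) w.
have b0 := nrm_ge0 dot w.
have h5 := BV s v us.
have h6 := nrm_le_add hd w v; rewrite (nrmBC hd w v) in h6.
have xp : nrm (partial_dot e s) w <= nrm (partial_dot e s) v + d by lra.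
have ab : nr v <= nr w + d by lra.
have ba : nr w <= nr v + d by lra.
exact: (parseval_arith e0 d0 dE xp ab ba h2 h5 p0 x0 b0 vp).
Qed.

(** Parseval on [D] gives Bessel on [D] only. Each partial form is continuous, so Bessel extends to
    all vectors by density, and [parseval_limit] applies. *)
Lemma parseval_dense {I : choiceType} (e : I -> V) (D : set V) :
  (forall v (eps : R), 0 < eps -> exists2 w, D w & sqn (v - w) < eps) ->
  (forall w, D w -> \esum_(i in [set: I]) (nsq (dot w (e i)))%:E = (sqn w)%:E)%E ->
  forall v, (\esum_(i in [set: I]) (nsq (dot v (e i)))%:E = (sqn v)%:E)%E.
Proof.
move=> dD PD.
have near v (eps : R) : 0 < eps -> exists2 w, D w & nr (v - w) < eps.
  move=> e0; have [w Dw h] := dD v (eps ^+ 2) (exprn_gt0 2 e0).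
  by exists w => //; exact: nrm_lt_sqn.
have BD (s : seq I) w : uniq s -> D w -> nrm (partial_dot e s) w <= nr w.
  move=> us Dw; apply: ler_wsqrtr; rewrite partial_dotvv -lee_fin -PD//.
  exact: le_nsq_esum.
have BV (s : seq I) v : uniq s -> nrm (partial_dot e s) v <= nr v.
  move=> us; have hs := semi_inner_partial e s.
  (* A continuity constant from Cauchy-Schwarz. It depends on [s], which is harmless because it only
     serves to extend the inequality with constant 1. *)
  pose C := \sum_(i <- s) sqn (e i).
  have C0 : 0 <= C by apply: sumr_ge0 => i _; exact: sqnorm_ge0.
  have pC w : nrm (partial_dot e s) w <= Num.sqrt C * nr w.
    rewrite -sqrtrM// ler_wsqrtr// partial_dotvv /C mulr_suml ler_sum// => i _.
    by rewrite mulrC; exact: cauchy_schwarz.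
  apply/ler_addgt0Pr => eps e0.
  have K0 : 0 < Num.sqrt C + 1 by rewrite ltr_wpDl// sqrtr_ge0.
  have [w Dw wv] := near v (eps / (Num.sqrt C + 1)) (divr_gt0 e0 K0).
  rewrite ltr_pdivlMr// mulrDr mulr1 in wv.
  apply: le_trans (nrm_le_add hs v w) _.
  apply: le_trans (lerD (BD s w us Dw) (pC _)) _.
  by have := nrm_le_add hd w v; rewrite (nrmBC hd w v); lra.
by move=> v; exact: (parseval_limit BV (dD v) PD).
Qed.

(* Bessel's identity turns Parseval and unit norms into orthogonality. *)
Lemma parseval_orthonormal {I : choiceType} (e : I -> V) :
  (forall v, \esum_(i in [set: I]) (nsq (dot v (e i)))%:E = (sqn v)%:E)%E ->
  (forall i, sqn (e i) = 1) ->
  forall i j, dot (e i) (e j) = (i == j)%:R.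
Proof.
move=> P e1 i j; have [->|ij] := eqVneq i j; first by rewrite (dotvv hd) e1.
have := @le_nsq_esum I e [:: i; j] (e i).
rewrite P e1 !big_cons big_nil addr0 lee_fin (dotvv hd) e1 nsqR expr1n.
rewrite /= inE ij => /(_ isT) h.
by apply: nsq_eq0; apply: le_anti; rewrite nsq_ge0 andbT; lra.
Qed.

Lemma orthonormal_residual {I : choiceType} (e : I -> V) (s : seq I) v :
  (forall i j, dot (e i) (e j) = (i == j)%:R) -> uniq s ->
  sqn (v - \sum_(i <- s) dot v (e i) *: e i) =
  sqn v - \sum_(i <- s) nsq (dot v (e i)).
Proof.
move=> oe us; rewrite (sqnormB hd).
have -> : complex.Re (dot v (\sum_(i <- s) dot v (e i) *: e i)) =
    \sum_(i <- s) nsq (dot v (e i)).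
  rewrite (dot_sumr hd) Re_sum; apply: eq_bigr => i _.
  by rewrite (dotZr hd) mulrC nsq_conjM.
have -> : sqn (\sum_(i <- s) dot v (e i) *: e i) =
    \sum_(i <- s) nsq (dot v (e i)).
  rewrite /sqnorm (dot_suml hd) Re_sum; apply: eq_big_seq => i si.
  rewrite (dotZl hd) (dot_sumr hd) (bigD1_seq i)//= (dotZr hd) oe eqxx mulr1.
  rewrite big1 ?addr0 ?nsq_conjM// => j ji.
  by rewrite (dotZr hd) oe eq_sym (negPf ji) mulr0.
by ring.
Qed.

Lemma parseval_orthonormal_basis {I : choiceType} (e : I -> V) :
  (forall v, \esum_(i in [set: I]) (nsq (dot v (e i)))%:E = (sqn v)%:E)%E ->
  (forall i, sqn (e i) = 1) -> orthonormal_basis dot e.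
Proof.
move=> P e1; have oe := parseval_orthonormal P e1; split=> // v eps e0.
have : ((sqn v - eps)%:E < (sqn v)%:E)%E by rewrite lte_fin; lra.
rewrite -P => /ereal_sup_gt[_ [X [finX _] <-]].
rewrite fsbig_finite// sumEFin lte_fin => h.
exists (finmap.enum_fset (fset_set X)), (fun i => dot v (e i)).
by rewrite orthonormal_residual ?finmap.fset_uniq//; move: h; lra.
Qed.

Lemma parseval_tight_frame {I : choiceType} (e : I -> V) :
  (forall v, \esum_(i in [set: I]) (nsq (dot v (e i)))%:E = (sqn v)%:E)%E ->
  normalized_tight_frame dot e.
Proof.
by move=> P v; rewrite -P; apply: eq_esum => i _; rewrite Re_sqr_norm.
Qed.

End Parseval.

Section GeometricLimits.
Context {R : realType}.

(** With the geometric tail r k = C q^k / (1 - q), the sequence a - r increases and a + r decreases;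
    this yields the limit and the error bound together. *)
Lemma geometric_cvg (a : nat -> R) (C q : R) : 0 <= q < 1 ->
  (forall k, `|a k.+1 - a k| <= C * q ^+ k) ->
  exists2 l, a @ \oo --> l & forall k, `|a k - l| <= C * q ^+ k / (1 - q).
Proof.
move=> /andP[q0 q1] aC.
have C0 : 0 <= C by have := aC 0%N; rewrite expr0 mulr1; apply: le_trans.
have p1 : 0 < 1 - q by lra.
have step k j : `|a (k + j)%N - a k| <= C * q ^+ k * (1 - q ^+ j) / (1 - q).
  elim: j => [|j IH]; first by rewrite addn0 subrr normr0 expr0 subrr mulr0 mul0r.
  rewrite addnS; apply: le_trans (ler_distD (a (k + j)%N) _ _) _.
  apply: le_trans (lerD (aC _) IH) _.
  rewrite ler_pdivlMr// mulrDl divfK ?gt_eqF// exprD exprS.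
  by rewrite le_eqVlt; apply/orP; left; apply/eqP; ring.
have step' k j : `|a (k + j)%N - a k| <= C * q ^+ k / (1 - q).
  apply: le_trans (step k j) _; rewrite ler_pM2r ?invr_gt0//.
  by rewrite ler_piMr ?mulr_ge0 ?exprn_ge0// lerBlDr lerDl exprn_ge0.
have qk : (fun k => C * q ^+ k / (1 - q)) @ \oo --> (0 : R).
  rewrite [X in _ --> X](_ : 0 = C * 0 / (1 - q)); last by rewrite mulr0 mul0r.
  apply: cvgMl; apply: cvgMr; apply: cvg_expr; first by rewrite ger0_norm.
pose r k := C * q ^+ k / (1 - q).
have rS k : r k - r k.+1 = C * q ^+ k.
  by rewrite /r exprS; field; exact: lt0r_neq0.
pose u k := a k - r k; pose v k := a k + r k.
have uS : nondecreasing_seq u.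
  apply/nondecreasing_seqP => k; rewrite /u.
  by have := rS k; have := aC k; rewrite ler_norml => /andP[]; lra.
have vS : nonincreasing_seq v.
  apply/nonincreasing_seqP => k; rewrite /v.
  by have := rS k; have := aC k; rewrite ler_norml => /andP[]; lra.
have ub : has_ubound (range u).
  exists (a 0%N + r 0%N) => _ [k _ <-]; rewrite /u.
  have r0 : 0 <= r k by rewrite /r divr_ge0 ?mulr_ge0 ?exprn_ge0// ltW.
  by have := step' 0%N k; rewrite add0n -/(r 0%N) ler_norml => /andP[]; lra.
have cu := nondecreasing_cvgn uS ub; set l := sup _ in cu.
have ca : a @ \oo --> l.
  rewrite (_ : a = u \+ r); first by have := cvgD cu qk; rewrite addr0; apply.
  by apply/funext => k /=; rewrite /u subrK.
have cv : v @ \oo --> l.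
  rewrite (_ : v = a \+ r)//; by have := cvgD ca qk; rewrite addr0; apply.
exists l => // k; rewrite -/(r k) ler_norml.
have h1 : u k <= l.
  by rewrite -(cvg_lim _ cu)//; apply: nondecreasing_cvgn_le => //; apply/cvg_ex; exists l.
have h2 : l <= v k.
  by rewrite -(cvg_lim _ cv)//; apply: nonincreasing_cvgn_ge => //; apply/cvg_ex; exists l.
by move: h1 h2; rewrite /u /v => h1 h2; apply/andP; split; lra.
Qed.

Lemma complex_geometric_cvg (a : nat -> R[i]) (C q : R) : 0 <= q < 1 ->
  (forall k, cabs (a k.+1 - a k) <= C * q ^+ k) ->
  exists l : R[i], [/\ (fun k => complex.Re (a k)) @ \oo --> complex.Re l,
    (fun k => complex.Im (a k)) @ \oo --> complex.Im l &
    forall k, cabs (a k - l) <= 2 * (C * q ^+ k / (1 - q))].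
Proof.
move=> q01 aC.
have [k|l1 al1 bl1] := @geometric_cvg (fun k => complex.Re (a k)) C q q01.
  by rewrite -ReN -ReD (le_trans (Re_le_cabs _)).
have [k|l2 al2 bl2] := @geometric_cvg (fun k => complex.Im (a k)) C q q01.
  by rewrite -ImN -ImD (le_trans (Im_le_cabs _)).
exists (l1 +i* l2); split=> // k.
apply: le_trans (cabs_le_ReIm _) _; rewrite ReD ImD ReN ImN /=.
by rewrite mulr_natl mulr2n lerD.
Qed.

End GeometricLimits.

(** * The classes of square integrable functions and their inner product *)

Section L2Space.
Context {R : realType}.
Local Notation mu := (@lebesgue_measure R).
Local Notation MR := (measurableTypeR R).

(** The predicates here live on [R], whereas the almost-everywhere filter lives on
    [measurableTypeR R]; stating the filter rules once in this form removes the change of carrier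
    from later proofs. *)
Lemma aeS (P Q : R -> Prop) : (forall x, P x -> Q x) ->
  {ae mu, forall x, P x} -> {ae mu, forall x, Q x}.
Proof. by move=> PQ aP; apply: (filterS (P := P : set MR) _ aP) => x; exact: PQ. Qed.

Lemma aeS2 (P Q S : R -> Prop) : (forall x, P x -> Q x -> S x) ->
  {ae mu, forall x, P x} -> {ae mu, forall x, Q x} -> {ae mu, forall x, S x}.
Proof.
move=> PQ aP aQ.
exact: (@filterS2 MR _ _ P Q S PQ aP aQ).
Qed.

Lemma aeT (P : R -> Prop) : (forall x, P x) -> {ae mu, forall x, P x}.
Proof. by move=> aP; apply: (@aeW _ MR _ mu P). Qed.

Lemma Lfun2P (h : MR -> R) : h \in Lfun mu 2%:E <->
  (measurable_fun setT h /\ (\int[mu]_x ((h x) ^+ 2)%:E < +oo)%E).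
Proof.
split=> [hL|[mh hi]].
  have mh : measurable_fun setT h by move: hL => /andP[]; rewrite inE.
  split=> //; have /integrableP[_] := Lfun2_integrable_sqr hL.
  by under eq_integral do rewrite gee0_abs ?lee_fin ?sqr_ge0//.
apply/andP; split; rewrite inE//= /finite_norm unlock /=.
rewrite poweR_lty// (le_lt_trans _ hi)//.
rewrite le_eqVlt; apply/orP; left; apply/eqP; apply: eq_integral => x _.
by rewrite powR_mulrn// real_normK// num_real.
Qed.

Lemma sqintP (f : MR -> R[i]) : f \in sqint <-> sqi mu f.
Proof.
rewrite inE; split=> [/andP[/Lfun2P[m1 i1] /Lfun2P[m2 i2]]|[[m1 m2] fi]].
  split=> //; rewrite /nsqint; under eq_integral do rewrite EFinD.
  rewrite ge0_integralD//.
  - exact: lte_add_pinfty.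
  - by move=> x _; rewrite lee_fin sqr_ge0.
  - by apply/measurable_EFinP; exact: measurable_funX.
  - by move=> x _; rewrite lee_fin sqr_ge0.
  - by apply/measurable_EFinP; exact: measurable_funX.
apply/andP; split; apply/Lfun2P; split=> //; apply: le_lt_trans fi; apply: ge0_le_integral => //.
- by move=> x _; rewrite lee_fin sqr_ge0.
- by apply/measurable_EFinP; exact: measurable_funX.
- by apply: measurable_EFin_nsq.
- by move=> x _; rewrite lee_fin Re_sqr_le.
- by move=> x _; rewrite lee_fin sqr_ge0.
- by apply/measurable_EFinP; exact: measurable_funX.
- by apply: measurable_EFin_nsq.
- by move=> x _; rewrite lee_fin Im_sqr_le.
Qed.

Lemma L2_sqi (u : L2 R) : sqi mu (u : MR -> R[i]).
Proof. by apply/sqintP; exact: (valP (repr u)). Qed.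

Lemma L2_cmeas (u : L2 R) : cmeas (u : MR -> R[i]).
Proof. by case: (L2_sqi u). Qed.

Lemma pi_L2_ae (f g : L2fun) : {ae mu, forall x, f x = g x :> R[i]} ->
  \pi_(L2 R)%qT f = \pi_(L2 R)%qT g.
Proof.
move=> fg; apply/eqP; rewrite -Quotient.idealrBE; apply/asboolP.
by apply: aeS fg => x fg; rewrite -[LHS]/(f x - g x) fg subrr.
Qed.

Lemma pi_L2_aeP (f g : @L2fun R) : \pi_(L2 R)%qT f = \pi_(L2 R)%qT g ->
  {ae mu, forall x, f x = g x :> R[i]}.
Proof.
move=> /eqP; rewrite -Quotient.idealrBE => /asboolP.
by apply: aeS => x /eqP; rewrite -[X in X == _]/(f x - g x) subr_eq0 => /eqP.
Qed.

Lemma repr_pi_ae (f : @L2fun R) :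
  {ae mu, forall x, (\pi_(L2 R)%qT f : L2 R) x = f x}.
Proof. by apply: pi_L2_aeP; rewrite reprK. Qed.

Lemma L2_eq (u v : L2 R) : {ae mu, forall x, u x = v x} -> u = v.
Proof.
by move=> uv; rewrite -(reprK u) -(reprK v); exact: pi_L2_ae.
Qed.

Lemma to_L2E (f : R -> R[i]) : sqi mu (f : MR -> R[i]) ->
  {ae mu, forall x, to_L2 f x = f x}.
Proof.
move=> /sqintP sf; rewrite /to_L2; case: insubP => [g _ gE|]; last by rewrite sf.
by apply: aeS (repr_pi_ae g) => x ->; rewrite -gE.
Qed.

Lemma to_L2_ae (f : R -> R[i]) (u : L2 R) : cmeas (f : MR -> R[i]) ->
  {ae mu, forall x, f x = u x} -> to_L2 f = u.
Proof.
move=> mf fu; have sf : sqi mu (f : MR -> R[i]) by apply: sqi_ae fu => //; exact: L2_sqi.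
by apply: L2_eq; apply: aeS2 fu (to_L2E sf) => x <-.
Qed.

Lemma eq_to_L2 (f g : R -> R[i]) : sqi mu (f : MR -> R[i]) -> cmeas (g : MR -> R[i]) ->
  {ae mu, forall x, f x = g x} -> to_L2 f = to_L2 g.
Proof.
move=> sf mg fg; apply/esym/to_L2_ae => //.
by apply: aeS2 fg (to_L2E sf) => x <- ->.
Qed.

Lemma L2_addE (u v : L2 R) : {ae mu, forall x, (u + v : L2 R) x = u x + v x}.
Proof.
have e : \pi_(L2 R)%qT (repr u + repr v) = u + v by rewrite L2_piD !reprK.
by apply: aeS (repr_pi_ae (repr u + repr v)) => x; rewrite e => ->.
Qed.

Lemma L2_scaleE (a : R[i]) (u : L2 R) : {ae mu, forall x, (a *: u : L2 R) x = a * u x}.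
Proof.
by apply: aeS (repr_pi_ae (a *: repr u)) => x ->.
Qed.

Lemma L2_0E : {ae mu, forall x, (0 : L2 R) x = 0}.
Proof.
have e : \pi_(L2 R)%qT (0 : @L2fun R) = 0.
  by apply: (addrI (\pi_(L2 R)%qT (0 : @L2fun R))); rewrite -L2_piD !addr0.
by apply: aeS (repr_pi_ae 0) => x; rewrite e => ->.
Qed.

Lemma L2_oppE (u : L2 R) : {ae mu, forall x, (- u : L2 R) x = - u x}.
Proof.
by apply: aeS (L2_scaleE (-1) u) => x; rewrite scaleN1r mulN1r.
Qed.

Lemma L2_subE (u v : L2 R) : {ae mu, forall x, (u - v : L2 R) x = u x - v x}.
Proof. by apply: aeS2 (L2_addE u (- v)) (L2_oppE v) => x -> ->. Qed.

Lemma L2_sumE I (r : seq I) (F : I -> L2 R) :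
  {ae mu, forall x, (\sum_(i <- r) F i : L2 R) x = \sum_(i <- r) F i x}.
Proof.
elim: r => [|i r IH].
  by apply: aeS L2_0E => x; rewrite !big_nil.
by apply: aeS2 (L2_addE (F i) (\sum_(j <- r) F j)) IH => x; rewrite !big_cons => -> ->.
Qed.

Lemma L2_dotE (u v : L2 R) : L2_dot u v = cint mu (fun x : MR => u x * (v x)^*).
Proof. by []. Qed.

Lemma L2_dot_ae (u v : L2 R) (f g : MR -> R[i]) : cmeas f -> cmeas g ->
  {ae mu, forall x, u x = f x} -> {ae mu, forall x, v x = g x} ->
  L2_dot u v = cint mu (fun x => f x * (g x)^*).
Proof.
move=> mf mg uf vg; rewrite L2_dotE; apply: ae_eq_cint.
- by apply: cmeasM; [|apply: cmeasJ]; exact: L2_cmeas.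
- by apply: cmeasM => //; exact: cmeasJ.
- by apply: aeS2 uf vg => x -> ->.
Qed.

Lemma L2_sqnorm (u : L2 R) : sqnorm (@L2_dot R) u = fine (nsqint mu (u : MR -> R[i])).
Proof. by rewrite /sqnorm L2_dotE nsqint_cint//; exact: L2_sqi. Qed.

Lemma L2_sqnormE (u : L2 R) :
  (sqnorm (@L2_dot R) u)%:E = nsqint mu (u : MR -> R[i]).
Proof.
rewrite L2_sqnorm fineK// ge0_fin_numE ?nsqint_ge0//.
by case: (L2_sqi u).
Qed.

Lemma L2_sqnorm_ae (u : L2 R) (f : MR -> R[i]) : cmeas f ->
  {ae mu, forall x, u x = f x} -> (sqnorm (@L2_dot R) u)%:E = nsqint mu f.
Proof.
move=> mf uf; rewrite L2_sqnormE; apply: ae_eq_nsqint => //; exact: L2_cmeas.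
Qed.

Lemma L2_semi_inner : semi_inner (@L2_dot R).
Proof.
have lin (a : R[i]) (u v w : L2 R) :
    L2_dot (a *: u + v : L2 R) w = a * L2_dot u w + L2_dot v w.
  rewrite (L2_dot_ae (f := fun x => a * u x + v x) (g := w)).
  - rewrite L2_dotE -cintZ; last by apply: sqiM; [|apply: sqiJ]; exact: L2_sqi.
    rewrite L2_dotE -cintD; last 2 first.
    + by apply: cintegrableZ; apply: sqiM; [|apply: sqiJ]; exact: L2_sqi.
    + by apply: sqiM; [|apply: sqiJ]; exact: L2_sqi.
    by apply: eq_cint => x; rewrite mulrDl mulrA.
  - by apply: cmeasD; [apply: cmeasM; [exact: cmeas_cst|]|]; exact: L2_cmeas.
  - exact: L2_cmeas.
  - by apply: aeS2 (L2_addE (a *: u) v) (L2_scaleE a u) => x -> ->.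
  - exact: aeT.
have sym (u v : L2 R) : L2_dot v u = (L2_dot u v)^*.
  rewrite !L2_dotE -cintJ; last by apply: sqiM; [|apply: sqiJ]; exact: L2_sqi.
  by apply: eq_cint => x; rewrite rmorphM /= conjcK mulrC.
by split=> [//|//|u]; rewrite L2_sqnorm fine_ge0// nsqint_ge0.
Qed.

Lemma L2_dot_eq0 (u : L2 R) : sqnorm (@L2_dot R) u = 0 -> u = 0.
Proof.
move=> u0; apply: L2_eq.
have : nsqint mu (u : MR -> R[i]) = 0%E by rewrite -L2_sqnormE u0.
by move/(nsqint_eq0 (L2_cmeas u)) => h; apply: aeS2 h L2_0E => x -> ->.
Qed.

End L2Space.

Section L2Limits.
Context {d : measure_display} {T : measurableType d} {R : realType}.
Variable mu : {measure set T -> \bar R}.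

Lemma fatou_bound (f_ : (T -> \bar R)^nat) (f : T -> \bar R) (e : \bar R) :
  (forall n, measurable_fun setT (f_ n)) -> (forall n x, 0 <= f_ n x)%E ->
  (forall x, f_ ^~ x @ \oo --> f x) -> (forall n, \int[mu]_x f_ n x <= e)%E ->
  (\int[mu]_x f x <= e)%E.
Proof.
move=> mf f0 ff fe.
have -> : (\int[mu]_x f x = \int[mu]_x limn_einf (f_ ^~ x))%E.
  by apply: eq_integral => x _; rewrite (cvg_limn_einf_sup (ff x)).1.
apply: le_trans (fatou mu measurableT mf (fun n x _ => f0 n x)) _.
rewrite limn_einf_lim; apply: lime_le; first exact: is_cvg_einfs.
near=> n; apply: le_trans (fe n); apply: ereal_inf_lbound.
by exists n => //=.
Unshelve. all: end_near. Qed.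

(** Dominated convergence, with dominating function 4 |g|^2 because |f_n - f|^2 <= 2 |f_n|^2 + 2
    |f|^2. *)
Lemma nsqint_dominated (f_ : (T -> R[i])^nat) (f g : T -> R[i]) :
  (forall n, cmeas (f_ n)) -> cmeas f -> sqi mu g ->
  (forall n x, nsq (f_ n x) <= nsq (g x)) -> (forall x, nsq (f x) <= nsq (g x)) ->
  (forall x, (fun n => nsq (f_ n x - f x)) @ \oo --> (0 : R)) ->
  nsqint mu (fun x => f_ n x - f x) @[n --> \oo] --> 0%E.
Proof.
move=> mf_ mf sg fg_ fg cf.
have m n : measurable_fun setT (fun x => (nsq (f_ n x - f x))%:E).
  by apply: measurable_EFin_nsq; exact: cmeasB.
have i4 : mu.-integrable setT (fun x => (4 * nsq (g x))%:E).
  by apply: integrable_EFinZ; exact: sqi_integrable.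
have lim0 : \forall x \ae mu, setT x -> (nsq (f_ n x - f x))%:E @[n --> \oo] --> 0%E.
  by apply: aeW => x _; apply: cvg_EFin; [exact: nearW|exact: cf].
have le4 : \forall x \ae mu, forall n, setT x -> (`|(nsq (f_ n x - f x))%:E| <= (4 * nsq (g x))%:E)%E.
  apply: aeW => x n _; rewrite gee0_abs ?lee_fin ?nsq_ge0//.
  apply: le_trans (nsqD_le _ _) _; rewrite nsqN.
  by have := fg_ n x; have := fg x; lra.
have [_ _] := dominated_convergence measurableT m (measurable_cst 0%E) lim0 i4 le4.
by rewrite integral0.
Qed.

Lemma cvge0_lt (u : nat -> \bar R) : u @ \oo --> 0%E ->
  forall eps : R, 0 < eps -> exists N, forall n, (N <= n)%N -> (u n < eps%:E)%E.
Proof.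
move=> u0 eps e0.
have [] := u0 [set x | (x < eps%:E)%E].
  by apply: open_nbhs_nbhs; split; [exact: open_ereal_lt_ereal|rewrite /= lte_fin].
by move=> N _ h; exists N.
Qed.

End L2Limits.

Lemma nsq_cvg (R : realType) (a : nat -> R[i]) (c l : R[i]) :
  (fun k => complex.Re (a k)) @ \oo --> complex.Re l ->
  (fun k => complex.Im (a k)) @ \oo --> complex.Im l ->
  (fun k => nsq (c - a k)) @ \oo --> nsq (c - l).
Proof.
move=> c1 c2; rewrite /nsq; under eq_fun do rewrite !ReD !ReN !ImD !ImN !expr2.
rewrite !ReD !ReN !ImD !ImN !expr2.
by apply: cvgD; apply: cvgM; apply: cvgB => //; exact: cvg_cst.
Qed.

Lemma cvg_addl_index (R : realType) (a : nat -> R) (l : R) (K : nat) :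
  a @ \oo --> l -> (fun k => a (K + k)%N) @ \oo --> l.
Proof. by rewrite -(cvg_shiftn K); under eq_fun do rewrite addnC. Qed.

(** * Completeness of L2 *)

Section L2Complete.
Context {R : realType}.
Local Notation mu := (@lebesgue_measure R).
Local Notation MR := (measurableTypeR R).
Local Notation sqn := (sqnorm (@L2_dot R)).

Definition cauchy_L2 (u : nat -> L2 R) : Prop := forall eps : R, 0 < eps ->
  exists N, forall m n, (N <= m)%N -> (N <= n)%N -> sqn (u m - u n) < eps.

(** A fast subsequence converges almost everywhere at a geometric rate, and Fatou's lemma compares
    the original sequence with its pointwise limit. *)
Lemma L2_complete (u : nat -> L2 R) : cauchy_L2 u ->
  exists v, forall eps : R, 0 < eps ->
    exists N, forall n, (N <= n)%N -> sqn (u n - v) < eps.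
Proof.
move=> cu.
(* Multiplied by 4^k these bounds still sum to at most 1. The weight turns finiteness of the sum at
   a point into increments of order 2^-k there. *)
pose e8 k : R := (4^-1 ^+ k) * (2 ^+ k.+1)^-1.
have e80 k : 0 < e8 k by rewrite mulr_gt0 ?exprn_gt0 ?invr_gt0 ?exprn_gt0.
pose N k := projT1 (cid (cu (e8 k) (e80 k))).
have NP k m n : (N k <= m)%N -> (N k <= n)%N -> sqn (u m - u n) < e8 k.
  by rewrite /N; case: cid => /= M h; exact: h.
pose nk k := \sum_(i < k.+1) (N i).+1.
have nkS k : nk k.+1 = (nk k + (N k.+1).+1)%N by rewrite /nk big_ord_recr.
have Nnk k : (N k <= nk k)%N by rewrite /nk big_ord_recr /= (leq_trans (leqnSn _))// leq_addl.
have nk_mono k j : (k <= j)%N -> (nk k <= nk j)%N.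
  move=> /subnK <-; elim: (j - k)%N => [//|i IH].
  by rewrite addSn nkS (leq_trans IH)// leq_addr.
pose g k : MR -> R[i] := u (nk k).
have mg k : cmeas (g k) by exact: L2_cmeas.
have mdg k : cmeas (fun x => g k.+1 x - g k x) by exact: cmeasB.
have sub_nsqint m n : nsqint mu (fun x : MR => u m x - u n x) = (sqn (u m - u n))%:E.
  apply/esym/L2_sqnorm_ae; last exact: L2_subE.
  by apply: cmeasB; exact: L2_cmeas.
have dg k : (nsqint mu (fun x => g k.+1 x - g k x)%R <= (e8 k)%:E)%E.
  rewrite sub_nsqint lee_fin; apply/ltW/NP; last exact: Nnk.
  by rewrite nkS (leq_trans (Nnk _))// leq_addr.
pose t k (x : MR) : \bar R := (4 ^+ k * nsq (g k.+1 x - g k x))%:E.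
have mt k : measurable_fun setT (t k).
  by apply/measurable_EFinP; apply: measurable_funM => //; exact: measurable_nsq.
have t0 k x : (0 <= t k x)%E by rewrite lee_fin mulr_ge0 ?nsq_ge0.
pose S x := (\sum_(k <oo) t k x)%E.
have mS : measurable_fun setT S by apply: ge0_emeasurable_sum => // k x _ _; exact: t0.
have S0 x : (0 <= S x)%E by apply: nneseries_ge0.
have iS : mu.-integrable setT S.
  apply/integrableP; split=> //.
  under eq_integral do rewrite gee0_abs//.
  rewrite /S integral_nneseries//.
  apply: le_lt_trans (_ : _ <= 1%:E)%E (ltry _).
  apply: le_trans (epsilon_trick0 xpredT ler01).
  apply: lee_nneseries => [k *|k *]; first by apply: integral_ge0 => x _; exact: t0.
  rewrite /t; under eq_integral do rewrite EFinM.
  rewrite ge0_integralZl//; last first.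
    - by move=> x _; rewrite lee_fin nsq_ge0.
    - exact: measurable_EFin_nsq.
  apply: le_trans (_ : (4 ^+ k)%:E * (e8 k)%:E <= _)%E.
    by apply: lee_wpmul2l; [rewrite lee_fin exprn_ge0|exact: dg].
  by rewrite -EFinM lee_fin /e8 mulrA -exprMn mulfV// expr1n natrX.
(* Outside the null complement of [A] the subsequence is geometric; multiplying by the indicator of
   [A] makes it converge at every point. *)
pose A := [set x : MR | S x \is a fin_num].
have mA : measurable A by have := emeasurable_fin_num measurableT mS; rewrite setTI.
have aeA : {ae mu, forall x, A x}.
  by apply: aeS (integrable_ae measurableT iS) => x; apply.
pose h k (x : MR) : R[i] := (\1_A x)%:C * g k x.
have mh k : cmeas (h k) by apply: cmeasM => //; exact: cmeas_indic.
have hcvg x : exists l : R[i], [/\ (fun k => complex.Re (h k x)) @ \oo --> complex.Re l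
    & (fun k => complex.Im (h k x)) @ \oo --> complex.Im l].
  have [Ax|nAx] := pselect (A x); last first.
    exists 0; rewrite /h indicE memNset//=.
    by split; under eq_fun do rewrite mul0r; exact: cvg_cst.
  have Sx := fineK Ax.
  have [|k|l [l1 l2 _]] := @complex_geometric_cvg R (h ^~ x) (Num.sqrt (fine (S x))) (2^-1).
  - by rewrite invr_ge0 ler0n invf_lt1 ?ltr1n//=.
  - rewrite /h indicE mem_set//= !mul1r.
    have tS : (t k x <= S x)%E.
      apply: le_trans (_ : _ <= \sum_(0 <= i < k.+1) t i x)%E _; last first.
        by apply: nneseries_lim_ge => *; exact: t0.
      by rewrite big_nat_recr//= leeDr// sume_ge0// => n _; exact: t0.
    rewrite -Sx lee_fin in tS.
    rewrite -(ler_pXn2r (n := 2)) ?nnegrE ?cabs_ge0 ?mulr_ge0 ?sqrtr_ge0 ?exprn_ge0 ?invr_ge0//.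
    rewrite cabs_sqr exprMn sqr_sqrtr ?fine_ge0//.
    rewrite -exprM mulnC exprM -(ler_pM2l (x := 4 ^+ k)) ?exprn_gt0//.
    apply: le_trans tS _; rewrite mulrCA -exprMn (_ : 4 * _ = 1) ?expr1n ?mulr1//.
    by field.
  - by exists l; split.
pose G (x : MR) : R[i] := projT1 (cid (hcvg x)).
have GP x : [/\ (fun k => complex.Re (h k x)) @ \oo --> complex.Re (G x)
    & (fun k => complex.Im (h k x)) @ \oo --> complex.Im (G x)].
  by rewrite /G; case: cid.
have mG : cmeas G.
  split.
    by apply: (measurable_fun_cvg (fun k => (mh k).1)) => x _; case: (GP x).
  by apply: (measurable_fun_cvg (fun k => (mh k).2)) => x _; case: (GP x).
have hg k : {ae mu, forall x, h k x = g k x}.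
  by apply: aeS aeA => x Ax; rewrite /h indicE mem_set//= mul1r.
(* Fatou along the subsequence: a bound on the distances from [u n] to its late terms passes to the
   limit [G]. *)
have bound n e K : (forall k, (K <= k)%N -> sqn (u n - u (nk k)) <= e) ->
    (nsqint mu (fun x : MR => u n x - G x)%R <= e%:E)%E.
  move=> ne; apply: (@fatou_bound _ _ _ mu (fun k x => (nsq (u n x - h (K + k)%N x))%:E)).
  - by move=> k; apply: measurable_EFin_nsq; apply: cmeasB => //; exact: L2_cmeas.
  - by move=> k x; rewrite lee_fin nsq_ge0.
  - move=> x; apply: cvg_EFin; first exact: nearW.
    have [c1 c2] := GP x.
    have cc := @nsq_cvg R (h ^~ x) (u n x) (G x) c1 c2.
    exact: (@cvg_addl_index R (fun k => nsq (u n x - h k x)) _ K cc).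
  - move=> k; rewrite -/(nsqint mu (fun x : MR => u n x - h (K + k)%N x)).
    rewrite (@ae_eq_nsqint _ _ _ _ _ (fun x : MR => u n x - g (K + k)%N x)).
    + by rewrite sub_nsqint lee_fin ne// leq_addr.
    + by apply: cmeasB => //; exact: L2_cmeas.
    + by apply: cmeasB => //; exact: L2_cmeas.
    + by apply: aeS (hg (K + k)%N) => x ->.
have sG : sqi mu G.
  have b0 : (nsqint mu (fun x : MR => u (nk 0%N) x - G x)%R <= (e8 0%N)%:E)%E.
    apply: (bound _ _ 0%N) => k _; apply/ltW/NP; first exact: Nnk.
    exact: leq_trans (Nnk 0%N) (nk_mono _ _ _).
  have sd : sqi mu (fun x : MR => u (nk 0%N) x - G x).
    split; first by apply: cmeasB => //; exact: L2_cmeas.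
    exact: le_lt_trans b0 (ltry _).
  have := sqiB (L2_sqi (u (nk 0%N))) sd.
  by under eq_fun do rewrite subKr.
exists (to_L2 G) => eps e0.
have [M hM] := cu (eps / 2) (divr_gt0 e0 (ltr0n _ 2)).
have nkge k : (k <= nk k)%N.
  by elim: k => [//|k IH]; rewrite nkS addnS ltnS (leq_trans IH)// leq_addr.
exists M => n Mn; have : (sqn (u n - to_L2 G))%:E = nsqint mu (fun x : MR => u n x - G x).
  apply: L2_sqnorm_ae; first by apply: cmeasB => //; exact: L2_cmeas.
  by apply: aeS2 (L2_subE (u n) (to_L2 G)) (to_L2E sG) => x -> ->.
have : (nsqint mu (fun x : MR => u n x - G x)%R <= (eps / 2)%:E)%E.
  apply: (bound _ _ M) => k Mk; apply/ltW/hM => //; exact: leq_trans Mk (nkge k).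
by move=> /[swap] <-; rewrite lee_fin; lra.
Qed.

End L2Complete.

(** * Fourier series and the Fourier transform *)

Section Approx.
Context {R : realType} {V : lmodType R[i]}.
Variables (dot : V -> V -> R[i]) (hd : semi_inner dot).
Context {I : choiceType} (e : I -> V).
Local Notation sqn := (sqnorm dot).

Definition combo (s : seq (R[i] * I)) : V := \sum_(p <- s) p.1 *: e p.2.

(** Membership in the closed linear span of the family, expressed by finite lists of coefficients
    and indices. *)
Definition approx (v : V) : Prop := forall eps : R, 0 < eps ->
  exists s, sqn (v - combo s) < eps.

Lemma sqnormD_le u v : sqn (u + v) <= 2 * sqn u + 2 * sqn v.
Proof.
have := sqnorm_ge0 hd (u - v); rewrite (sqnormB hd) (sqnormD hd u v); lra.
Qed.

Lemma approx_combo s : approx (combo s).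
Proof. by move=> eps e0; exists s; rewrite subrr (sqnorm0 hd). Qed.

Lemma approxD u v : approx u -> approx v -> approx (u + v).
Proof.
move=> au av eps e0; have e4 : 0 < eps / 4 by rewrite divr_gt0.
have [s hs] := au _ e4; have [t ht] := av _ e4.
exists (s ++ t); rewrite /combo big_cat/= opprD addrACA.
by apply: le_lt_trans (sqnormD_le _ _) _; move: hs ht; rewrite /combo; lra.
Qed.

Lemma approxZ c u : approx u -> approx (c *: u).
Proof.
move=> au eps e0; have n1 : 0 < nsq c + 1 by rewrite ltr_wpDl// nsq_ge0.
have [s hs] := au (eps / (nsq c + 1)) (divr_gt0 e0 n1).
exists [seq (c * p.1, p.2) | p <- s].
have -> : combo [seq (c * p.1, p.2) | p <- s] = c *: combo s.
  by rewrite /combo big_map scaler_sumr; apply: eq_bigr => p _; rewrite scalerA.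
rewrite -scalerBr (sqnormZ hd); move: hs; rewrite ltr_pdivlMr//.
by have := sqnorm_ge0 hd (u - combo s); lra.
Qed.

Lemma approx_lim v :
  (forall eps : R, 0 < eps -> exists2 w, approx w & sqn (v - w) < eps) -> approx v.
Proof.
move=> h eps e0; have e4 : 0 < eps / 4 by rewrite divr_gt0.
have [w aw hw] := h _ e4; have [s hs] := aw _ e4.
exists s; rewrite -(subrKA w).
by apply: le_lt_trans (sqnormD_le _ _) _; move: hs hw; lra.
Qed.

(** A finite combination equals its own orthogonal expansion, so its residual is zero and Parseval
    holds for it; Bessel then carries the identity to the closure. *)
Lemma parseval_approx v : (forall i j, dot (e i) (e j) = (i == j)%:R) -> approx v ->
  (\esum_(i in [set: I]) (nsq (dot v (e i)))%:E = (sqn v)%:E)%E.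
Proof.
move=> oe av.
have bessel (s : seq I) u : uniq s -> \sum_(i <- s) nsq (dot u (e i)) <= sqn u.
  move=> us; have := sqnorm_ge0 hd (u - \sum_(i <- s) dot u (e i) *: e i).
  by rewrite orthonormal_residual// subr_ge0.
apply: (@parseval_limit _ _ _ hd _ e (range combo)).
- move=> s u us; apply: ler_wsqrtr; rewrite partial_dotvv; exact: bessel.
- by move=> eps /av[s hs]; exists (combo s) => //; exists s.
move=> _ [s _ <-]; set w := combo s.
apply/eqP; rewrite eq_le; apply/andP; split.
  apply: ge_ereal_sup => _ [X [finX _] <-].
  by rewrite fsbig_finite// sumEFin lee_fin bessel// finmap.fset_uniq.
pose t := undup [seq p.2 | p <- s].
have wt : \sum_(i <- t) dot w (e i) *: e i = w.
  rewrite /w /combo; under eq_bigr do rewrite (dot_suml hd) scaler_suml.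
  rewrite exchange_big/=; apply: eq_big_seq => p ps.
  rewrite (bigD1_seq p.2) ?undup_uniq//=; last by rewrite mem_undup map_f.
  rewrite (dotZl hd) oe eqxx mulr1 big1 ?addr0// => i ip.
  by rewrite (dotZl hd) oe eq_sym (negPf ip) mulr0 scale0r.
apply: le_trans (@le_nsq_esum _ _ dot _ e t w (undup_uniq _)).
have := orthonormal_residual hd w oe (undup_uniq [seq p.2 | p <- s]).
by rewrite -/t wt subrr (sqnorm0 hd) lee_fin; lra.
Qed.

End Approx.

(** * Completeness of the exponentials on a period *)

Section Trig.
Context {R : realType}.
Local Notation mu := (@lebesgue_measure R).
Local Notation MR := (measurableTypeR R).
Local Notation sqn := (sqnorm (@L2_dot R)).
Local Notation tau := (2 * pi : R).

Lemma aeI (P Q : R -> Prop) : {ae mu, forall x, P x} -> {ae mu, forall x, Q x} ->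
  {ae mu, forall x, P x /\ Q x}.
Proof. by apply: aeS2 => x p q; split. Qed.

Lemma tau_gt0 : 0 < tau. Proof. by rewrite mulr_gt0 ?pi_gt0. Qed.

Lemma measurable_cos : measurable_fun [set: MR] (@cos R).
Proof. exact: continuous_measurable_fun (@continuous_cos R). Qed.
Lemma measurable_sin : measurable_fun [set: MR] (@sin R).
Proof. exact: continuous_measurable_fun (@continuous_sin R). Qed.

Lemma cmeas_cis a b : cmeas (fun x : MR => cval (cis (a * x + b))).
Proof.
split => /=.
  exact: measurableT_comp measurable_cos (measurable_affine a b).
exact: measurableT_comp measurable_sin (measurable_affine a b).
Qed.

Lemma cmeas_cisM a : cmeas (fun x : MR => cval (cis (a * x))).
Proof. by have := cmeas_cis a 0; under eq_fun do rewrite addr0. Qed.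

Lemma nsqint_chi c : 0 <= c -> nsqint mu (fun x : MR => (chi c x)%:C) = c%:E.
Proof.
move=> c0; rewrite -(circm_setT c0) -(mul1e (circm c _)).
have -> : (fun x : MR => (chi c x)%:C) = (fun x => (chi c x)%:C * 1).
  by apply/funext => x; rewrite mulr1.
rewrite -nsqint_circm; last exact: cmeas_cst.
by rewrite /nsqint; under eq_integral do rewrite nsq1; rewrite integral_cst.
Qed.

Lemma sqi_chi c : 0 <= c -> sqi mu (fun x : MR => (chi c x)%:C).
Proof.
move=> c0; split; first by apply: cmeas_real; exact: measurable_chi.
by rewrite nsqint_chi// ltry.
Qed.

Lemma sqi_chiM c (f : MR -> R[i]) (B : R) : 0 <= c -> cmeas f ->
  (forall x, nsq (f x) <= B) -> sqi mu (fun x : MR => (chi c x)%:C * f x).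
Proof.
move=> c0 mf fB; under eq_fun do rewrite mulrC.
by apply: (@sqiM_bounded _ MR _ _ _ _ B) => //; exact: sqi_chi.
Qed.

(** L2 of the circle is realized inside L2 of the line: the normalized exponentials are extended by
    0 outside [0, 2 pi[. *)
Definition trig (k : int) : L2 R :=
  to_L2 (fun x : MR => (Num.sqrt tau)^-1%:C * ((chi tau x)%:C * cis (k%:~R * x))).

Lemma sqi_chi_cis (k : int) : sqi mu (fun x : MR => (chi tau x)%:C * cis (k%:~R * x)).
Proof.
apply: (@sqi_chiM _ _ 1); first exact: ltW tau_gt0.
- exact: cmeas_cisM.
- by move=> x; rewrite nsq_circle.
Qed.

Lemma trigE k : {ae mu, forall x,
  trig k x = (Num.sqrt tau)^-1%:C * ((chi tau x)%:C * cis (k%:~R * x))}.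
Proof. by apply: to_L2E; apply: sqiZ; exact: sqi_chi_cis. Qed.

Lemma alternating_sum (m : nat) : \sum_(j < m.*2) (-1) ^+ j = 0 :> R[i].
Proof.
elim: m => [|m IH]; first by rewrite big_ord0.
by rewrite doubleS !big_ord_recr/= IH add0r exprS mulN1r subrr.
Qed.

Lemma cis_pi_nat (j : nat) : cval (cis (j%:R * pi)) = (-1) ^+ j :> R[i].
Proof.
elim: j => [|j IH]; first by rewrite mul0r cis0.
rewrite -natr1 mulrDl mul1r cisD IH exprSr; congr (_ * _).
by apply: ReIm_inj; rewrite /= ?cospi ?sinpi ?oppr0.
Qed.

Lemma cis_pi_int (n : int) : cval (cis (n%:~R * pi)) = (-1) ^+ `|n|%N :> R[i].
Proof.
case: n => j; first by rewrite cis_pi_nat.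
rewrite -[`|Negz j|%N]/(j.+1) NegzE mulrNz mulNr cisN -pmulrn cis_pi_nat.
by rewrite rmorphXn rmorphN rmorph1.
Qed.

(** The period is cut into 2|n| pieces of length pi / |n|. From one piece to the next the
    exponential only changes sign, so the integrals cancel in pairs. *)
Lemma cint_chi_cis (n : int) : n != 0 ->
  cint mu (fun x : MR => (chi tau x)%:C * cis (n%:~R * x)) = 0.
Proof.
move=> n0; pose m := `|n|%N.
have m0 : (0 < m)%N by rewrite absz_gt0.
have mR : (0 : R) < m%:R by rewrite ltr0n.
pose c : R := pi / m%:R.
have c0 : 0 < c by rewrite divr_gt0// pi_gt0.
have tc : tau = m.*2%:R * c.
  by rewrite /c -muln2 natrM; field; exact: lt0r_neq0.
have i1 : cintegrable mu (fun x : MR => (chi tau x)%:C * cis (n%:~R * x)).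
  have := sqiM (sqi_chi (ltW tau_gt0)) (sqi_chi_cis n).
  by under eq_fun do rewrite mulrA -rmorphM /= chi_sqr.
rewrite tc in i1 *.
have [_ ->] := cint_tile c0 (cmeas_cisM _) i1.
have ph (j : nat) x : cval (cis (n%:~R * (x + j%:R * c))) =
    (-1) ^+ j * cval (cis (n%:~R * x)) :> R[i].
  rewrite mulrDr cisD mulrC; congr (_ * _).
  have -> : n%:~R * (j%:R * c) = (sgz n * j%:Z)%:~R * pi :> R.
    rewrite {1}[n]intEsg !rmorphM /= -/m -!pmulrn /c.
    by field; exact: lt0r_neq0.
  have s1 : `|sgz n|%N = 1%N by case: sgzP n0 => // ->; rewrite eqxx.
  by rewrite cis_pi_int abszM s1 mul1n.
transitivity (\sum_(j < m.*2) (-1) ^+ j *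
    cint mu (fun x : MR => (chi c x)%:C * cis (n%:~R * x))).
  apply: eq_bigr => j _; rewrite -cintZ; first by apply: eq_cint => x; rewrite ph mulrCA.
  have [h _] := cint_tile c0 (cmeas_cisM _) i1.
  have := h 0%N _; rewrite double_gt0 => /(_ m0).
  by under eq_fun do rewrite mul0r addr0.
by rewrite -mulr_suml alternating_sum mul0r.
Qed.

Lemma trig_dot (u : L2 R) (f : MR -> R[i]) k : sqi mu f -> {ae mu, forall x, u x = f x} ->
  L2_dot u (trig k) = (Num.sqrt tau)^-1%:C *
    cint mu (fun x => (chi tau x)%:C * (f x * cis (- (k%:~R * x)))).
Proof.
move=> sf uf; rewrite -cintZ; last first.
  have := sqiM sf (sqiJ (sqi_chi_cis k)).
  by under eq_fun do rewrite conjCM conjCR -cisN mulrCA.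
rewrite (L2_dot_ae _ _ uf (trigE k)).
- by apply: eq_cint => x; rewrite NconjE !conjCM !conjCR -cisN; ring.
- by case: sf.
- apply: cmeasM; first exact: cmeas_cst.
  by case: (sqi_chi_cis k).
Qed.

Lemma trig_orthonormal j k : L2_dot (trig j) (trig k) = (j == k)%:R.
Proof.
rewrite (trig_dot _ _ (trigE j)); last by apply: sqiZ; exact: sqi_chi_cis.
have -> : (fun x : MR => (chi tau x)%:C *
    ((Num.sqrt tau)^-1%:C * ((chi tau x)%:C * cis (j%:~R * x)) * cis (- (k%:~R * x)))) =
    (fun x => (Num.sqrt tau)^-1%:C * ((chi tau x)%:C * cis ((j - k)%:~R * x))).
  apply/funext => x; rewrite rmorphB mulrBl cisD.
  have e : (chi tau x)%:C = (chi tau x)%:C * (chi tau x)%:C :> R[i].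
    by rewrite -rmorphM /= chi_sqr.
  by rewrite [in RHS]e; ring.
have int n : cintegrable mu (fun x : MR => (chi tau x)%:C * cis (n%:~R * x)).
  have := sqiM (sqi_chi (ltW tau_gt0)) (sqi_chi_cis n).
  by under eq_fun do rewrite mulrA -rmorphM /= chi_sqr.
rewrite cintZ//; have [->|jk] := eqVneq j k; last first.
  by rewrite cint_chi_cis ?mulr0// subr_eq0.
have -> : cint mu (fun x : MR => (chi tau x)%:C * cis ((k - k)%:~R * x)) = tau%:C.
  have := nsqint_cint (sqi_chi (ltW tau_gt0)); rewrite nsqint_chi ?(ltW tau_gt0)// -[fine _]/tau => <-.
  by apply: eq_cint => x; rewrite subrr mulr0z mul0r cis0 mulr1 NconjE conjCR -rmorphM /= chi_sqr.
rewrite -!rmorphM mulrA -invfM -expr2 sqr_sqrtr ?(ltW tau_gt0)//.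
by rewrite mulVf ?gt_eqF ?tau_gt0// rmorph1.
Qed.

Definition realtrig (h : R -> R) : Prop := exists s : seq (R[i] * int),
  forall x, (h x)%:C = \sum_(p <- s) p.1 * cis (p.2%:~R * x).

Lemma realtrigD h1 h2 : realtrig h1 -> realtrig h2 -> realtrig (fun x => h1 x + h2 x).
Proof.
move=> [s hs] [t ht]; exists (s ++ t) => x.
by rewrite big_cat/= -hs -ht rmorphD.
Qed.

Lemma realtrigM h1 h2 : realtrig h1 -> realtrig h2 -> realtrig (fun x => h1 x * h2 x).
Proof.
move=> [s hs] [t ht]; exists [seq (p.1 * q.1, p.2 + q.2) | p <- s, q <- t] => x.
have -> : (h1 x * h2 x)%:C = (h1 x)%:C * (h2 x)%:C by exact: rmorphM.
rewrite big_allpairs_dep hs ht mulr_suml; apply: eq_bigr => p _.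
rewrite mulr_sumr; apply: eq_bigr => q _.
rewrite -[RHS]/(p.1 * q.1 * cis ((p.2 + q.2)%:~R * x)).
by rewrite rmorphD mulrDl cisD; ring.
Qed.

Lemma realtrig_cst (c : R) : realtrig (fun=> c).
Proof. by exists [:: (c%:C, 0)] => x; rewrite big_seq1 mul0r cis0 mulr1. Qed.

Lemma realtrigZ (c : R) h : realtrig h -> realtrig (fun x => c * h x).
Proof. by apply: realtrigM; exact: realtrig_cst. Qed.

Lemma realtrig_cosB (a : R) : realtrig (fun x => cos (x - a)).
Proof.
exists [:: (2^-1 * cval (cis (- a)), 1); (2^-1 * cval (cis a), -1)] => x.
rewrite big_cons big_seq1 /= -!mulrA -!cisD.
have -> : a + (-1)%:~R * x = - (x - a) by rewrite mulrN1z; ring.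
have -> : - a + 1%:~R * x = x - a by rewrite mulr1z; ring.
rewrite cisN; apply: ReIm_inj; rewrite /=; last by ring.
by field.
Qed.

(** The Newton-Schulz polynomial: it maps [-1, 1] to itself, fixes -1, 0 and 1, and its iterates
    converge there to the sign function. *)
Definition smooth_sign (x : R) : R := (3 * x - x ^+ 3) / 2.

Lemma realtrig_iter h n : realtrig h -> realtrig (fun x => iter n smooth_sign (h x)).
Proof.
move=> th; elim: n => [//|n IH] /=.
have -> : (fun x => smooth_sign (iter n smooth_sign (h x))) =
  (fun x => 2^-1 * (3 * iter n smooth_sign (h x)) + (- 2^-1) *
    (iter n smooth_sign (h x) * (iter n smooth_sign (h x) * iter n smooth_sign (h x)))).
  by apply/funext => x; rewrite /smooth_sign; field.
by apply: realtrigD; apply: realtrigZ; [exact: realtrigZ|do 2 apply: realtrigM => //].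
Qed.

Lemma smooth_sign_itv x : -1 <= x <= 1 -> -1 <= smooth_sign x <= 1.
Proof.
move=> /andP[a b]; rewrite /smooth_sign; apply/andP; split.
  have : 0 <= (1 + x) * (1 + x) * (2 - x) by rewrite !mulr_ge0//; lra.
  by rewrite !exprS expr0; lra.
have : 0 <= (1 - x) * (1 - x) * (2 + x) by rewrite !mulr_ge0//; lra.
by rewrite !exprS expr0; lra.
Qed.

Lemma iter_smooth_sign_itv n x : -1 <= x <= 1 -> -1 <= iter n smooth_sign x <= 1.
Proof. by move=> x1; elim: n => [//|n IH] /=; exact: smooth_sign_itv. Qed.

Lemma iter_smooth_signN n x : iter n smooth_sign (- x) = - iter n smooth_sign x.
Proof.
elim: n => [//|n IH] /=; rewrite IH /smooth_sign; move: (iter _ _ _) => y.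
by field.
Qed.

Lemma cvg_iter_smooth_sign x : -1 <= x <= 1 ->
  (fun n => iter n smooth_sign x) @ \oo --> Num.sg x.
Proof.
have pos y : 0 < y <= 1 -> (fun n => iter n smooth_sign y) @ \oo --> (1 : R).
  (* From 1 - [smooth_sign] z = (1 - z) (1 - z)(2 + z)/2 the distance to 1 shrinks by a factor 1 -
     z/2 - z^2/2, at most [q] because the iterates stay above [y]. *)
  move=> /andP[y0 y1]; pose q := 1 - y / 2.
  have q01 : 0 <= q < 1 by rewrite /q; apply/andP; split; lra.
  have H n : y <= iter n smooth_sign y <= 1 /\ 1 - iter n smooth_sign y <= 1 * q ^+ n.
    elim: n => [|n [/andP[h1 h2] h3]]; first by rewrite /= lexx y1 expr0; split => //; lra.
    rewrite /= exprS mul1r; set z := iter n _ _ in h1 h2 h3 *.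
    have e : 1 - smooth_sign z = (1 - z) * ((1 - z) * (2 + z) / 2).
      by rewrite /smooth_sign; field.
    have zz : 0 <= (1 - z) * z by rewrite mulr_ge0//; lra.
    have z2 : 0 <= z * z by rewrite mulr_ge0//; lra.
    have w1 : (1 - z) * (2 + z) / 2 <= q by rewrite /q; lra.
    have w0 : 0 <= (1 - z) * (2 + z) / 2 by rewrite !mulr_ge0//; lra.
    have le1 : (1 - z) * ((1 - z) * (2 + z) / 2) <= (1 - z) * 1.
      by rewrite ler_wpM2l//; lra.
    split.
      apply/andP; split; first by lra.
      have : 0 <= (1 - z) * ((1 - z) * (2 + z) / 2) by rewrite mulr_ge0//; lra.
      by lra.
    rewrite e mulrC; apply: ler_pM => //; [lra|by rewrite mul1r in h3].
  have c0 : (fun n => 1 - 1 * q ^+ n) @ \oo --> (1 : R).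
    rewrite -[X in _ --> X]subr0; apply: cvgB; first exact: cvg_cst.
    rewrite -[X in _ --> X](mulr0 1); apply: cvgMr; apply: cvg_expr.
    by rewrite ger0_norm; case/andP: q01.
  apply: (squeeze_cvgr _ c0 (cvg_cst (1 : R))); apply: nearW => n.
  by have [/andP[h1 h2] h3] := H n; apply/andP; split; lra.
move=> /andP[a b]; have [x0|x0|->] := ltgtP x 0.
- rewrite ltr0_sg//.
  have xN : 0 < - x <= 1 by apply/andP; split; lra.
  rewrite (_ : (fun n => _) = (fun n => - iter n smooth_sign (- x))).
    by apply: cvgN; exact: pos.
  by apply/funext => n; rewrite iter_smooth_signN opprK.
- by rewrite gtr0_sg//; apply: pos; rewrite x0.
- rewrite sgr0 (_ : (fun n => _) = (fun=> 0)); first exact: cvg_cst.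
  apply/funext; elim=> [//|n IH] /=; rewrite IH /smooth_sign.
  by rewrite expr0n mulr0 subr0 mul0r.
Qed.

Definition approx_fun (f : MR -> R[i]) : Prop :=
  approx (@L2_dot R) trig (to_L2 (fun x : MR => (chi tau x)%:C * f x)).

Let hd := @L2_semi_inner R.

Lemma sqi_chi_bounded (f : MR -> R[i]) (B : R) : cmeas f -> (forall x, nsq (f x) <= B) ->
  sqi mu (fun x : MR => (chi tau x)%:C * f x).
Proof. by move=> mf fB; apply: (@sqi_chiM _ _ B) => //; exact: ltW tau_gt0. Qed.

Lemma measurable_realtrig h : realtrig h -> measurable_fun [set: MR] h.
Proof.
move=> [s hs]; have [] : cmeas (fun x : MR => (h x)%:C) => //.
have -> : (fun x : MR => (h x)%:C) = (fun x => \sum_(p <- s) p.1 * cis (p.2%:~R * x)).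
  exact/funext.
by apply: cmeas_sum => p _; apply: cmeasM; [exact: cmeas_cst|exact: cmeas_cisM].
Qed.

Lemma approx_realtrig h : realtrig h -> approx_fun (fun x => (h x)%:C).
Proof.
move=> /[dup] th [s hs]; rewrite /approx_fun.
rewrite (_ : to_L2 _ = combo trig [seq ((Num.sqrt tau)%:C * p.1, p.2) | p <- s]).
  exact: approx_combo.
apply: to_L2_ae.
  by apply: cmeas_chi; apply: cmeas_real; exact: measurable_realtrig.
rewrite /combo big_map.
have ae_all (t : seq (R[i] * int)) :
  {ae mu, forall x, forall p, p \in t -> trig p.2 x =
     (Num.sqrt tau)^-1%:C * ((chi tau x)%:C * cis (p.2%:~R * x))}.
  elim: t => [|p t IH]; first exact: aeT.
  apply: aeS2 (trigE p.2) IH => x h1 h2 q; rewrite inE => /predU1P[->//|].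
  exact: h2.
have ae_sc (t : seq (R[i] * int)) :
  {ae mu, forall x, forall p, p \in t ->
     ((Num.sqrt tau)%:C * p.1 *: trig p.2 : L2 R) x = (Num.sqrt tau)%:C * p.1 * trig p.2 x}.
  elim: t => [|p t IH]; first exact: aeT.
  apply: aeS2 (L2_scaleE ((Num.sqrt tau)%:C * p.1) (trig p.2)) IH => x h1 h2 q.
  rewrite inE => /predU1P[->//|].
  exact: h2.
apply: aeS2 (L2_sumE s (fun p => (Num.sqrt tau)%:C * p.1 *: trig p.2))
  (aeI (ae_all s) (ae_sc s)) => x -> [h1 h2]; rewrite hs mulr_sumr; apply: eq_big_seq => p ps.
rewrite h2// h1//.
have -> : (Num.sqrt tau)^-1%:C = ((Num.sqrt tau)%:C)^-1 :> R[i] by rewrite fmorphV.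
have t0 : (Num.sqrt tau)%:C != 0 :> R[i].
  by rewrite fmorph_eq0 gt_eqF// sqrtr_gt0 tau_gt0.
by field.
Qed.

(** Dominated convergence in L2; together with linearity this is the only passage from trigonometric
    polynomials to general functions. *)
Lemma approx_fun_lim (f_ : (MR -> R[i])^nat) (f : MR -> R[i]) (g : MR -> R[i]) :
  (forall n, cmeas (f_ n)) -> cmeas f -> sqi mu (fun x : MR => (chi tau x)%:C * g x) ->
  (forall n x, nsq (f_ n x) <= nsq (g x)) -> (forall x, nsq (f x) <= nsq (g x)) ->
  (forall x, (fun n => nsq (f_ n x - f x)) @ \oo --> (0 : R)) ->
  (forall n, approx_fun (f_ n)) -> approx_fun f.
Proof.
move=> mf_ mf sg fg_ fg ff af_.
have cg_ n x : nsq ((chi tau x)%:C * f_ n x) <= nsq ((chi tau x)%:C * g x).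
  by rewrite !nsqM ler_wpM2l ?nsq_ge0.
have cg x : nsq ((chi tau x)%:C * f x) <= nsq ((chi tau x)%:C * g x).
  by rewrite !nsqM ler_wpM2l ?nsq_ge0.
apply: (approx_lim hd) => eps e0.
have cff x : (fun n => nsq ((chi tau x)%:C * f_ n x - (chi tau x)%:C * f x)) @ \oo --> (0 : R).
  rewrite [X in _ --> X](_ : 0 = nsq (chi tau x)%:C * 0); last by rewrite mulr0.
  rewrite (_ : (fun n => _) = (fun n => nsq (chi tau x)%:C * nsq (f_ n x - f x))).
    by apply: cvgMr; exact: ff.
  by apply/funext => n; rewrite -mulrBr nsqM.
have := @nsqint_dominated _ _ _ mu (fun n x => (chi tau x)%:C * f_ n x)
  (fun x => (chi tau x)%:C * f x) _ (fun n => cmeas_chi _ (mf_ n)) (cmeas_chi _ mf) sg cg_ cg cff.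
move=> /cvge0_lt /(_ eps e0)[n hn].
exists (to_L2 (fun x : MR => (chi tau x)%:C * f_ n x)); first exact: af_.
have sf_ : sqi mu (fun x : MR => (chi tau x)%:C * f_ n x).
  by apply: sqi_le sg _ => //; exact: cmeas_chi.
have sf : sqi mu (fun x : MR => (chi tau x)%:C * f x).
  by apply: sqi_le sg _ => //; exact: cmeas_chi.
rewrite (sqnormBC hd) -lte_fin.
rewrite (@L2_sqnorm_ae _ _ (fun x : MR => (chi tau x)%:C * f_ n x - (chi tau x)%:C * f x)).
- exact: hn.
- by apply: cmeasB; exact: cmeas_chi.
- apply: aeS2 (L2_subE (to_L2 (fun x : MR => (chi tau x)%:C * f_ n x))
    (to_L2 (fun x : MR => (chi tau x)%:C * f x))) (aeI (to_L2E sf_) (to_L2E sf)).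
  by move=> x -> [-> ->].
Qed.

Lemma approx_funD (f g : MR -> R[i]) :
  sqi mu (fun x : MR => (chi tau x)%:C * f x) -> sqi mu (fun x : MR => (chi tau x)%:C * g x) ->
  approx_fun f -> approx_fun g -> approx_fun (fun x => f x + g x).
Proof.
move=> sf sg af ag; rewrite /approx_fun.
rewrite (_ : to_L2 _ = to_L2 (fun x : MR => (chi tau x)%:C * f x) +
  to_L2 (fun x : MR => (chi tau x)%:C * g x)); first exact: (approxD hd).
apply: to_L2_ae.
  by under eq_fun do rewrite mulrDr; apply: cmeasD; [case: sf|case: sg].
apply: aeS2 (L2_addE (to_L2 (fun x : MR => (chi tau x)%:C * f x))
    (to_L2 (fun x : MR => (chi tau x)%:C * g x))) (aeI (to_L2E sf) (to_L2E sg)).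
by move=> x -> [-> ->]; rewrite mulrDr.
Qed.

Lemma approx_funZ (c : R[i]) (f : MR -> R[i]) :
  sqi mu (fun x : MR => (chi tau x)%:C * f x) ->
  approx_fun f -> approx_fun (fun x => c * f x).
Proof.
move=> sf af; rewrite /approx_fun.
rewrite (_ : to_L2 _ = c *: to_L2 (fun x : MR => (chi tau x)%:C * f x)).
  exact: (approxZ hd).
apply: to_L2_ae.
  by under eq_fun do rewrite mulrCA; apply: cmeasM; [exact: cmeas_cst|case: sf].
by apply: aeS2 (L2_scaleE c (to_L2 (fun x : MR => (chi tau x)%:C * f x))) (to_L2E sf)
  => x -> ->; rewrite mulrCA.
Qed.

Lemma eq_approx_fun (f g : MR -> R[i]) : cmeas f -> cmeas g ->
  sqi mu (fun x : MR => (chi tau x)%:C * g x) ->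
  {ae mu, forall x, (chi tau x)%:C * f x = (chi tau x)%:C * g x} ->
  approx_fun g -> approx_fun f.
Proof.
move=> mf mg sg fg; rewrite /approx_fun.
by rewrite (@eq_to_L2 _ _ (fun x => (chi tau x)%:C * f x) sg (cmeas_chi tau mf))//; apply: aeS fg.
Qed.

Lemma sqi_chi_indic (A : set MR) : measurable A ->
  sqi mu (fun x : MR => (chi tau x)%:C * (\1_A x)%:C).
Proof.
move=> mA; apply: (@sqi_chi_bounded _ 1); first exact: cmeas_indic.
move=> x; rewrite nsqR indicE; case: (_ \in _); by rewrite /= ?expr1n// expr0n.
Qed.

Lemma approx_fun_cst (c : R) : approx_fun (fun=> c%:C).
Proof. exact: approx_realtrig (realtrig_cst c). Qed.

(* [sin (x / 2) * sin ((s - x) / 2)] is a trigonometric polynomial with the sign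
   of [s - x] on [0, 2 pi[, and the smooth_sign iterates turn it into the sign. *)
Lemma approx_fun_itv (s : R) : approx_fun (fun x => (\1_(`]-oo, s[%classic) x)%:C).
Proof.
have mI r : measurable_fun [set: MR] (\1_(`]-oo, r[%classic) : MR -> R).
  exact: measurable_indic.
have ind x : \1_(`]-oo, s[%classic) x = ((x < s)%R : nat)%:R :> R.
  by rewrite indicE mem_setE in_itv.
have [s0|s0] := leP s 0.
  apply: (eq_approx_fun _ (cmeas_cst _) _ _ (approx_fun_cst 0)).
  - exact: cmeas_real.
  - by under eq_fun do rewrite mulr0; exact: sqi0.
  - apply: aeT => x; rewrite mulr0 ind chiE -rmorphM /= -natrM mulnb.
    by rewrite (_ : _ && _ = false)//; apply/negP => /andP[/andP[]]; lra.
have [s2|s2] := leP tau s.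
  apply: (eq_approx_fun _ (cmeas_cst _) _ _ (approx_fun_cst 1)).
  - exact: cmeas_real.
  - by under eq_fun do rewrite mulr1; exact: sqi_chi (ltW tau_gt0).
  - apply: aeT => x; rewrite mulr1 ind chiE -rmorphM /= -natrM mulnb.
    have [/andP[_ h]|//] := boolP (0 <= x < tau).
    by have -> : (x < s) by lra.
pose t (x : R) := 2^-1 * cos (x - s / 2) + - (2^-1 * cos (s / 2)).
have tt : realtrig t.
  by apply: realtrigD; [apply: realtrigZ; exact: realtrig_cosB|exact: realtrig_cst].
have tE x : t x = sin (x / 2) * sin ((s - x) / 2).
  have e1 : x - s / 2 = x / 2 - (s - x) / 2 by field.
  have e2 : s / 2 = x / 2 + (s - x) / 2 by field.
  by rewrite /t e1 e2 cosB cosD; field.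
have t1 x : -1 <= t x <= 1.
  rewrite tE -ler_norml normrM mulr_ile1//.
    by rewrite ler_norml sin_geN1 sin_le1.
  by rewrite ler_norml sin_geN1 sin_le1.
pose f_ n (x : MR) : R[i] := (iter n smooth_sign (t x))%:C.
pose f (x : MR) : R[i] := (Num.sg (t x))%:C.
have mf_ n : cmeas (f_ n).
  by apply: cmeas_real; apply: measurable_realtrig; exact: realtrig_iter.
have ff x : (fun n => iter n smooth_sign (t x)) @ \oo --> Num.sg (t x).
  exact: cvg_iter_smooth_sign.
have mf : cmeas f.
  by apply: cmeas_real; apply: (measurable_fun_cvg (fun n => (mf_ n).1)) => x _; exact: ff.
have le1 y : -1 <= y <= 1 -> nsq y%:C <= nsq (1 : R[i]).
  by rewrite nsqR nsq1 -ler_norml -(real_normK (num_real y)) => y1; rewrite exprn_ile1.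
have sg1 y : nsq (Num.sg y)%:C <= nsq (1 : R[i]).
  by apply: le1; rewrite -ler_norml normr_sg; case: (_ == _) => /=; rewrite ?ler01.
have af : approx_fun f.
  apply: (@approx_fun_lim f_ f (fun=> 1)) => //.
  - by under eq_fun do rewrite mulr1; exact: sqi_chi (ltW tau_gt0).
  - by move=> n x; apply: le1; exact: iter_smooth_sign_itv.
  - by move=> x; exact: sg1.
  - move=> x; rewrite [X in _ --> X](_ : 0 = (Num.sg (t x) - Num.sg (t x)) ^+ 2); last first.
      by rewrite subrr expr0n.
    rewrite (_ : (fun n => _) = (fun n => (iter n smooth_sign (t x) - Num.sg (t x)) ^+ 2)).
      apply: (cvg_comp _ (fun y => (y - Num.sg (t x)) ^+ 2) (ff x)).
      exact: (continuous_comp (f := fun y => y - Num.sg (t x)) (g := fun y => y ^+ 2)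
         (cvgB cvg_id (cvg_cst _)) (@exprn_continuous _ 2 _)).
    by apply/funext => n; rewrite /f_ /f -rmorphB /= nsqR.
  - by move=> n; apply: approx_realtrig; exact: realtrig_iter.
have sf : sqi mu (fun x : MR => (chi tau x)%:C * f x).
  by apply: (@sqi_chi_bounded _ 1) => // x; rewrite -(@nsq1 R); exact: sg1.
have s1 : sqi mu (fun x : MR => (chi tau x)%:C * 1).
  by under eq_fun do rewrite mulr1; exact: sqi_chi (ltW tau_gt0).
have mg : cmeas (fun x : MR => 2^-1%:C * (1 + f x)).
  by apply: cmeasM; [exact: cmeas_cst|apply: cmeasD => //; exact: cmeas_cst].
have sg : sqi mu (fun x : MR => (chi tau x)%:C * (1 + f x)).
  by under eq_fun do rewrite mulrDr; exact: sqiD.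
have sg' : sqi mu (fun x : MR => (chi tau x)%:C * (2^-1%:C * (1 + f x))).
  by under eq_fun do rewrite mulrCA; exact: sqiZ.
apply: (eq_approx_fun _ mg sg'); first exact: cmeas_real.
  (* At 0 and at [s] the sign is 0 and (1 + sign)/2 is not an indicator value; these two points form
     a null set. *)
  have n01 : {ae mu, forall x : R, x != 0 /\ x != s}.
    exists [set x | x = 0 \/ x = s]; split.
    - by apply: measurableU; exact: measurable_set1.
    - apply: countable_lebesgue_measure0.
      by apply: finite_set_countable; rewrite finite_setU; split; exact: finite_set1.
    - move=> x /=; apply: contra_notP => /not_orP[x0 xs].
      by split; exact/eqP.
  apply: aeS n01 => x [x0 xs]; rewrite ind /f chiE.
  have [xp|_] := boolP (0 <= x < tau); last by rewrite !mul0r.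
  move: xp => /andP[xp x2]; rewrite !mul1r tE sgrM.
  have xp' : 0 < x by rewrite lt_neqAle eq_sym x0.
  have spos y : 0 < y < pi -> 0 < sin y by exact: sin_gt0_pi.
  have -> : Num.sg (sin (x / 2)) = 1.
    by apply: gtr0_sg; apply: spos; apply/andP; split; lra.
  have [sx|sx] := ltP x s.
    rewrite gtr0_sg; last by apply: spos; apply/andP; split; lra.
    by apply: ReIm_inj; rewrite /= ?mulr0n; field.
  have sx' : s < x by rewrite lt_neqAle eq_sym xs.
  rewrite (_ : (s - x) / 2 = - ((x - s) / 2)) ?sinN ?sgrN; last by field.
  rewrite gtr0_sg; last by apply: spos; apply/andP; split; lra.
  by apply: ReIm_inj; rewrite /= ?mulr0n; field.
exact: (approx_funZ _ sg (approx_funD s1 sf (approx_fun_cst 1) af)).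
Qed.

(** Dynkin induction from the half-lines, which are stable under intersection. Complements come from
    linearity, disjoint unions from dominated convergence of the partial sums. *)
Lemma approx_fun_indic (A : set MR) : measurable A -> approx_fun (fun x => (\1_A x)%:C).
Proof.
move=> mA.
have E := @RGenInftyO.measurableE R.
apply: (@dynkin_induction _ MR (@RGenInftyO.G R) (fun A => approx_fun (fun x => (\1_A x)%:C))).
- exact: E.
- move=> _ _ [x ->] [y ->]; exists (Num.min x y).
  by apply/seteqP; split => z /=; rewrite !in_itv/= lt_min => /andP.
- by under eq_fun do rewrite indicT; exact: approx_fun_cst.
- by move=> _ [s ->]; exact: approx_fun_itv.
- move=> S mS aS; rewrite (_ : (fun x => _) = (fun x : MR => 1 + (-1) * (\1_S x)%:C)).
    apply: approx_funD.
    + by under eq_fun do rewrite mulr1; exact: sqi_chi (ltW tau_gt0).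
    + by under eq_fun do rewrite mulrCA; apply: sqiZ; exact: sqi_chi_indic.
    + exact: (approx_fun_cst 1).
    + by apply: approx_funZ => //; exact: sqi_chi_indic.
  apply/funext => x; rewrite !indicE in_setC; case: (_ \in _) => /=.
    by rewrite mulN1r subrr.
  by rewrite mulr0 addr0.
- move=> F mF tF aF.
  have trv k i x : F k x -> (x \in F i)%:R = (i == k)%:R :> R.
    move=> Fkx; have [->|ik] := eqVneq i k; first by rewrite mem_set.
    rewrite memNset// => Fix; move/trivIsetP : tF => /(_ i k I I ik).
    by apply/eqP/set0P; exists x.
  pose f_ n (x : MR) : R[i] := \sum_(i < n) (\1_(F i) x)%:C.
  have f_k k n x : F k x -> f_ n x = ((k < n)%N : nat)%:R%:C.
    move=> Fkx; rewrite /f_; elim: n => [|n IH]; first by rewrite big_ord0.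
    rewrite big_ord_recr/= IH indicE (trv _ _ _ Fkx) ltnS [in RHS]leq_eqVlt eq_sym.
    by case: ltngtP => /= _; rewrite ?addr0 ?add0r.
  have f_0 n x : (forall k, ~ F k x) -> f_ n x = 0.
    by move=> nF; rewrite /f_ big1// => i _; rewrite indicE memNset.
  have mf_ n : cmeas (f_ n) by apply: cmeas_sum => i _; exact: cmeas_indic.
  have sf_ n : sqi mu (fun x : MR => (chi tau x)%:C * f_ n x).
    rewrite /f_; under eq_fun do rewrite mulr_sumr.
    by apply: sqi_sum => i; exact: sqi_chi_indic.
  apply: (@approx_fun_lim f_ _ (fun=> 1)) => //.
  + by apply: cmeas_indic; exact: bigcupT_measurable.
  + by under eq_fun do rewrite mulr1; exact: sqi_chi (ltW tau_gt0).
  + move=> n x; have [[k Fk]|nF] := pselect (exists k, F k x).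
      rewrite (f_k k)// nsqR nsq1; case: (_ < _)%N; by rewrite /= ?expr1n// expr0n ler01.
    by rewrite f_0 ?nsq0 ?nsq_ge0// => k Fk; apply: nF; exists k.
  + move=> x; rewrite nsqR nsq1 indicE; case: (_ \in _); by rewrite /= ?expr1n// expr0n ler01.
  + move=> x; have [[k Fk]|nF] := pselect (exists k, F k x).
      apply: cvg_near_cst; exists k.+1 => //= n kn.
      rewrite (f_k k)// kn indicE mem_set ?subrr ?nsq0//.
      by exists k.
    rewrite (_ : (fun n => _) = (fun=> 0)); first exact: cvg_cst.
    apply/funext => n; rewrite f_0 ?indicE ?memNset ?subrr ?nsq0//.
      by move=> [k _ Fk]; apply: nF; exists k.
    by move=> k Fk; apply: nF; exists k.
  + elim=> [|n IH].
      rewrite /f_; under eq_fun do rewrite big_ord0.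
      exact: approx_fun_cst 0.
    rewrite /f_; under eq_fun do rewrite big_ord_recr/=.
    by apply: approx_funD => //; [exact: sf_|exact: sqi_chi_indic].
- by have : (@RGenInftyO.G R).-sigma.-measurable A by rewrite -E.
Qed.

Import HBNNSimple.

(** Simple functions increase to [h] and are dominated by it, and each one is a finite combination
    of indicators. *)
Lemma approx_fun_nonneg (h : MR -> R) : measurable_fun setT h -> (forall x, 0 <= h x) ->
  sqi mu (fun x : MR => (chi tau x)%:C * (h x)%:C) -> approx_fun (fun x => (h x)%:C).
Proof.
move=> mh h0 sh.
have mEh : measurable_fun setT (EFin \o h) by exact/measurable_EFinP.
pose h_ := nnsfun_approx measurableT mEh.
have hc x : (fun n => h_ n x) @ \oo --> h x.
  have h0' y : setT y -> (0 <= (EFin \o h) y)%E by rewrite lee_fin.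
  exact: (fine_cvg (@cvg_nnsfun_approx _ _ _ _ measurableT _ mEh h0' x I)).
have hle n x : h_ n x <= h x.
  rewrite -(cvg_lim _ (hc x))//; apply: (nondecreasing_cvgn_le (u_ := h_ ^~ x)).
    by move=> a b ab; have /lefP := @nd_nnsfun_approx _ _ _ _ measurableT _ mEh a b ab; apply.
  by apply/cvg_ex; exists (h x).
apply: (@approx_fun_lim (fun n x => (h_ n x)%:C) _ (fun x => (h x)%:C)) => //.
- by move=> n x; rewrite !nsqR ler_pXn2r// ?nnegrE.
- move=> x; rewrite [X in _ --> X](_ : 0 = (h x - h x) ^+ 2); last by rewrite subrr expr0n.
  rewrite (_ : (fun n => _) = (fun n => (h_ n x - h x) ^+ 2)).
    by under eq_fun do rewrite expr2; rewrite expr2; apply: cvgM; apply: cvgB => //; exact: cvg_cst.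
  by apply/funext => n; rewrite -rmorphB /= nsqR.
move=> n; have mpre y : measurable (h_ n @^-1` [set y]) by exact: measurable_sfunP.
rewrite (_ : (fun x => _) = (fun x : MR =>
    \sum_(y <- finmap.enum_fset (fset_set (range (h_ n)))) y%:C * (\1_(h_ n @^-1` [set y]) x)%:C)).
  elim: (finmap.enum_fset _) => [|y s IH].
    by under eq_fun do rewrite big_nil; exact: approx_fun_cst 0.
  under eq_fun do rewrite big_cons.
  apply: approx_funD => //.
  - by under eq_fun do rewrite mulrCA; apply: sqiZ; exact: sqi_chi_indic.
  - under eq_fun do rewrite mulr_sumr; apply: sqi_sum => z.
    by under eq_fun do rewrite mulrCA; apply: sqiZ; exact: sqi_chi_indic.
  - by apply: approx_funZ; [exact: sqi_chi_indic|exact: approx_fun_indic].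
apply/funext => x; rewrite [in LHS]fimfunE fsbig_finite//= rmorph_sum.
by apply: eq_bigr => y _; rewrite rmorphM.
Qed.

Lemma approx_fun_sqi (f : MR -> R[i]) : cmeas f ->
  sqi mu (fun x : MR => (chi tau x)%:C * f x) -> approx_fun f.
Proof.
move=> [m1 m2] sf.
have bound (h : MR -> R) : measurable_fun setT h -> (forall x, `|h x| <= cabs (f x)) ->
    sqi mu (fun x : MR => (chi tau x)%:C * (h x)%:C).
  move=> mh hf; apply: sqi_le sf _; first by apply: cmeas_chi; exact: cmeas_real.
  move=> x; rewrite !nsqM ler_wpM2l ?nsq_ge0// -!cabs_sqr cabsR.
  by rewrite ler_pXn2r ?nnegrE ?cabs_ge0.
have real (h : MR -> R) : measurable_fun setT h -> (forall x, `|h x| <= cabs (f x)) ->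
    approx_fun (fun x => (h x)%:C).
  move=> mh hf.
  have mp : measurable_fun [set: MR] (fun x => Num.max (h x) 0) by exact: measurable_maxr.
  have mm : measurable_fun [set: MR] (fun x => Num.max (- h x) 0).
    apply: measurable_maxr => //; exact: measurableT_comp (@oppr_measurable _ _) mh.
  have mb (y : R) : `|Num.max y 0| <= `|y| by case: (leP y 0); rewrite ?normr0.
  have bp x : `|Num.max (h x) 0| <= cabs (f x) by exact: le_trans (mb _) (hf x).
  have bm x : `|Num.max (- h x) 0| <= cabs (f x).
    by apply: le_trans (mb _) _; rewrite normrN.
  have sp := bound _ mp bp; have sm := bound _ mm bm.
  rewrite (_ : (fun x => _) = (fun x : MR => (Num.max (h x) 0)%:C + (-1) * (Num.max (- h x) 0)%:C)).
    apply: approx_funD => //.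
    + by under eq_fun do rewrite mulrCA; exact: sqiZ.
    + by apply: approx_fun_nonneg => // x; rewrite le_max lexx orbT.
    + by apply: approx_funZ => //; apply: approx_fun_nonneg => // x; rewrite le_max lexx orbT.
  apply/funext => x; rewrite mulN1r -rmorphB /=; congr (_%:C).
  by case: (ltgtP (h x) 0) => hx; rewrite ?oppr_gt0 ?oppr_lt0 ?hx; case: leP; lra.
rewrite (_ : f = (fun x : MR => (complex.Re (f x))%:C + 'i%C * (complex.Im (f x))%:C)).
  apply: approx_funD.
  - by apply: bound => // x; exact: Re_le_cabs.
  - by under eq_fun do rewrite mulrCA; apply: sqiZ; apply: bound => // x; exact: Im_le_cabs.
  - by apply: real => // x; exact: Re_le_cabs.
  - apply: approx_funZ; first by apply: bound => // x; exact: Im_le_cabs.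
    by apply: real => // x; exact: Im_le_cabs.
by apply/funext => x; rewrite -complexE.
Qed.

(** The factor [tau] appears because the exponentials are used here without the normalization of
    [trig]. *)
Lemma parseval_circle (f : MR -> R[i]) : cmeas f ->
  sqi mu (fun x : MR => (chi tau x)%:C * f x) ->
  (\esum_(k in [set: int])
     (nsq (cint mu (fun x : MR => (chi tau x)%:C * (f x * cis (- (k%:~R * x))))))%:E =
   tau%:E * nsqint mu (fun x : MR => (chi tau x)%:C * f x)%R)%E.
Proof.
move=> mf sf.
have := parseval_approx hd trig_orthonormal (approx_fun_sqi mf sf).
rewrite (L2_sqnorm_ae _ (to_L2E sf)); last exact: cmeas_chi.
move=> <-; rewrite -esumZl ?(ltW tau_gt0)//; last by move=> k; rewrite lee_fin nsq_ge0.
apply: eq_esum => k _; rewrite (trig_dot k sf (to_L2E sf)) nsqM nsqR exprVn sqr_sqrtr ?(ltW tau_gt0)//.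
rewrite -EFinM mulrA mulfV ?gt_eqF ?tau_gt0// mul1r; congr (nsq _)%:E; apply: eq_cint => x.
by rewrite !mulrA -rmorphM /= chi_sqr.
Qed.

End Trig.

(** * Fourier integrals of compactly supported functions *)

Section CompactFourier.
Context {R : realType}.
Local Notation mu := (@lebesgue_measure R).
Local Notation MR := (measurableTypeR R).
Local Notation tau := (2 * pi : R).
Implicit Types f g v : MR -> R[i].

Definition ft f (xi : R) : R[i] := cint mu (fun x : MR => f x * cis (- (xi * x))).

Lemma cmeas_cisN (xi : R) : cmeas (fun x : MR => cval (cis (- (xi * x)))).
Proof. by have := cmeas_cisM (- xi); under eq_fun do rewrite mulNr. Qed.

Lemma cintegrable_cis f (xi : R) : cintegrable mu f ->
  cintegrable mu (fun x : MR => f x * cis (- (xi * x))).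
Proof.
move=> fi; apply: (cintegrable_le _ (integrable_cabs fi)).
  by apply: cmeasM; [exact: cintegrable_meas fi|exact: cmeas_cisN].
by move=> x; rewrite cabsM cabs_circle mulr1.
Qed.

Lemma ftD f g xi : cintegrable mu f -> cintegrable mu g ->
  ft (fun x => f x + g x) xi = ft f xi + ft g xi.
Proof.
move=> fi gi; rewrite /ft -cintD; try exact: cintegrable_cis.
by apply: eq_cint => x; rewrite mulrDl.
Qed.

Lemma ftZ c f xi : cintegrable mu f -> ft (fun x => c * f x) xi = c * ft f xi.
Proof.
move=> fi; rewrite /ft -cintZ; last exact: cintegrable_cis.
by apply: eq_cint => x; rewrite mulrA.
Qed.

Lemma eq_ft f g : cmeas f -> cmeas g -> {ae mu, forall x, f x = g x} -> ft f = ft g.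
Proof.
move=> mf mg fg; apply/funext => xi; apply: ae_eq_cint.
- by apply: cmeasM => //; exact: cmeas_cisN.
- by apply: cmeasM => //; exact: cmeas_cisN.
- by apply: aeS fg => x ->.
Qed.

(** Dominated convergence makes the integral continuous in the parameter, and continuity gives
    measurability. *)
Lemma measurable_Rintegral_param (h : R -> MR -> R) (b : MR -> R) :
  (forall xi, measurable_fun setT (h xi)) -> (forall x, continuous (h ^~ x)) ->
  mu.-integrable setT (EFin \o b) -> (forall xi x, `|h xi x| <= b x) ->
  measurable_fun [set: MR] (fun xi : R => \int[mu]_x h xi x).
Proof.
move=> mh ch ib hb; apply: continuous_measurable_fun => a.
apply: (@continuity_under_integral R _ MR mu h setT measurableT (a - 1) (a + 1) _ _ b) => //.
- move=> xi _; apply: le_integrable ib => //; first exact/measurable_EFinP.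
  by move=> x _ /=; rewrite lee_fin (le_trans (hb _ _))// ler_norm.
- by apply: aeW => x _ y _; exact: ch.
- by move=> xi _; apply: aeW => x _; exact: hb.
- by rewrite inE/= in_itv/=; apply/andP; split; lra.
Qed.

Lemma cmeas_ft f : cintegrable mu f -> cmeas (ft f : MR -> R[i]).
Proof.
move=> fi; have ic := integrable_cabs fi; have [m1 m2] := cintegrable_meas fi.
have mc xi := cmeasM (conj m1 m2) (cmeas_cisN xi).
have cc (x : R) : continuous (fun xi : R => cos (- (xi * x))).
  move=> xi; apply: continuous_comp; last exact: continuous_cos.
  by apply: cvgN; apply: cvgMl; exact: cvg_id.
have cs (x : R) : continuous (fun xi : R => sin (- (xi * x))).
  move=> xi; apply: continuous_comp; last exact: continuous_sin.
  by apply: cvgN; apply: cvgMl; exact: cvg_id.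
split.
  apply: (@measurable_Rintegral_param
    (fun xi x => complex.Re (f x * cis (- (xi * x)))) (fun x => cabs (f x))) => //.
  - by move=> xi; case: (mc xi).
  - move=> x; rewrite (_ : (fun xi => _) = (fun xi => complex.Re (f x) * cos (- (xi * x)) -
        complex.Im (f x) * sin (- (xi * x)))); last by apply/funext => xi; rewrite cReM.
    move=> xi; apply: cvgB; apply: cvgMr; [exact: cc|exact: cs].
  - by move=> xi x; apply: le_trans (Re_le_cabs _) _; rewrite cabsM cabs_circle mulr1.
apply: (@measurable_Rintegral_param
  (fun xi x => complex.Im (f x * cis (- (xi * x)))) (fun x => cabs (f x))) => //.
- by move=> xi; case: (mc xi).
- move=> x; rewrite (_ : (fun xi => _) = (fun xi => complex.Re (f x) * sin (- (xi * x)) +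
      complex.Im (f x) * cos (- (xi * x)))); last by apply/funext => xi; rewrite cImM.
  move=> xi; apply: cvgD; apply: cvgMr; [exact: cs|exact: cc].
- by move=> xi x; apply: le_trans (Im_le_cabs _) _; rewrite cabsM cabs_circle mulr1.
Qed.

(** The product of [v] with the cut-off of [-A, A[ is [v] itself, and both factors are square
    integrable. *)
Lemma sqi_bounded_support v (A : R) : 0 < A -> sqi mu v ->
  (forall x, A <= `|x| -> v x = 0) -> cintegrable mu v.
Proof.
move=> A0 sv vA.
have A2 : 0 <= A + A by lra.
have := sqiM (sqi_affine A (oner_neq0 R) (sqi_chi A2)) sv.
congr cintegrable; apply/funext => x; rewrite mul1r chiE.
have [h|h] := leP A `|x|; first by rewrite vA// mulr0.
have -> : 0 <= x + A < A + A.
  by move: h; rewrite ltr_norml => /andP[? ?]; apply/andP; split; lra.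
by rewrite mul1r.
Qed.

(* Parseval for the Fourier series of [v] on a period, applied to all the
   modulations of [v], and averaged over one period of the frequencies. *)
Lemma plancherel_compact v (A : R) : 0 < A -> sqi mu v ->
  (forall x, A <= `|x| -> v x = 0) ->
  sqi mu (ft v : MR -> R[i]) /\ nsqint mu (ft v : MR -> R[i]) = (tau%:E * nsqint mu v)%E.
Proof.
move=> A0 sv vA; have iv := sqi_bounded_support A0 sv vA.
have mft := cmeas_ft iv.
suff H : nsqint mu (ft v : MR -> R[i]) = (tau%:E * nsqint mu v)%E.
  split=> //; split=> //; rewrite H lte_mul_pinfty//; first by rewrite lee_fin ltW// tau_gt0.
  by case: sv.
have p0 := @pi_gt0 R.
(* [c] is the frequency spacing of the Fourier series on ]-A, A[: 2 A c = 2 pi. *)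
have [c c0 pE] : exists2 c : R, 0 < c & pi = A * c.
  by exists (pi / A); [rewrite divr_gt0|rewrite mulrC divfK// gt_eqF].
have cA : 2 * A * c = tau by rewrite pE mulrA.
rewrite {1}/nsqint (@ge0_integral_periodize _ c)//; last 2 first.
- exact: measurable_EFin_nsq.
- by move=> x; rewrite lee_fin nsq_ge0.
have key (t : R) : (\esum_(k in [set: int]) (nsq (ft v (t + k%:~R * c)))%:E =
    (2 * A)%:E * nsqint mu v)%E.
  (* The modulation of [v] by frequency [t], carried affinely from [-A, A[ to [0, 2 pi[. *)
  pose f (y : MR) : R[i] := v (c^-1 * y + - A) * cis (- (t * (c^-1 * y + - A))).
  have mf : cmeas f.
    have := cmeas_affine c^-1 (- A) (cmeasM (cintegrable_meas iv) (cmeas_cisN t)).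
    exact.
  have fchi y : (chi tau y)%:C * f y = f y.
    rewrite chiE; have [//|h] := boolP (0 <= y < tau); first by rewrite mul1r.
    rewrite /f vA ?mul0r ?mulr0// leNgt; apply: contra h; rewrite ltr_norml.
    have -> : c^-1 * y = y / c by rewrite mulrC.
    move=> /andP[h1 h2].
    have h3 : 0 < y / c by lra.
    have : y / c < 2 * A by lra.
    rewrite ltr_pdivrMr// cA => h4.
    by rewrite pmulr_lgt0 ?invr_gt0// in h3; rewrite ltW.
  have cv0 : c^-1 != 0 by rewrite invr_eq0 gt_eqF.
  have nf y : nsq (f y) = nsq (v (c^-1 * y + - A)) by rewrite /f nsqM nsq_circle mulr1.
  have mva := cmeas_affine c^-1 (- A) (cintegrable_meas iv).
  have sf : sqi mu (fun x : MR => (chi tau x)%:C * f x).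
    under eq_fun do rewrite fchi.
    by apply: (sqi_le mf (sqi_affine (- A) cv0 sv)) => y; rewrite nf.
  have nfE : nsqint mu (fun x : MR => (chi tau x)%:C * f x)%R = (c%:E * nsqint mu v)%E.
    rewrite /nsqint; under eq_integral do rewrite fchi nf.
    rewrite -/(nsqint mu (fun y : MR => v (c^-1 * y + - A))) nsqint_affine//.
      by rewrite ger0_norm ?invr_ge0 ?ltW// invrK.
    exact: cintegrable_meas iv.
  have coef (k : int) : nsq (cint mu (fun x : MR => (chi tau x)%:C *
      (f x * cis (- (k%:~R * x))))) = c ^+ 2 * nsq (ft v (t + k%:~R * c)).
    pose G (x : MR) := cval (cis (- (k%:~R * pi))) * (v x * cis (- ((t + k%:~R * c) * x))).
    have iG : cintegrable mu G by apply: cintegrableZ; exact: cintegrable_cis.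
    have -> : cint mu (fun x : MR => (chi tau x)%:C * (f x * cis (- (k%:~R * x)))) =
        cint mu (fun y : MR => G (c^-1 * y + - A)).
      apply: eq_cint => y; rewrite mulrA fchi /f /G -mulrA -cisD mulrCA -cisD.
      congr (_ * cval (cis _)); rewrite pE; field.
      by rewrite gt_eqF.
    rewrite cint_affine// nsqM nsqR /G cintZ; last exact: cintegrable_cis.
    by rewrite nsqM nsq_circle mul1r ger0_norm ?invr_ge0 ?ltW// invrK.
  have := parseval_circle mf sf; rewrite nfE.
  rewrite (eq_esum (b := fun k : int => (c ^+ 2)%:E * (nsq (ft v (t + k%:~R * c)))%:E)%E).
    rewrite esumZl ?sqr_ge0//; last by move=> k; rewrite lee_fin nsq_ge0.
    move=> /(congr1 (fun z => (c ^+ 2)^-1%:E * z)%E); rewrite !muleA -!EFinM.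
    rewrite mulVf ?expf_neq0 ?gt_eqF// mul1e => ->; congr (_%:E * _)%E.
    by rewrite -cA; field; rewrite gt_eqF.
  by move=> k _; rewrite coef EFinM.
(* The integrand over the frequencies in [0, c[ is constant, so the integral is c 2 A = 2 pi times
   the square integral of [v]. *)
rewrite (eq_integral (cst ((2 * A)%:E * nsqint mu v)%E)); last by move=> t _; exact: key.
have fv : nsqint mu v \is a fin_num by rewrite ge0_fin_numE ?nsqint_ge0//; case: sv.
rewrite -(fineK fv) -!EFinM integral_cst// circm_setT ?ltW// -EFinM.
by congr EFin; rewrite -cA; ring.
Qed.

Lemma cint_prod_bound (H : MR * MR -> R[i]) f g : cintegrable mu f -> cintegrable mu g ->
  cmeas H -> (forall z, cabs (H z) <= cabs (f z.1) * cabs (g z.2)) ->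
  cintegrable (mu \x mu)%E H.
Proof.
move=> fi gi mH HB.
have mf := measurable_cabs (cintegrable_meas fi).
have mg := measurable_cabs (cintegrable_meas gi).
apply: (@cintegrable_le _ _ _ _ _ (fun z => cabs (f z.1) * cabs (g z.2))) => //.
have mfg : measurable_fun setT (fun z : MR * MR => (cabs (f z.1) * cabs (g z.2))%:E).
  apply/measurable_EFinP; apply: measurable_funM.
    exact: measurableT_comp mf (@measurable_fst _ _ _ _).
  exact: measurableT_comp mg (@measurable_snd _ _ _ _).
apply/integrableP; split=> //.
under eq_integral do rewrite gee0_abs ?lee_fin ?mulr_ge0 ?cabs_ge0//.
rewrite fubini_tonelli1//=; last by move=> z; rewrite lee_fin mulr_ge0 ?cabs_ge0.
rewrite /fubini_F /=.
have [_ fI] := integrableP _ _ _ (integrable_cabs fi).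
have [_ gI] := integrableP _ _ _ (integrable_cabs gi).
have f0 : (0 <= \int[mu]_x (cabs (f x))%:E)%E by apply: integral_ge0 => x _; rewrite lee_fin cabs_ge0.
have g0 : (0 <= \int[mu]_x (cabs (g x))%:E)%E by apply: integral_ge0 => x _; rewrite lee_fin cabs_ge0.
have fI' : (\int[mu]_x (cabs (f x))%:E < +oo)%E.
  by move: fI; under eq_integral do rewrite gee0_abs ?lee_fin ?cabs_ge0//.
have gI' : (\int[mu]_x (cabs (g x))%:E < +oo)%E.
  by move: gI; under eq_integral do rewrite gee0_abs ?lee_fin ?cabs_ge0//.
under eq_integral => x _.
  under eq_integral do rewrite EFinM.
  rewrite ge0_integralZl//; last 3 first.
  - exact/measurable_EFinP.
  - by move=> y _; rewrite lee_fin cabs_ge0.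
  - by rewrite lee_fin cabs_ge0.
  over.
rewrite ge0_integralZr//.
- by rewrite lte_mul_pinfty// ge0_fin_numE.
- exact/measurable_EFinP.
- by move=> y _; rewrite lee_fin cabs_ge0.
Qed.

Lemma Rintegral_Fubini (h : MR * MR -> R) :
  (mu \x mu)%E.-integrable setT (fun z => (h z)%:E) ->
  (forall x, mu.-integrable setT (fun y => (h (x, y))%:E)) ->
  (forall y, mu.-integrable setT (fun x => (h (x, y))%:E)) ->
  \int[mu]_x \int[mu]_y h (x, y) = \int[mu]_y \int[mu]_x h (x, y).
Proof.
move=> ih h1 h2; have F := Fubini ih; rewrite {1}/Rintegral [RHS]/Rintegral.
congr fine; transitivity (\int[mu]_x \int[mu]_y (h (x, y))%:E)%E.
  by apply: eq_integral => x _; rewrite fineK//; apply: integrable_fin_num.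
rewrite F; apply: eq_integral => x _; rewrite fineK//; exact: integrable_fin_num.
Qed.

Lemma cint_Fubini (H : MR * MR -> R[i]) : cintegrable (mu \x mu)%E H ->
  (forall x, cintegrable mu (fun y => H (x, y))) ->
  (forall y, cintegrable mu (fun x => H (x, y))) ->
  cint mu (fun x : MR => cint mu (fun y : MR => H (x, y))) =
  cint mu (fun y : MR => cint mu (fun x : MR => H (x, y))).
Proof.
move=> [H1 H2] Hx Hy; apply: ReIm_inj => /=.
  apply: (@Rintegral_Fubini (fun z => complex.Re (H z))) => // z.
    by case: (Hx z).
  by case: (Hy z).
apply: (@Rintegral_Fubini (fun z => complex.Im (H z))) => // z.
  by case: (Hx z).
by case: (Hy z).
Qed.

(** Fubini for f(x) conj(g(y)) e^{-ixy}. Conjugating the transform of [g] reverses its frequency,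
    whence the argument [- x]. *)
Lemma ft_adjoint f g : cintegrable mu f -> cintegrable mu g ->
  cint mu (fun xi : MR => ft f xi * ((g xi)^*)%C) =
  cint mu (fun x : MR => f x * ((ft g (- x))^*)%C).
Proof.
move=> fi gi.
pose H (z : MR * MR) := f z.1 * ((g z.2)^*)%C * cis (- (z.2 * z.1)).
have mp : cmeas (fun z : MR * MR => cval (cis (- (z.2 * z.1)))).
  have m : measurable_fun setT (fun z : MR * MR => - (z.2 * z.1) : MR).
    apply: measurableT_comp (@oppr_measurable _ _) _.
    by apply: measurable_funM; [exact: measurable_snd|exact: measurable_fst].
  split => /=.
    exact: measurableT_comp (@measurable_cos R) m.
  exact: measurableT_comp (@measurable_sin R) m.
have [f1 f2] := cintegrable_meas fi; have [g1 g2] := cintegrable_meas gi.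
have mH : cmeas H.
  apply: cmeasM mp; apply: cmeasM.
    split; [exact: measurableT_comp f1 (@measurable_fst _ _ _ _)|
            exact: measurableT_comp f2 (@measurable_fst _ _ _ _)].
  apply: cmeasJ.
  split; [exact: measurableT_comp g1 (@measurable_snd _ _ _ _)|
          exact: measurableT_comp g2 (@measurable_snd _ _ _ _)].
have iH : cintegrable (mu \x mu)%E H.
  apply: (cint_prod_bound fi gi mH) => z.
  by rewrite /H !cabsM cabs_circle mulr1 cabsJ.
have Hx x : cintegrable mu (fun y => H (x, y)).
  have := cintegrableZ (f x) (cintegrable_cis x (cintegrableJ gi)).
  by rewrite /H /=; under eq_fun do rewrite mulrA (mulrC x).
have Hy y : cintegrable mu (fun x => H (x, y)).
  have := cintegrableZ ((g y)^*)%C (cintegrable_cis y fi).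
  by rewrite /H /=; under eq_fun do rewrite mulrCA mulrA.
have E1 xi : ft f xi * ((g xi)^*)%C = cint mu (fun x : MR => H (x, xi)).
  rewrite mulrC -cintZ; last exact: cintegrable_cis.
  by apply: eq_cint => x; rewrite /H /= mulrCA mulrA.
have E2 x : f x * ((ft g (- x))^*)%C = cint mu (fun xi : MR => H (x, xi)).
  rewrite -cintJ; last exact: cintegrable_cis.
  rewrite -cintZ; last by apply: cintegrableJ; exact: cintegrable_cis.
  apply: eq_cint => xi; rewrite /H -[(x, xi).1]/x -[(x, xi).2]/xi conjCM -cisN -mulrA.
  by congr (_ * (_ * cval (cis _))); ring.
under eq_fun do rewrite E1.
by rewrite -cint_Fubini//; apply: eq_cint => x; rewrite E2.
Qed.

End CompactFourier.

Section OpInv.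
Context {V : zmodType}.

(** [op_inv] is a chosen partial inverse, so its values are known only once injectivity is. *)
Lemma op_inv_eq (A : V -> V) x y : injective A -> A x = y -> op_inv A y = x.
Proof.
move=> iA <-; rewrite /op_inv; apply: pinvKV; rewrite ?inE//.
by move=> a b _ _; exact: iA.
Qed.

Lemma op_invK (A B : V -> V) : cancel A B -> cancel B A -> op_inv A = B.
Proof.
by move=> AB BA; apply/funext => y; apply: (op_inv_eq (can_inj AB)); rewrite BA.
Qed.

End OpInv.

(** * Norm limits and inner products *)

Section SqLim.
Context {R : realType} {V : lmodType R[i]}.
Variables (dot : V -> V -> R[i]) (hd : semi_inner dot).
Local Notation sqn := (sqnorm dot).

Definition sqlim (a : nat -> V) (l : V) : Prop := forall eps : R, 0 < eps ->
  exists N, forall n, (N <= n)%N -> sqn (a n - l) < eps.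

Lemma sqlimD a b l k : sqlim a l -> sqlim b k -> sqlim (fun n => a n + b n) (l + k).
Proof.
move=> al bk eps e0; have e4 : 0 < eps / 4 by rewrite divr_gt0.
have [N hN] := al _ e4; have [M hM] := bk _ e4.
exists (maxn N M) => n; rewrite geq_max => /andP[Nn Mn].
rewrite opprD addrACA; apply: le_lt_trans (sqnormD_le hd _ _) _.
by have := hN n Nn; have := hM n Mn; lra.
Qed.

Lemma sqlimZ c a l : sqlim a l -> sqlim (fun n => c *: a n) (c *: l).
Proof.
move=> al eps e0; have n1 : 0 < nsq c + 1 by rewrite ltr_wpDl// nsq_ge0.
have [N hN] := al (eps / (nsq c + 1)) (divr_gt0 e0 n1).
exists N => n /hN; rewrite -scalerBr (sqnormZ hd) ltr_pdivlMr//.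
by have := sqnorm_ge0 hd (a n - l); lra.
Qed.

Lemma sqlim_subseq a l (phi : nat -> nat) : (forall n, (n <= phi n)%N) ->
  sqlim a l -> sqlim (a \o phi) l.
Proof.
move=> hphi al eps /al[N hN]; exists N => n Nn /=.
by apply: hN; exact: leq_trans Nn (hphi n).
Qed.

Lemma sqlim_unique a l k : (forall v, sqn v = 0 -> v = 0) ->
  sqlim a l -> sqlim a k -> l = k.
Proof.
move=> df al ak; apply/eqP; rewrite -subr_eq0; apply/eqP/df/eqP.
rewrite eq_le sqnorm_ge0// andbT; apply/ler_addgt0Pr => eps e0; rewrite add0r.
have e4 : 0 < eps / 4 by rewrite divr_gt0.
have [N hN] := al _ e4; have [M hM] := ak _ e4.
rewrite -(subrKA (a (maxn N M))); apply: le_trans (sqnormD_le hd _ _) _.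
rewrite (sqnormBC hd l).
have := hN (maxn N M) (leq_maxl _ _); have := hM (maxn N M) (leq_maxr _ _).
by move: (sqn _) (sqn _) => x y; lra.
Qed.

Lemma cabs_dot_le u v : cabs (dot u v) <= nrm dot u * nrm dot v.
Proof.
rewrite -(ler_pXn2r (n := 2)) ?nnegrE ?cabs_ge0 ?mulr_ge0 ?nrm_ge0//.
by rewrite cabs_sqr exprMn !(nrm_sqr hd) cauchy_schwarz.
Qed.

Lemma sqlim_dot a b l k : sqlim a l -> sqlim b k -> forall eps : R, 0 < eps ->
  exists N, forall n, (N <= n)%N -> cabs (dot (a n) (b n) - dot l k) < eps.
Proof.
move=> al bk eps e0.
pose K := nrm dot k + nrm dot l + 2.
have K0 : 0 < K by have := nrm_ge0 dot k; have := nrm_ge0 dot l; rewrite /K; lra.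
(* Both sequences are brought within [d] of their limits. The three error terms sum to at most d (1
   + |k| + |l|), strictly below d K; hence the 2 in [K]. *)
pose d := Num.min 1 (eps / K).
have d0 : 0 < d by rewrite lt_min ltr01 divr_gt0.
have d1 : d <= 1 by rewrite ge_min lexx.
have dK : d * K <= eps by rewrite -ler_pdivlMr// ge_min lexx orbT.
have [N hN] := al (d ^+ 2) (exprn_gt0 2 d0).
have [M hM] := bk (d ^+ 2) (exprn_gt0 2 d0).
exists (maxn N M) => n; rewrite geq_max => /andP[Nn Mn].
have an := nrm_lt_sqn hd d0 (hN n Nn); have bn := nrm_lt_sqn hd d0 (hM n Mn).
have -> : dot (a n) (b n) - dot l k =
    dot (a n - l) (b n - k) + dot (a n - l) k + dot l (b n - k).
  by rewrite !(dotBl hd) !(dotBr hd); ring.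
apply: le_lt_trans (cabsD _ _) _.
have h1 := cabsD (dot (a n - l) (b n - k)) (dot (a n - l) k).
have h2 := cabs_dot_le (a n - l) (b n - k).
have h3 := cabs_dot_le (a n - l) k.
have h4 := cabs_dot_le l (b n - k).
have na := nrm_ge0 dot (a n - l); have nb := nrm_ge0 dot (b n - k).
have nk := nrm_ge0 dot k; have nl := nrm_ge0 dot l.
have h5 : nrm dot (a n - l) * nrm dot (b n - k) <= d * 1.
  by apply: ler_pM => //; lra.
have h6 : nrm dot (a n - l) * nrm dot k <= d * nrm dot k by rewrite ler_wpM2r// ltW.
have h7 : nrm dot l * nrm dot (b n - k) <= nrm dot l * d by rewrite ler_wpM2l// ltW.
by move: dK; rewrite /K; lra.
Qed.

Lemma sqlim_dot_eq (t : R[i]) a b c d l k l' k' : sqlim a l -> sqlim b k ->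
  sqlim c l' -> sqlim d k' -> (forall n, dot (a n) (b n) = t * dot (c n) (d n)) ->
  dot l k = t * dot l' k'.
Proof.
move=> al bk cl dk e; apply/eqP; rewrite -subr_eq0; apply/eqP/cabs_eq0/eqP.
rewrite eq_le cabs_ge0 andbT; apply/ler_addgt0Pr => eps e0; rewrite add0r.
have t0 : 0 < cabs t + 1 by rewrite ltr_wpDl// cabs_ge0.
have e2 : 0 < eps / 2 by rewrite divr_gt0.
have [N hN] := sqlim_dot al bk e2; have [M hM] := sqlim_dot cl dk (divr_gt0 e2 t0).
pose n := maxn N M.
have -> : dot l k - t * dot l' k' =
    - (dot (a n) (b n) - dot l k) + t * (dot (c n) (d n) - dot l' k').
  by rewrite e; ring.
apply: le_trans (cabsD _ _) _; rewrite cabsN cabsM.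
have := hN n (leq_maxl _ _); have := hM n (leq_maxr _ _).
rewrite ltr_pdivlMr//.
have := cabs_ge0 t; have := cabs_ge0 (dot (c n) (d n) - dot l' k').
by move: (cabs _) (cabs t) (cabs (dot (a n) _ - _)) => x y z; lra.
Qed.

Lemma sqlim_sqn_eq (t : R) a c l l' : sqlim a l -> sqlim c l' ->
  (forall n, sqn (a n) = t * sqn (c n)) -> sqn l = t * sqn l'.
Proof.
move=> al cl e; have := sqlim_dot_eq (t := t%:C) al al cl cl _.
rewrite !(dotvv hd) -rmorphM => h.
suff /h[] : forall n, dot (a n) (a n) = t%:C * dot (c n) (c n) by [].
by move=> n; rewrite !(dotvv hd) e rmorphM.
Qed.

End SqLim.

Section AffineL2.
Context {R : realType}.
Local Notation mu := (@lebesgue_measure R).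
Local Notation MR := (measurableTypeR R).
Local Notation sqn := (sqnorm (@L2_dot R)).

(** [U0], its inverse and the reflection x |-> -x are all of this form, so linearity, norm and
    continuity are settled once. *)
Definition affL2 (c : R[i]) (a b : R) (u : L2 R) : L2 R :=
  to_L2 (fun x : R => c * u (a * x + b)).

Variables (c : R[i]) (a b : R) (a0 : a != 0).

Lemma affL2E u : {ae mu, forall x, affL2 c a b u x = c * u (a * x + b)}.
Proof.
by apply: to_L2E; apply: sqiZ; apply: (sqi_affine b a0); exact: L2_sqi.
Qed.

Lemma affL2_to_L2 (f : MR -> R[i]) : sqi mu f ->
  affL2 c a b (to_L2 f) = to_L2 (fun x : R => c * f (a * x + b)).
Proof.
move=> sf; apply: L2_eq.
have sg : sqi mu (fun x : MR => c * f (a * x + b)) by apply: sqiZ; exact: sqi_affine.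
apply: aeS2 (aeI (affL2E (to_L2 f)) (to_L2E sg)) (ae_affine b a0 (to_L2E sf)).
by move=> x [-> ->] ->.
Qed.

Lemma affL2P t u v : affL2 c a b (t *: u + v) = t *: affL2 c a b u + affL2 c a b v.
Proof.
apply: L2_eq; apply: aeS2 (aeI (affL2E (t *: u + v)) (affL2E v))
  (aeI (aeI (L2_addE (t *: affL2 c a b u) (affL2 c a b v)) (aeI (L2_scaleE t (affL2 c a b u)) (affL2E u)))
    (ae_affine b a0 (aeI (L2_addE (t *: u) v) (L2_scaleE t u)))).
move=> x [-> e1] [[-> [-> ->]] [-> ->]]; rewrite e1.
by ring.
Qed.

Lemma sqn_affL2 u : sqn (affL2 c a b u) = nsq c / `|a| * sqn u.
Proof.
apply: EFin_inj; rewrite (L2_sqnorm_ae _ (affL2E u)); last first.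
  by apply: cmeasM; [exact: cmeas_cst|apply: cmeas_affine; exact: L2_cmeas].
rewrite nsqintZ; last by apply: cmeas_affine; exact: L2_cmeas.
rewrite nsqint_affine//; last exact: L2_cmeas.
by rewrite -L2_sqnormE -!EFinM mulrA.
Qed.

Lemma sqlim_affL2 (u_ : nat -> L2 R) u : sqlim (@L2_dot R) u_ u ->
  sqlim (@L2_dot R) (fun n => affL2 c a b (u_ n)) (affL2 c a b u).
Proof.
move=> ul eps e0; pose K := nsq c / `|a|.
have K0 : 0 <= K by rewrite divr_ge0// nsq_ge0.
have [N hN] := ul (eps / (K + 1)) (divr_gt0 e0 (ltr_wpDl K0 ltr01)).
exists N => n /hN; rewrite ltr_pdivlMr; last by rewrite ltr_wpDl.
have -> : affL2 c a b (u_ n) - affL2 c a b u = affL2 c a b (u_ n - u).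
  by have := affL2P (-1) u (u_ n); rewrite !scaleN1r => h; rewrite [LHS]addrC -h addrC.
rewrite sqn_affL2 -/K; have := sqnorm_ge0 (@L2_semi_inner R) (u_ n - u).
by move: (sqn _) => x; lra.
Qed.

End AffineL2.

(** * Plancherel, inversion and dilation for the L2 Fourier transform *)

Section FourierL2.
Context {R : realType}.
Local Notation mu := (@lebesgue_measure R).
Local Notation MR := (measurableTypeR R).
Local Notation sqn := (sqnorm (@L2_dot R)).
Local Notation sqlim := (sqlim (@L2_dot R)).
Local Notation tau := (2 * pi : R).
Implicit Types u v : L2 R.

Definition win (n : nat) (f : MR -> R[i]) (x : MR) : R[i] :=
  (\1_(`[- n%:R, n%:R]%classic : set R) x)%:C * f x.

Lemma winE n f x : win n f x = if `|x| <= n%:R then f x else 0.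
Proof.
rewrite /win indicE mem_setE in_itv/= -ler_norml.
by case: ifP => _; rewrite ?mul1r ?mul0r.
Qed.

Lemma sqi_win n f : sqi mu f -> sqi mu (win n f).
Proof.
move=> sf; apply: (sqiM_bounded (B := 1)) sf _; first by apply: cmeas_indic; exact: measurable_itv.
by move=> x; rewrite nsqR indicE; case: (_ \in _); rewrite ?expr1n// expr0n.
Qed.

(** The window is closed and [win n f] may be nonzero at |x| = n, so the support bound is [n.+1]. *)
Lemma win_support n f x : (n.+1)%:R <= `|x| -> win n f x = 0.
Proof.
rewrite winE; case: ifP => // h1 h2; have := le_trans h2 h1.
by rewrite ler_nat ltnn.
Qed.

Lemma cintegrable_win n f : sqi mu f -> cintegrable mu (win n f).
Proof.
by move=> sf; apply: (@sqi_bounded_support _ _ n.+1%:R) => //; [exact: sqi_win|exact: win_support].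
Qed.

Lemma truncated_fourierE f n xi : truncated_fourier f n xi = ft (win n f) xi.
Proof.
have e (g h : MR -> R) : (forall x, h x = \1_(`[- n%:R, n%:R]%classic : set R) x * g x) ->
    \int[mu]_(x in `[- n%:R, n%:R]) g x = \int[mu]_x h x.
  move=> gh; rewrite [LHS]Rintegral_mkcond; apply: eq_Rintegral => x _.
  by rewrite gh patchE indicE; case: (_ \in _); rewrite ?mul1r ?mul0r.
apply: ReIm_inj; apply: e => x; rewrite /win -mulrA.
  by rewrite cReRM.
by rewrite cImRM.
Qed.

Lemma L2_sub_ae u v f g : {ae mu, forall x, u x = f x} -> {ae mu, forall x, v x = g x} ->
  {ae mu, forall x, (u - v : L2 R) x = f x - g x}.
Proof.
move=> uf vg; apply: aeS2 (aeI uf vg) (L2_subE u v).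
by move=> x [e1 e2] e3; rewrite e3 e1 e2.
Qed.

Definition cut n u : L2 R := to_L2 (win n u).
Definition FTn n u : L2 R := to_L2 (ft (win n u)).

(** Stated for differences, with two windows, because it has to show that the truncated transforms
    form a Cauchy sequence. *)
Lemma plancherel_win n m f g : sqi mu f -> sqi mu g ->
  sqi mu (fun x : MR => ft (win n f) x - ft (win m g) x) /\
  nsqint mu (fun x : MR => ft (win n f) x - ft (win m g) x) =
    (tau%:E * nsqint mu (fun x => win n f x - win m g x)%R)%E.
Proof.
move=> sf sg.
have e : ft (fun x => win n f x - win m g x) = fun x : MR => ft (win n f) x - ft (win m g) x.
  apply/funext => xi; rewrite -mulN1r -ftZ; last exact: cintegrable_win.
  rewrite -ftD; [|exact: cintegrable_win|by apply: cintegrableZ; exact: cintegrable_win].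
  by congr (cint _ _); apply/funext => x; rewrite mulN1r.
have := @plancherel_compact R (fun x => win n f x - win m g x) (maxn n m).+1%:R.
rewrite e; apply=> //; first by apply: sqiB; exact: sqi_win.
move=> x nx; rewrite !win_support ?subrr//; apply: le_trans nx.
  by rewrite ler_nat ltnS leq_maxr.
by rewrite ler_nat ltnS leq_maxl.
Qed.

Lemma win0 n : win n (fun=> 0) = fun=> 0.
Proof. by apply/funext => x; rewrite /win mulr0. Qed.

Lemma ft0 : ft (fun=> 0) = (fun=> 0 : R[i]) .
Proof.
by apply/funext => x; rewrite /ft -[RHS](cint0 mu); apply: eq_cint => y; rewrite mul0r.
Qed.

Lemma sqi_ft_win n f : sqi mu f -> sqi mu (ft (win n f) : MR -> R[i]).
Proof.
move=> sf; have [+ _] := plancherel_win n n sf (sqi0 mu).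
by rewrite win0 ft0; congr sqi; apply/funext => x; rewrite subr0.
Qed.

Lemma cmeas_win n u : cmeas (win n u).
Proof. by case: (sqi_win n (L2_sqi u)). Qed.

Lemma cmeas_ft_win n u : cmeas (ft (win n u) : MR -> R[i]).
Proof. by case: (sqi_ft_win n (L2_sqi u)). Qed.

Lemma cut_ae n u : {ae mu, forall x, cut n u x = win n u x}.
Proof. by apply: to_L2E; apply: sqi_win; exact: L2_sqi. Qed.

Lemma FTn_ae n u : {ae mu, forall x, FTn n u x = ft (win n u) x}.
Proof. by apply: to_L2E; apply: sqi_ft_win; exact: L2_sqi. Qed.

Lemma sqn_FTnB n m u v : sqn (FTn n u - FTn m v) = tau * sqn (cut n u - cut m v).
Proof.
apply: EFin_inj; have [[h1 _] h2] := plancherel_win n m (L2_sqi u) (L2_sqi v).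
rewrite (@L2_sqnorm_ae _ _ (fun x : MR => ft (win n u) x - ft (win m v) x)) //; last first.
  by apply: L2_sub_ae; exact: FTn_ae.
rewrite h2 [RHS]EFinM; congr (_ * _)%E.
rewrite (@L2_sqnorm_ae _ _ (fun x : MR => win n u x - win m v x)) //.
  by apply: cmeasB; apply: (proj1 (sqi_win _ (L2_sqi _))).
by apply: L2_sub_ae; exact: cut_ae.
Qed.

Lemma FTnP n c u v : FTn n (c *: u + v) = c *: FTn n u + FTn n v.
Proof.
apply: L2_eq.
have iu := cintegrable_win n (L2_sqi u); have iv := cintegrable_win n (L2_sqi v).
have -> : FTn n (c *: u + v) = to_L2 (fun xi => c * ft (win n u) xi + ft (win n v) xi).
  congr to_L2; apply/funext => xi; rewrite -ftZ// -ftD//; last exact: cintegrableZ.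
  congr (_ xi); apply: eq_ft.
  - exact: cmeas_win.
  - by apply: cmeasD; [apply: cmeasM; [exact: cmeas_cst|]|]; exact: cmeas_win.
  - apply: aeS (aeI (L2_addE (c *: u) v) (L2_scaleE c u)) => x [e1 e2].
    by rewrite /win e1 e2; ring.
have sf : sqi mu (fun xi : MR => c * ft (win n u) xi + ft (win n v) xi).
  by apply: sqiD; [apply: sqiZ|]; apply: sqi_ft_win; exact: L2_sqi.
apply: aeS2 (aeI (FTn_ae n u) (FTn_ae n v))
  (aeI (L2_addE (c *: FTn n u) (FTn n v)) (aeI (L2_scaleE c (FTn n u)) (to_L2E sf))).
by move=> x [e1 e2] [e3 [e4 e5]]; rewrite e3 e4 e1 e2 e5.
Qed.

Lemma win_cvg f : sqi mu f -> nsqint mu (fun x => win n f x - f x) @[n --> \oo] --> 0%E.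
Proof.
move=> sf; apply: (nsqint_dominated (g := f)) => //.
- by move=> n; case: (sqi_win n sf).
- by case: sf.
- by move=> n x; rewrite winE; case: ifP; rewrite // nsq0 nsq_ge0.
- move=> x; apply: (@cvg_near_cst _ R^o); near=> n; rewrite winE ifT ?subrr ?nsq0//.
  by near: n; exact: nbhs_infty_ger.
Unshelve. all: by end_near. Qed.

Lemma cut_cvg u : sqlim (cut ^~ u) u.
Proof.
move=> eps e0; have [N hN] := cvge0_lt (win_cvg (L2_sqi u)) e0.
exists N => n /hN; rewrite -lte_fin.
rewrite (@L2_sqnorm_ae _ _ (fun x : MR => win n u x - u x)) //.
  by apply: cmeasB; [exact: cmeas_win|exact: L2_cmeas].
by apply: L2_sub_ae; [exact: cut_ae|exact: aeT].
Qed.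

Lemma cauchy_FTn u : cauchy_L2 (FTn ^~ u).
Proof.
move=> eps e0; have t0 := @tau_gt0 R.
have [N hN] := cut_cvg u (divr_gt0 (divr_gt0 e0 t0) (ltr0Sn _ 3)).
exists N => m n Nm Nn; rewrite sqn_FTnB mulrC -ltr_pdivlMr//.
rewrite -(subrKA u); apply: le_lt_trans (sqnormD_le (@L2_semi_inner R) _ _) _.
rewrite (sqnormBC (@L2_semi_inner R) u).
have := hN m Nm; have := hN n Nn; move: (sqn _) (sqn _) (eps / tau) => x y z; lra.
Qed.

(** [fourier] is picked by [xget], with default 0. Plancherel makes the truncated transforms Cauchy,
    and completeness supplies the limit that makes the choice genuine. *)
Lemma fourierP u : sqlim (FTn ^~ u) (fourier u).
Proof.
have E v n : (\int[mu]_xi (complex.Re (`|truncated_fourier u n xi - v xi| ^+ 2))%:E)%E =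
    (sqn (FTn n u - v))%:E.
  rewrite (@L2_sqnorm_ae _ _ (fun xi : MR => ft (win n u) xi - v xi)).
  - by apply: eq_integral => x _; rewrite Re_sqr_norm truncated_fourierE.
  - by apply: cmeasB; [exact: cmeas_ft_win|exact: L2_cmeas].
  - by apply: L2_sub_ae; [exact: FTn_ae|exact: aeT].
have H v : sqlim (FTn ^~ u) v <-> (\int[mu]_xi
     (complex.Re (`|truncated_fourier u n xi - v xi| ^+ 2))%:E)%E @[n --> \oo] --> 0%E.
  split=> [h|/cvge0_lt h eps /h[N hN]]; last by exists N => n /hN; rewrite E lte_fin.
  under eq_fun do rewrite E; apply: cvg_EFin; first exact: nearW.
  apply/cvgr0Pnorm_lt => e e0; have [N hN] := h e e0.
  by exists N => // n /= /hN; rewrite ger0_norm// sqnorm_ge0//; exact: L2_semi_inner.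
by rewrite /fourier; case: xgetP => [v _ /H//|nv]; have [v /H/nv] := L2_complete (cauchy_FTn u).
Qed.

Lemma fourier_lin c u v : fourier (c *: u + v) = c *: fourier u + fourier v.
Proof.
have hd := @L2_semi_inner R.
apply: (sqlim_unique hd (@L2_dot_eq0 R) (fourierP _)).
rewrite (_ : FTn ^~ _ = fun n => c *: FTn n u + FTn n v).
  by apply: (sqlimD hd) => //; [apply: (sqlimZ hd)|]; exact: fourierP.
by apply/funext => n; exact: FTnP.
Qed.

Lemma fourier0 : fourier 0 = 0 :> L2 R.
Proof. by have := fourier_lin (-1) 0 0; rewrite !scaleN1r addr0 oppr0 addNr. Qed.

Lemma sqn_FTn n u : sqn (FTn n u) = tau * sqn (cut n u).
Proof.
have z k : FTn k 0 = 0 by have := FTnP k (-1) 0 0; rewrite !scaleN1r addr0 oppr0 addNr.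
have := sqn_FTnB n n u 0; rewrite z subr0 => ->; congr (_ * sqn _).
rewrite [X in _ - X](_ : _ = 0) ?subr0//.
apply: to_L2_ae; first exact: cmeas_win.
by apply: aeS (@L2_0E R) => x e; rewrite winE e if_same.
Qed.

Lemma sqn_fourier u : sqn (fourier u) = tau * sqn u.
Proof.
apply: (sqlim_sqn_eq (@L2_semi_inner R) (fourierP u) (cut_cvg u)) => n.
exact: sqn_FTn.
Qed.

Definition refl u : L2 R := affL2 1 (-1) 0 u.

Lemma sqn_refl u : sqn (refl u) = sqn u.
Proof.
rewrite sqn_affL2; last by rewrite oppr_eq0 oner_eq0.
by rewrite nsq1 normrN1 divr1 mul1r.
Qed.

Lemma fourier_adjoint u v : L2_dot (fourier u) v = L2_dot u (refl (fourier v)).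
Proof.
have hd := @L2_semi_inner R.
have n1 : (-1 : R) != 0 by rewrite oppr_eq0 oner_eq0.
rewrite -[RHS]mul1r.
apply: (sqlim_dot_eq hd (fourierP u) (cut_cvg v) (cut_cvg u)
  (sqlim_affL2 1 0 n1 (fourierP v))) => n.
rewrite mul1r.
rewrite (L2_dot_ae (cmeas_ft_win n u) (cmeas_win n v) (FTn_ae n u) (cut_ae n v)).
have e : {ae mu, forall x, affL2 1 (-1) 0 (FTn n v) x = ft (win n v) (- x)}.
  apply: aeS2 (affL2E 1 0 n1 (FTn n v)) (ae_affine 0 n1 (FTn_ae n v)).
  by move=> x e1 e2; rewrite e1 e2 mul1r mulN1r addr0.
have mR : cmeas (fun x : MR => ft (win n v) (- x)).
  have := cmeas_affine (-1) 0 (cmeas_ft_win n v); congr cmeas.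
  by apply/funext => x; rewrite mulN1r addr0.
rewrite (L2_dot_ae (cmeas_win n u) mR (cut_ae n u) e).
by under [RHS]eq_cint do rewrite NconjE;
  under eq_cint do rewrite NconjE; rewrite ft_adjoint//; apply: cintegrable_win; exact: L2_sqi.
Qed.

(** The inversion formula: (1 / 2 pi) times the transform read at -x. *)
Let G v : L2 R := (tau^-1)%:C *: refl (fourier v).

(** Expanding the squared norm of the difference, the adjoint formula and Plancherel give (tau^2 - 2
    tau^2 + tau^2) |u|^2 = 0. The next lemma gets surjectivity in the same way. *)
Lemma refl_fourierK u : refl (fourier (fourier u)) = tau%:C *: u.
Proof.
have hd := @L2_semi_inner R.
apply/eqP; rewrite -subr_eq0; apply/eqP/(@L2_dot_eq0 R).
rewrite (sqnormBC hd) (sqnormB hd) (sqnormZ hd) (dotZl hd) -fourier_adjoint (dotvv hd).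
have e := etrans (sqn_refl _) (etrans (sqn_fourier (fourier u)) (congr1 _ (sqn_fourier u))).
rewrite (nsqR tau) cReRM.
rewrite [X in _ + X - _]e.
rewrite [X in X%:C]sqn_fourier.
by rewrite [complex.Re _]/=; move: (sqn u) (pi : R) => x y; ring.
Qed.

Lemma fourier_reflK v : fourier (refl (fourier v)) = tau%:C *: v.
Proof.
have hd := @L2_semi_inner R.
apply/eqP; rewrite -subr_eq0; apply/eqP/(@L2_dot_eq0 R).
rewrite (sqnormB hd) (sqnormZ hd) (dotZr hd) fourier_adjoint (dotvv hd).
have e1 := etrans (sqn_refl _) (sqn_fourier v).
have e2 := etrans (sqn_fourier _) (congr1 _ e1).
rewrite NconjE conjCR (nsqR tau) cReRM [X in X + _ - _]e2 [X in X%:C]e1.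
by rewrite [complex.Re _]/=; move: (sqn v) (pi : R) => x y; ring.
Qed.

Lemma fourierK : cancel (@fourier R) G.
Proof.
move=> u; rewrite /G refl_fourierK scalerA -rmorphM/= mulVf ?scale1r//.
by rewrite gt_eqF// tau_gt0.
Qed.

Lemma fourierZ c u : fourier (c *: u) = c *: fourier u.
Proof. by rewrite -[c *: u]addr0 fourier_lin fourier0 addr0. Qed.

Lemma fourierVK : cancel G (@fourier R).
Proof.
move=> u; rewrite /G fourierZ fourier_reflK scalerA -rmorphM/= mulVf ?scale1r//.
by rewrite gt_eqF// tau_gt0.
Qed.

Lemma fourier_op_invK : cancel (op_inv (@fourier R)) (@fourier R).
Proof. by rewrite (op_invK fourierK fourierVK); exact: fourierVK. Qed.

Lemma dot_fourier u v : L2_dot (fourier u) (fourier v) = tau%:C * L2_dot u v.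
Proof.
have hd := @L2_semi_inner R.
by rewrite fourier_adjoint refl_fourierK (dotZr hd) NconjE conjCR.
Qed.

Section Dilation.
Variables (N : nat) (N0 : (0 < N)%N).

(** At once the inverse of [U0] and the operator that [U0] becomes on the Fourier side. *)
Definition dil u : L2 R := affL2 (sqrtN N) N%:R 0 u.

Lemma sqrtN_sqr : sqrtN N * sqrtN N = N%:R :> R[i].
Proof. by rewrite /sqrtN -rmorphM /= -expr2 sqr_sqrtr ?ler0n// rmorph_nat. Qed.

Lemma sqrtN_neq0 : sqrtN N != 0 :> R[i].
Proof.
apply/eqP => e; have := sqrtN_sqr; rewrite e mul0r => /esym/eqP.
by rewrite pnatr_eq0 -leqn0 leqNgt N0.
Qed.

Lemma U0_affL2 u : U0 N u = affL2 (sqrtN N)^-1 N%:R^-1 0 u.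
Proof.
congr to_L2; apply/funext => x; congr (_ * u _).
by rewrite addr0 mulrC.
Qed.

(** Stretching by [N] carries the window of radius [n] to that of radius [N * n], so the identity is
    exact before the limit, which is then taken along the multiples of [N]. *)
Lemma FTn_U0 n u : FTn (N * n) (U0 N u) = dil (FTn n u).
Proof.
have Nr0 : (N%:R : R) != 0 by rewrite pnatr_eq0 -lt0n.
have Ni0 : (N%:R^-1 : R) != 0 by rewrite invr_eq0.
have sW : sqi mu (win n u) by apply: sqi_win; exact: L2_sqi.
have iW : cintegrable mu (win n u) by apply: cintegrable_win; exact: L2_sqi.
rewrite /dil /FTn affL2_to_L2//; last by apply: sqi_ft_win; exact: L2_sqi.
congr to_L2; apply/funext => xi.
transitivity (ft (fun x : MR => (sqrtN N)^-1 * win n u (N%:R^-1 * x + 0)) xi).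
  congr (_ xi); apply: eq_ft.
  - exact: cmeas_win.
  - by apply: cmeasM; [exact: cmeas_cst|apply: cmeas_affine; exact: (proj1 sW)].
  - rewrite U0_affL2; apply: aeS (affL2E (sqrtN N)^-1 0 Ni0 u) => x e.
    rewrite !winE e addr0 natrM normrM ger0_norm ?invr_ge0//.
    by rewrite ler_pdivrMl ?ltr0n//; case: ifP; rewrite ?mulr0.
have := @cint_affine R N%:R^-1 0 (fun y : MR => win n u y * cis (- (N%:R * xi * y))) Ni0 _.
rewrite gtr0_norm ?invr_gt0 ?ltr0n// invrK => H.
rewrite ftZ; last exact: cintegrable_affine.
have -> : sqrtN N * ft (win n u) (N%:R * xi + 0) =
    (sqrtN N)^-1 * (N%:R)%:C * ft (win n u) (N%:R * xi + 0).
  congr (_ * _).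
  apply: (mulfI sqrtN_neq0); rewrite mulrA mulfV ?sqrtN_neq0// mul1r sqrtN_sqr.
  by rewrite rmorph_nat.
rewrite -mulrA; congr (_ * _); rewrite addr0 /ft -H; last exact: cintegrable_cis.
apply: eq_cint => x; congr (_ * cval (cis (- _))).
by rewrite addr0; field.
Qed.

Lemma fourier_U0 u : fourier (U0 N u) = dil (fourier u).
Proof.
have hd := @L2_semi_inner R.
have Nr0 : (N%:R : R) != 0 by rewrite pnatr_eq0 -lt0n.
apply: (sqlim_unique hd (@L2_dot_eq0 R) _ (sqlim_affL2 (sqrtN N) 0 Nr0 (fourierP u))).
have -> : (fun n => affL2 (sqrtN N) N%:R 0 (FTn n u)) = (FTn ^~ (U0 N u)) \o (muln N).
  by apply/funext => n /=; rewrite FTn_U0.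
by apply: sqlim_subseq (fourierP _) => n; exact: leq_pmull.
Qed.

End Dilation.

End FourierL2.

(** If each value in [s] were taken only up to some index, an index beyond all of these bounds would
    have no value left. *)
Lemma infinite_pigeonhole (T : eqType) (s : seq T) (F : nat -> T) (P : nat -> Prop) :
  (forall B, exists2 i, (B <= i)%N & P i) -> (forall i, P i -> F i \in s) ->
  exists2 x, x \in s & forall B, exists i, [/\ (B <= i)%N, P i & F i = x].
Proof.
move=> iP sF; apply: contrapT => nx.
have H x : exists B, x \in s -> forall i, (B <= i)%N -> P i -> F i != x.
  apply: contrapT => nB; apply: nx; exists x => [|B]; apply: contrapT => nn.
    by apply: nB; exists 0%N => xs.
  apply: nB; exists B => xs i Bi Pi; apply/eqP => Fi.
  by apply: nn; exists i.
have [b hb] := choice H; have [i Bi Pi] := iP (\max_(x <- s) b x)%N.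
have Fs := sF i Pi; have /negP := hb _ Fs i (leq_trans (@leq_bigmax_seq _ s xpredT b _ Fs isT) Bi) Pi.
by apply; exact: eqxx.
Qed.

(** * The infinite products attached to the cycles *)

Section BackwardOrbits.
Context {T : eqType} (g : T -> T) (K : T -> Prop) (Z : seq T).
Hypothesis back : forall z, K z -> exists w, [/\ K w, g w = z & w \notin Z].
Hypothesis fwd : forall z, K z -> exists j y, y \in Z /\ iter j g y = z.

Lemma backward_path x : K x -> exists y : nat -> T,
  [/\ y 0%N = x, forall i, K (y i) & forall i, g (y i.+1) = y i].
Proof.
move=> Kx; have H z : exists w, K z -> [/\ K w, g w = z & w \notin Z].
  by have [/back[w hw]|nk] := EM (K z); [exists w|exists z].
have [f hf] := choice H; exists (fun i => iter i f x).
have Ki i : K (iter i f x) by elim: i => [//|i /hf[]].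
by split=> // i; case: (hf _ (Ki i)).
Qed.

Lemma iter_path (y : nat -> T) i d : (forall i, g (y i.+1) = y i) ->
  iter d g (y (i + d)%N) = y i.
Proof. by move=> gy; elim: d => [|d IH]; rewrite ?addn0// iterSr addnS gy. Qed.

(** A backward path in [K] consists of forward images of the finitely many points of [Z], one of
    which, [u], serves infinitely many path points. Its forward orbit turns out to be finite, so the
    path repeats a point, and [x] lies ahead of that point. *)
Lemma backward_periodic x : K x -> exists q, iter q.+1 g x = x.
Proof.
move=> Kx; have [y [y0 Ky gy]] := backward_path Kx.
suff [i [d yd]] : exists i d, y (i + d.+1)%N = y i.
  exists d; rewrite -y0 -(iter_path 0 i gy) add0n -iterD addnC iterD.
  by congr iter; rewrite -{1}yd iter_path.
have [j hj] := choice (fun i => fwd (Ky i)); have [ze {}hj] := choice hj.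
have [u uZ hu] := @infinite_pigeonhole _ Z ze (fun=> True)
  (fun B => ex_intro2 _ _ B (leqnn B) I) (fun i _ => proj1 (hj i)).
have yu i : ze i = u -> y i = iter (j i) g u by move=> <-; case: (hj i).
have [[a [d ad]]|wand] := EM (exists a d, iter (a + d.+1) g u = iter a g u); last first.
  exfalso; have [i [_ _ zi]] := hu 0%N.
  (* Such a late [i'] makes the exponent (i' - i) + j i' exceed j i, so going forward from y i' to y
     i shows two different iterates of [u] to be equal. *)
  have [i' [ii _ zi']] := hu (i + j i).+1.
  pose d := (i' - i)%N; have i'E : i' = (i + d)%N by rewrite subnKC//; lia.
  have := iter_path i d gy; rewrite -i'E (yu _ zi) (yu _ zi') -iterD.
  have [k kE] : exists k, (d + j i')%N = (j i + k.+1)%N.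
    by exists (d + j i' - j i).-1; rewrite /d; lia.
  by rewrite kE => e; apply: wand; exists (j i), k.
pose s := [seq iter c g u | c <- iota 0 (a + d.+1)].
have us c : iter c g u \in s.
  elim/ltn_ind: c => c IH; have [ca|ac] := ltnP c (a + d.+1).
    by apply/mapP; exists c => //; rewrite mem_iota.
  have -> : c = ((c - (a + d.+1)) + (a + d.+1))%N by rewrite subnK.
  rewrite iterD ad -iterD; apply: IH; lia.
(* Second pigeonhole: infinitely many path points lie in the finite orbit [s] of [u]. *)
have [v vs hv] := @infinite_pigeonhole _ s y (fun i => ze i = u)
  (fun B => let: ex_intro i (And3 h1 _ h2) := hu B in ex_intro2 _ _ i h1 h2)
  (fun i e => eq_ind_r (fun x => x \in s) (us _) (yu i e)).
have [i [_ _ yi]] := hv 0%N; have [i' [ii' _ yi']] := hv i.+1.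
by exists i, (i' - i.+1)%N; rewrite yi -yi'; congr y; lia.
Qed.

Lemma iterM_fix q n x : iter q g x = x -> iter (n * q) g x = x.
Proof. by move=> e; elim: n => [//|n IH]; rewrite mulSn iterD IH. Qed.

(** A common period P of both points gives w = g^{P-1} (g w), and the same for w'. *)
Lemma periodic_inj w w' : K w -> K w' -> g w = g w' -> w = w'.
Proof.
move=> /backward_periodic[q hq] /backward_periodic[r hr] e.
have := iterM_fix r.+1 hq; have := iterM_fix q.+1 hr; rewrite mulnC.
by rewrite mulSn addSn !iterSr e => -> ->.
Qed.

(** If [z] has period q + 1, then q steps back along a path in [K] amount to one step forward,
    because the point reached is periodic as well. *)
Lemma periodic_closed z : K z -> K (g z).
Proof.
move=> Kz; have [q hq] := backward_periodic Kz; have [y [y0 Ky gy]] := backward_path Kz.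
have /= hz := iter_path 0 q gy; rewrite add0n y0 in hz.
have [r hr] := backward_periodic (Ky q).
suff -> : g z = y q by exact: Ky.
rewrite -hz -iterS; have := iterM_fix q.+1 hr.
have -> : (q.+1 * r.+1 = (q.+1 * r.+1 - q) + q)%N by rewrite subnK//; lia.
rewrite iterD hz => {1}<-; rewrite -iterD addnC iterD.
have -> : iter q.+1 g z = z by [].
have := iterM_fix q.+1 hr.
have {1}-> : (q.+1 * r.+1 = (q.+1 * r.+1 - q) + q)%N by rewrite subnK//; lia.
by rewrite iterD hz.
Qed.

End BackwardOrbits.

Lemma ccvg_cabs_le (R : realType) (a : nat -> R[i]) (l : R[i]) (B : R) :
  (fun k => complex.Re (a k)) @ \oo --> complex.Re l ->
  (fun k => complex.Im (a k)) @ \oo --> complex.Im l ->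
  (forall k, cabs (a k) <= B) -> cabs l <= B.
Proof.
move=> h1 h2 aB; have B0 : 0 <= B by apply: le_trans (aB 0%N); exact: cabs_ge0.
rewrite -(ler_pXn2r (n := 2)) ?nnegrE ?cabs_ge0// cabs_sqr.
have := nsq_cvg (c := 0) h1 h2; rewrite sub0r nsqN => h.
rewrite -(cvg_lim _ h)//; apply: limr_le; first by apply/cvg_ex; eexists; exact: h.
apply: nearW => k; rewrite sub0r nsqN -cabs_sqr.
by rewrite ler_pXn2r ?nnegrE ?cabs_ge0.
Qed.

Lemma esum_finType (R : realType) (I : finType) (f : I -> \bar R) : (forall i, 0 <= f i)%E ->
  (\esum_(i in [set: I]) f i = \sum_i f i)%E.
Proof.
move=> f0; have -> : [set: I] = [set` index_enum I].
  by apply/seteqP; split=> // i _ /=; rewrite mem_index_enum.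
by rewrite esum_fset// -fsbig_seq// index_enum_uniq.
Qed.

Lemma esum_ge1 (R : realType) (I : choiceType) (f : I -> \bar R) i :
  (forall i, 0 <= f i)%E -> (f i <= \esum_(i in [set: I]) f i)%E.
Proof.
move=> f0; rewrite -(esum_set1 (t := i))// [leRHS](esumID [set i])//.
by rewrite setTI leeDl// esum_ge0.
Qed.

Lemma esum_le_finite (R : realType) (I : choiceType) (f : I -> R) (B : R) :
  (forall s : seq I, uniq s -> \sum_(i <- s) f i <= B) ->
  (\esum_(i in [set: I]) (f i)%:E <= B%:E)%E.
Proof.
move=> h; apply: ge_ereal_sup => _ [X [finX _] <-].
by rewrite fsbig_finite// sumEFin lee_fin h// finmap.fset_uniq.
Qed.

Lemma esum_finite_ge (R : realType) (I : choiceType) (f : I -> R) (s : seq I) : uniq s ->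
  (forall i, 0 <= f i) -> ((\sum_(i <- s) f i)%:E <= \esum_(i in [set: I]) (f i)%:E)%E.
Proof.
move=> us f0; apply: esum_ge; exists [set` s].
  by split=> //; exact: finite_seq.
by rewrite -fsbig_seq// sumEFin.
Qed.

Lemma esum_finite_adherent (R : realType) (I : choiceType) (f : I -> R) (e : R) : 0 < e ->
  (\esum_(i in [set: I]) (f i)%:E \is a fin_num)%E ->
  exists2 s : seq I, uniq s & fine (\esum_(i in [set: I]) (f i)%:E) - e < \sum_(i <- s) f i.
Proof.
move=> e0 fin; have [_ [X [finX _] <-]] := ub_ereal_sup_adherent e0 fin.
rewrite fsbig_finite// sumEFin => h; eexists; first exact: (finmap.fset_uniq (fset_set X)).
by move: h; rewrite -/(esum _ _) -{1}(fineK fin) -EFinB lte_fin.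
Qed.

(** * The scaling functions and the identity h = 1 *)

Section Mask.
Context {R : realType} (N : nat) (m0 : circle R -> R[i]).
Local Notation M := (unroll m0).
Local Notation tau := (2 * pi : R).

Lemma unroll_periodic (f : circle R -> R[i]) t (k : int) : unroll f (t + k%:~R * tau) = unroll f t.
Proof.
rewrite /unroll; congr f; rewrite opprD -[RHS](cis_2pi (- k)); congr cis.
by rewrite mulrNz mulNr.
Qed.

Context (N2 : (2 <= N)%N) (K : R).
Hypothesis M_lip : forall t u : R, cabs (M t - M u) <= K * `|t - u|.
Hypothesis qmf : forall t : R, \sum_(r < N) nsq (M ((t + r%:R * tau) / N%:R)) = N%:R.
Context {A : finType} (s pr : A -> A) (theta : A -> R) (alpha : A -> R[i]).
Hypotheses (sK : cancel s pr) (prK : cancel pr s).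
Hypothesis theta_s : forall a, exists k : int, N%:R * theta a = theta (s a) + k%:~R * tau.
Hypothesis M_theta : forall a, M (theta a) = alpha a * sqrtN N.
Hypothesis alpha1 : forall a, nsq (alpha a) = 1.

Let Ngt0 : (0 < N%:R :> R). Proof. by rewrite ltr0n; lia. Qed.

Lemma lip_ge0 : 0 <= K.
Proof.
have := M_lip 1 0; rewrite subr0 normr1 mulr1; apply: le_trans; exact: cabs_ge0.
Qed.

Lemma nsq_sqrtN : nsq (sqrtN N) = N%:R :> R.
Proof. by rewrite /sqrtN nsqR sqr_sqrtr ?ler0n. Qed.

Lemma nsq_mask_le t : nsq (M t) <= N%:R.
Proof.
have N0 : (0 < N)%N by lia.
rewrite -(qmf (N%:R * t)) (bigD1 (Ordinal N0))//= mul0r addr0 mulrC mulKf ?gt_eqF//.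
by rewrite lerDl sumr_ge0// => i _; exact: nsq_ge0.
Qed.

Definition fac a (x : R) : R[i] := ((alpha a)^*)%C * M (x + theta a) / sqrtN N.

Lemma nsq_fac a x : nsq (fac a x) = nsq (M (x + theta a)) / N%:R.
Proof. by rewrite /fac !nsqM nsqV nsqJ alpha1 mul1r nsq_sqrtN. Qed.

Lemma fac_le1 a x : cabs (fac a x) <= 1.
Proof.
rewrite -(ler_pXn2r (n := 2)) ?nnegrE ?cabs_ge0// cabs_sqr expr1n nsq_fac.
by rewrite ler_pdivrMr// mul1r nsq_mask_le.
Qed.

Lemma fac0 a : fac a 0 = 1.
Proof.
rewrite /fac add0r M_theta mulrA mulfK; last by apply: sqrtN_neq0; lia.
by rewrite mulrC -NconjE nsq_conjM alpha1.
Qed.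

Lemma fac_lip a x y : cabs (fac a x - fac a y) <= K * `|x - y|.
Proof.
rewrite /fac -mulrBl -mulrBr !cabsM.
have -> : cabs ((alpha a)^*)%C = 1 by rewrite /cabs nsqJ alpha1 sqrtr1.
have c1 : cabs (sqrtN N)^-1 <= 1 :> R.
  rewrite -(ler_pXn2r (n := 2)) ?nnegrE ?cabs_ge0// cabs_sqr nsqV nsq_sqrtN expr1n.
  by rewrite invf_le1// ler1n; lia.
rewrite mul1r; apply: le_trans (_ : K * `|x - y| * 1 <= _); last by rewrite mulr1.
apply: ler_pM => //; rewrite ?cabs_ge0//.
by apply: le_trans (M_lip _ _) _; rewrite opprD addrACA subrr addr0.
Qed.

(** The recursion splits off the first factor, so that replacing x by N x peels off one factor; the
    refinement equation and the bound h <= 1 rest on this form. *)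
Fixpoint PP (L : nat) (a : A) (x : R) : R[i] :=
  if L is L'.+1 then fac (pr a) (x / N%:R) * PP L' (pr a) (x / N%:R) else 1.

Lemma PP_prod L a x : PP L a x =
  \prod_(1 <= l < L.+1) fac (iter l pr a) (x / N%:R ^+ l).
Proof.
elim: L a x => [|L IH] a x; first by rewrite big_geq.
rewrite big_nat_recl//= IH expr1; congr (_ * _); apply: eq_big_nat => l _.
by rewrite -iterSr exprS invfM mulrA.
Qed.

Lemma PP_le1 L a x : cabs (PP L a x) <= 1.
Proof.
elim: L a x => [|L IH] a x /=; first by rewrite cabs1.
by rewrite cabsM mulr_ile1 ?cabs_ge0 ?fac_le1.
Qed.

Lemma PP0 L a : PP L a 0 = 1.
Proof. by elim: L a => [//|L IH] a /=; rewrite mul0r fac0 IH mul1r. Qed.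

(** The constant does not grow with [L]: the product rule doubles it, and the division of the
    argument by N >= 2 at least halves it again. *)
Lemma PP_lip L a x y : cabs (PP L a x - PP L a y) <= K * `|x - y|.
Proof.
elim: L a x y => [|L IH] a x y /=; first by rewrite subrr cabs0 mulr_ge0 ?lip_ge0.
set x' := x / _; set y' := y / _.
have -> : fac (pr a) x' * PP L (pr a) x' - fac (pr a) y' * PP L (pr a) y' =
  (fac (pr a) x' - fac (pr a) y') * PP L (pr a) x' +
  fac (pr a) y' * (PP L (pr a) x' - PP L (pr a) y') by ring.
apply: le_trans (cabsD _ _) _; rewrite cabsM [X in _ + X]cabsM.
have e : `|x' - y'| = `|x - y| / N%:R.
  by rewrite -mulrBl normrM (ger0_norm (_ : 0 <= N%:R^-1)) ?invr_ge0.
have h1 : cabs (fac (pr a) x' - fac (pr a) y') * cabs (PP L (pr a) x') <= K * `|x' - y'| * 1.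
  by apply: ler_pM; rewrite ?cabs_ge0 ?PP_le1 ?fac_lip.
have h2 : cabs (fac (pr a) y') * cabs (PP L (pr a) x' - PP L (pr a) y') <= 1 * (K * `|x' - y'|).
  by apply: ler_pM; rewrite ?cabs_ge0 ?fac_le1.
apply: le_trans (lerD h1 h2) _; rewrite mulr1 mul1r e.
have N2r : 2 <= N%:R :> R by rewrite ler_nat.
have : (N%:R)^-1 <= 2^-1 :> R by rewrite lef_pV2 ?posrE.
have := mulr_ge0 lip_ge0 (normr_ge0 (x - y)); rewrite mulrA.
by move: (K * _) (N%:R^-1) => u v u0 v2; nra.
Qed.

(** Two successive products differ in one factor, taken at x / N^(L+1), where it is close to its
    value 1 at 0. *)
Lemma PP_step L a x : cabs (PP L.+1 a x - PP L a x) <= K * `|x| * N%:R^-1 ^+ L.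
Proof.
elim: L a x => [|L IH] a x.
  by have := PP_lip 1 a x 0; rewrite PP0 subr0 expr0 mulr1.
rewrite [PP L.+2 a x]/(fac (pr a) (x / N%:R) * PP L.+1 (pr a) (x / N%:R)).
rewrite [PP L.+1 a x]/(fac (pr a) (x / N%:R) * PP L (pr a) (x / N%:R)).
rewrite -mulrBr cabsM -[leRHS]mul1r; apply: ler_pM; rewrite ?cabs_ge0 ?fac_le1//.
apply: le_trans (IH _ _) _; rewrite normrM (ger0_norm (_ : 0 <= N%:R^-1)) ?invr_ge0//.
by rewrite exprS !mulrA.
Qed.

(** The limit is taken separately in the real and imaginary parts; [phi_hat_phiA] later identifies
    it with the complex limit in [phi_hat]. *)
Definition phiA a (x : R) : R[i] :=
  lim ((complex.Re (PP L a x) : R) @[L --> \oo]) +i*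
  lim ((complex.Im (PP L a x) : R) @[L --> \oo]).

Lemma phiA_cvg a x : [/\ (fun k => complex.Re (PP k a x)) @ \oo --> complex.Re (phiA a x),
    (fun k => complex.Im (PP k a x)) @ \oo --> complex.Im (phiA a x) &
    forall k, cabs (PP k a x - phiA a x) <= 2 * (K * `|x| * N%:R^-1 ^+ k / (1 - N%:R^-1))].
Proof.
have q1 : 0 <= (N%:R^-1 : R) < 1.
  by rewrite invr_ge0 ler0n invf_lt1//= ltr1n; lia.
have [l [h1 h2 h3]] := complex_geometric_cvg q1 (fun k => PP_step k a x).
suff -> : phiA a x = l by [].
by apply: ReIm_inj => /=; exact: cvg_lim.
Qed.

Lemma cvgB_Re a x b y :
  (fun k => complex.Re (PP k a x - PP k b y)) @ \oo --> complex.Re (phiA a x - phiA b y).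
Proof.
have [h1 _ _] := phiA_cvg a x; have [h2 _ _] := phiA_cvg b y.
by under eq_fun do rewrite ReD ReN; rewrite ReD ReN; exact: cvgB.
Qed.

Lemma cvgB_Im a x b y :
  (fun k => complex.Im (PP k a x - PP k b y)) @ \oo --> complex.Im (phiA a x - phiA b y).
Proof.
have [_ h1 _] := phiA_cvg a x; have [_ h2 _] := phiA_cvg b y.
by under eq_fun do rewrite ImD ImN; rewrite ImD ImN; exact: cvgB.
Qed.

Lemma phiA_lip a x y : cabs (phiA a x - phiA a y) <= K * `|x - y|.
Proof.
apply: (ccvg_cabs_le (@cvgB_Re a x a y) (@cvgB_Im a x a y)) => k; exact: PP_lip.
Qed.

Lemma phiA_le1 a x : cabs (phiA a x) <= 1.
Proof. by have [h1 h2 _] := phiA_cvg a x; apply: (ccvg_cabs_le h1 h2) => k; exact: PP_le1. Qed.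

Lemma nsq_phiA_le1 a x : nsq (phiA a x) <= 1.
Proof. by rewrite -cabs_sqr expr_le1// ?cabs_ge0// phiA_le1. Qed.

Lemma phiA0 a : phiA a 0 = 1.
Proof.
have [_ _ h] := phiA_cvg a 0; have := h 0%N; rewrite normr0 mulr0 !mul0r mulr0 PP0 => h0.
apply/esym/eqP; rewrite -subr_eq0; apply/eqP/cabs_eq0/eqP.
by rewrite eq_le h0 cabs_ge0.
Qed.

Lemma phiA_refine a x :
  phiA (s a) (N%:R * x) = fac a x * phiA a x.
Proof.
have e k : PP k.+1 (s a) (N%:R * x) = fac a x * PP k a x.
  by rewrite [LHS]/= sK [N%:R * x]mulrC mulfK// gt_eqF.
have [h1 h2 _] := phiA_cvg (s a) (N%:R * x); have [g1 g2 _] := phiA_cvg a x.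
have sh (f : nat -> R) (l : R) : f @ \oo --> l -> (fun n => f n.+1) @ \oo --> l.
  by move=> fl; rewrite (cvg_shiftS f).
have u (f : nat -> R) (l l' : R) : f @ \oo --> l -> f @ \oo --> l' -> l = l'.
  by move=> fl; apply: cvg_unique.
apply: ReIm_inj.
  apply: u (sh _ _ h1) _; under eq_fun do rewrite e cReM; rewrite cReM.
  by apply: cvgB; apply: cvgM => //; exact: cvg_cst.
apply: u (sh _ _ h2) _; under eq_fun do rewrite e cImM; rewrite cImM.
by apply: cvgD; apply: cvgM => //; exact: cvg_cst.
Qed.

Lemma continuous_cabs_lip (f : R -> R[i]) : (forall x y, cabs (f x - f y) <= K * `|x - y|) ->
  continuous (fun x => complex.Re (f x)) /\ continuous (fun x => complex.Im (f x)).
Proof.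
move=> fl; have H (g : R -> R) : (forall x y, `|g x - g y| <= K * `|x - y|) -> continuous g.
  have K1 : 0 < K + 1 by have := lip_ge0; lra.
  move=> gl x; apply/cvgrPdist_lt => e e0; near=> y.
  apply: le_lt_trans (gl _ _) _.
  have : `|x - y| < e / (K + 1).
    by near: y; apply/nbhs_ballP; exists (e / (K + 1)); rewrite /= ?divr_gt0.
  rewrite ltr_pdivlMr// => h; apply: le_lt_trans h.
  by rewrite mulrC ler_wpM2l//; lra.
by split; apply: H => x y; apply: le_trans (fl x y);
  [rewrite -ReN -ReD Re_le_cabs|rewrite -ImN -ImD Im_le_cabs].
Unshelve. all: by end_near. Qed.

Lemma cmeas_cabs_lip (f : R -> R[i]) : (forall x y, cabs (f x - f y) <= K * `|x - y|) ->
  cmeas (f : measurableTypeR R -> R[i]).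
Proof.
by move=> /continuous_cabs_lip[h1 h2]; split; exact: continuous_measurable_fun.
Qed.

Lemma cmeas_phiA a : cmeas (phiA a : measurableTypeR R -> R[i]).
Proof. by apply: cmeas_cabs_lip => x y; exact: phiA_lip. Qed.

Lemma cmeas_mask : cmeas (M : measurableTypeR R -> R[i]).
Proof. exact: cmeas_cabs_lip. Qed.

Definition pos (x : A * int) (t : R) : R := t - theta x.1 + x.2%:~R * tau.

(** Kept general in [F] because the recursion is applied to cut-off partial products as well as to
    the squares of [phiA]. *)
Definition tilesum (F : A -> R -> R) (t : R) : \bar R :=
  (\esum_(x in [set: A * int]) (F x.1 (pos x t))%:E)%E.

(** Euclidean division by [N] writes each index uniquely as (s b, N j + r - k_b), where N theta_b =
    theta_{s b} + 2 pi k_b. The remainder [r] selects the N-th root, and the mask at that root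
    factors out by periodicity. *)
Lemma tilesum_rec (F G : A -> R -> R) t : (forall a x, 0 <= F a x) ->
  (forall a x, G (s a) (N%:R * x) = nsq (M (x + theta a)) / N%:R * F a x) ->
  (tilesum G t = \sum_(r < N) (nsq (M ((t + r%:R * tau) / N%:R)) / N%:R)%:E *
    tilesum F ((t + r%:R * tau) / N%:R)%R)%E.
Proof.
move=> F0 GF; have [kb hkb] := choice theta_s.
pose e (y : 'I_N * (A * int)) : A * int := (s y.2.1, N%:Z * y.2.2 + (y.1 : nat)%:Z - kb y.2.1).
have Nz : (N%:Z != 0)%R by rewrite eqz_nat; lia.
have eb : set_bij setT setT e.
  split=> //.
    move=> [r [b j]] [r' [b' j']] _ _ [/(can_inj sK) ->] /addIr h.
    have rE (q : 'I_N) (i : int) : modz (N%:Z * i + (q : nat)%:Z) N%:Z = (q : nat)%:Z.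
      by rewrite mulrC modzMDl modz_small// ltz_nat ltn_ord.
    have hr : r = r' by apply: val_inj; have := congr1 (fun z => modz z N%:Z) h; rewrite !rE => -[].
    by move: h; rewrite hr => /addIr/(mulfI Nz) ->.
  move=> [a l] _; pose k := l + kb (pr a).
  have rlt : (`|modz k N%:Z|%N < N)%N.
    by rewrite -ltz_nat gez0_abs ?modz_ge0// ltz_pmod// ltz_nat; lia.
  exists (Ordinal rlt, (pr a, divz k N%:Z)) => //.
  rewrite /e /= prK; congr (_, _).
  by rewrite gez0_abs ?modz_ge0// mulrC -divz_eq /k addrK.
rewrite /tilesum (reindex_esum _ _ _ _ eb).
transitivity (\esum_(y in [set: 'I_N] `*`` (fun=> [set: A * int]))
    ((nsq (M ((t + (y.1 : 'I_N)%:R * tau) / N%:R)) / N%:R *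
      F y.2.1 (pos y.2 ((t + (y.1 : 'I_N)%:R * tau) / N%:R)))%:E))%E.
  rewrite (_ : _ `*`` _ = setT); last by apply/seteqP.
  apply: eq_esum => -[r [b j]] _ /=; congr (_%:E).
  set tr := (t + r%:R * tau) / N%:R.
  have -> : pos (e (r, (b, j))) t = N%:R * pos (b, j) tr.
    rewrite /pos /= rmorphB rmorphD rmorphM /= -!pmulrn.
    have -> : t = N%:R * tr - r%:R * tau by rewrite /tr mulrC mulfVK ?gt_eqF// addrK.
    have := hkb b; move: (theta (s b)) (theta b) (kb b) => u v k h.
    have -> : u = N%:R * v - k%:~R * tau by rewrite h addrK.
    ring.
  rewrite GF; congr (nsq _ / _ * _).
  have -> : pos (b, j) tr + theta b = tr + j%:~R * tau by rewrite /pos /=; ring.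
  exact: unroll_periodic.
rewrite -(@esum_esum _ _ _ setT (fun=> setT) (fun (r : 'I_N) (x : A * int) =>
  (nsq (M ((t + r%:R * tau) / N%:R)) / N%:R * F x.1 (pos x ((t + r%:R * tau) / N%:R)))%:E));
  last first.
  by move=> r x _ _; rewrite lee_fin mulr_ge0// divr_ge0 ?nsq_ge0// ltW.
rewrite esum_finType; last first.
  by move=> r; apply: esum_ge0 => x _; rewrite lee_fin mulr_ge0// divr_ge0 ?nsq_ge0// ltW.
apply: eq_bigr => r _; rewrite -esumZl.
- by apply: eq_esum => x _; rewrite EFinM.
- by rewrite divr_ge0 ?nsq_ge0// ltW.
- by move=> x; rewrite lee_fin.
Qed.

Definition hsum (t : R) : \bar R := tilesum (fun a x => nsq (phiA a x)) t.

Lemma hsum_rec t :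
  (hsum t = \sum_(r < N) (nsq (M ((t + r%:R * tau) / N%:R)) / N%:R)%:E *
    hsum ((t + r%:R * tau) / N%:R)%R)%E.
Proof.
apply: tilesum_rec => [a x|a x]; first exact: nsq_ge0.
by rewrite phiA_refine nsqM nsq_fac.
Qed.

Hypothesis theta_inj : forall a b (k : int), theta a = theta b + k%:~R * tau -> a = b.

Lemma nsq_phiA_near a x : 1 - 2 * K * `|x| <= nsq (phiA a x).
Proof.
have h : 1 - K * `|x| <= cabs (phiA a x).
  have := phiA_lip a 0 x; rewrite phiA0 sub0r normrN => h.
  have := cabsD (1 - phiA a x) (phiA a x); rewrite subrK cabs1.
  by move: h; lra.
have [h0|h0] := leP 0 (1 - K * `|x|).
  rewrite -cabs_sqr; have K0 := mulr_ge0 lip_ge0 (normr_ge0 x).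
  move: h h0 K0 (cabs_ge0 (phiA a x)); rewrite -!mulrA; move: (K * _) (cabs _) => u v; nra.
by apply: le_trans (nsq_ge0 _); move: h0; rewrite -!mulrA; move: (K * _) => u; lra.
Qed.

Lemma dist_progression (c : R) : exists2 d : R, 0 < d &
  forall k : int, c + k%:~R * tau != 0 -> d <= `|c + k%:~R * tau|.
Proof.
have t0 : 0 < tau := tau_gt0.
pose k0 := Num.floor (c / tau); pose c0 := c - k0%:~R * tau.
have [c00 c0t] : 0 <= c0 /\ c0 < tau.
  have /andP[h1 h2] := floor_itv (c / tau).
  rewrite /c0 subr_ge0 -ler_pdivlMr// h1; split=> //.
  by rewrite ltrBlDr; move: h2; rewrite intrD -/k0 ltr_pdivrMr// mulrDl mul1r addrC.
have H (k : int) : c + k%:~R * tau = c0 + (k + k0)%:~R * tau.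
  by rewrite /c0 rmorphD /=; ring.
clearbody c0.
pose d := if c0 == 0 then tau else Num.min c0 (tau - c0).
exists d.
  rewrite /d; case: (eqVneq c0 0) => // c0n; rewrite lt_min [X in _ && X]subr_gt0 c0t andbT.
  by rewrite lt_neqAle eq_sym c0n.
move=> k; rewrite H; move: (k + k0) => {}k; rewrite /d.
have kt (j : int) : j != 0 -> tau <= `|j%:~R * tau|.
  move=> j0; rewrite normrM (ger0_norm (ltW t0)) ler_peMl ?(ltW t0)//.
  by rewrite -intr_norm -[leLHS](mulr1z 1) ler_int -gtz0_ge1 normr_gt0.
case: (eqVneq c0 0) => [->|c0n].
  rewrite add0r => h; apply: kt; apply: contraNneq h => ->.
  by rewrite mul0r.
move=> _; rewrite ge_min; have [k1|[->|k1]] : k <= -1 \/ k = 0 \/ 1 <= k by lia.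
- apply/orP; right; rewrite -normrN; apply: le_trans (ler_norm _).
  have : k%:~R <= (-1)%:~R :> R by rewrite ler_int.
  rewrite rmorphN1.
  by move: (k%:~R : R) t0 => x; move: tau => y; nra.
- by rewrite mul0r addr0 ler_norm.
- apply/orP; left; apply: le_trans (ler_norm _); rewrite lerDl mulr_ge0 ?(ltW t0)//.
  by rewrite ler0z; lia.
Qed.

(** The nonzero differences of the points theta_a modulo 2 pi stay away from 0 by a common bound,
    since [A] is finite. Half of it prevents two positions from being near 0 together. *)
Lemma separated : exists2 d : R, 0 < d & forall (x y : A * int) (t : R),
  `|pos x t| < d -> `|pos y t| < d -> x = y.
Proof.
have [D hD] := choice (fun x : A * A => let: ex_intro2 d d0 hd :=
  dist_progression (theta x.1 - theta x.2) in ex_intro (fun d => 0 < d /\ _) d (conj d0 hd)).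
pose d := \big[Num.min/1]_x D x.
have d0 : 0 < d by apply: lt_bigmin => // x _; case: (hD x).
exists (d / 2); first by rewrite divr_gt0.
move=> [a j] [b l] t; rewrite /pos /= => h1 h2.
have h : `|theta a - theta b + (l - j)%:~R * tau| < d.
  have -> : theta a - theta b + (l - j)%:~R * tau =
     (t - theta b + l%:~R * tau) - (t - theta a + j%:~R * tau) by rewrite rmorphB /=; ring.
  by apply: le_lt_trans (ler_normB _ _) _; lra.
have : theta a - theta b + (l - j)%:~R * tau = 0.
  apply/eqP; apply: contraTT h => /(proj2 (hD (a, b)) _) /= h; rewrite -leNgt.
  by apply: le_trans h; rewrite /d; exact: bigmin_le.
move=> /eqP; rewrite addrAC subr_eq0 => /eqP e.
have ab : a = b by apply: (theta_inj (k := j - l)); rewrite -e rmorphB rmorphB /=; ring.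
move: e; rewrite ab -[X in _ = X]addr0 => /addrI/eqP; rewrite mulf_eq0 intr_eq0.
by rewrite [_ * _ == 0](gt_eqF tau_gt0) orbF subr_eq0 => /eqP ->.
Qed.

(** The bound is propagated along cut-off partial products: at level 0 separation leaves at most one
    term, and each further level is a weighted mean with total weight 1 by [qmf]. Finite partial
    sums then pass to the limit. *)
Lemma hsum_le1 t : (hsum t <= 1)%E.
Proof.
have [d d0 sep] := separated.
(* The cut-off radius N^L d follows the dilation of [tilesum_rec] and exhausts the line as [L]
   grows. *)
pose Q L a x := nsq (PP L a x) * (`|x| < N%:R ^+ L * d)%R%:R.
have Q0 L a x : 0 <= Q L a x by rewrite mulr_ge0// nsq_ge0.
have hQ L u : (tilesum (Q L) u <= 1)%E.
  elim: L u => [|L IH] u.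
    have Q1 x : Q 0%N x.1 (pos x u) = (`|pos x u| < d)%R%:R by rewrite /Q /= nsq1 mul1r expr0 mul1r.
    have [[x hx]|nx] := EM (exists x, `|pos x u| < d); last first.
      by rewrite /tilesum esum1// => x _; rewrite Q1; case: ltP => // h; case: nx; exists x.
    rewrite /tilesum (esumID [set x])//; last by move=> y _; rewrite lee_fin.
    rewrite !setTI esum_set1 ?lee_fin// esum1 ?adde0.
      by rewrite Q1 hx.
    move=> y /= yx; rewrite Q1; case: ltP => // hy; case: yx.
    exact: sep hy hx.
  rewrite (@tilesum_rec (Q L))//; last first.
    move=> a x; rewrite /Q [PP L.+1 _ _]/= sK [N%:R * x]mulrC mulfK ?gt_eqF// nsqM nsq_fac -mulrA.
    have -> // : (`|x * N%:R| < N%:R ^+ L.+1 * d) = (`|x| < N%:R ^+ L * d).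
    by rewrite normrM (ger0_norm (ltW Ngt0)) [`|x| * _]mulrC exprS -mulrA ltr_pM2l.
  apply: le_trans (_ : (\sum_(r < N) (nsq (M ((u + r%:R * tau) / N%:R)) / N%:R)%:E * 1)%E <= _)%E.
    by apply: lee_sum => r _; rewrite lee_wpmul2l// lee_fin divr_ge0 ?nsq_ge0// ltW.
  under eq_bigr do rewrite mule1.
  by rewrite sumEFin -mulr_suml qmf mulfV ?gt_eqF.
apply: esum_le_finite => X uX.
have cQ x : (fun L => Q L x.1 (pos x t)) @ \oo --> nsq (phiA x.1 (pos x t)).
  rewrite -[X in _ --> X]mulr1; apply: cvgM.
    have [h1 h2 _] := phiA_cvg x.1 (pos x t).
    have := nsq_cvg (c := 0) h1 h2; rewrite sub0r nsqN.
    by under eq_fun do rewrite sub0r nsqN.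
  apply: (@cvg_near_cst _ R^o).
  have [L0 hL0] : exists L0, `|pos x t| / d < L0%:R by exists (Num.truncn (`|pos x t| / d)).+1; exact: truncnS_gt.
  near=> L; rewrite -ltr_pdivrMr//.
  have -> // : `|pos x t| / d < N%:R ^+ L.
  apply: lt_le_trans hL0 _; rewrite -natrX ler_nat.
  apply: leq_trans (_ : L <= _)%N; first by near: L; exact: nbhs_infty_ge.
  by apply/ltnW/ltn_expl; lia.
have cS : (fun L => \sum_(x <- X) Q L x.1 (pos x t)) @ \oo --> \sum_(x <- X) nsq (phiA x.1 (pos x t)).
  by apply: cvg_big => [|x _]; [exact: add_continuous|exact: cQ].
rewrite -(cvg_lim _ cS)//; apply: limr_le; first by apply/cvg_ex; eexists; exact: cS.
apply: nearW => L; rewrite -lee_fin; apply: le_trans (hQ L t).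
by apply: (esum_finite_ge (f := fun x => Q L x.1 (pos x t))).
Unshelve. all: by end_near. Qed.

Definition hr t : R := fine (hsum t).

Lemma hsum_ge0 t : (0 <= hsum t)%E.
Proof. by apply: esum_ge0 => x _; rewrite lee_fin nsq_ge0. Qed.

Lemma hsum_fin t : hsum t \is a fin_num.
Proof. by rewrite ge0_fin_numE ?hsum_ge0//; apply: le_lt_trans (hsum_le1 t) (ltry _). Qed.

Lemma hrE t : (hr t)%:E = hsum t. Proof. by rewrite fineK// hsum_fin. Qed.

Lemma hr_le1 t : hr t <= 1. Proof. by rewrite -lee_fin hrE hsum_le1. Qed.

Lemma hr_rec t : hr t = \sum_(r < N) nsq (M ((t + r%:R * tau) / N%:R)) / N%:R *
  hr ((t + r%:R * tau) / N%:R).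
Proof.
apply: EFin_inj; rewrite hrE hsum_rec -sumEFin.
by apply: eq_bigr => r _; rewrite -hrE -EFinM.
Qed.

Lemma hr_periodic t (k : int) : hr (t + k%:~R * tau) = hr t.
Proof.
rewrite /hr /hsum /tilesum; congr fine.
pose e (x : A * int) : A * int := (x.1, x.2 - k).
have eb : set_bij setT setT e.
  split=> //; first by move=> [a j] [b l] _ _ [-> /addIr ->].
  by move=> [a j] _; exists (a, j + k); rewrite // /e /= addrK.
rewrite (reindex_esum _ _ _ _ eb); apply: eq_esum => -[a j] _ /=.
by congr (nsq (phiA _ _))%:E; rewrite /pos /= rmorphB /=; ring.
Qed.

Lemma hr_ge a (j : int) t : 1 - 2 * K * `|pos (a, j) t| <= hr t.
Proof.
apply: le_trans (nsq_phiA_near a _) _; rewrite -lee_fin hrE.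
apply: (@esum_ge1 R _ (fun x : A * int => (nsq (phiA x.1 (pos x t)))%:E) (a, j)) => x.
by rewrite lee_fin nsq_ge0.
Qed.

(** A sum of nonnegative continuous functions is the supremum of its finite partial sums, hence
    lower semicontinuous. *)
Lemma hr_lsc t (e : R) : 0 < e -> \forall u \near t, hr t - e < hr u.
Proof.
move=> e0; have [X uX hX] := esum_finite_adherent e0 (hsum_fin t).
pose f u := \sum_(x <- X) nsq (phiA x.1 (pos x u)).
have fh u : f u <= hr u.
  rewrite -lee_fin hrE.
  by apply: (esum_finite_ge (f := fun x : A * int => nsq (phiA x.1 (pos x u)))) => // x; exact: nsq_ge0.
have cf : continuous f.
  move=> u; apply: cvg_big => [|[a j] _]; first exact: add_continuous.
  have [h1 h2] := continuous_cabs_lip (phiA_lip a).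
  have cp : {for u, continuous (pos (a, j))}.
    rewrite /continuous_at /pos; apply: cvgD; last exact: cvg_cst.
    by apply: cvgB; [exact: cvg_id|exact: cvg_cst].
  have c1 := continuous_comp cp (h1 _); have c2 := continuous_comp cp (h2 _).
  rewrite /nsq; apply: cvgD; rewrite expr2; under eq_fun do rewrite expr2.
    by apply: cvgM; exact: c1.
  by apply: cvgM; exact: c2.
have := cvgr_gt _ (cf t) _ hX => /(_ _).
by apply: filterS => u /= h; exact: lt_le_trans h (fh u).
Qed.

(** Periodicity brings a minimizing sequence into the compact interval [0, 2 pi]; at a cluster point
    lower semicontinuity suffices. *)
Lemma hr_min : exists t, forall u, hr t <= hr u.
Proof.
pose c := inf (range hr).
have hi : has_inf (range hr).
  by split; [exists (hr 0), 0|exists 0 => _ [t _ <-]; rewrite -lee_fin hrE hsum_ge0].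
have cle u : c <= hr u by apply: ge_inf; [case: hi|exists u].
have seqP n : exists t, t \in `[0, tau] /\ hr t < c + n.+1%:R^-1.
  have n0 : 0 < n.+1%:R^-1 :> R by rewrite invr_gt0.
  have [_ [t _ <-] ht] := inf_adherent n0 hi.
  have [k [hk _]] := itv_translates t (@tau_gt0 R).
  exists (t - k%:~R * tau); split.
    by move: hk; rewrite !in_itv /= => /andP[-> /ltW].
  by rewrite -mulNr -mulrNz hr_periodic.
have [t_ ht_] := choice seqP.
have [p [_ cl]] : [set` `[0, tau : R]] `&` cluster (t_ @ \oo) !=set0.
  apply: (@segment_compact R 0 tau (t_ @ \oo)).
  by exists 0%N => // n _; exact: (proj1 (ht_ n)).
exists p => u; apply: le_trans (cle u); apply/ler_addgt0Pr => e e0.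
have e2 : 0 < e / 2 by rewrite divr_gt0.
have [n hn] : exists n, n.+1%:R^-1 < e / 2.
  exists (Num.truncn (e / 2)^-1); rewrite invf_plt ?posrE//; exact: truncnS_gt.
have [|_ [[k nk <-] h]] := cl [set t_ k | k in [set k | (n <= k)%N]] _ _ (hr_lsc p e2).
  by exists n => // k /= nk; exists k.
have [_ hk] := ht_ k.
have : k.+1%:R^-1 <= n.+1%:R^-1 :> R by rewrite lef_pV2 ?posrE// ler_nat ltnS.
move=> kn; have h1 : hr p - e / 2 < c + e / 2.
  apply: lt_trans h _; apply: lt_trans hk _.
  by rewrite ltrD2l; exact: le_lt_trans kn hn.
by move: h1; lra.
Unshelve. all: by end_near. Qed.

Hypothesis A_inhabited : A.
Hypothesis zeros_finite : finite_set [set z | m0 z = 0].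
Hypothesis cycles_complete : forall (q : nat) (w : 'I_q -> circle R),
  is_filter_cycle N m0 w -> exists k a, w k = cis (- theta a).

Let g (z : circle R) := (z ^+ N)%g.

Lemma iter_pow_cis j u : iter j g (cis (- u)) = cis (- (N%:R ^+ j * u)).
Proof.
elim: j => [|j IH]; first by rewrite expr0 mul1r.
by rewrite iterS IH /g cis_circleX mulrN exprS mulrA.
Qed.

Lemma mask_neq0 (t : R) : exists r : 'I_N, M ((t + r%:R * tau) / N%:R) != 0.
Proof.
apply: contrapT => h; have := qmf t; rewrite big1 => [/eqP|r _].
  by rewrite eq_sym gt_eqF.
by have [->|/eqP nz] := eqVneq (M ((t + r%:R * tau) / N%:R)) 0; [exact: nsq0|case: h; exists r; exact/eqP].
Qed.

Lemma root_cis (z : circle R) t : g z = cis (- t) ->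
  exists r : 'I_N, z = cis (- ((t + r%:R * tau) / N%:R)).
Proof.
have [u0 ->] := cis_surj z; rewrite -[u0]opprK; move: (- u0) => u.
rewrite /g cis_circleX => /cis_eq[k]; rewrite mulrN => e.
have Nz : (N%:Z != 0)%R by rewrite eqz_nat; lia.
have rlt : (`|modz (- k) N%:Z|%N < N)%N.
  by rewrite -ltz_nat gez0_abs ?modz_ge0// ltz_pmod// ltz_nat; lia.
exists (Ordinal rlt); rewrite -[LHS](cis_2pi (divz (- k) N%:Z)); congr cis.
have rE : ((Ordinal rlt : nat)%:R : R) = (modz (- k) N%:Z)%:~R.
  by rewrite /= pmulrn gez0_abs ?modz_ge0.
have kE : (k%:~R : R) = - ((divz (- k) N%:Z)%:~R * N%:R + (modz (- k) N%:Z)%:~R).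
  have := divz_eq (- k) N%:Z; set d := divz _ _; set m := modz _ _ => h.
  by rewrite -[k]opprK h rmorphN rmorphD rmorphM /= -pmulrn.
have N0 : (N%:R : R) != 0 by rewrite gt_eqF.
rewrite rE; apply: (mulfI N0); rewrite mulrDr !mulrN [N%:R * (_ / _)]mulrC mulfVK// e kE; ring.
Qed.

Lemma root_cis_inj t (r r' : 'I_N) :
  cis (- ((t + r%:R * tau) / N%:R)) = cis (- ((t + r'%:R * tau) / N%:R)) -> r = r'.
Proof.
move=> /cis_eq[k e].
have N0 : (N%:R : R) != 0 by rewrite gt_eqF.
have t0 : (tau : R) != 0 by rewrite gt_eqF// tau_gt0.
have h : r'%:R = r%:R + k%:~R * N%:R :> R.
  have d (q : R) : N%:R * ((t + q * tau) / N%:R) = t + q * tau by rewrite mulrC mulfVK.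
  have := congr1 (fun x => N%:R * x) e; move: (d r%:R) (d r'%:R).
  move: (_ / _) (_ / _) => u v hu hv h.
  have : r'%:R * tau = (r%:R + k%:~R * N%:R) * tau.
    by move: h hu hv; move: tau => y; move: (k%:~R : R) => z; lra.
  by move=> /(mulIf t0).
have hz : (r' : nat)%:Z = (r : nat)%:Z + k * N%:Z.
  by apply/eqP; rewrite -(eqr_int R) rmorphD rmorphM /= -!pmulrn; apply/eqP.
have k0 : k = 0.
  have := ltn_ord r; have := ltn_ord r'; move: hz; move: (r : nat) (r' : nat) => a b; nia.
by apply: val_inj; move: hz; rewrite k0 mul0r addr0 => -[].
Qed.

(** At a minimum the weighted mean of [hr] over the N-th roots equals the minimum, so every root of
    positive weight is a minimum too. *)
Lemma hr_branch t c : (forall u, c <= hr u) -> hr t = c -> forall r : 'I_N,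
  M ((t + r%:R * tau) / N%:R) != 0 -> hr ((t + r%:R * tau) / N%:R) = c.
Proof.
move=> cm tc r Mr; have w0 (i : 'I_N) : 0 <= nsq (M ((t + i%:R * tau) / N%:R)) / N%:R.
  by rewrite divr_ge0 ?nsq_ge0// ltW.
have : \sum_(i < N) nsq (M ((t + i%:R * tau) / N%:R)) / N%:R *
    (hr ((t + i%:R * tau) / N%:R) - c) = 0.
  under eq_bigr do rewrite mulrBr.
  by rewrite sumrB -hr_rec tc -!mulr_suml qmf mulfV ?gt_eqF// mul1r subrr.
move=> /eqP; rewrite psumr_eq0; last by move=> i _; rewrite mulr_ge0// subr_ge0.
move=> /allP/(_ r (mem_index_enum _)); rewrite /= !mulf_eq0 subr_eq0 invr_eq0 (gt_eqF Ngt0) orbF.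
case/orP => [/eqP/nsq_eq0 e|/eqP//]; by rewrite e eqxx in Mr.
Qed.

(** Otherwise every point (t + 2 pi k) / N^j is a minimum, and such points approach some theta_a,
    where [hr] is close to 1 by [hr_ge], above [c]. *)
Lemma preimages_dense (t c : R) : (forall u, c <= hr u) -> hr t = c -> c < 1 ->
  exists j y, m0 y = 0 /\ iter j g y = cis (- t).
Proof.
move=> cm tc c1; apply: contrapT => nz.
have H j (k : int) : hr ((t + k%:~R * tau) / N%:R ^+ j) = c.
  elim: j => [|j IH]; first by rewrite expr0 divr1 hr_periodic.
  have N0 : (0 < N)%N by lia.
  have := hr_branch cm IH (r := Ordinal N0); rewrite /= mul0r addr0 -mulrA -invfM -exprSr.
  apply; apply/eqP => M0; apply: nz; exists j.+1, (cis (- ((t + k%:~R * tau) / N%:R ^+ j.+1))).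
  split=> //; rewrite iter_pow_cis mulrC mulfVK ?expf_neq0 ?gt_eqF//.
  by rewrite opprD -mulNr -mulrNz cis_2pi.
(* A spacing 2 pi / N^j so fine that the loss 2 K |x| is below 1 - c. *)
have [j hj] : exists j : nat, 2 * K * tau < (1 - c) * N%:R ^+ j.
  have [j hj] : exists j : nat, 2 * K * tau / (1 - c) < j%:R.
    by exists (Num.truncn (2 * K * tau / (1 - c))).+1; exact: truncnS_gt.
  exists j; rewrite [(1 - c) * _]mulrC -ltr_pdivrMr ?subr_gt0//; apply: lt_le_trans hj _.
  by rewrite -natrX ler_nat; apply/ltnW/ltn_expl; lia.
have Nj : 0 < N%:R ^+ j :> R by rewrite exprn_gt0.
(* The floor picks the iterated root of [t] lying just below theta_a, at distance at most 2 pi /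
   N^j. *)
pose a := A_inhabited; pose k := Num.floor ((N%:R ^+ j * theta a - t) / tau).
have /andP[f1 f2] := floor_itv ((N%:R ^+ j * theta a - t) / tau).
rewrite -/k ler_pdivlMr ?tau_gt0// in f1.
rewrite -/k intrD ltr_pdivrMr ?tau_gt0// in f2.
have := hr_ge a 0 ((t + k%:~R * tau) / N%:R ^+ j); rewrite H /pos /= mul0r addr0.
apply/negP; rewrite -ltNge.
set D := `|_ - theta a|; suff : D * N%:R ^+ j <= tau.
  have D0 : 0 <= D by exact: normr_ge0.
  have := lip_ge0 => K0 hD; rewrite ltrBrDr -ltrBrDl.
  rewrite -(ltr_pM2r Nj); apply: le_lt_trans hj.
  by rewrite -[2 * K * D * _]mulrA ler_wpM2l// mulr_ge0.
rewrite /D -{2}(ger0_norm (ltW Nj)) -normrM mulrBl mulfVK ?gt_eqF//.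
rewrite ler_norml; move: f1 f2; rewrite mulrDl mul1r [theta a * _]mulrC.
by move: tau (@tau_gt0 R) => y y0; lra.
Qed.

Theorem hsum_eq1 t : hsum t = 1%E.
Proof.
have [t0 t0min] := hr_min.
suff : ~ hr t0 < 1.
  move=> /negP; rewrite -leNgt => h; rewrite -hrE; congr (_%:E).
  by apply/le_anti; rewrite hr_le1 (le_trans h).
move=> c1; pose c := hr t0; have cm u : c <= hr u by [].
pose Kc (z : circle R) := exists2 u, z = cis (- u) & hr u = c.
have [Z hZ] : exists s : seq (circle R), [set z | m0 z = 0] = [set` s] by exact/finite_seqP.
have mZ z : (z \in Z) <-> m0 z = 0.
  by split=> [zZ|zZ]; [rewrite -[_ = 0]/([set z | m0 z = 0] z) hZ|have : [set` Z] z by rewrite -hZ].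
have KcE u : Kc (cis (- u)) -> hr u = c.
  move=> [v /cis_eq[k e] <-]; rewrite -(hr_periodic v (- k)); congr hr.
  by rewrite rmorphN mulNr; move: e; lra.
have branch z w : Kc z -> g w = z -> m0 w <> 0 -> Kc w.
  move=> [u -> uc] /root_cis[r ->] nz; exists ((u + r%:R * tau) / N%:R) => //.
  by apply: hr_branch => //; exact/eqP.
have back z : Kc z -> exists w, [/\ Kc w, g w = z & w \notin Z].
  move=> Kz; have [u zu uc] := Kz; have [r hr0] := mask_neq0 u.
  have gz : g (cis (- ((u + r%:R * tau) / N%:R))) = z.
    rewrite zu -[LHS]/(iter 1 g _) iter_pow_cis expr1 mulrC mulfVK ?gt_eqF//.
    by rewrite pmulrn opprD -mulNr -mulrNz cis_2pi.
  exists (cis (- ((u + r%:R * tau) / N%:R))); split=> //.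
    by apply: branch Kz gz _; exact/eqP.
  by apply/negP => /mZ/eqP; rewrite (negPf hr0).
have fwd z : Kc z -> exists j y, y \in Z /\ iter j g y = z.
  move=> [u -> uc]; have [j [y [y0 hy]]] := preimages_dense cm uc c1.
  by exists j, y; split=> //; exact/mZ.
have Ninj := periodic_inj back fwd.
have Kg := periodic_closed back fwd.
(* Any other root of [g z] outside the zeros would belong to [Kc] and have the same image as z,
   against injectivity; the [qmf] sum at [g z] thus reduces to the single term |m0 z|^2 = N. *)
have Kmod z : Kc z -> `|m0 z| = sqrtN N.
  move=> Kz; have [u gu uc] := Kg z Kz; have [r zr] := root_cis gu.
  have : nsq (m0 z) = N%:R.
    rewrite -(qmf u) (bigD1 r)//= /unroll -zr big1 ?addr0// => i ir.
    set w := cis _; have [w0|/eqP w0] := eqVneq (m0 w) 0; first by rewrite w0 nsq0.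
    have gw : g w = g z.
      rewrite gu -[LHS]/(iter 1 g _) iter_pow_cis expr1 mulrC mulfVK ?gt_eqF//.
      by rewrite pmulrn opprD -mulNr -mulrNz cis_2pi.
    have Kw : Kc w by apply: (branch (g z)) => //; exact: Kg.
    have := Ninj _ _ Kw Kz gw; rewrite zr => /root_cis_inj e.
    by rewrite e eqxx in ir.
  by move=> e; rewrite cabsE /cabs e.
pose x := cis (- t0); have Kx : Kc x by exists t0.
(* The minimal period makes the enumeration of the orbit injective, as a cycle requires. *)
have perx : exists q, iter q.+1 g x == x.
  by have [q hq] := backward_periodic back fwd Kx; exists q; exact/eqP.
case: (ex_minnP perx) => q /eqP hq qmin.
have Ki k : Kc (iter k g x) by elim: k => [//|k IH]; exact: Kg.
have iinj d k : iter (k + d) g x = iter k g x -> iter d g x = x.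
  by elim: k => [//|k IH]; rewrite addSn => /(Ninj _ _ (Ki _) (Ki _)).
pose w (k : 'I_q.+1) := iter k g x.
have winj (i j : 'I_q.+1) : (i <= j)%N -> w i = w j -> i = j.
  move=> ij e; apply: val_inj; have [d dE] : exists d, (j : nat) = (i + d)%N.
    by exists (j - i)%N; rewrite subnKC.
  case: d => [|d] in dE; first by rewrite /= dE addn0.
  move: e; rewrite /w dE => /esym/iinj/eqP/qmin.
  by have := ltn_ord j; rewrite dE; lia.
have wcyc : is_filter_cycle N m0 w.
  split=> [|k]; last by apply: Kmod; exact: Ki.
  split=> // [i j e|k].
    by have [ij|/ltnW ji] := leqP i j; [exact: winj ij e|exact/esym/(winj _ _ ji)/esym].
  rewrite /w /=; have [kq|kq] := ltnP k q; first by rewrite modn_small.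
  have -> : (k : nat) = q by have := ltn_ord k; lia.
  by rewrite modnn -[LHS]/(iter q.+1 g x).
have [k [a wk]] := cycles_complete wcyc.
(* At theta_a the term with l = 0 is already 1, so [hr] cannot equal c < 1 there. *)
have := hr_ge a 0 (theta a); rewrite (KcE (theta a)); last by rewrite -wk; exact: Ki.
by rewrite /pos /= mul0r addr0 subrr normr0 mulr0 subr0 leNgt c1.
Qed.

End Mask.

(** * Wavelet coefficients *)

Section CircleFilters.
Context {R : realType}.
Local Notation mu := (@lebesgue_measure R).
Local Notation MR := (measurableTypeR R).
Local Notation tau := (2 * pi : R).

Lemma esum_oppz (a : int -> \bar R) :
  (\esum_(k in [set: int]) a (- k)%R = \esum_(k in [set: int]) a k)%E.
Proof.
have eb : set_bij [set: int] [set: int] (fun k : int => - k).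
  by split=> // [k l _ _ /oppr_inj//|k _]; exists (- k); rewrite ?opprK.
by rewrite [RHS](reindex_esum _ _ _ _ eb).
Qed.

Lemma chi_sum c (M : nat) x : 0 < c -> chi (M%:R * c) x = \sum_(j < M) chi c (x - j%:R * c) :> R.
Proof.
move=> c0; elim: M => [|M IH]; last by rewrite chiS// big_ord_recr /= IH.
by rewrite big_ord0 mul0r chiE; case: andP => // -[h1 h2]; move: (le_lt_trans h1 h2); rewrite ltxx.
Qed.

Lemma nsq_chi c x (z : R[i]) : nsq ((chi c x)%:C * z) = chi c x * nsq z.
Proof. by rewrite nsqM nsqR expr2 chi_sqr. Qed.

Lemma chi_ge0 c x : 0 <= chi c x :> R.
Proof. by rewrite chiE. Qed.

Lemma nsqint_tile c (M : nat) (G : MR -> R[i]) : 0 < c -> cmeas G ->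
  (nsqint mu (fun t : MR => (chi (M%:R * c) t)%:C * G t)%R =
   \sum_(j < M) nsqint mu (fun t : MR => (chi c t)%:C * G (t + j%:R * c)%R)%R)%E.
Proof.
move=> c0 mG; rewrite /nsqint.
under eq_integral => x _ do rewrite nsq_chi chi_sum// mulr_suml -sumEFin.
have mj (j : 'I_M) : cmeas (fun x : MR => (chi c (x - j%:R * c))%:C * G x).
  have := cmeas_chi c (cmeas_affine 1 (j%:R * c) mG).
  move=> /(cmeas_affine 1 (- (j%:R * c))); congr cmeas; apply/funext => x.
  by rewrite !mul1r subrK.
rewrite ge0_integral_sum//; last 2 first.
- move=> j; have := measurable_EFin_nsq (mj j).
  by under eq_fun do rewrite nsq_chi.
- by move=> j x _; rewrite lee_fin mulr_ge0 ?chi_ge0 ?nsq_ge0.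
apply: eq_bigr => j _.
transitivity (nsqint mu (fun x : MR => (chi c (x - j%:R * c))%:C * G x)%R).
  by apply: eq_integral => x _; rewrite nsq_chi.
rewrite -[LHS]mul1e -[X in (X%:E * _)%E](invr1 R) -{1}(normr1 R) -(nsqint_affine (j%:R * c))//.
by apply: eq_integral => x _; rewrite mul1r addrK.
Qed.

Context (N : nat) (N2 : (2 <= N)%N) (F : nat -> R -> R[i]).
Hypothesis F_meas : forall i, (i < N)%N -> cmeas (F i : MR -> R[i]).
Hypothesis F_le : forall i t, (i < N)%N -> nsq (F i t) <= N%:R.
Hypothesis F_unitary : {ae mu, forall t : R, forall c : 'I_N -> R[i],
  \sum_(i < N) nsq (\sum_(j < N) c j * ((F i (t + j%:R * (tau / N%:R)))^*)%C) =
  N%:R * \sum_(j < N) nsq (c j)}.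

Let Ngt0 : 0 < N%:R :> R. Proof. by rewrite ltr0n; lia. Qed.
Let c := tau / N%:R.
Let c0 : 0 < c. Proof. by rewrite divr_gt0// tau_gt0. Qed.
Let NcE : N%:R * c = tau. Proof. by rewrite mulrC mulfVK ?gt_eqF. Qed.

Lemma sqi_shift_tile (G : MR -> R[i]) (j : nat) : (j < N)%N -> cmeas G ->
  sqi mu (fun t : MR => (chi tau t)%:C * G t) ->
  sqi mu (fun t : MR => (chi c t)%:C * G (t + j%:R * c)).
Proof.
move=> jN mG [_ sG]; split.
  apply: cmeas_chi; have := cmeas_affine 1 (j%:R * c) mG.
  by congr cmeas; apply/funext => x; rewrite mul1r.
apply: le_lt_trans sG; have := nsqint_tile N c0 mG; rewrite NcE => ->.
rewrite (bigD1 (Ordinal jN))//=.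
by rewrite leeDl// sume_ge0// => i _; exact: nsqint_ge0.
Qed.

Lemma chi_tile x : chi c (N%:R^-1 * x) = chi tau x.
Proof. by rewrite !chiE pmulr_rge0 ?invr_gt0// ltr_pdivrMl// NcE. Qed.

Lemma cis_tile (k : int) (j : nat) (t : R) :
  cis (- (N%:R * k%:~R * (t + j%:R * c))) = cis (- (N%:R * k%:~R * t)).
Proof.
rewrite -[RHS](cis_2pi (- (k * j%:Z))); congr (cis _).
by rewrite -NcE rmorphN rmorphM /= -pmulrn; ring.
Qed.

(** The exponential of frequency N k has period 2 pi / N, so the N tiles of the period fold onto
    one; rescaled, the integral is the k-th Fourier coefficient of the folded function. *)
Lemma filter_coef (G f : MR -> R[i]) (k : int) : cmeas G -> cmeas f ->
  sqi mu (fun t : MR => (chi tau t)%:C * (G t * f t)) ->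
  cint mu (fun t : MR => (chi tau t)%:C * (G t * f t * cis (- (N%:R * k%:~R * t)))) =
  N%:R^-1%:C * cint mu (fun x : MR => (chi tau x)%:C *
    ((\sum_(j < N) G (N%:R^-1 * x + j%:R * c) * f (N%:R^-1 * x + j%:R * c)) *
     cis (- (k%:~R * x)))).
Proof.
move=> mG mf sG; have mGf := cmeasM mG mf.
set g : MR -> R[i] := fun t => G t * f t.
have mc (u : R) : cmeas (fun t : MR => cval (cis (- (u * t)))) by exact: cmeas_cisN.
have H : cintegrable mu (fun t : MR => (chi tau t)%:C * (g t * cis (- (N%:R * k%:~R * t)))).
  have := sqiM (sqi_chi (ltW (@tau_gt0 R))) (sqiM_bounded (B := 1) (mc (N%:R * k%:~R)) sG _).
  have h1 (x : MR) : nsq (cis (- (N%:R * k%:~R * x))) <= 1 by rewrite nsq_circle.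
  move=> /(_ h1); congr cintegrable; apply/funext => x.
  rewrite -[RHS]mul1r; case: (boolP (0 <= x < tau)) => hx; rewrite !chiE ?hx ?(negPf hx) /=.
    by rewrite /g !mul1r mulrC.
  by rewrite !mul0r mulr0.
have := @cint_tile R c N (fun t => g t * cis (- (N%:R * k%:~R * t))) c0 _ _.
rewrite NcE => /(_ (cmeasM mGf (mc _)) H)[Hj ->].
rewrite -cint_sum; last by move=> j; exact: Hj.
have -> : (fun x : MR => \sum_(i < N) (chi c x)%:C * (g (x + i%:R * c) *
      cis (- (N%:R * k%:~R * (x + i%:R * c))))) =
    (fun t : MR => (chi c t)%:C * ((\sum_(j < N) g (t + j%:R * c)) * cis (- (N%:R * k%:~R * t)))).
  apply/funext => t; rewrite -mulr_sumr; congr (_ * _).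
  rewrite mulr_suml; apply: eq_bigr => j _; congr (_ * _).
  by rewrite cis_tile.
set f0 : MR -> R[i] := fun t => _.
have i0 : N%:R^-1 != 0 :> R by rewrite invr_eq0 gt_eqF.
have if0 : cintegrable mu f0.
  have -> : f0 = (fun x : MR => \sum_(i < N) (chi c x)%:C * (g (x + i%:R * c) *
      cis (- (N%:R * k%:~R * (x + i%:R * c))))).
    apply/funext => t; rewrite /f0 -mulr_sumr; congr (_ * _).
    rewrite mulr_suml; apply: eq_bigr => j _; congr (_ * _).
    by rewrite cis_tile.
  by apply: cintegrable_sum => j; exact: Hj.
have := cint_affine 0 i0 if0; rewrite (ger0_norm (_ : 0 <= N%:R^-1)) ?invr_ge0// invrK => e.
have -> : cint mu f0 = N%:R^-1%:C * cint mu (fun x : MR => f0 (N%:R^-1 * x + 0)).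
  by rewrite e mulrA -rmorphM mulVf ?gt_eqF// mul1r.
congr (_ * _); apply: eq_cint => x; rewrite /f0 addr0; congr (_%:C * (_ * cval (cis (- _)))).
  exact: chi_tile.
by rewrite mulrA [N%:R * _]mulrC mulfK ?gt_eqF.
Qed.

Lemma esum_filter_coef (G f : MR -> R[i]) : cmeas G -> cmeas f ->
  sqi mu (fun t : MR => (chi tau t)%:C * (G t * f t)) ->
  (\esum_(k in [set: int]) (nsq (cint mu (fun t : MR =>
      (chi tau t)%:C * (G t * f t * cis (- (N%:R * k%:~R * t))))))%:E =
   (tau / N%:R)%:E * nsqint mu (fun t : MR => (chi c t)%:C *
      \sum_(j < N) G (t + j%:R * c)%R * f (t + j%:R * c)%R)%R)%E.
Proof.
move=> mG mf sG; set g : MR -> R[i] := fun t => \sum_(j < N) G (t + j%:R * c) * f (t + j%:R * c).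
have mg : cmeas g.
  apply: cmeas_sum => j _; have := cmeas_affine 1 (j%:R * c) (cmeasM mG mf).
  by congr cmeas; apply/funext => x; rewrite mul1r.
have i0 : N%:R^-1 != 0 :> R by rewrite invr_eq0 gt_eqF.
pose h (x : MR) : R[i] := g (N%:R^-1 * x + 0).
have mh : cmeas h by exact: cmeas_affine.
have e2 : nsqint mu (fun x : MR => (chi tau x)%:C * h x)%R =
    (N%:R%:E * nsqint mu (fun t : MR => (chi c t)%:C * g t)%R)%E.
  have := nsqint_affine 0 i0 (cmeas_chi c mg).
  rewrite (ger0_norm (_ : 0 <= N%:R^-1)) ?invr_ge0// invrK => <-.
  by apply: eq_integral => x _; rewrite /h addr0 chi_tile.
have sg : sqi mu (fun t : MR => (chi c t)%:C * g t).
  have -> : (fun t : MR => (chi c t)%:C * g t) =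
     (fun t => \sum_(j < N) (chi c t)%:C * (G (t + j%:R * c) * f (t + j%:R * c))).
    by apply/funext => t; rewrite mulr_sumr.
  apply: sqi_sum => j.
  exact: (@sqi_shift_tile (fun t => G t * f t) j (ltn_ord j) (cmeasM mG mf)).
have sh : sqi mu (fun x : MR => (chi tau x)%:C * h x).
  by split; [exact: cmeas_chi|rewrite e2 lte_mul_pinfty ?lee_fin//; case: sg].
have P := parseval_circle mh sh.
transitivity ((N%:R^-1 ^+ 2)%:E * \esum_(k in [set: int]) (nsq (cint mu (fun x : MR =>
    (chi tau x)%:C * (h x * cis (- (k%:~R * x))))))%:E)%E.
  rewrite -esumZl; last 2 first.
  - by rewrite exprn_ge0 ?invr_ge0.
  - by move=> k; rewrite lee_fin nsq_ge0.
  apply: eq_esum => k _; rewrite filter_coef// nsqM nsqR EFinM; congr (_ * (nsq (cint _ _))%:E)%E.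
  by apply/funext => x; rewrite /h /g addr0.
rewrite P e2 !muleA -!EFinM; congr (_%:E * _)%E.
by rewrite expr2; field; rewrite gt_eqF.
Qed.

(** Parseval is applied to each folded function. For almost every t the filter matrix sends the N
    values of G on the tiles to the N folded values, multiplying the sum of squares by N. *)
Lemma circle_filters (G : MR -> R[i]) : cmeas G -> sqi mu (fun t : MR => (chi tau t)%:C * G t) ->
  (\sum_(i < N) \esum_(k in [set: int]) (nsq (cint mu (fun t : MR =>
      (chi tau t)%:C * (G t * ((F i t)^*)%C * cis (N%:R * k%:~R * t)))))%:E =
   tau%:E * nsqint mu (fun t : MR => (chi tau t)%:C * G t)%R)%E.
Proof.
move=> mG sG.
have mF (i : 'I_N) : cmeas (fun t : MR => ((F i t)^*)%C) by apply: cmeasJ; exact: F_meas.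
have sGF (i : 'I_N) : sqi mu (fun t : MR => (chi tau t)%:C * (G t * ((F i t)^*)%C)).
  have := sqiM_bounded (B := N%:R) (mF i) sG _.
  have h (x : MR) : nsq ((F i x)^*)%C <= N%:R by rewrite nsqJ F_le.
  by move=> /(_ h); congr sqi; apply/funext => t; ring.
pose g i t := \sum_(j < N) G (t + j%:R * c) * ((F i (t + j%:R * c))^*)%C.
transitivity (\sum_(i < N) (tau / N%:R)%:E *
    nsqint mu (fun t : MR => (chi c t)%:C * g i t)%R)%E.
  apply: eq_bigr => i _; apply: etrans (esum_filter_coef mG (mF i) (sGF i)).
  rewrite -esum_oppz; apply: eq_esum => k _; congr (nsq (cint _ _))%:E; apply/funext => t.
  by rewrite rmorphN mulrN mulNr.
rewrite -ge0_sume_distrr; last by move=> i _; exact: nsqint_ge0.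
have mgi (i : 'I_N) : cmeas (fun t : MR => (chi c t)%:C * g i t).
  apply: cmeas_chi; apply: cmeas_sum => j _.
  have := cmeas_affine 1 (j%:R * c) (cmeasM mG (mF i)).
  by congr cmeas; apply/funext => x; rewrite mul1r.
have mGj (j : 'I_N) : cmeas (fun t : MR => (chi c t)%:C * G (t + j%:R * c)).
  apply: cmeas_chi; have := cmeas_affine 1 (j%:R * c) mG.
  by congr cmeas; apply/funext => x; rewrite mul1r.
have -> : (\sum_(i < N) nsqint mu (fun t : MR => (chi c t)%:C * g i t)%R =
    N%:R%:E * nsqint mu (fun t : MR => (chi tau t)%:C * G t)%R)%E.
  have := nsqint_tile N c0 mG; rewrite NcE => ->.
  rewrite -ge0_integral_sum//; last 2 first.
  - by move=> i; exact: measurable_EFin_nsq.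
  - by move=> i x _; rewrite lee_fin nsq_ge0.
  rewrite -ge0_integral_sum//; last 2 first.
  - by move=> i; exact: measurable_EFin_nsq.
  - by move=> i x _; rewrite lee_fin nsq_ge0.
  rewrite -ge0_integralZl_EFin//; last 2 first.
  - by move=> x _; apply: sume_ge0 => i _; rewrite lee_fin nsq_ge0.
  - by apply: emeasurable_fun_sum => i; exact: measurable_EFin_nsq.
  apply: ae_eq_integral => //.
  - by apply: emeasurable_fun_sum => i; exact: measurable_EFin_nsq.
  - by apply: measurable_funeM; apply: emeasurable_fun_sum => i; exact: measurable_EFin_nsq.
  apply: aeS F_unitary => t /(_ (fun j => G (t + j%:R * c))) h _.
  rewrite !sumEFin -EFinM; congr EFin.
  under eq_bigr do rewrite nsq_chi.
  under [in RHS]eq_bigr do rewrite nsq_chi.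
  by rewrite -!mulr_sumr h mulrCA.
rewrite muleA -EFinM; congr (_%:E * _)%E.
by rewrite mulfVK// gt_eqF.
Qed.

End CircleFilters.

Lemma esum_pair (R : realType) (I J : choiceType) (a : I * J -> \bar R) : (forall p, 0 <= a p)%E ->
  (\esum_(p in [set: I * J]) a p = \esum_(i in [set: I]) \esum_(j in [set: J]) a (i, j))%E.
Proof.
move=> a0; rewrite esum_esum; last by move=> i j _ _; exact: a0.
rewrite (_ : _ `*`` _ = setT); last by apply/seteqP.
by apply: eq_esum => -[i j].
Qed.

(** [b] consists of the increments of [a], which runs from 0 at -oo to [T] at +oo. The relation is
    written as a sum to avoid subtraction in [\bar R]. *)
Lemma esum_telescope (R : realType) (a b : int -> \bar R) (T : R) :
  (forall j, 0 <= a j)%E -> (forall j, 0 <= b j)%E ->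
  (forall j, b (j + 1)%R + a j = a (j + 1)%R)%E ->
  (forall eps : R, 0 < eps -> exists J0, forall J, (J0 <= J)%N ->
     (a J%:Z <= T%:E)%E /\ ((T - eps)%:E <= a J%:Z)%E) ->
  (forall eps : R, 0 < eps -> exists J0, forall J, (J0 <= J)%N -> (a (- J%:Z)%R <= eps%:E)%E) ->
  (\esum_(j in [set: int]) b j = T%:E)%E.
Proof.
move=> a0 b0 step hi lo.
have tele (j : int) n : (\sum_(i < n) b (j + i%:Z + 1)%R + a j = a (j + n%:Z)%R)%E.
  elim: n => [|n IH]; first by rewrite big_ord0 add0e addr0.
  by rewrite big_ord_recr /= [X in (X + _)%E]addeC -addeA IH step; congr a; lia.
have e_inj (j : int) : injective (fun i : nat => j + i%:Z + 1).
  by move=> i k /addIr/addrI[].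
(* The integers from -J + 1 to J: the increments between [a] at -J and at J. *)
pose s J := [seq - J%:Z + i%:Z + 1 | i <- index_iota 0 (2 * J)].
have us J : uniq (s J) by rewrite map_inj_uniq ?iota_uniq//; exact: e_inj.
have sE J : (\sum_(j \in [set` s J]) b j + a (- J%:Z)%R = a J%:Z)%E.
  rewrite -fsbig_seq// big_map big_mkord tele.
  by congr a; lia.
apply/eqP; rewrite eq_le; apply/andP; split.
  apply: ge_ereal_sup => _ [X [finX _] <-].
  have [J0 hJ0] := hi 1 ltr01.
  pose J := maxn J0 (\max_(x <- finmap.enum_fset (fset_set X)) `|x|%N).+1.
  apply: le_trans (proj1 (hJ0 J (leq_maxl _ _))); rewrite -(sE J).
  apply: (@le_trans _ _ (\sum_(j \in [set` s J]) b j)%E); last by rewrite leeDl.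
  apply: lee_fsum_nneg_subset => //.
  - exact: finite_seq.
  - move=> x; rewrite !inE /= => Xx.
    have : (`|x| <= \max_(x <- finmap.enum_fset (fset_set X)) `|x|)%N.
      by apply: (leq_bigmax_seq (F := fun x : int => `|x|%N)) => //; rewrite in_fset_set// inE.
    move=> hx; apply/mapP; exists (absz (x + J%:Z - 1)%R).
      by rewrite mem_index_iota; move: hx; rewrite /J; move: (\max_(_ <- _) _)%N => M; lia.
    by move: hx; rewrite /J; move: (\max_(_ <- _) _)%N => M; lia.
apply/lee_addgt0Pr => e e0; have e2 : 0 < e / 2 by rewrite divr_gt0.
have [J1 h1] := hi _ e2; have [J2 h2] := lo _ e2; pose J := maxn J1 J2.
have [_ u1] := h1 J (leq_maxl _ _); have u2 := h2 J (leq_maxr _ _).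
have : (T%:E <= a J%:Z + (e / 2)%:E)%E.
  by rewrite -leeBlDr// -EFinB.
move/le_trans; apply; rewrite -(sE J) -addeA [in leRHS](splitr e) EFinD.
apply: leeD; last by rewrite leeD2r.
by apply: esum_ge; exists [set` s J] => //; split=> //; exact: finite_seq.
Qed.

(** * Folding functions of bounded support onto one period *)

Section Coefficients.
Context {R : realType} {A : finType} (theta : A -> R).
Local Notation mu := (@lebesgue_measure R).
Local Notation MR := (measurableTypeR R).
Local Notation tau := (2 * pi : R).
Implicit Types (w u : A -> MR -> R[i]).

Definition bounded_support (B D : R) w : Prop := forall a, cmeas (w a) /\
  forall x, nsq (w a x) <= B /\ (D <= `|x| -> w a x = 0).

(** With this [L], the 2L translates indexed by -L, ..., L - 1 cover the support shifted by any
    theta_a. *)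
Definition wide (L : nat) (D : R) : Prop := forall a, D + `|theta a| <= L%:R * tau.

Lemma wide_exists D : exists L, wide L D.
Proof.
have [f hf] : exists f : A -> nat, forall a, (D + `|theta a|) / tau < (f a)%:R.
  by exists (fun a => (Num.truncn ((D + `|theta a|) / tau)).+1) => a; exact: truncnS_gt.
exists (\max_a f a)%N => a; rewrite -ler_pdivrMr ?tau_gt0//; apply: ltW.
by apply: lt_le_trans (hf a) _; rewrite ler_nat; exact: leq_bigmax.
Qed.

(** The index [j] stands for the integer j - L, so the nonzero part of the periodization becomes a
    sum over an ordinal. *)
Definition place (L : nat) (a : A) (j : nat) (t : R) : R :=
  t - theta a + (j%:R - L%:R) * tau.

Lemma sqi_bounded (f : MR -> R[i]) (B D : R) : 0 < D -> cmeas f ->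
  (forall x, nsq (f x) <= B /\ (D <= `|x| -> f x = 0)) -> sqi mu f.
Proof.
move=> D0 mf hf; have B0 : 0 <= B by apply: le_trans (nsq_ge0 (f 0)) (proj1 (hf 0)).
have D2 : 0 <= D + D by lra.
have := sqiZ (Num.sqrt B)%:C (sqi_affine D (oner_neq0 R) (sqi_chi D2)).
move=> sg; apply: (sqi_le mf sg) => x; rewrite mul1r nsqM !nsqR sqr_sqrtr// expr2 chi_sqr.
have [fB fD] := hf x; have [xD|xD] := leP D `|x|; first by rewrite fD// nsq0 mulr_ge0 ?chi_ge0.
move: xD; rewrite ltr_norml => /andP[h1 h2]; rewrite chiE.
have -> : (0 <= x + D < D + D) = true by apply/andP; split; lra.
by rewrite mulr1.
Qed.

Section Placing.
Variables (B D : R) (L : nat) (D0 : 0 < D) (wL : wide L D).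

Lemma support_chi a (f : MR -> R[i]) : (forall x, D <= `|x| -> f x = 0) ->
  let g : MR -> R[i] := fun x => f (1 * x + (- theta a - L%:R * tau)) in
  (fun x : MR => (chi ((2 * L)%:R * tau) x)%:C * g x) = g.
Proof.
move=> fD g; apply/funext => x; rewrite chiE.
have [_|h] := boolP (0 <= x < _); first by rewrite mul1r.
rewrite mul0r /g fD// leNgt; apply/negP; rewrite mul1r ltr_norml => /andP[h1 h2].
have := wL a; have := ler_norm (theta a); have := ler_norm (- theta a); rewrite normrN.
move: h1 h2 => h1 h2 h3 h4 h5; move: h; apply/negP; rewrite negbK natrM -mulrA; apply/andP.
by split; move: h1 h2 h3 h4 h5; move: (L%:R * tau) => y; lra.
Qed.

Lemma cint_place (f : MR -> R[i]) a : sqi mu f -> (forall x, D <= `|x| -> f x = 0) ->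
  (forall j, (j < 2 * L)%N ->
     cintegrable mu (fun t : MR => (chi tau t)%:C * f (place L a j t))) /\
  cint mu f = \sum_(j < 2 * L) cint mu (fun t : MR => (chi tau t)%:C * f (place L a j t)).
Proof.
move=> sf fD; have cf := sqi_bounded_support D0 sf fD.
pose b := - theta a - L%:R * tau.
pose g : MR -> R[i] := fun x => f (1 * x + b).
have mg : cmeas g by apply: cmeas_affine; exact: cintegrable_meas cf.
have gE := support_chi a fD : (fun x : MR => (chi ((2 * L)%:R * tau) x)%:C * g x) = g.
have := @cint_tile R tau (2 * L) g (@tau_gt0 R) mg; rewrite gE => H.
have cg : cintegrable mu g by apply: cintegrable_affine => //; exact: oner_neq0.
have [h1 h2] := H cg.
have pE j t : g (t + j%:R * tau) = f (place L a j t).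
  by rewrite /g /place /b; congr f; ring.
split=> [j jL|].
  by have := h1 j jL; congr cintegrable; apply/funext => t; rewrite pE.
have := cint_affine b (oner_neq0 R) cf; rewrite normr1 invr1 mul1r => <-.
rewrite -/g h2; apply: eq_bigr => j _; apply: eq_cint => t; by rewrite pE.
Qed.

Lemma cint_sum_place w u (B' : R) : bounded_support B D w ->
  (forall a, cmeas (u a) /\ forall x, nsq (u a x) <= B') ->
  \sum_a cint mu (fun x : MR => w a x * u a x) =
  cint mu (fun t : MR => (chi tau t)%:C *
    \sum_a \sum_(j < 2 * L) w a (place L a j t) * u a (place L a j t)).
Proof.
move=> hw hu.
have H a : sqi mu (fun x : MR => w a x * u a x) /\ forall x, D <= `|x| -> w a x * u a x = 0.
  have [mw hwa] := hw a; have [mu' hua] := hu a.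
  split=> [|x /(proj2 (hwa x)) ->]; last by rewrite mul0r.
  have := sqiM_bounded mu' (sqi_bounded D0 mw hwa) hua.
  by congr sqi; apply/funext => x; rewrite mulrC.
have K a := cint_place a (proj1 (H a)) (proj2 (H a)).
under eq_bigr => a _ do rewrite (proj2 (K a)).
under [RHS]eq_cint => t do rewrite mulr_sumr.
rewrite cint_sum; last first.
  move=> a; under eq_fun do rewrite mulr_sumr.
  by apply: cintegrable_sum => j; exact: (proj1 (K a)).
apply: eq_bigr => a _; under [RHS]eq_cint => t do rewrite mulr_sumr.
by rewrite cint_sum// => j; exact: (proj1 (K a)).
Qed.

End Placing.
End Coefficients.

(** * Energy balance between successive scales *)

Section Multiresolution.
Context {R : realType} (N : nat) (N2 : (2 <= N)%N) (F : nat -> R -> R[i]).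
Local Notation mu := (@lebesgue_measure R).
Local Notation MR := (measurableTypeR R).
Local Notation tau := (2 * pi : R).
Hypothesis F_meas : forall i, (i < N)%N -> cmeas (F i : MR -> R[i]).
Hypothesis F_le : forall i t, (i < N)%N -> nsq (F i t) <= N%:R.
Hypothesis F_per : forall i t (k : int), F i (t + k%:~R * tau) = F i t.
Hypothesis F_unitary : {ae mu, forall t : R, forall c : 'I_N -> R[i],
  \sum_(i < N) nsq (\sum_(j < N) c j * ((F i (t + j%:R * (tau / N%:R)))^*)%C) =
  N%:R * \sum_(j < N) nsq (c j)}.
Context {A : finType} (s pr : A -> A) (theta : A -> R) (alpha : A -> R[i]).
Hypotheses (sK : cancel s pr) (prK : cancel pr s).
Hypothesis theta_s : forall a, exists k : int, N%:R * theta a = theta (s a) + k%:~R * tau.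
Hypothesis alpha1 : forall a, nsq (alpha a) = 1.
Context (phi : A -> MR -> R[i]).
Hypothesis phi_meas : forall a, cmeas (phi a).
Hypothesis phi_le : forall a x, nsq (phi a x) <= 1.
Hypothesis phi_refine : forall a x,
  phi (s a) (N%:R * x) = ((alpha a)^*)%C * F 0%N (x + theta a) / sqrtN N * phi a x.
Implicit Types (w v : A -> MR -> R[i]).

Let Ngt0 : 0 < N%:R :> R. Proof. by rewrite ltr0n; lia. Qed.

(** On the Fourier side, 2 pi times the coefficient against U Pi(z)^k U^{-1} Pi(m_i) phi:
    conjugation by U turns the frequency k into N k. *)
Definition cf (i : nat) (k : int) w : R[i] :=
  \sum_a cint mu (fun x : MR => w a x * ((cval (cis (- (N%:R * k%:~R * (x + theta a)))) *
    (F i (x + theta a) * phi a x))^*)%C).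

Definition cphi (k : int) w : R[i] :=
  \sum_a cint mu (fun x : MR => w a x * ((cval (cis (- (k%:~R * (x + theta a)))) * phi a x)^*)%C).

(** The periodic function G_v of the overview, as a finite sum, for [w] of bounded support. *)
Definition bracket (L : nat) w (t : MR) : R[i] :=
  \sum_a \sum_(j < 2 * L) w a (place theta L a j t) * ((phi a (place theta L a j t))^*)%C.

Definition Uh w : A -> MR -> R[i] := fun a x => alpha a * sqrtN N * w (s a) (N%:R * x).
Definition Uhi w : A -> MR -> R[i] :=
  fun a x => ((alpha (pr a))^*)%C / sqrtN N * w (pr a) (N%:R^-1 * x).

Lemma place_int L a j t :
  place theta L a j t + theta a = t + (j%:Z - L%:Z)%:~R * tau.
Proof. by rewrite /place rmorphB /= -!pmulrn; ring. Qed.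

Lemma cis_place (k : int) L a j t :
  cis (- (k%:~R * (place theta L a j t + theta a))) = cis (- (k%:~R * t)).
Proof.
rewrite place_int -[RHS](cis_2pi (- (k * (j%:Z - L%:Z)))); congr cis.
by rewrite rmorphN rmorphM /=; ring.
Qed.

Lemma cmeas_cis_shift (u v : R) : cmeas (fun x : MR => cval (cis (- (u * (x + v))))).
Proof.
have := cmeas_affine 1 v (cmeas_cisN u).
by congr cmeas; apply/funext => x; rewrite mul1r.
Qed.

Section Bracket.
Variables (B D : R) (L : nat) (w : A -> MR -> R[i]).
Hypotheses (D0 : 0 < D) (wL : wide theta L D) (hw : bounded_support B D w).

(** The exponential and the filter, evaluated at x + theta_a, are periodic; after folding they leave
    the sum over the translates. *)
Lemma cf_bracket i k : (i < N)%N -> cf i k w = cint mu (fun t : MR =>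
  (chi tau t)%:C * (bracket L w t * ((F i t)^*)%C * cis (N%:R * k%:~R * t))).
Proof.
move=> iN; rewrite /cf (cint_sum_place D0 wL (B' := N%:R) hw).
  apply: eq_cint => t; congr (_ * _); rewrite /bracket mulrAC 2!mulr_suml.
  apply: eq_bigr => a _; rewrite 2!mulr_suml; apply: eq_bigr => j _.
  have -> : N%:R * k%:~R = (N%:Z * k)%:~R :> R by rewrite rmorphM /= -pmulrn.
  by rewrite cis_place place_int F_per !conjCM -cisN opprK; ring.
move=> a; split=> [|x].
  apply: cmeasJ; apply: cmeasM; first exact: cmeas_cis_shift.
  apply: cmeasM => //; have := cmeas_affine 1 (theta a) (F_meas iN).
  by congr cmeas; apply/funext => x; rewrite mul1r.
rewrite nsqJ nsqM nsq_circle mul1r nsqM -[leRHS]mulr1.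
by apply: ler_pM; rewrite ?nsq_ge0 ?F_le.
Qed.

Lemma cphi_bracket k : cphi k w = cint mu (fun t : MR =>
  (chi tau t)%:C * (bracket L w t * cis (k%:~R * t))).
Proof.
rewrite /cphi (cint_sum_place D0 wL (B' := 1) hw).
  apply: eq_cint => t; congr (_ * _); rewrite /bracket mulr_suml.
  apply: eq_bigr => a _; rewrite mulr_suml; apply: eq_bigr => j _.
  by rewrite cis_place conjCM -cisN opprK; ring.
move=> a; split=> [|x].
  by apply: cmeasJ; apply: cmeasM => //; exact: cmeas_cis_shift.
by rewrite nsqJ nsqM nsq_circle mul1r.
Qed.

Lemma cmeas_place (f : MR -> R[i]) a j : cmeas f -> cmeas (fun t : MR => f (place theta L a j t)).
Proof.
move=> mf; have := cmeas_affine 1 (- theta a + (j%:R - L%:R) * tau) mf.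
by congr cmeas; apply/funext => t; rewrite mul1r addrA.
Qed.

Lemma cmeas_bracket : cmeas (bracket L w).
Proof.
apply: cmeas_sum => a _; apply: cmeas_sum => j _; apply: cmeasM.
  by apply: cmeas_place; case: (hw a).
by apply: cmeasJ; apply: cmeas_place.
Qed.

Lemma sqi_bracket : sqi mu (fun t : MR => (chi tau t)%:C * bracket L w t).
Proof.
have -> : (fun t : MR => (chi tau t)%:C * bracket L w t) =
  (fun t : MR => \sum_a \sum_(j < 2 * L) w a (place theta L a j t) *
     ((phi a (place theta L a j t))^*)%C * (chi tau t)%:C).
  apply/funext => t; rewrite /bracket mulr_sumr; apply: eq_bigr => a _.
  by rewrite mulr_sumr; apply: eq_bigr => j _; rewrite mulrC.
apply: sqi_sum => a; apply: sqi_sum => j; apply: (sqiM_bounded (B := B)).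
- by apply: cmeasM; [apply: cmeas_place; case: (hw a)|apply: cmeasJ; apply: cmeas_place].
- by apply: sqi_chi; exact: ltW (@tau_gt0 R).
- move=> x; rewrite nsqM nsqJ -[leRHS]mulr1; apply: ler_pM; rewrite ?nsq_ge0//.
  by have [_ /(_ (place theta L a j x))[]] := hw a.
Qed.

(** The energy seen by the integer translates of phi; [S1] below is the energy seen by one scale of
    wavelets, where filter 0 is left out and U has been applied once. *)
Definition S0 v : \bar R := (\esum_(k in [set: int]) (nsq (cphi k v))%:E)%E.
Definition S1 v : \bar R :=
  (\sum_(i < N.-1) \esum_(k in [set: int]) (nsq (cf i.+1 k v))%:E)%E.

Lemma S0_bracket : S0 w = (tau%:E * nsqint mu (fun t : MR => (chi tau t)%:C * bracket L w t)%R)%E.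
Proof.
rewrite -(parseval_circle cmeas_bracket sqi_bracket) -[RHS]esum_oppz.
apply: eq_esum => k _; rewrite cphi_bracket; congr (nsq (cint _ _))%:E.
by apply/funext => t; rewrite rmorphN mulNr opprK.
Qed.

Lemma S1_bracket :
  (\esum_(k in [set: int]) (nsq (cf 0 k w))%:E + S1 w =
   tau%:E * nsqint mu (fun t : MR => (chi tau t)%:C * bracket L w t)%R)%E.
Proof.
rewrite -(circle_filters N2 F_meas F_le F_unitary cmeas_bracket sqi_bracket).
have -> : (\esum_(k in [set: int]) (nsq (cf 0 k w))%:E + S1 w =
    \sum_(0 <= i < N) \esum_(k in [set: int]) (nsq (cf i k w))%:E)%E.
  have -> : N = N.-1.+1 by lia.
  by rewrite big_nat_recl// big_mkord.
rewrite big_mkord; apply: eq_bigr => i _; apply: eq_esum => k _.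
by rewrite cf_bracket.
Qed.

End Bracket.

Lemma F0_phi a x : F 0%N (x + theta a) * phi a x = alpha a * sqrtN N * phi (s a) (N%:R * x).
Proof.
rewrite phi_refine; have aa : alpha a * ((alpha a)^*)%C = 1.
  by have := nsq_conjM (alpha a); rewrite NconjE alpha1.
have sn : sqrtN N != 0 :> R[i] by apply: sqrtN_neq0; lia.
rewrite -[LHS]mul1r -aa; field.
exact: sn.
Qed.

Lemma cis_theta_s (k : int) a x :
  cis (- (N%:R * k%:~R * (x + theta a))) = cis (- (k%:~R * (N%:R * x + theta (s a)))).
Proof.
have [l hl] := theta_s a; rewrite -[RHS](cis_2pi (- (k * l))); congr cis.
rewrite rmorphN rmorphM /=; have -> : theta (s a) = N%:R * theta a - l%:~R * tau by rewrite hl addrK.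
by ring.
Qed.

Lemma bounded_support_Uh B D w : bounded_support B D w ->
  bounded_support (N%:R * B) (D / N%:R) (Uh w).
Proof.
move=> hw a; have [mw h] := hw (s a); split=> [|x].
  apply: cmeasM; first exact: cmeas_cst.
  by have := cmeas_affine N%:R 0 mw; congr cmeas; apply/funext => x; rewrite addr0.
rewrite /Uh; split.
  by rewrite 2!nsqM alpha1 mul1r nsq_sqrtN ler_pM2l//; case: (h (N%:R * x)).
rewrite ler_pdivrMr// => Dx; have [_ ->] := h (N%:R * x); rewrite ?mulr0//.
by rewrite normrM mulrC (ger0_norm (ltW Ngt0)).
Qed.

Lemma bounded_support_Uhi B D w : bounded_support B D w ->
  bounded_support (B / N%:R) (D * N%:R) (Uhi w).
Proof.
move=> hw a; have [mw h] := hw (pr a); split=> [|x].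
  apply: cmeasM; first exact: cmeas_cst.
  by have := cmeas_affine N%:R^-1 0 mw; congr cmeas; apply/funext => x; rewrite addr0.
rewrite /Uhi; split.
  rewrite 2!nsqM nsqJ alpha1 mul1r nsqV nsq_sqrtN mulrC ler_pM2r ?invr_gt0//.
  by case: (h (N%:R^-1 * x)).
move=> Dx; have [_ ->] := h (N%:R^-1 * x); rewrite ?mulr0//.
by rewrite normrM mulrC (ger0_norm (_ : 0 <= N%:R^-1)) ?invr_ge0 ?ler0n// ler_pdivlMr.
Qed.

Lemma UhK w : Uh (Uhi w) = w.
Proof.
apply/funext => a; apply/funext => x; rewrite /Uh /Uhi sK mulKf ?gt_eqF//.
have aa : alpha a * ((alpha a)^*)%C = 1.
  by have := nsq_conjM (alpha a); rewrite NconjE alpha1.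
have sn : sqrtN N != 0 :> R[i] by apply: sqrtN_neq0; lia.
by rewrite -[RHS]mul1r -aa; field.
Qed.

(** The refinement equation: the filter of index 0 applied to phi is U phi, and U preserves inner
    products. *)
Lemma cf0_Uh k B D w : 0 < D -> bounded_support B D w -> cf 0 k (Uh w) = cphi k w.
Proof.
move=> D0 hw; rewrite /cf /cphi [RHS](reindex s); last by exists pr => a _; rewrite ?sK ?prK.
apply: eq_bigr => a _.
set g : MR -> R[i] := fun x => w (s a) x * _.
have ig : cintegrable mu g.
  have [mw h] := hw (s a).
  apply: (@sqi_bounded_support _ _ D) => //; last first.
    by move=> x /(proj2 (h x)); rewrite /g => ->; rewrite mul0r.
  have mc : cmeas (fun x : MR => ((cval (cis (- (k%:~R * (x + theta (s a))))) * phi (s a) x)^*)%C).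
    by apply: cmeasJ; apply: cmeasM => //; exact: cmeas_cis_shift.
  have := sqiM_bounded (B := 1) mc (sqi_bounded D0 mw h) _.
  have hb (x : MR) : nsq ((cval (cis (- (k%:~R * (x + theta (s a))))) * phi (s a) x)^*)%C <= 1.
    by rewrite nsqJ nsqM nsq_circle mul1r.
  by move=> /(_ hb); congr sqi; apply/funext => x; rewrite /g mulrC.
have N0 : N%:R != 0 :> R by rewrite gt_eqF.
have e := cint_affine 0 N0 ig; rewrite gtr0_norm// in e.
have -> : cint mu g = (N%:R)%:C * cint mu (fun x : MR => g (N%:R * x + 0)).
  by rewrite e mulrA -rmorphM mulfV// mul1r.
rewrite -cintZ; last exact: cintegrable_affine.
apply: eq_cint => x; rewrite /g /Uh addr0 F0_phi cis_theta_s !conjCM.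
have aa : alpha a * ((alpha a)^*)%C = 1.
  by have := nsq_conjM (alpha a); rewrite NconjE alpha1.
have ss : sqrtN N * ((sqrtN N)^*)%C = (N%:R)%:C :> R[i].
  by rewrite conjCR sqrtN_sqr rmorph_nat.
rewrite -ss -[RHS]mul1r -aa; ring.
Qed.

(** All N filters together recover the full energy of the bracket of U w; the share of filter 0 is
    the energy of w one scale below. *)
Lemma S_step B D w : 0 < D -> bounded_support B D w -> (S1 (Uh w) + S0 w = S0 (Uh w))%E.
Proof.
move=> D0 hw; have DN : 0 < D / N%:R by rewrite divr_gt0.
have hU := bounded_support_Uh hw; have [L wL] := wide_exists theta (D / N%:R).
rewrite (S0_bracket DN wL hU) -(S1_bracket DN wL hU) addeC; congr (_ + _)%E.
by apply: eq_esum => k _; rewrite (cf0_Uh k D0 hw).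
Qed.

Lemma S0_ge0 w : (0 <= S0 w)%E.
Proof. by apply: esum_ge0 => k _; rewrite lee_fin nsq_ge0. Qed.

Lemma S1_ge0 w : (0 <= S1 w)%E.
Proof. by apply: sume_ge0 => i _; apply: esum_ge0 => k _; rewrite lee_fin nsq_ge0. Qed.

(** By Plancherel, 2 pi times the squared norm of the vector represented by [w]. *)
Definition W w : \bar R := (\sum_a nsqint mu (w a))%E.

Lemma W_Uh w : (forall a, cmeas (w a)) -> W (Uh w) = W w.
Proof.
move=> mw; rewrite /W [RHS](reindex s)/=; last by exists pr => a _; rewrite ?sK ?prK.
apply: eq_bigr => a _; have N0 : N%:R != 0 :> R by rewrite gt_eqF.
have m2 : cmeas (fun x : MR => w (s a) (N%:R * x)).
  by have := cmeas_affine N%:R 0 (mw (s a)); congr cmeas; apply/funext => x; rewrite addr0.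
rewrite /Uh nsqintZ// nsqM alpha1 mul1r nsq_sqrtN.
have := nsqint_affine 0 N0 (mw (s a)); rewrite gtr0_norm// => e.
under eq_fun do rewrite -[N%:R * _]addr0; rewrite e muleA -EFinM mulfV// mul1e.
by [].
Qed.

Lemma nsqint_place (L : nat) a (f : MR -> R[i]) : cmeas f ->
  (\sum_(j < 2 * L) nsqint mu (fun t : MR => (chi tau t)%:C * f (place theta L a j t))%R
    <= nsqint mu f)%E.
Proof.
move=> mf; pose b := - theta a - L%:R * tau.
pose g : MR -> R[i] := fun x => f (1 * x + b).
have mg : cmeas g by apply: cmeas_affine.
have := nsqint_affine b (oner_neq0 R) mf; rewrite normr1 invr1 mul1e => <-.
have := nsqint_tile (2 * L) (@tau_gt0 R) mg => e.
rewrite (_ : (\sum_(j < _) _ = nsqint mu (fun t : MR => (chi ((2 * L)%:R * tau) t)%:C * g t)%R)%E).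
  apply: nsqint_le; [exact: cmeas_chi|exact: mg|].
  by move=> x; rewrite nsq_chi -[f _]/(g x) ler_piMl ?nsq_ge0// chiE; case: (_ && _).
rewrite e; apply: eq_bigr => j _; congr (nsqint _ _); apply/funext => t.
by rewrite /g /place /b; congr (_ * f _); ring.
Qed.

Lemma nsqint_place_eq (D : R) (L : nat) a (f : MR -> R[i]) : wide theta L D -> cmeas f ->
  (forall x, D <= `|x| -> f x = 0) ->
  (\sum_(j < 2 * L) nsqint mu (fun t : MR => (chi tau t)%:C * f (place theta L a j t))%R
    = nsqint mu f)%E.
Proof.
move=> wL mf fD; pose b := - theta a - L%:R * tau.
pose g : MR -> R[i] := fun x => f (1 * x + b).
have mg : cmeas g by apply: cmeas_affine.
have := nsqint_affine b (oner_neq0 R) mf; rewrite normr1 invr1 mul1e => <-.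
have gE := support_chi wL a fD : (fun x : MR => (chi ((2 * L)%:R * tau) x)%:C * g x) = g.
transitivity (nsqint mu (fun x : MR => (chi ((2 * L)%:R * tau) x)%:C * g x)%R); last by rewrite gE.
rewrite (nsqint_tile (2 * L) (@tau_gt0 R) mg).
apply: eq_bigr => j _; congr (nsqint _ _); apply/funext => t.
by rewrite /g /place /b; congr (_ * f _); ring.
Qed.

Context (d : R) (K : R).
Hypothesis d0 : 0 < d.
Hypothesis K0 : 0 <= K.
Hypothesis sep : forall (x y : A * int) (t : R),
  `|pos theta x t| < d -> `|pos theta y t| < d -> x = y.
Hypothesis phi_near : forall a x, 1 - 2 * K * `|x| <= nsq (phi a x).

Lemma sum_unique (I : finType) (f : I -> R[i]) (P : I -> Prop) :
  (forall i, ~ P i -> f i = 0) -> (forall i j, P i -> P j -> i = j) ->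
  nsq (\sum_i f i) = \sum_i nsq (f i).
Proof.
move=> f0 Pu; have [[i Pi]|nP] := EM (exists i, P i).
  have z j : j != i -> f j = 0.
    by move=> /eqP ji; apply: f0 => Pj; apply: ji; exact: Pu.
  rewrite (bigD1 i)//= [in RHS](bigD1 i)//= !big1 ?addr0// => j ji; rewrite z//.
  exact: nsq0.
have z j : f j = 0 by apply: f0 => Pj; apply: nP; exists j.
by rewrite !big1 ?nsq0// => j _; rewrite z ?nsq0.
Qed.

Lemma place_pos L a j t : place theta L a j t = pos theta (a, j%:Z - L%:Z) t.
Proof. by rewrite /place /pos /= rmorphB /= -!pmulrn. Qed.

(** Within the separation radius at most one term of the bracket is nonzero at each t, so the square
    of the sum is the sum of the squares. *)
Lemma S0_small B D w : 0 < D -> D <= d -> bounded_support B D w ->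
  S0 w = (tau%:E * \sum_a nsqint mu (fun x : MR => w a x * ((phi a x)^*)%C)%R)%E.
Proof.
move=> D0 Dd hw; have [L wL] := wide_exists theta D.
rewrite (S0_bracket D0 wL hw); congr (_ * _)%E.
pose f a (x : MR) := w a x * ((phi a x)^*)%C.
have mf a : cmeas (f a) by apply: cmeasM; [case: (hw a)|exact: cmeasJ].
have fD a x : D <= `|x| -> f a x = 0 by move=> h; rewrite /f (proj2 (proj2 (hw a) x) h) mul0r.
under [RHS]eq_bigr => a _ do rewrite -(nsqint_place_eq a wL (mf a) (fD a)).
rewrite pair_big /= /nsqint -ge0_integral_sum//; last 2 first.
- by move=> p; apply: measurable_EFin_nsq; apply: cmeas_chi; exact: cmeas_place.
- by move=> p x _; rewrite lee_fin nsq_ge0.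
apply: eq_integral => t _; rewrite sumEFin; congr EFin.
rewrite nsq_chi /bracket pair_big /=.
rewrite (@sum_unique _ _ (fun p : A * 'I_(2 * L) => `|place theta L p.1 p.2 t| < d)).
- by rewrite mulr_sumr; apply: eq_bigr => p _; rewrite nsq_chi.
- move=> [a j] /= /negP; rewrite -leNgt => h; apply: fD; exact: le_trans Dd h.
- move=> [a j] [b l] /=; rewrite !place_pos => h1 h2.
  by have [-> /addIr[/val_inj ->]] := sep h1 h2.
Qed.

Lemma S0_small_bounds B D w : 0 < D -> D <= d -> bounded_support B D w ->
  (S0 w <= tau%:E * W w)%E /\ ((tau * (1 - 2 * K * D))%:E * W w <= S0 w)%E.
Proof.
move=> D0 Dd hw; rewrite (S0_small D0 Dd hw).
have t0 := @tau_gt0 R.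
have mf a : cmeas (fun x : MR => w a x * ((phi a x)^*)%C).
  by apply: cmeasM; [case: (hw a)|exact: cmeasJ].
split.
  apply: lee_wpmul2l; first by rewrite lee_fin ltW.
  apply: lee_sum => a _; apply: nsqint_le => //; first by case: (hw a).
  by move=> x; rewrite nsqM nsqJ ler_piMr ?nsq_ge0.
rewrite EFinM -muleA; apply: lee_wpmul2l; first by rewrite lee_fin ltW.
have [neg|pos] := leP (1 - 2 * K * D) 0.
  apply: (@le_trans _ _ 0%E); last by apply: sume_ge0 => a _; exact: nsqint_ge0.
  by rewrite mule_le0_ge0 ?lee_fin//; apply: sume_ge0 => a _; exact: nsqint_ge0.
rewrite /W ge0_sume_distrr; last by move=> a _; exact: nsqint_ge0.
apply: lee_sum => a _; have [mw h] := hw a.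
rewrite -ge0_integralZl_EFin//; last 3 first.
- by move=> x _; rewrite lee_fin nsq_ge0.
- exact: measurable_EFin_nsq.
- exact: ltW.
apply: ge0_le_integral => //.
- by move=> x _; rewrite lee_fin mulr_ge0 ?nsq_ge0// ltW.
- by apply: measurable_funeM; exact: measurable_EFin_nsq.
- exact: (measurable_EFin_nsq (mf a)).
move=> x _; rewrite lee_fin nsqM nsqJ mulrC.
have [xD|xD] := leP D `|x|; first by rewrite (proj2 (h x) xD) nsq0 !mul0r.
apply: ler_wpM2l; first exact: nsq_ge0.
apply: le_trans (phi_near a x); rewrite lerB// ler_wpM2l ?mulr_ge0//; exact: ltW.
Qed.

Lemma nsq_sum_le (I : finType) (f : I -> R[i]) :
  nsq (\sum_i f i) <= #|I|%:R * \sum_i nsq (f i).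
Proof.
have H (x : I -> R) : (\sum_i x i) ^+ 2 <= #|I|%:R * \sum_i x i ^+ 2.
  have h : 0 <= \sum_i \sum_j (x i - x j) ^+ 2.
    by apply: sumr_ge0 => i _; apply: sumr_ge0 => j _; exact: sqr_ge0.
  have e : \sum_i \sum_j (x i - x j) ^+ 2 =
      2 * (#|I|%:R * \sum_i x i ^+ 2 - (\sum_i x i) ^+ 2).
    transitivity (\sum_i (#|I|%:R * x i ^+ 2 + (\sum_j x j ^+ 2 - 2 * (x i * \sum_j x j)))).
      apply: eq_bigr => i _; rewrite !mulr_sumr -sumrB.
      have -> : #|I|%:R * x i ^+ 2 = \sum_(j : I) x i ^+ 2 by rewrite sumr_const -[RHS]mulr_natl.
      by rewrite -big_split /=; apply: eq_bigr => j _; ring.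
    rewrite big_split /= sumrB sumr_const -mulr_sumr -mulr_sumr -mulr_suml -mulr_natl.
    by rewrite expr2; ring.
  by move: h; rewrite e pmulr_rge0// subr_ge0.
rewrite /nsq Re_sum Im_sum big_split /= mulrDr.
by apply: lerD; exact: H.
Qed.

Definition tail (r : R) (a : A) (x : MR) : R[i] := if r <= `|x| then phi a x else 0.

Lemma cmeas_tail r a : cmeas (tail r a).
Proof.
have -> : tail r a = fun x => (\1_[set x : MR | r <= `|x|] x)%:C * phi a x.
  apply/funext => x; rewrite /tail indicE; case: ifPn => h.
    by rewrite mem_set ?mul1r.
  by rewrite memNset ?mul0r//=; exact/negP.
apply: cmeasM => //; apply: cmeas_indic.
rewrite -[X in measurable X]setTI; by apply: measurable_fun_le.
Qed.

(** Where [w] does not vanish, phi equals its tail. The square of the sum costs a factor equal to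
    the number of its terms. *)
Lemma S0_tail (B D r : R) L w : 0 < D -> wide theta L D -> bounded_support B D w ->
  (forall a x, `|x| < r -> w a x = 0) ->
  (S0 w <= (tau * (#|{: A * 'I_(2 * L)}|%:R * B))%:E * \sum_a nsqint mu (tail r a))%E.
Proof.
move=> D0 wL hw wr; rewrite (S0_bracket D0 wL hw) [X in (_ <= X * _)%E]EFinM -muleA.
apply: lee_wpmul2l; first by rewrite lee_fin ltW// tau_gt0.
set n := #|{: A * 'I_(2 * L)}|%:R.
have B0 (a : A) : 0 <= B by apply: le_trans (nsq_ge0 (w a 0)) (proj1 (proj2 (hw a) 0)).
have nB : 0 <= n * B.
  rewrite /n; have [->|/card_gt0P[[a _] _]] := posnP #|{: A * 'I_(2 * L)}|; first by rewrite mul0r.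
  by rewrite mulr_ge0// (B0 a).
apply: (@le_trans _ _ ((n * B)%:E * \sum_a \sum_(j < 2 * L)
  nsqint mu (fun t : MR => (chi tau t)%:C * tail r a (place theta L a j t))%R)%E); last first.
  apply: lee_wpmul2l; rewrite ?lee_fin//; apply: lee_sum => a _.
  by apply: nsqint_place; exact: cmeas_tail.
have mt (p : A * 'I_(2 * L)) : measurable_fun setT
    (fun t : MR => (nsq ((chi tau t)%:C * tail r p.1 (place theta L p.1 p.2 t)))%:E).
  by apply: measurable_EFin_nsq; apply: cmeas_chi; apply: cmeas_place; exact: cmeas_tail.
rewrite pair_big /= /nsqint -ge0_integral_sum//; last by move=> p x _; rewrite lee_fin nsq_ge0.
rewrite -ge0_integralZl_EFin//; last 2 first.
- by move=> x _; apply: sume_ge0 => p _; rewrite lee_fin nsq_ge0.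
- by apply: emeasurable_fun_sum => p; exact: mt.
apply: ge0_le_integral => //.
- by move=> x _; rewrite lee_fin nsq_ge0.
- apply: (measurable_EFin_nsq (f := fun t : MR => (chi tau t)%:C * bracket L w t)).
  by apply: cmeas_chi; exact: cmeas_bracket hw.
- by apply: measurable_funeM; apply: emeasurable_fun_sum => p; exact: mt.
move=> t _; rewrite sumEFin -EFinM lee_fin.
have -> : bracket L w t = \sum_(p : A * 'I_(2 * L)) w p.1 (place theta L p.1 p.2 t) *
    ((tail r p.1 (place theta L p.1 p.2 t))^*)%C.
  rewrite /bracket pair_big /=; apply: eq_bigr => -[a j] _ /=; rewrite /tail.
  by case: leP => // h; rewrite wr// !mul0r.
rewrite nsq_chi; under [X in _ <= _ * X]eq_bigr do rewrite nsq_chi.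
rewrite -mulr_sumr [leRHS]mulrCA; apply: ler_wpM2l; first exact: chi_ge0.
apply: le_trans (nsq_sum_le _) _; rewrite -/n -mulrA; apply: ler_wpM2l; first by rewrite /n.
rewrite mulr_sumr; apply: ler_sum => -[a j] _ /=; rewrite nsqM nsqJ ler_wpM2r ?nsq_ge0//.
by case: (proj2 (hw a) (place theta L a j t)).
Qed.

Hypothesis phi_sqi : forall a, sqi mu (phi a).

Lemma tail_small (eps : R) : 0 < eps -> exists r0 : R, forall r, r0 <= r ->
  (\sum_a nsqint mu (tail r a) < eps%:E)%E.
Proof.
move=> e0; pose n := #|A|.+1.
have en : 0 < eps / n%:R by rewrite divr_gt0.
have H a : exists M : nat, forall k, (M <= k)%N ->
    (nsqint mu (fun x => win k (phi a) x - phi a x)%R < (eps / n%:R)%:E)%E.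
  by have [M hM] := cvge0_lt (win_cvg (phi_sqi a)) en; exists M.
pose M := fun a => projT1 (cid (H a)).
have hM a := projT2 (cid (H a)); pose M0 := (\max_a M a)%N.
exists (M0.+1)%:R => r hr.
apply: (@le_lt_trans _ _ (\sum_(a : A) (eps / n%:R)%:E)%E).
  apply: lee_sum => a _; apply: le_trans (ltW (hM a M0 (leq_bigmax a))).
  apply: nsqint_le; first exact: cmeas_tail.
    by apply: cmeasB => //; case: (sqi_win M0 (phi_sqi a)).
  move=> x; rewrite /tail; case: ifP => [rx|_]; last by rewrite nsq0 nsq_ge0.
  by rewrite win_support ?sub0r ?nsqN//; exact: le_trans hr rx.
rewrite sumEFin lte_fin sumr_const -[X in X < _]mulr_natl mulrCA gtr_pMr//.
by rewrite ltr_pdivrMr// mul1r ltr_nat.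
Qed.

Lemma iter_Uh_support B D v J : bounded_support B D v ->
  bounded_support (N%:R ^+ J * B) (D / N%:R ^+ J) (iter J Uh v).
Proof.
move=> hv; elim: J => [|J IH]; first by rewrite expr0 mul1r divr1.
by have := bounded_support_Uh IH; rewrite mulrA -exprS -mulrA -invfM -exprSr.
Qed.

Lemma iter_Uhi_support B D v J : bounded_support B D v ->
  bounded_support (B / N%:R ^+ J) (D * N%:R ^+ J) (iter J Uhi v).
Proof.
move=> hv; elim: J => [|J IH]; first by rewrite expr0 mulr1 divr1.
by rewrite exprSr invfM !mulrA; exact: bounded_support_Uhi IH.
Qed.

Lemma iter_Uhi_zero r v J : (forall a x, `|x| < r -> v a x = 0) ->
  forall a x, `|x| < r * N%:R ^+ J -> iter J Uhi v a x = 0.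
Proof.
move=> hv; elim: J => [|J IH] a x; first by rewrite expr0 mulr1; exact: hv.
move=> h; rewrite iterS /Uhi IH ?mulr0// normrM (ger0_norm (_ : 0 <= N%:R^-1)) ?invr_ge0 ?ler0n//.
by rewrite ltr_pdivrMl// mulrCA -exprS.
Qed.

Lemma W_iter_Uh B D v J : bounded_support B D v -> W (iter J Uh v) = W v.
Proof.
move=> hv; elim: J => [//|J IH]; rewrite iterS W_Uh// => a.
by case: (iter_Uh_support J hv a).
Qed.

Lemma geometric_large (c : R) : exists J0, forall J, (J0 <= J)%N -> c <= N%:R ^+ J.
Proof.
exists (Num.truncn c).+1 => J hJ; apply: ltW; apply: lt_le_trans (truncnS_gt c) _.
by rewrite -natrX ler_nat; apply: leq_trans hJ _; apply/ltnW/ltn_expl; lia.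
Qed.

Lemma W_fin B D v : 0 < D -> bounded_support B D v -> W v \is a fin_num.
Proof.
move=> D0 hv; rewrite /W; apply/sum_fin_numP => a _ _.
rewrite ge0_fin_numE ?nsqint_ge0//; have [mv h] := hv a.
by case: (sqi_bounded D0 mv h).
Qed.

Lemma S0_forward B D v (eps : R) : 0 < D -> bounded_support B D v -> 0 < eps ->
  exists J0, forall J, (J0 <= J)%N ->
    (S0 (iter J Uh v) <= tau%:E * W v)%E /\
    ((tau * fine (W v) - eps)%:E <= S0 (iter J Uh v))%E.
Proof.
move=> D0 hv e0; have t0 := @tau_gt0 R.
have Wf := W_fin D0 hv; set w := fine (W v); have w0 : 0 <= w.
  by rewrite fine_ge0//; apply: sume_ge0 => a _; exact: nsqint_ge0.
(* The first bound shrinks the support into the separation radius [d]; the second makes the loss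
   from |phi|^2 >= 1 - 2 K |x| at most [eps]. *)
have [J1 h1] := geometric_large (D / d); have [J2 h2] := geometric_large (tau * (2 * K * D) * w / eps).
exists (maxn J1 J2) => J; rewrite geq_max => /andP[/h1 hd /h2 he].
have NJ : 0 < N%:R ^+ J :> R by rewrite exprn_gt0.
have DJ : 0 < D / N%:R ^+ J by rewrite divr_gt0.
have [] := S0_small_bounds DJ _ (iter_Uh_support J hv).
  by rewrite ler_pdivrMr// mulrC -ler_pdivrMr.
rewrite (W_iter_Uh J hv) => u1 u2; split=> //; apply: le_trans u2.
rewrite -(fineK Wf) -/w -EFinM lee_fin.
rewrite ler_pdivrMr// in he.
have : tau * (2 * K * (D / N%:R ^+ J)) * w <= eps.
  have -> : tau * (2 * K * (D / N%:R ^+ J)) * w = (tau * (2 * K * D) * w) / N%:R ^+ J by ring.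
  by rewrite ler_pdivrMr// [eps * _]mulrC.
by lra.
Qed.

(** The support grows like N^J and with it the number of bracket terms, but the bound on |w|^2
    shrinks like N^-J. The two cancel, and the tails of phi beyond r N^J decide. *)
Lemma S0_backward B D r v (eps : R) : 0 < D -> 0 < r -> bounded_support B D v ->
  (forall a x, `|x| < r -> v a x = 0) -> 0 < eps ->
  exists J0, forall J, (J0 <= J)%N -> (S0 (iter J Uhi v) <= eps%:E)%E.
Proof.
move=> D0 r0 hv vr e0; have t0 := @tau_gt0 R.
pose T := \sum_a `|theta a|; have T0 : 0 <= T by apply: sumr_ge0.
pose B1 := `|B|.
(* Number of terms times bound on |w|^2, uniformly in J: L is at most ((D + T) / tau + 1) N^J. *)
pose C := tau * (#|A|%:R * (2 * ((D + T) / tau + 1)) * B1).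
have C0 : 0 <= C.
  have Q0 : 0 <= (D + T) / tau + 1.
    by apply: addr_ge0 => //; apply: divr_ge0 (ltW t0); apply: addr_ge0 => //; exact: ltW.
  apply: mulr_ge0 (ltW t0) _; apply: mulr_ge0; last exact: normr_ge0.
  by apply: mulr_ge0 => //; apply: mulr_ge0.
have C1 : 0 < C + 1 by lra.
have [r1 hr1] := tail_small (divr_gt0 e0 C1).
have [J0 hJ0] := geometric_large (r1 / r).
exists J0 => J /hJ0 hJ; have NJ : 0 < N%:R ^+ J :> R by rewrite exprn_gt0.
have NJ1 : 1 <= N%:R ^+ J :> R by rewrite exprn_ege1// ler1n (ltnW N2).
have DJ : 0 < D * N%:R ^+ J by rewrite mulr_gt0.
pose L := (Num.truncn ((D * N%:R ^+ J + T) / tau)).+1.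
have q0 : 0 <= (D * N%:R ^+ J + T) / tau by apply: divr_ge0 (ltW t0); apply: addr_ge0 => //; exact: ltW.
have wL : wide theta L (D * N%:R ^+ J).
  move=> a; rewrite -ler_pdivrMr//; apply: le_trans (ltW (truncnS_gt _)).
  by rewrite ler_pM2r ?invr_gt0// lerD2l /T (bigD1 a)//= lerDl sumr_ge0.
have LN : L%:R <= ((D + T) / tau + 1) * N%:R ^+ J.
  rewrite /L -natr1; apply: (@le_trans _ _ ((D * N%:R ^+ J + T) / tau + 1)).
    by rewrite lerD2r truncn_le.
  rewrite [leRHS]mulrDl mul1r; apply: lerD => //; rewrite [leRHS]mulrAC ler_pM2r ?invr_gt0//.
  by rewrite mulrDl lerD2l ler_peMr.
have hs := iter_Uhi_support J hv.
have := S0_tail DJ wL hs (iter_Uhi_zero (J := J) vr); move/le_trans; apply.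
have tl := hr1 (r * N%:R ^+ J); rewrite ler_pdivrMr// mulrC in hJ.
have {tl}/ltW tl := tl hJ.
apply: (@le_trans _ _ (C%:E * (eps / (C + 1))%:E)%E); last first.
  by rewrite -EFinM lee_fin mulrA ler_pdivrMr//; move: (mulr_ge0 C0 (ltW e0)); lra.
apply: (@le_trans _ _ (C%:E * \sum_a nsqint mu (tail (r * N%:R ^+ J) a))%E).
  apply: lee_wpmul2r; first by apply: sume_ge0 => a _; exact: nsqint_ge0.
  rewrite lee_fin /C; apply: ler_wpM2l; first exact: ltW.
  rewrite card_prod card_ord natrM natrM.
  apply: (@le_trans _ _ (#|A|%:R * (2 * L%:R) * (B1 / N%:R ^+ J))).
    by apply: ler_wpM2l; rewrite ?mulr_ge0// ler_pM2r ?invr_gt0// ler_norm.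
  rewrite -!mulrA; apply: ler_wpM2l => //; apply: ler_wpM2l => //.
  rewrite mulrCA [leRHS]mulrC; apply: ler_wpM2l; first exact: normr_ge0.
  by rewrite ler_pdivrMr.
by apply: lee_wpmul2l; rewrite ?lee_fin.
Qed.

Definition Uz (j : int) v : A -> MR -> R[i] :=
  match j with Posz n => iter n Uh v | Negz n => iter n.+1 Uhi v end.

Lemma Uh_Uz j v : Uh (Uz j v) = Uz (j + 1) v.
Proof.
case: j => [n|[|n]].
- by have -> : n%:Z + 1 = n.+1%:Z by rewrite -addn1 PoszD.
- have -> : Negz 0 + 1 = 0 by [].
  by rewrite [LHS]/= UhK.
have -> : Negz n.+1 + 1 = Negz n by rewrite !NegzE -addn1 PoszD opprD addrNK.
by rewrite [LHS]/= UhK.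
Qed.

Lemma Uz_support B D v j : 0 < D -> bounded_support B D v ->
  exists B' D', 0 < D' /\ bounded_support B' D' (Uz j v).
Proof.
move=> D0 hv; case: j => n.
  exists (N%:R ^+ n * B), (D / N%:R ^+ n); split; first by rewrite divr_gt0 ?exprn_gt0.
  exact: iter_Uh_support.
exists (B / N%:R ^+ n.+1), (D * N%:R ^+ n.+1); split; first by rewrite mulr_gt0 ?exprn_gt0.
exact: iter_Uhi_support.
Qed.

Theorem esum_S1 B D r v : 0 < D -> 0 < r -> bounded_support B D v ->
  (forall a x, `|x| < r -> v a x = 0) ->
  (\esum_(j in [set: int]) S1 (Uz j v) = tau%:E * W v)%E.
Proof.
move=> D0 r0 hv vr; rewrite -(fineK (W_fin D0 hv)) -EFinM.
apply: (esum_telescope (a := fun j => S0 (Uz j v))).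
- by move=> j; exact: S0_ge0.
- by move=> j; exact: S1_ge0.
- move=> j; have [B' [D' [D'0 h]]] := Uz_support j D0 hv.
  by rewrite -Uh_Uz (S_step D'0 h).
- move=> eps e0; have [J0 hJ] := S0_forward D0 hv e0; exists J0 => J /hJ[h1 h2].
  by rewrite EFinM fineK ?(W_fin D0 hv).
- move=> eps e0; have [J0 hJ] := S0_backward D0 r0 hv vr e0; exists J0.+1 => -[//|J] hh.
  by have := hJ J.+1 (ltnW hh); rewrite -NegzE.
Qed.

(** The coefficients at scale j are read off after applying U^{1-j}, so the sum over scales is the
    telescoped one reindexed by j |-> 1 - j. *)
Theorem parseval_coefficients B D r v : 0 < D -> 0 < r -> bounded_support B D v ->
  (forall a x, `|x| < r -> v a x = 0) ->
  (\esum_(x in [set: 'I_N.-1 * int * int])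
     (nsq (cf x.1.1.+1 x.2 (Uz (1 - x.1.2) v)))%:E = tau%:E * W v)%E.
Proof.
move=> D0 r0 hv vr; have n0 (z : R[i]) : (0 <= (nsq z)%:E)%E by rewrite lee_fin nsq_ge0.
rewrite esum_pair//= esum_pair; last by move=> p; exact: esum_ge0.
rewrite esum_finType; last by move=> i; apply: esum_ge0 => j _; exact: esum_ge0.
rewrite -esum_sum; last by move=> j i _ _; exact: esum_ge0.
rewrite -(esum_S1 D0 r0 hv vr).
have eb : set_bij [set: int] [set: int] (fun j : int => 1 - j).
  by split=> // [k l _ _ /addrI/oppr_inj//|k _]; exists (1 - k); rewrite // opprB addrC subrK.
by rewrite [RHS](reindex_esum _ _ _ _ eb).
Qed.

End Multiresolution.

(** * Square integrals of products of the scaling functions with periodic functions *)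

Section Periodization.
Context {R : realType} {A : finType} (theta : A -> R) (phi : A -> measurableTypeR R -> R[i]).
Local Notation mu := (@lebesgue_measure R).
Local Notation MR := (measurableTypeR R).
Local Notation tau := (2 * pi : R).
Hypothesis phi_meas : forall a, cmeas (phi a).

Lemma measurable_tilesum :
  measurable_fun setT (fun t : MR => tilesum theta (fun a x => nsq (phi a x)) t).
Proof.
apply: measurable_esum => [[a k]|x t]; last by rewrite lee_fin nsq_ge0.
apply: measurable_EFin_nsq => /=.
have := cmeas_affine 1 (- theta a + k%:~R * tau) (phi_meas a).
by congr cmeas; apply/funext => t; rewrite mul1r addrA.
Qed.

(** Shifting by theta_a and folding brings the periodic factor to the same point for all a and all
    translates, so it comes out of the sum. *)
Lemma periodize_tilesum (g : MR -> R[i]) : cmeas g ->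
  (forall t (k : int), g (t + k%:~R * tau) = g t) ->
  (\sum_a nsqint mu (fun x : MR => g (x + theta a) * phi a x)%R =
   \int[circm tau]_t ((nsq (g t))%:E * tilesum theta (fun a x => nsq (phi a x)) t))%E.
Proof.
move=> mg gper; have t0 := @tau_gt0 R.
have mga a : cmeas (fun x : MR => g (x + theta a) * phi a x).
  apply: cmeasM => //; have := cmeas_affine 1 (theta a) mg.
  by congr cmeas; apply/funext => t; rewrite mul1r.
have mk a (k : int) : cmeas (fun t : MR => g t * phi a (pos theta (a, k) t)).
  apply: cmeasM => //; have := cmeas_affine 1 (- theta a + k%:~R * tau) (phi_meas a).
  by congr cmeas; apply/funext => t; rewrite mul1r addrA.
have e a : (nsqint mu (fun x : MR => g (x + theta a) * phi a x)%R = \int[circm tau]_t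
    \esum_(k in [set: int]) (nsq (g t * phi a (pos theta (a, k) t)))%:E)%E.
  have := nsqint_affine (- theta a) (oner_neq0 R) (mga a); rewrite normr1 invr1 mul1e => <-.
  rewrite /nsqint (ge0_integral_periodize t0)//; last by move=> x; rewrite lee_fin nsq_ge0.
    apply: eq_integral => t _; apply: eq_esum => k _; congr (nsq _)%:E.
    rewrite mul1r subrK gper; congr (_ * phi a _).
    by rewrite /pos /=; ring.
  by apply: measurable_EFin_nsq; apply: (cmeas_affine 1 (- theta a) (mga a)).
under eq_bigr do rewrite e.
rewrite -ge0_integral_sum//; last 2 first.
- move=> a; apply: measurable_esum => [k|k x]; last by rewrite lee_fin nsq_ge0.
  by apply: measurable_EFin_nsq.
- by move=> a x _; apply: esum_ge0 => k _; rewrite lee_fin nsq_ge0.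
apply: eq_integral => t _; rewrite /tilesum -esumZl ?nsq_ge0//; last first.
  by move=> x; rewrite lee_fin nsq_ge0.
rewrite esum_pair; last by move=> x; rewrite -EFinM lee_fin mulr_ge0 ?nsq_ge0.
rewrite esum_finType; last first.
  by move=> a; apply: esum_ge0 => k _; rewrite -EFinM lee_fin mulr_ge0 ?nsq_ge0.
by apply: eq_bigr => a _; apply: eq_esum => k _; rewrite nsqM EFinM.
Qed.

(** With g = 1 the folding formula bounds the total square integral of the [phi a] by 2 pi. *)
Lemma sqi_tilesum a : (forall t, tilesum theta (fun a x => nsq (phi a x)) t <= 1)%E ->
  sqi mu (phi a).
Proof.
move=> h1; split=> //; have t0 := @tau_gt0 R.
have := periodize_tilesum (g := fun=> 1) (cmeas_cst _) (fun _ _ => erefl) => e.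
apply: (@le_lt_trans _ _ (\sum_a nsqint mu (fun x : MR => 1 * phi a x)%R)%E).
  rewrite (bigD1 a)//=; under [X in (nsqint _ X + _)%E]eq_fun do rewrite mul1r.
  by rewrite leeDl// sume_ge0// => b _; exact: nsqint_ge0.
rewrite e; apply: (@le_lt_trans _ _ (\int[circm tau]_t (cst 1%E t))%E).
  apply: ge0_le_integral => //.
  - by move=> x _; rewrite mule_ge0 ?lee_fin ?nsq_ge0// esum_ge0// => ? _; rewrite lee_fin nsq_ge0.
  - by apply: measurable_funeM; exact: measurable_tilesum.
  - by move=> t _; rewrite nsq1 mul1e h1.
by rewrite integral_cst// mul1e circm_setT ?ltry// ltW.
Qed.

Lemma nsqint_tilesum1 (g : MR -> R[i]) : cmeas g ->
  (forall t (k : int), g (t + k%:~R * tau) = g t) ->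
  (forall t, tilesum theta (fun a x => nsq (phi a x)) t = 1%E) ->
  (\sum_a nsqint mu (fun x : MR => g (x + theta a) * phi a x)%R =
   nsqint mu (fun t : MR => (chi tau t)%:C * g t)%R)%E.
Proof.
move=> mg gper h1; rewrite periodize_tilesum// -nsqint_circm//.
by apply: eq_integral => t _; rewrite h1 mule1.
Qed.

End Periodization.

(** * The triples of the cycles *)

Section L2Operators.
Context {R : realType}.
Local Notation mu := (@lebesgue_measure R).
Local Notation MR := (measurableTypeR R).
Local Notation tau := (2 * pi : R).
Implicit Types u v : L2 R.

Lemma affL2K (c : R[i]) (a : R) u : a != 0 -> c != 0 ->
  affL2 c a 0 (affL2 c^-1 a^-1 0 u) = u.
Proof.
move=> a0 c0; have ai0 : a^-1 != 0 by rewrite invr_eq0.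
apply: L2_eq; apply: aeS2 (affL2E c 0 a0 (affL2 c^-1 a^-1 0 u)) (ae_affine 0 a0 (affL2E c^-1 0 ai0 u)).
by move=> x e1 e2; rewrite e1 e2 !addr0 mulKf// mulVKf.
Qed.

Lemma dot_affL2 (c : R[i]) (a : R) u v : a != 0 ->
  L2_dot (affL2 c a 0 u) (affL2 c a 0 v) = (nsq c / `|a|)%:C * L2_dot u v.
Proof.
move=> a0; have mf (w : L2 R) : cmeas (fun x : MR => c * w (a * x + 0)).
  by apply: cmeasM; [exact: cmeas_cst|exact: (cmeas_affine a 0 (L2_cmeas w))].
rewrite (L2_dot_ae (mf u) (mf v) (affL2E c 0 a0 u) (affL2E c 0 a0 v)) L2_dotE.
have iuv : cintegrable mu (fun x : MR => u x * (v x)^*).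
  by apply: sqiM; [exact: L2_sqi|exact: (sqiJ (L2_sqi v))].
transitivity (cint mu (fun x : MR => (nsq c)%:C * (u (a * x + 0) * (v (a * x + 0))^*))).
  apply: eq_cint => x; rewrite NconjE conjCM -nsq_conjM !NconjE; ring.
rewrite cintZ; last exact: (cintegrable_affine 0 a0 iuv).
by rewrite (cint_affine 0 a0 iuv) rmorphM /= mulrA.
Qed.

Section Dilation.
Variables (N : nat) (N0 : (0 < N)%N).

Let Nr0 : (N%:R : R) != 0. Proof. by rewrite pnatr_eq0 -lt0n. Qed.

Lemma U0K : cancel (@U0 R N) (@dil R N).
Proof. by move=> u; rewrite /dil U0_affL2; apply: affL2K => //; exact: sqrtN_neq0. Qed.

Lemma dilK : cancel (@dil R N) (@U0 R N).
Proof.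
move=> u; rewrite /dil U0_affL2 -{2}(invrK (sqrtN N)) -{2}(invrK (N%:R : R)).
by apply: affL2K; rewrite invr_eq0//; exact: sqrtN_neq0.
Qed.

Lemma U0P t u v : U0 N (t *: u + v) = t *: U0 N u + U0 N v.
Proof. by rewrite !U0_affL2 affL2P// invr_eq0. Qed.

Lemma U00 : U0 N 0 = 0 :> L2 R.
Proof. by have := U0P (-1) 0 0; rewrite !scaleN1r addr0 oppr0 addNr. Qed.

Lemma dot_U0 u v : L2_dot (U0 N u) (U0 N v) = L2_dot u v.
Proof.
rewrite !U0_affL2 dot_affL2; last by rewrite invr_eq0.
rewrite nsqV nsq_sqrtN ger0_norm ?invr_ge0// mulfV ?invr_eq0//.
by rewrite mul1r.
Qed.

End Dilation.

Lemma fourier_pi0 f u (g : MR -> R[i]) : cmeas (unroll f : MR -> R[i]) -> sqi mu g ->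
  {ae mu, forall x, unroll f x * fourier u x = g x} ->
  {ae mu, forall x, fourier (pi0 f u) x = g x}.
Proof.
move=> mf sg fg; rewrite /pi0 fourier_op_invK.
have -> : to_L2 (fun x => unroll f x * fourier u x) = to_L2 g.
  apply: eq_to_L2; last by apply: aeS fg => x ->.
    by apply: (sqi_ae _ sg fg); apply: cmeasM => //; exact: L2_cmeas.
  by case: sg.
exact: to_L2E.
Qed.

Lemma pi00 f : cmeas (unroll f : MR -> R[i]) -> pi0 f 0 = 0 :> L2 R.
Proof.
move=> mf; apply: (can_inj fourierK); apply: L2_eq; rewrite fourier0.
have h : {ae mu, forall x, unroll f x * fourier (0 : L2 R) x = 0}.
  by rewrite fourier0; apply: aeS (@L2_0E R) => x ->; rewrite mulr0.
by apply: aeS2 (fourier_pi0 mf (sqi0 mu) h) (@L2_0E R) => x -> ->.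
Qed.

(** Multiplication by a unimodular function preserves square integrability, so the multiplier of [f]
    can undo it on the Fourier side. *)
Lemma pi0_unimodK (f g : circle R -> R[i]) : cmeas (unroll f : MR -> R[i]) ->
  cmeas (unroll g : MR -> R[i]) -> (forall w, f w * g w = 1) -> (forall w, nsq (g w) = 1) ->
  cancel (pi0 g) (pi0 f).
Proof.
move=> mf mg fg g1 u; apply: (can_inj fourierK); apply: L2_eq.
apply: fourier_pi0 => //; first exact: L2_sqi.
have sg : sqi mu (fun x : MR => unroll g x * fourier u x).
  apply: (sqiM_bounded (B := 1)) => //; first exact: L2_sqi.
  by move=> x; rewrite /unroll g1.
have h : {ae mu, forall x, unroll g x * fourier u x = unroll g x * fourier u x} by apply: aeT.
have k x y : y = unroll g x * fourier u x -> unroll f x * y = fourier u x.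
  by move=> ->; rewrite mulrA /unroll fg mul1r.
by apply: aeS (fourier_pi0 mg sg h) => x; exact: k.
Qed.

End L2Operators.

(** * Direct sums of cycle triples on the Fourier side *)

Section CycleSum.
Context {R : realType} (N : nat) (N2 : (2 <= N)%N) (p : nat -> nat).
Context (z : forall i, 'I_(p i) -> circle R) (alpha : forall i, 'I_(p i) -> R[i]).
Context (theta : forall i, 'I_(p i) -> R) (m : nat).
Local Notation mu := (@lebesgue_measure R).
Local Notation MR := (measurableTypeR R).
Local Notation tau := (2 * pi : R).
Let C i := cycle_triple N (@z i) (@alpha i).
Local Notation HH := (dsum C m).
Local Notation A := {i : 'I_m & 'I_(p i)}.
Hypothesis z_theta : forall i k, (i < m)%N -> @z i k = cis (- @theta i k).
Hypothesis alpha_unit : forall i k, (i < m)%N -> nsq (@alpha i k) = 1.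
Implicit Types (u v : HH).

Let N0 : (0 < N)%N. Proof. exact: ltnW. Qed.

(** A vector of the direct sum is a dependent function of functions; indexing by the sigma type [A]
    flattens it into one family of L2 functions over all cycle points. *)
Definition comp u (a : A) : L2 R := (u (tag a) : 'I_(p (tag a)) -> L2 R) (tagged a).
Definition glue (f : A -> L2 R) : HH :=
  fun i => (fun k => f (Tagged (fun i : 'I_m => 'I_(p i)) k)) : 'I_(p i) -> L2 R.
Definition thetaA (a : A) : R := theta (tagged a).
Definition alphaA (a : A) : R[i] := alpha (tagged a).
Definition succA (a : A) : A := Tagged (fun i : 'I_m => 'I_(p i)) (ordS (tagged a)).
Definition predA (a : A) : A := Tagged (fun i : 'I_m => 'I_(p i)) (ord_pred (tagged a)).

Lemma succAK : cancel succA predA.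
Proof. by move=> [i k]; rewrite /succA /predA /= ordSK. Qed.

Lemma predAK : cancel predA succA.
Proof. by move=> [i k]; rewrite /succA /predA /= ord_predK. Qed.

Lemma alphaA_unit a : nsq (alphaA a) = 1.
Proof. by apply: alpha_unit; exact: ltn_ord. Qed.

Lemma comp_inj u v : comp u =1 comp v -> u = v.
Proof.
move=> e; apply: dsumP => i; apply/funext => k.
exact: (e (Tagged (fun i : 'I_m => 'I_(p i)) k)).
Qed.

Lemma comp_glue f : comp (glue f) =1 f.
Proof. by case. Qed.

Lemma compP (c : R[i]) u v a : comp (c *: u + v) a = c *: comp u a + comp v a.
Proof. by []. Qed.

Lemma comp_sub u v a : comp (u - v) a = comp u a - comp v a.
Proof. by []. Qed.

Lemma dotE u v : dot u v = \sum_a L2_dot (comp u a) (comp v a).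
Proof.
rewrite -(sig_big_dep (J := fun i : 'I_m => 'I_(p i)) xpredT (fun _ _ => true)
  (fun i k => L2_dot ((u i : 'I_(p i) -> L2 R) k) ((v i : 'I_(p i) -> L2 R) k))).
by [].
Qed.

Lemma sqnE u : sqnorm (@dot R HH) u = \sum_a sqnorm (@L2_dot R) (comp u a).
Proof. by rewrite /sqnorm dotE Re_sum. Qed.

Lemma dsum_semi_inner : semi_inner (@dot R HH).
Proof.
have hd := @L2_semi_inner R.
split=> [c u v w|u v|u].
- rewrite !dotE mulr_sumr -big_split /=; apply: eq_bigr => a _.
  by rewrite compP (dotP hd).
- rewrite !dotE rmorph_sum /=; apply: eq_bigr => a _; exact: (dotC hd).
- by rewrite sqnE sumr_ge0// => a _; exact: (sqnorm_ge0 hd).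
Qed.

Lemma dsum_dot_eq0 u : sqnorm (@dot R HH) u = 0 -> u = 0.
Proof.
rewrite sqnE => /eqP; rewrite psumr_eq0; last by move=> a _; exact: (sqnorm_ge0 (@L2_semi_inner R)).
move=> /allP h; apply: comp_inj => a.
have /eqP/L2_dot_eq0 -> := h a (mem_index_enum _).
by [].
Qed.

Let T := @opU R HH.
Let S := @opPi R HH (@cval R).

Lemma comp_opU u a : comp (T u) a = alphaA a *: U0 N (comp u (succA a)).
Proof. by case: a. Qed.

Definition opUi u : HH := glue (fun a => ((alphaA (predA a))^*)%C *: dil N (comp u (predA a))).

Lemma alphaA_conj a : alphaA a * ((alphaA a)^*)%C = 1.
Proof. by have := nsq_conjM (alphaA a); rewrite NconjE alphaA_unit. Qed.

Lemma dilZ c (f : L2 R) : dil N (c *: f) = c *: dil N f.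
Proof.
have Nr0 : (N%:R : R) != 0 by rewrite pnatr_eq0 -lt0n.
have d0 : dil N (0 : L2 R) = 0.
  by have := affL2P (sqrtN N) 0 Nr0 (-1) 0 0; rewrite !scaleN1r addr0 oppr0 addNr.
by rewrite -[c *: f]addr0 /dil affL2P// -/(dil N 0) d0 addr0.
Qed.

Lemma U0Z c (f : L2 R) : U0 N (c *: f) = c *: U0 N f.
Proof. by rewrite -[c *: f]addr0 U0P// U00// addr0. Qed.

Lemma opUK : cancel T opUi.
Proof.
move=> u; apply: comp_inj => a; rewrite comp_glue comp_opU predAK dilZ scalerA.
by rewrite mulrC alphaA_conj scale1r U0K.
Qed.

Lemma opUiK : cancel opUi T.
Proof.
move=> u; apply: comp_inj => a; rewrite comp_opU comp_glue succAK U0Z scalerA.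
by rewrite alphaA_conj scale1r dilK.
Qed.

Lemma op_inv_opU : op_inv T = opUi.
Proof. exact: op_invK opUK opUiK. Qed.

Lemma dot_opU u v : dot (T u) (T v) = dot u v.
Proof.
have hd := @L2_semi_inner R.
rewrite !dotE [RHS](reindex succA); last by exists predA => a _; rewrite ?succAK ?predAK.
apply: eq_bigr => a _; rewrite !comp_opU (dotZl hd) (dotZr hd) dot_U0//.
by rewrite mulrA NconjE alphaA_conj mul1r.
Qed.

Lemma unroll_shift (f : circle R -> R[i]) (a : A) x :
  unroll (fun w => f (z (tagged a) * w)%g) x = unroll f (x + thetaA a).
Proof.
by rewrite /unroll z_theta ?ltn_ord// -cisD_circle opprD addrC.
Qed.

Lemma cmeas_unroll_shift (f : circle R -> R[i]) (a : A) : cmeas (unroll f : MR -> R[i]) ->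
  cmeas (unroll (fun w => f (z (tagged a) * w)%g) : MR -> R[i]).
Proof.
move=> mf; have := cmeas_affine 1 (thetaA a) mf; congr cmeas; apply/funext => x.
by rewrite unroll_shift mul1r.
Qed.

Lemma cmeas_unroll_cval : cmeas (unroll (@cval R) : MR -> R[i]).
Proof.
have := @cmeas_cisN R 1; congr cmeas; apply/funext => x.
by rewrite mul1r.
Qed.

Lemma cmeas_unroll_cvalJ : cmeas (unroll (fun w : circle R => ((cval w)^*)%C) : MR -> R[i]).
Proof. exact: cmeasJ cmeas_unroll_cval. Qed.

Lemma comp_opPi f u a : comp (opPi f u) a = pi0 (fun w => f (z (tagged a) * w)%g) (comp u a).
Proof. by case: a. Qed.

Lemma cval_conj (w : circle R) : cval w * ((cval w)^*)%C = 1.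
Proof. by have := nsq_conjM (cval w); rewrite NconjE nsq_circle. Qed.

Let Si := @opPi R HH (fun w : circle R => ((cval w)^*)%C).

Lemma opPi_cvalK : cancel S Si.
Proof.
move=> u; apply: comp_inj => a; rewrite !comp_opPi; apply: pi0_unimodK.
- exact: (cmeas_unroll_shift a cmeas_unroll_cvalJ).
- exact: (cmeas_unroll_shift a cmeas_unroll_cval).
- by move=> w; rewrite mulrC cval_conj.
- by move=> w; rewrite nsq_circle.
Qed.

Lemma opPi_cvalJK : cancel Si S.
Proof.
move=> u; apply: comp_inj => a; rewrite !comp_opPi; apply: pi0_unimodK.
- exact: (cmeas_unroll_shift a cmeas_unroll_cval).
- exact: (cmeas_unroll_shift a cmeas_unroll_cvalJ).
- by move=> w; rewrite cval_conj.
- by move=> w; rewrite nsqJ nsq_circle.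
Qed.

Lemma op_inv_opPi : op_inv S = Si.
Proof. exact: op_invK opPi_cvalK opPi_cvalJK. Qed.

(** Genuine functions instead of classes, so that identities of the multiresolution part, which hold
    at every point, can be used. *)
Definition rep u (g : A -> MR -> R[i]) : Prop :=
  forall a, {ae mu, forall x, fourier (comp u a) x = g a x}.

Lemma rep_opU u g : rep u g -> rep (T u) (Uh N succA alphaA g).
Proof.
move=> ug a; rewrite comp_opU fourierZ fourier_U0// /dil.
have Nr0 : (N%:R : R) != 0 by rewrite pnatr_eq0 -lt0n.
have k (x : R) (y1 y2 y3 : R[i]) : y1 = alphaA a * y2 /\ y2 = sqrtN N * y3 ->
    y3 = g (succA a) (N%:R * x + 0) -> y1 = Uh N succA alphaA g a x.
  by move=> [-> ->] ->; rewrite /Uh addr0 mulrA.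
apply: aeS2 (aeI (L2_scaleE (alphaA a) _) (affL2E (sqrtN N) 0 Nr0 (fourier (comp u (succA a)))))
  (ae_affine 0 Nr0 (ug (succA a))) => x.
exact: k.
Qed.

Lemma fourier_dil (f : L2 R) : fourier (dil N f) = U0 N (fourier f).
Proof.
by apply: (can_inj (dilK N0)); rewrite -fourier_U0// dilK// U0K.
Qed.

Lemma rep_opUi u g : rep u g -> rep (opUi u) (Uhi N predA alphaA g).
Proof.
move=> ug a; rewrite comp_glue fourierZ fourier_dil U0_affL2.
have Ni0 : (N%:R^-1 : R) != 0 by rewrite invr_eq0 pnatr_eq0 -lt0n.
have k (x : R) (y1 y2 y3 : R[i]) : y1 = ((alphaA (predA a))^*)%C * y2 /\ y2 = (sqrtN N)^-1 * y3 ->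
    y3 = g (predA a) (N%:R^-1 * x + 0) -> y1 = Uhi N predA alphaA g a x.
  by move=> [-> ->] ->; rewrite /Uhi addr0 mulrA.
apply: aeS2 (aeI (L2_scaleE _ _) (affL2E (sqrtN N)^-1 0 Ni0 (fourier (comp u (predA a)))))
  (ae_affine 0 Ni0 (ug (predA a))) => x.
exact: k.
Qed.

Lemma rep_powU u g j : rep u g -> rep (op_pow T j u) (Uz N succA predA alphaA j g).
Proof.
move=> ug; case: j => n; rewrite /op_pow /Uz ?op_inv_opU.
  by elim: n => [//|n IH]; rewrite !iterS; exact: rep_opU.
by elim: n => [|n IH]; [exact: rep_opUi|rewrite iterS [iter _ (Uhi _ _ _) _]iterS; exact: rep_opUi].
Qed.

Lemma rep_opPi f u g (h : A -> MR -> R[i]) : cmeas (unroll f : MR -> R[i]) -> rep u g ->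
  (forall a, sqi mu (h a)) ->
  (forall a, {ae mu, forall x, unroll f (x + thetaA a) * g a x = h a x}) -> rep (opPi f u) h.
Proof.
move=> mf ug sh gh a; rewrite comp_opPi.
apply: fourier_pi0 => //; first exact: (cmeas_unroll_shift a mf).
by apply: aeS2 (ug a) (gh a) => x e1 e2; rewrite unroll_shift -e2 -e1.
Qed.

(** With the convention z = e^{-it}, each factor Pi(z) multiplies by e^{-i(x + theta_a)}. Negative
    powers use that conjugation inverts it. *)
Lemma rep_powPi u g (k : int) : rep u g -> (forall a, sqi mu (g a)) ->
  rep (op_pow S k u) (fun a x => cval (cis (- (k%:~R * (x + thetaA a)))) * g a x).
Proof.
move=> ug sg; have sc (l : int) a : sqi mu (fun x : MR => cval (cis (- (l%:~R * (x + thetaA a)))) * g a x).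
  apply: (sqiM_bounded (B := 1)) => //; first exact: cmeas_cis_shift.
  by move=> x; rewrite nsq_circle.
have z0 : rep u (fun a x => cval (cis (- ((0 : int)%:~R * (x + thetaA a)))) * g a x).
  by move=> a; apply: aeS (ug a) => x ->; rewrite mul0r oppr0 cis0 mul1r.
have mulc (l1 l2 : int) (y t : R) : y = l1%:~R + l2%:~R ->
    cval (cis (- (l1%:~R * t))) * cval (cis (- (l2%:~R * t))) = cval (cis (- (y * t))).
  by move=> ->; rewrite -cisD -opprD mulrDl.
have sU v (l : int) : rep v (fun a x => cval (cis (- (l%:~R * (x + thetaA a)))) * g a x) ->
    rep (S v) (fun a x => cval (cis (- ((l + 1)%:~R * (x + thetaA a)))) * g a x).
  move=> vg; have e a x : unroll (@cval R) (x + thetaA a) *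
      (cval (cis (- (l%:~R * (x + thetaA a)))) * g a x) =
      cval (cis (- ((l + 1)%:~R * (x + thetaA a)))) * g a x.
    rewrite mulrA; congr (_ * _); rewrite /unroll.
    have := mulc 1 l (l + 1)%:~R (x + thetaA a); rewrite mul1r; apply.
    by rewrite rmorphD /= addrC.
  by apply: (rep_opPi cmeas_unroll_cval vg (sc _)) => a; apply: aeT.
have sD v (l : int) : rep v (fun a x => cval (cis (- (l%:~R * (x + thetaA a)))) * g a x) ->
    rep (Si v) (fun a x => cval (cis (- ((l - 1)%:~R * (x + thetaA a)))) * g a x).
  move=> vg; have e a x : unroll (fun w : circle R => ((cval w)^*)%C) (x + thetaA a) *
      (cval (cis (- (l%:~R * (x + thetaA a)))) * g a x) =
      cval (cis (- ((l - 1)%:~R * (x + thetaA a)))) * g a x.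
    rewrite mulrA; congr (_ * _); rewrite /unroll -cisN opprK.
    have := mulc (-1) l (l - 1)%:~R (x + thetaA a); rewrite mulN1r opprK; apply.
    by rewrite rmorphB /= rmorphN1 addrC.
  by apply: (rep_opPi cmeas_unroll_cvalJ vg (sc _)) => a; apply: aeT.
case: k => n; rewrite /op_pow ?op_inv_opPi.
  elim: n => [//|n IH]; have := sU _ _ IH.
  by have -> : n%:Z + 1 = n.+1%:Z by rewrite -addn1 PoszD.
elim: n => [|n IH].
  by have := sD _ _ z0; have -> : (0 : int) - 1 = Negz 0 by [].
have := sD _ _ IH; have -> : Negz n - 1 = Negz n.+1; last by [].
by rewrite !NegzE -[in RHS]addn1 PoszD opprD.
Qed.

Lemma dot_rep u v g h : rep u g -> rep v h -> (forall a, cmeas (g a)) -> (forall a, cmeas (h a)) ->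
  dot u v = (tau^-1)%:C * \sum_a cint mu (fun x : MR => g a x * ((h a x)^*)%C).
Proof.
move=> ug vh mg mh; rewrite dotE mulr_sumr; apply: eq_bigr => a _.
have := L2_dot_ae (mg a) (mh a) (ug a) (vh a); rewrite dot_fourier => e.
have -> : cint mu (fun x : MR => g a x * ((h a x)^*)%C) = tau%:C * L2_dot (comp u a) (comp v a).
  by rewrite e; apply: eq_cint => x; rewrite NconjE.
by rewrite mulrA -rmorphM mulVf ?mul1r// gt_eqF// tau_gt0.
Qed.

Lemma sqn_rep u g : rep u g -> (forall a, cmeas (g a)) ->
  ((sqnorm (@dot R HH) u)%:E = (tau^-1)%:E * \sum_a nsqint mu (g a))%E.
Proof.
move=> ug mg; have t0 := @tau_gt0 R.
rewrite sqnE -sumEFin ge0_sume_distrr; last by move=> a _; exact: nsqint_ge0.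
apply: eq_bigr => a _; rewrite -(L2_sqnorm_ae (mg a) (ug a)) sqn_fourier EFinM muleA -EFinM.
by rewrite mulVf ?mul1r// gt_eqF.
Qed.

End CycleSum.

(** * The wavelet basis of the direct sum *)

Section FilterBasis.
Context {R : realType} (N : nat) (N2 : (2 <= N)%N) (p : nat -> nat).
Context (z : forall i, 'I_(p i) -> circle R) (alpha : forall i, 'I_(p i) -> R[i]).
Context (theta : forall i, 'I_(p i) -> R) (m : nat).
Local Notation mu := (@lebesgue_measure R).
Local Notation MR := (measurableTypeR R).
Local Notation tau := (2 * pi : R).
Local Notation HH := (dsum (fun i => cycle_triple N (@z i) (@alpha i)) m).
Local Notation A := {i : 'I_m & 'I_(p i)}.
Local Notation thA := (@thetaA R p theta m).
Local Notation alA := (@alphaA R p alpha m).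
Local Notation sA := (@succA p m).
Local Notation pA := (@predA p m).
Hypothesis z_theta : forall i k, (i < m)%N -> @z i k = cis (- @theta i k).
Hypothesis alpha_unit : forall i k, (i < m)%N -> nsq (@alpha i k) = 1.
Context (F : nat -> R -> R[i]).
Hypothesis F_meas : forall i, (i < N)%N -> cmeas (F i : MR -> R[i]).
Hypothesis F_le : forall i t, (i < N)%N -> nsq (F i t) <= N%:R.
Hypothesis F_per : forall i t (k : int), F i (t + k%:~R * tau) = F i t.
Hypothesis F_unitary : {ae mu, forall t : R, forall c : 'I_N -> R[i],
  \sum_(i < N) nsq (\sum_(j < N) c j * ((F i (t + j%:R * (tau / N%:R)))^*)%C) =
  N%:R * \sum_(j < N) nsq (c j)}.
Hypothesis F_norm : forall i, (i < N)%N ->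
  nsqint mu (fun t : MR => (chi tau t)%:C * F i t) = tau%:E.
Hypothesis theta_s : forall a : A, exists k : int, N%:R * thA a = thA (sA a) + k%:~R * tau.
Context (phi : A -> MR -> R[i]).
Hypothesis phi_meas : forall a, cmeas (phi a).
Hypothesis phi_le : forall a x, nsq (phi a x) <= 1.
Hypothesis phi_refine : forall a x,
  phi (sA a) (N%:R * x) = ((alA a)^*)%C * F 0%N (x + thA a) / sqrtN N * phi a x.
Context (d K : R) (d0 : 0 < d) (K0 : 0 <= K).
Hypothesis sep : forall (x y : A * int) (t : R),
  `|pos thA x t| < d -> `|pos thA y t| < d -> x = y.
Hypothesis phi_near : forall a x, 1 - 2 * K * `|x| <= nsq (phi a x).
Hypothesis phi_tile : forall t, tilesum thA (fun a x => nsq (phi a x)) t = 1%E.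
(** [ff] are the filters that enter the operators, [F] the representatives whose bounds hold at
    every point; [ff_F] ties them together. *)
Context (ff : nat -> circle R -> R[i]) (phi_m : HH).
Hypothesis ff_meas : forall i, (i < N)%N -> cmeas (unroll (ff i) : MR -> R[i]).
Hypothesis ff_F : forall i, (i < N)%N -> {ae mu, forall t, unroll (ff i) t = F i t}.
Hypothesis phi_rep : rep phi_m phi.

Let T := @opU R HH.
Let S := @opPi R HH (@cval R).
Let al1 := alphaA_unit alpha_unit.
Let phi_sqi a : sqi mu (phi a).
Proof. by apply: (sqi_tilesum (theta := thA)) => // t; rewrite phi_tile. Qed.

Definition filter_vec (i : nat) : HH := opPi (ff i) phi_m.
Definition basis_vec (x : 'I_N.-1 * int * int) : HH :=
  op_pow T x.1.2 (op_pow S x.2 (op_inv T (filter_vec x.1.1.+1))).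

Let ordN (i : 'I_N.-1) : (i.+1 < N)%N.
Proof. by have := ltn_ord i; lia. Qed.

Lemma F_shift_meas i a : (i < N)%N -> cmeas (fun x : MR => F i (x + thA a)).
Proof.
move=> iN; have := cmeas_affine 1 (thA a) (F_meas iN).
by congr cmeas; apply/funext => x; rewrite mul1r.
Qed.

Lemma sqi_F_phi i a : (i < N)%N -> sqi mu (fun x : MR => F i (x + thA a) * phi a x).
Proof.
move=> iN; apply: (sqiM_bounded (B := N%:R)) => //; first exact: F_shift_meas.
by move=> x; exact: F_le.
Qed.

Lemma rep_filter i : (i < N)%N ->
  rep (filter_vec i) (fun a x => F i (x + thA a) * phi a x).
Proof.
move=> iN; apply: (rep_opPi z_theta (ff_meas iN) phi_rep); first by move=> a; exact: sqi_F_phi.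
move=> a; have h := ae_affine (thA a) (oner_neq0 R) (ff_F iN).
by apply: aeS h => x; rewrite mul1r => ->.
Qed.

Definition base_vec i k : HH := op_pow S k (op_inv T (filter_vec i)).

(** Applying U cancels the U^{-1} of the wavelet, and by the cycle relation for theta the frequency
    k turns into N k. *)
Lemma rep_base i k : (i < N)%N -> rep (T (base_vec i k))
  (fun a x => cval (cis (- (N%:R * k%:~R * (x + thA a)))) * (F i (x + thA a) * phi a x)).
Proof.
move=> iN; have Nr0 : (N%:R : R) != 0 by rewrite pnatr_eq0; lia.
have Ni0 : (N%:R^-1 : R) != 0 by rewrite invr_eq0.
have r1 := rep_opUi N2 (rep_filter iN).
have sU a : sqi mu (Uhi N pA alA (fun a x => F i (x + thA a) * phi a x) a).
  have := sqiZ (((alA (pA a))^*)%C / sqrtN N) (sqi_affine 0 Ni0 (sqi_F_phi (pA a) iN)).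
  by congr sqi; apply/funext => x; rewrite /Uhi addr0.
have r2 := rep_opU N2 (rep_powPi z_theta k r1 sU).
rewrite /base_vec op_inv_opU// => a; apply: aeS (r2 a) => x ->.
rewrite /Uh /Uhi succAK mulKf// (cis_theta_s theta_s).
have sn : sqrtN N != 0 :> R[i] by apply: sqrtN_neq0; lia.
have aa := alphaA_conj alpha_unit a.
by rewrite -[RHS]mul1r -aa; field.
Qed.

Lemma dot_iter_opU n u v : dot u (iter n T v) = dot (iter n (op_inv T) u) v.
Proof.
elim: n u => [//|n IH] u.
rewrite [iter n.+1 (op_inv T) u]iterSr -IH [iter n.+1 T v]iterS.
have e w : T (op_inv T w) = w by rewrite op_inv_opU//; exact: opUiK.
by rewrite -[RHS](dot_opU N2 alpha_unit) [X in _ = dot X _]e.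
Qed.

Lemma dot_iter_opUi n u v : dot u (iter n (op_inv T) v) = dot (iter n T u) v.
Proof.
elim: n u => [//|n IH] u.
rewrite [iter n.+1 T u]iterSr -IH [iter n.+1 (op_inv T) v]iterS.
have e w : T (op_inv T w) = w by rewrite op_inv_opU//; exact: opUiK.
by rewrite -[LHS](dot_opU N2 alpha_unit) [X in dot _ X = _]e.
Qed.

Lemma dot_powU j u v : dot u (op_pow T j v) = dot (op_pow T (- j) u) v.
Proof.
case: j => [[|n]|n]; [by rewrite oppr0| |].
  by rewrite -NegzE; exact: dot_iter_opU.
by rewrite NegzE opprK; exact: dot_iter_opUi.
Qed.

(** U^j is moved to [v] as U^{-j}, and one more U is applied to both sides; hence the exponent 1 -
    j. *)
Lemma dot_basis v g B D i j k : rep v g -> 0 < D -> bounded_support B D g ->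
  dot v (basis_vec (i, j, k)) =
  (tau^-1)%:C * cf N F thA phi i.+1 k (Uz N sA pA alA (1 - j) g).
Proof.
move=> vg D0 hg; rewrite /basis_vec dot_powU -(dot_opU N2 alpha_unit).
have r1 : rep (T (op_pow T (- j) v)) (Uz N sA pA alA (1 - j) g).
  have := rep_opU N2 (rep_powU N2 alpha_unit (- j) vg).
  by rewrite (Uh_Uz N2 (@succAK p m) al1) [- j + 1]addrC.
have [B' [D' [_ hU]]] := Uz_support N2 sA pA al1 (1 - j) D0 hg.
apply: (dot_rep r1 (rep_base k (ordN i))); first by move=> a; case: (hU a).
move=> a; apply: cmeasM; first exact: cmeas_cis_shift.
by case: (sqi_F_phi a (ordN i)).
Qed.

Definition test_vec (v : HH) : Prop := exists g B D r, [/\ rep v g, 0 < D /\ 0 < r,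
  bounded_support B D g & forall a x, `|x| < r -> g a x = 0].

Lemma parseval_test v : test_vec v ->
  (\esum_(x in [set: 'I_N.-1 * int * int]) (nsq (dot v (basis_vec x)))%:E =
   (sqnorm (@dot R HH) v)%:E)%E.
Proof.
move=> [g [B [D [r [vg [D0 r0] hg gr]]]]]; have t0 := @tau_gt0 R.
rewrite (sqn_rep vg); last by move=> a; case: (hg a).
have P := parseval_coefficients N2 F_meas F_le F_per F_unitary (@succAK p m) (@predAK p m)
  theta_s al1 phi_meas phi_le phi_refine d0 K0 sep phi_near phi_sqi D0 r0 hg gr.
transitivity ((tau^-1 ^+ 2)%:E * (tau%:E * W g))%E.
  rewrite -P -esumZl ?sqr_ge0//; last by move=> x; rewrite lee_fin nsq_ge0.
  apply: eq_esum => -[[i j] k] _; rewrite (dot_basis i j k vg D0 hg) nsqM nsqR EFinM.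
  by [].
rewrite muleA -EFinM; congr (_%:E * _)%E.
by rewrite expr2 -mulrA mulVf ?mulr1// gt_eqF.
Qed.

(** On the Fourier side, cut away a neighbourhood of 0, the far region and the large values;
    dominated convergence shows that little is lost. *)
Lemma test_dense v (eps : R) : 0 < eps ->
  exists2 w, test_vec w & sqnorm (@dot R HH) (v - w) < eps.
Proof.
move=> e0; have t0 := @tau_gt0 R.
(* Setting the value at 0 to 0 makes the cut-offs converge at every point, since they all vanish
   there. *)
pose f a : MR -> R[i] := fun x => if x == 0 then 0 else fourier (comp v a) x.
have fae a : {ae mu, forall x, f a x = fourier (comp v a) x}.
  have : {ae mu, forall x : R, x != 0}.
    exists [set 0]; split; [exact: measurable_set1|exact: lebesgue_measure_set1|].
    by move=> x /= /negP/negPn/eqP.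
  by apply: aeS => x x0; rewrite /f (negPf x0).
have mf a : cmeas (f a).
  have -> : f a = fun x : MR => (1 - (\1_[set (0 : MR)] x)%:C) * fourier (comp v a) x.
    apply/funext => x; rewrite /f indicE; have [->|x0] := eqVneq x 0.
      by rewrite mem_set// subrr mul0r.
    by rewrite memNset ?subr0 ?mul1r//=; apply/eqP.
  apply: cmeasM; last exact: L2_cmeas.
  by apply: cmeasB; [exact: cmeas_cst|apply: cmeas_indic; exact: measurable_set1].
have sf a : sqi mu (f a) by apply: sqi_ae (mf a) (L2_sqi (fourier (comp v a))) (fae a).
pose good n a x := [&& n.+1%:R^-1 <= `|x|, `|x| < n.+1%:R & nsq (f a x) <= n.+1%:R].
pose g n a : MR -> R[i] := fun x => if good n a x then f a x else 0.
have mg n a : cmeas (g n a).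
  have -> : g n a = fun x : MR => (\1_([set x : MR | n.+1%:R^-1 <= `|x|] `&`
       [set x : MR | `|x| < n.+1%:R] `&` [set x : MR | nsq (f a x) <= n.+1%:R]) x)%:C * f a x.
    apply/funext => x; rewrite /g /good indicE.
    case: ifPn => [/and3P[h1 h2 h3]|h]; first by rewrite mem_set ?mul1r.
    rewrite memNset ?mul0r// => -[[h1 h2] h3]; move/negP: h; apply; exact/and3P.
  apply: cmeasM => //; apply: cmeas_indic; apply: measurableI; first apply: measurableI.
  - by rewrite -[X in measurable X]setTI; apply: measurable_fun_le.
  - rewrite (_ : mkset _ = ~` [set x : MR | n.+1%:R <= `|x|]).
      by apply: measurableC; rewrite -[X in measurable X]setTI; apply: measurable_fun_le.
    by apply/seteqP; split=> x /=; rewrite ltNge => /negP.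
  - rewrite -[X in measurable X]setTI; apply: measurable_fun_le => //.
    exact: measurable_nsq.
have cv a : nsqint mu (fun x => g n a x - f a x) @[n --> \oo] --> 0%E.
  apply: (nsqint_dominated (g := f a)) => //.
  - by move=> n x; rewrite /g; case: ifP; rewrite // nsq0 nsq_ge0.
  - move=> x; apply: (@cvg_near_cst _ R^o).
    have [x0|x0] := eqVneq x 0.
      by near=> n; rewrite /g /f x0 eqxx if_same subrr nsq0.
    have nx : 0 < `|x| by rewrite normr_gt0.
    near=> n; rewrite /g ifT ?subrr ?nsq0// /good; apply/and3P; split.
    + rewrite invf_ple ?posrE//; apply: le_trans (_ : n%:R <= _); last by rewrite ler_nat.
      by near: n; exact: nbhs_infty_ger.
    + apply: (@le_lt_trans _ _ n%:R); last by rewrite ltr_nat.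
      by near: n; exact: nbhs_infty_ger.
    + apply: le_trans (_ : n%:R <= _); last by rewrite ler_nat.
      by near: n; exact: nbhs_infty_ger.
(* The successor avoids division by zero and leaves the total strictly below [eps]. *)
pose M := #|{: A}|.+1; have eM : 0 < tau * eps / M%:R by rewrite divr_gt0// mulr_gt0.
have hN a : exists n0, forall n, (n0 <= n)%N ->
    (nsqint mu (fun x => g n a x - f a x)%R < (tau * eps / M%:R)%:E)%E.
  by have [n0 h] := cvge0_lt (cv a) eM; exists n0.
pose n0 := (\max_a projT1 (cid (hN a)))%N.
have hn0 a := projT2 (cid (hN a)) n0 (leq_bigmax a).
pose w : HH := @glue R N p z alpha m (fun a => op_inv (@fourier R) (to_L2 (g n0 a))).
have sg a : sqi mu (g n0 a).
  by apply: sqi_le (mg n0 a) (sf a) _ => x; rewrite /g; case: ifP; rewrite // nsq0 nsq_ge0.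
have wg : rep w (g n0).
  by move=> a; rewrite comp_glue fourier_op_invK; exact: to_L2E.
exists w.
  exists (g n0), n0.+1%:R, n0.+1%:R, n0.+1%:R^-1; split=> //.
    move=> a; split=> // x; rewrite /g; split.
      by case: ifP => [/and3P[]//|_]; rewrite nsq0.
    by move=> h; rewrite ifF// /good [_ < n0.+1%:R]ltNge h andbF.
  by move=> a x h; rewrite /g ifF// /good leNgt h.
have vw : rep (w - v) (fun a x => g n0 a x - f a x).
  move=> a; rewrite comp_sub.
  have e : fourier (comp w a - comp v a) = fourier (comp w a) - fourier (comp v a).
    have := fourier_lin (-1) (comp v a) (comp w a); rewrite !scaleN1r => h.
    by rewrite addrC h addrC.
  rewrite e; apply: L2_sub_ae; first exact: wg.
  by apply: aeS (fae a) => x ->.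
rewrite (sqnormBC (@dsum_semi_inner R N p z alpha m)) -lte_fin (sqn_rep vw); last first.
  by move=> a; apply: cmeasB.
apply: (@le_lt_trans _ _ ((tau^-1)%:E * \sum_(a : A) (tau * eps / M%:R)%:E)%E).
  apply: lee_wpmul2l; first by rewrite lee_fin invr_ge0 ltW.
  by apply: lee_sum => a _; exact: ltW (hn0 a).
rewrite sumEFin -EFinM lte_fin sumr_const -[X in _ * X < _]mulr_natl.
have -> : tau^-1 * (#|{: A}|%:R * (tau * eps / M%:R)) = eps * (#|{: A}|%:R / M%:R).
  have : (tau : R) != 0 by rewrite gt_eqF.
  by move: tau => y y0; field; rewrite y0 pnatr_eq0.
by rewrite gtr_pMr// ltr_pdivrMr// mul1r ltr_nat.
Unshelve. all: by end_near. Qed.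

Theorem basis_parseval v :
  (\esum_(x in [set: 'I_N.-1 * int * int]) (nsq (dot v (basis_vec x)))%:E =
   (sqnorm (@dot R HH) v)%:E)%E.
Proof.
apply: (parseval_dense (@dsum_semi_inner R N p z alpha m) (D := test_vec)) => [u eps|u].
  exact: test_dense.
exact: parseval_test.
Qed.

(** Unitarity reduces to the first factor, and by h = 1 the norm of m_i phi is that of m_i on a
    period, which the unit rows of the filter matrix give. *)
Lemma basis_unit x : sqnorm (@dot R HH) (basis_vec x) = 1.
Proof.
case: x => -[i j] k; have t0 := @tau_gt0 R.
have nT u : sqnorm (@dot R HH) (T u) = sqnorm (@dot R HH) u.
  by rewrite /sqnorm dot_opU.
have nTi u : sqnorm (@dot R HH) (op_inv T u) = sqnorm (@dot R HH) u.
  by rewrite -nT op_inv_opU// /T opUiK.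
have it (B : HH -> HH) : (forall u, sqnorm (@dot R HH) (B u) = sqnorm (@dot R HH) u) ->
    forall n u, sqnorm (@dot R HH) (iter n B u) = sqnorm (@dot R HH) u.
  by move=> hB; elim=> [//|n IH] u; rewrite iterS hB.
have nP u : sqnorm (@dot R HH) (op_pow T j u) = sqnorm (@dot R HH) u.
  by case: (j) => n; exact: it.
rewrite /basis_vec /= nP -nT; apply: EFin_inj.
rewrite (sqn_rep (rep_base k (ordN i))); last first.
  move=> a; apply: cmeasM; first exact: cmeas_cis_shift.
  by case: (sqi_F_phi a (ordN i)).
transitivity ((tau^-1)%:E * \sum_(a : A) nsqint mu (fun x : MR => F i.+1 (x + thA a) * phi a x)%R)%E.
  congr (_ * _)%E; apply: eq_bigr => a _; apply: eq_integral => x _.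
  by rewrite nsqM nsq_circle mul1r.
rewrite nsqint_tilesum1//; last exact: F_meas.
by rewrite F_norm// -EFinM mulVf// gt_eqF.
Qed.

Theorem basis_orthonormal : orthonormal_basis (@dot R HH) basis_vec.
Proof.
apply: (parseval_orthonormal_basis (@dsum_semi_inner R N p z alpha m)).
  exact: basis_parseval.
exact: basis_unit.
Qed.

End FilterBasis.

(** * Lipschitz bound, mask identity and bounded filters *)

Section MaskFacts.
Context {R : realType} (N : nat) (N2 : (2 <= N)%N).
Local Notation mu := (@lebesgue_measure R).
Local Notation MR := (measurableTypeR R).
Local Notation tau := (2 * pi : R).

Let N0 : (0 < N)%N. Proof. exact: ltnW. Qed.
Let Ngt0 : 0 < N%:R :> R. Proof. by rewrite ltr0n. Qed.

Lemma mvt_bound (f df : R -> R) : (forall x : R, is_derive x (1 : R) f (df x)) ->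
  (forall x, `|df x| <= 1) -> forall t u, `|f t - f u| <= `|t - u|.
Proof.
move=> fd d1 t u; wlog tu : t u / t <= u.
  by move=> h; have [/h//|/ltW/h] := leP t u; rewrite distrC [X in _ <= X]distrC.
move: tu; rewrite le_eqVlt => /predU1P[->|tu]; first by rewrite !subrr.
have [|c _] := MVT tu (fun x _ => fd x).
  apply: derivable_within_continuous => x _.
  by apply: ex_derive; exact: fd.
rewrite [X in X <= _]distrC [X in _ <= X]distrC => ->.
by rewrite normrM ler_piMl.
Qed.

Lemma cis_lip (t u : R) : cabs (cval (cis (- t)) - cval (cis (- u))) <= 2 * `|t - u|.
Proof.
apply: le_trans (cabs_le_ReIm _) _; rewrite mulr_natl mulr2n !ReD !ImD !ReN !ImN.
have e : `|t - u| = `|- t - - u| by rewrite -opprD normrN.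
rewrite e; apply: lerD.
  apply: (@mvt_bound cos (fun x => - sin x)) => x.
  by rewrite normrN ler_norml sin_le1 sin_geN1.
apply: (@mvt_bound sin cos) => x.
by rewrite ler_norml cos_le1 cos_geN1.
Qed.

(** The constant [L] is complex; the order of [R[i]] passes to real parts. The 2 is one mean value
    bound for cos and one for sin. *)
Lemma lipschitz_unroll (f : circle R -> R[i]) : lipschitz_circle f ->
  exists2 K : R, 0 <= K & forall t u, cabs (unroll f t - unroll f u) <= K * `|t - u|.
Proof.
move=> [L hL]; exists (2 * `|complex.Re L|) => [|t u]; first by rewrite mulr_ge0.
have := hL (cis (- t)) (cis (- u)); rewrite !cabsE lecE => /andP[_].
rewrite [complex.Re _]/= mulrC cReRM => h; apply: le_trans h _.
apply: le_trans (ler_wpM2l (cabs_ge0 _) (ler_norm _)) _.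
by rewrite [leRHS]mulrAC ler_wpM2r ?normr_ge0 ?cis_lip.
Qed.

Lemma fsbig_finType (I : finType) (V : nmodType) (f : I -> V) :
  \sum_(i \in [set: I]) f i = \sum_i f i.
Proof.
have -> : [set: I] = [set` index_enum I].
  by apply/seteqP; split=> // i _ /=; rewrite mem_index_enum.
by rewrite -fsbig_seq// index_enum_uniq.
Qed.

(** The N-th roots of e^{-it} are enumerated by r |-> e^{-i(t + 2 pi r)/N}, which turns the sum over
    a set into one over an ordinal. *)
Lemma transfer_qmf (m0 : circle R -> R[i]) : transfer N m0 (fun=> 1) = (fun=> 1) ->
  forall t : R, \sum_(r < N) nsq (unroll m0 ((t + r%:R * tau) / N%:R)) = N%:R.
Proof.
move=> h t; have := congr1 (fun g => g (cis (- t))) h; rewrite /transfer.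
pose e (r : 'I_N) := cis (- ((t + r%:R * tau) / N%:R)).
have eb : set_bij [set: 'I_N] [set w : circle R | (w ^+ N)%g = cis (- t)] e.
  split.
  - move=> r _ /=; rewrite /e cis_circleX mulrN mulrC mulfVK ?gt_eqF//.
    by rewrite pmulrn opprD -mulNr -mulrNz cis_2pi.
  - by move=> r r' _ _; exact: root_cis_inj.
  - by move=> w /= /(root_cis N2)[r ->]; exists r.
rewrite (reindex_fsbig _ _ _ _ eb) fsbig_finType.
under eq_bigr do rewrite mulr1 -nsqE.
rewrite -rmorph_sum /= => /(congr1 (fun y => N%:R * y)).
rewrite mulr1 mulVKf; last by rewrite pnatr_eq0 -lt0n.
by rewrite -(rmorph_nat (real_complex R)) => -[].
Qed.

(** A square matrix with X X^* = 1 also satisfies X^* X = 1, so the isometry holds on the side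
    needed here; the diagonal of X X^* gives the unit rows. *)
Lemma unitary_isometry (n : nat) (X : 'M[R[i]]_n) : X \is unitarymx ->
  (forall c : 'I_n -> R[i], \sum_i nsq (\sum_j c j * ((X i j)^*)%C) = \sum_j nsq (c j)) /\
  (forall i, \sum_j nsq (X i j) = 1).
Proof.
move=> /unitarymxP XX; have XX' := mulmx1C XX; split=> [c|i].
  pose v : 'rV[R[i]]_n := \row_j c j.
  have vX : v *m (map_mx Num.conj (X^T)) *m X = v by rewrite -mulmxA XX' mulmx1.
  have H (w : 'rV[R[i]]_n) : (w *m (map_mx Num.conj (w^T))) 0 0 = (\sum_j nsq (w 0 j))%:C.
    rewrite mxE rmorph_sum; apply: eq_bigr => j _; rewrite !mxE.
    by rewrite nsq_conjM.
  have eX : map_mx Num.conj ((map_mx Num.conj (X^T))^T) = X.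
    by apply/matrixP => i j; rewrite !mxE !NconjE conjcK.
  have := H (v *m (map_mx Num.conj (X^T))); rewrite trmx_mul map_mxM eX.
  rewrite mulmxA vX H => -[e]; rewrite -[RHS](_ : \sum_j nsq (v 0 j) = _).
    rewrite e; apply: eq_bigr => i _; rewrite !mxE; congr nsq; apply: eq_bigr => j _.
    by rewrite !mxE NconjE.
  by apply: eq_bigr => j _; rewrite mxE.
have := congr1 (fun Y : 'M[R[i]]_n => Y i i) XX; rewrite !mxE eqxx => h.
have : (\sum_j nsq (X i j))%:C = 1 :> R[i].
  rewrite -[RHS]h rmorph_sum; apply: eq_bigr => j _; rewrite !mxE.
  by rewrite nsq_conjM.
by move=> [].
Qed.

Lemma Linf_cmeas (f : circle R -> R[i]) : Linf_circle f -> cmeas (unroll f : MR -> R[i]).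
Proof.
rewrite /Linf_circle /= inE => /andP[/andP[h1 _] /andP[h2 _]].
by move: h1 h2; rewrite !inE.
Qed.

Section BoundedFilters.
Context (mf : nat -> circle R -> R[i]).
Hypothesis mf_meas : forall i, (i < N)%N -> cmeas (unroll (mf i) : MR -> R[i]).
Hypothesis mf_unitary : {ae mu, forall t,
    (\matrix_(i < N, j < N)
       ((sqrtN N)^-1 * mf i (cis (2 * pi / N%:R) ^+ j * cis (- t))%g)) \is unitarymx}.

(* Almost everywhere equal to the filter, since the entries of a unitary matrix have
   modulus at most one; the truncation makes the bound hold at every point. *)
Definition bounded_filter (i : nat) (t : R) : R[i] :=
  if nsq (unroll (mf i) t) <= N%:R then unroll (mf i) t else 0.

Let c := tau / N%:R.
Let Nc : N%:R * c = tau. Proof. by rewrite mulrC mulfVK ?gt_eqF. Qed.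

(** Multiplying e^{-it} by rho^j lowers the angle to t - 2 pi j / N, hence the minus signs. At these
    points the truncation changes nothing; the last clause is the column j = 0. *)
Lemma unitary_points : {ae mu, forall t : R,
  (forall d : 'I_N -> R[i], \sum_(i < N) nsq (\sum_(j < N) d j * ((bounded_filter i (t - j%:R * c))^*)%C)
     = N%:R * \sum_(j < N) nsq (d j)) /\
  (forall i : 'I_N, \sum_(j < N) nsq (bounded_filter i (t - j%:R * c)) = N%:R) /\
  (forall i : 'I_N, bounded_filter i t = unroll (mf i) t)}.
Proof.
apply: aeS mf_unitary => t; set X := \matrix_(i, j) _ => /unitary_isometry[h1 h2].
have XE (i j : 'I_N) : X i j = (sqrtN N)^-1 * unroll (mf i) (t - j%:R * c).
  rewrite mxE /unroll; congr (_ * mf i _).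
  rewrite cis_circleX -cisD_circle; congr cis; rewrite /c; ring.
have le1 (i j : 'I_N) : nsq (X i j) <= 1.
  by rewrite -(h2 i) (bigD1 j)//= lerDl sumr_ge0// => l _; exact: nsq_ge0.
have bE (i j : 'I_N) : bounded_filter i (t - j%:R * c) = unroll (mf i) (t - j%:R * c).
  rewrite /bounded_filter ifT//; have := le1 i j.
  by rewrite XE nsqM nsqV nsq_sqrtN mulrC ler_pdivrMr// mul1r.
have bX (i j : 'I_N) : bounded_filter i (t - j%:R * c) = sqrtN N * X i j.
  by rewrite bE XE mulVKf//; exact: sqrtN_neq0.
split; last split.
- move=> d; rewrite -(h1 d) mulr_sumr; apply: eq_bigr => i _.
  rewrite -nsq_sqrtN -nsqM mulr_sumr; congr nsq; apply: eq_bigr => j _.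
  by rewrite bX conjCM conjCR; ring.
- move=> i; transitivity (N%:R * \sum_j nsq (X i j)); last by rewrite h2 mulr1.
  rewrite mulr_sumr; apply: eq_bigr => j _.
  by rewrite bX nsqM nsq_sqrtN.
- move=> i; have := bE i (Ordinal N0); by rewrite mul0r subr0.
Qed.

Lemma bounded_filter_per i t (k : int) : bounded_filter i (t + k%:~R * tau) = bounded_filter i t.
Proof. by rewrite /bounded_filter unroll_periodic. Qed.

Lemma bounded_filter_le i t : nsq (bounded_filter i t) <= N%:R.
Proof. by rewrite /bounded_filter; case: ifP => // _; rewrite nsq0. Qed.

Lemma cmeas_bounded_filter i : (i < N)%N -> cmeas (bounded_filter i : MR -> R[i]).
Proof.
move=> iN; have -> : bounded_filter i = fun t : MR =>
    (\1_[set t : MR | nsq (unroll (mf i) t) <= N%:R] t)%:C * unroll (mf i) t.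
  apply/funext => t; rewrite /bounded_filter indicE; case: ifPn => h.
    by rewrite mem_set ?mul1r.
  by rewrite memNset ?mul0r//=; exact/negP.
apply: cmeasM; last exact: mf_meas.
apply: cmeas_indic; rewrite -[X in measurable X]setTI; apply: measurable_fun_le => //.
by apply: measurable_nsq; exact: mf_meas.
Qed.

(** Negation modulo [N], which by periodicity exchanges the shifts t - 2 pi j / N and t + 2 pi j /
    N. *)
Let opp_ord (j : 'I_N) : 'I_N := Ordinal (ltn_pmod (N - j) N0).

Lemma opp_ordK : involutive opp_ord.
Proof.
move=> j; apply: val_inj => /=; have := ltn_ord j; case: (posnP j) => [->|j0] jN.
  by rewrite subn0 modnn subn0 modnn.
have -> : ((N - j) %% N = N - j)%N by rewrite modn_small//; lia.
by rewrite modn_small; lia.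
Qed.

Lemma bounded_filter_opp i t (j : 'I_N) :
  bounded_filter i (t + j%:R * c) = bounded_filter i (t - (opp_ord j)%:R * c).
Proof.
rewrite /opp_ord /=; have := ltn_ord j; case: (posnP j) => [->|j0] jN.
  by rewrite subn0 modnn !mul0r addr0 subr0.
have -> : ((N - j) %% N = N - j)%N by rewrite modn_small//; lia.
rewrite natrB 1?ltnW// mulrBl Nc opprB -[LHS](bounded_filter_per _ _ (-1)).
by rewrite rmorphN1 mulN1r addrA.
Qed.

Lemma bounded_filter_unitary : {ae mu, forall t : R, forall d : 'I_N -> R[i],
  \sum_(i < N) nsq (\sum_(j < N) d j * ((bounded_filter i (t + j%:R * (tau / N%:R)))^*)%C) =
  N%:R * \sum_(j < N) nsq (d j)}.
Proof.
have oi := can_inj opp_ordK.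
apply: aeS unitary_points => t [h _] d.
rewrite [in RHS](reindex_inj oi) -(h (d \o opp_ord)); apply: eq_bigr => i _; congr nsq.
rewrite [RHS](reindex_inj oi); apply: eq_bigr => j _ /=.
by rewrite opp_ordK bounded_filter_opp.
Qed.

(** The N tiles of the period, folded together, give the squared norm of one row of the filter
    matrix, which is constant. *)
Lemma bounded_filter_norm i : (i < N)%N ->
  nsqint mu (fun t : MR => (chi tau t)%:C * bounded_filter i t) = tau%:E.
Proof.
move=> iN; have c0 : 0 < c by rewrite divr_gt0// tau_gt0.
have mG := cmeas_bounded_filter iN.
have := nsqint_tile N c0 mG; rewrite Nc => ->.
have mj (j : 'I_N) : cmeas (fun t : MR => (chi c t)%:C * bounded_filter i (t + j%:R * c)).
  apply: cmeas_chi; have := cmeas_affine 1 (j%:R * c) mG.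
  by congr cmeas; apply/funext => x; rewrite mul1r.
rewrite -ge0_integral_sum//; last 2 first.
- by move=> j; exact: (measurable_EFin_nsq (mj j)).
- by move=> j x _; rewrite lee_fin nsq_ge0.
transitivity (\int[mu]_t (N%:R%:E * (nsq ((chi c t)%:C))%:E))%E.
  apply: ae_eq_integral => //.
  - by apply: emeasurable_fun_sum => j; exact: (measurable_EFin_nsq (mj j)).
  - apply: measurable_funeM; apply: measurable_EFin_nsq; apply: cmeas_real.
    exact: measurable_chi.
  apply: aeS unitary_points => t [_ [h _]] _; rewrite sumEFin -EFinM; congr EFin.
  under eq_bigr do rewrite nsq_chi.
  rewrite -mulr_sumr nsqR expr2 chi_sqr mulrC; congr (_ * _).
  rewrite -(h (Ordinal iN)) [RHS](reindex_inj (can_inj opp_ordK)).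
  by apply: eq_bigr => j _; rewrite bounded_filter_opp.
rewrite ge0_integralZl_EFin//; last 2 first.
- by move=> x _; rewrite lee_fin nsq_ge0.
- by apply: measurable_EFin_nsq; apply: cmeas_real; exact: measurable_chi.
rewrite -/(nsqint mu (fun t : MR => (chi c t)%:C)) nsqint_chi; last exact: ltW.
by rewrite -EFinM Nc.
Qed.

Lemma bounded_filter_ae i : (i < N)%N -> {ae mu, forall t, unroll (mf i) t = bounded_filter i t}.
Proof. by move=> iN; apply: aeS unitary_points => t [_ [_ h]]; rewrite (h (Ordinal iN)). Qed.

End BoundedFilters.

End MaskFacts.

(** * Inclusion of the first summands and its orthogonal projection *)

Section Truncation.
Context {R : realType} (T : nat -> triple R) (n m : nat) (nm : (n <= m)%N).
Local Notation HH := (dsum T m).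
Local Notation H := (dsum T n).
Local Notation incl := (@dsum_incl R T n m).

(** Left inverse and adjoint of the inclusion; the projection is [incl] after [restr], and [restr]
    is what intertwines the operators. *)
Definition restr (v : HH) : H := fun i : 'I_n => v (widen_ord nm i).

Lemma incl_widen (u : H) (i : 'I_n) : incl u (widen_ord nm i) = u i.
Proof.
case: i => i hi; rewrite /dsum_incl; case: {-}_ / boolP => [h|]; last by rewrite /= hi.
by rewrite (bool_irrelevance h hi).
Qed.

Lemma incl_out (u : H) (i : 'I_m) : ~~ (i < n)%N -> incl u i = 0.
Proof. by rewrite /dsum_incl; case: {-}_ / boolP => // h; rewrite h. Qed.

Lemma restr_incl u : restr (incl u) = u.
Proof. by apply: dsumP => i; exact: incl_widen. Qed.

Lemma dot_incl (hd : forall i, semi_inner (@dot R (T i))) u (v : HH) :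
  dot (incl u) v = dot u (restr v).
Proof.
rewrite [LHS]/dot /= (bigID (fun i : 'I_m => (i < n)%N)) /= [X in _ + X]big1 ?addr0.
  rewrite (big_ord_narrow nm); apply: eq_bigr => i _.
  by rewrite incl_widen.
by move=> i hi; rewrite incl_out// (dot0l (hd i)).
Qed.

Lemma incl_morph (f : forall i, T i -> T i) u : (forall i, f i 0 = 0) ->
  (fun i : 'I_m => f i (incl u i)) = incl (fun i : 'I_n => f i (u i)) :> dsum T m.
Proof.
move=> f0; apply: dsumP => i; have [h|h] := boolP (i < n)%N; last by rewrite !incl_out.
have -> : i = widen_ord nm (Ordinal h) by apply: val_inj.
by rewrite !incl_widen.
Qed.

Lemma restr_sub (v w : HH) : restr (v - w) = restr v - restr w.
Proof. by []. Qed.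

Lemma incl_sub (u w : H) : incl (u - w) = incl u - incl w.
Proof.
apply: dsumP => i; have -> : (incl u - incl w) i = incl u i - incl w i by [].
have [h|h] := boolP (i < n)%N; last by rewrite !incl_out// subrr.
have -> : i = widen_ord nm (Ordinal h) by apply: val_inj.
by rewrite !incl_widen.
Qed.

Section Projection.
Hypothesis hd : forall i, semi_inner (@dot R (T i)).
Hypothesis hH : semi_inner (@dot R H).
Hypothesis hHH : semi_inner (@dot R HH).
Hypothesis dot_definite : forall u : H, sqnorm (@dot R H) u = 0 -> u = 0.

(** [orth_proj] is a chosen vector. Two vectors meeting its condition differ by an element of the
    range orthogonal to itself, so definiteness identifies the choice. *)
Lemma orth_proj_incl v : orth_proj (@dot R HH) (range incl) v = incl (restr v).
Proof.
have good s : range incl s -> dot (v - incl (restr v)) s = 0.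
  move=> [u _ <-]; rewrite (dotC hHH) (dot_incl hd) restr_sub restr_incl subrr.
  by rewrite (dotC hH 0 u) (dot0l hH) !rmorph0.
rewrite /orth_proj; case: xgetP => [h _ [[u _ <-] oh]|no]; last first.
  by case: (no (incl (restr v))); split; [exists (restr v)|exact: good].
have ux : range incl (incl (u - restr v)) by exists (u - restr v).
have e : incl (u - restr v) = (v - incl (restr v)) - (v - incl u) :> HH.
  by rewrite incl_sub opprB [RHS]addrC addrA subrK.
have : dot (incl (u - restr v)) (incl (u - restr v)) = 0.
  by rewrite {1}e (dotBl hHH) (good _ ux) (oh _ ux) subrr.
rewrite (dot_incl hd) restr_incl => h0; congr incl; apply/eqP; rewrite -subr_eq0; apply/eqP.
by apply: dot_definite; rewrite /sqnorm h0.
Qed.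

Lemma restr_op_inv (f g : HH -> HH) (f' g' : H -> H) : cancel f g -> cancel g f ->
  cancel f' g' -> cancel g' f' -> (forall v, restr (f v) = f' (restr v)) ->
  forall v, restr (op_inv f v) = op_inv f' (restr v).
Proof.
move=> fg gf fg' gf' e v; rewrite (op_invK fg gf) (op_invK fg' gf').
by rewrite -{2}(gf v) e fg'.
Qed.

Lemma restr_op_pow (f : HH -> HH) (f' : H -> H) j : (forall v, restr (f v) = f' (restr v)) ->
  (forall v, restr (op_inv f v) = op_inv f' (restr v)) ->
  forall v, restr (op_pow f j v) = op_pow f' j (restr v).
Proof.
move=> e ei v; have it (h : HH -> HH) (h' : H -> H) k : (forall v, restr (h v) = h' (restr v)) ->
    restr (iter k h v) = iter k h' (restr v).
  by move=> eh; elim: k => [//|k IH]; rewrite !iterS eh IH.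
by case: j => k; exact: it.
Qed.

End Projection.

End Truncation.

Section PhiHat.
Context {R : realType} (N : nat) (m0 : circle R -> R[i]).
Local Notation M := (unroll m0).
Local Notation tau := (2 * pi : R).

Lemma complex_cvg (a : nat -> R[i]) (l : R[i]) :
  (fun k => complex.Re (a k)) @ \oo --> complex.Re l ->
  (fun k => complex.Im (a k)) @ \oo --> complex.Im l ->
  (a : nat -> R[i]^o) @ \oo --> (l : R[i]^o).
Proof.
move=> h1 h2; apply/cvgrPdist_lt => e e0.
have [er er0 eE] : exists2 er : R, 0 < er & e = er%:C.
  exists (complex.Re e); first by move: e0; rewrite ltcE => /andP[].
  by move: e0; rewrite ltcE /= => /andP[/eqP ei _]; apply: ReIm_inj.
have := nsq_cvg (c := l) h1 h2; rewrite subrr nsq0 => /cvgr0Pnorm_lt h.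
have e2 : 0 < er ^+ 2 by rewrite exprn_gt0.
have [n0 _ hn] := h _ e2; exists n0 => // k nk /=; have {}hn := hn k nk.
rewrite eE cabsE ltcR -(ltr_pXn2r (n := 2)) ?nnegrE ?cabs_ge0 ?(ltW er0)//.
by rewrite cabs_sqr; exact: le_lt_trans (ler_norm _) hn.
Qed.

(** Following predecessors in [A] visits the points of the cycle in the order of [ord_sub], so the
    partial products coincide. *)
Lemma phi_hat_phiA (p : nat) (alpha : 'I_p -> R[i]) (theta : 'I_p -> R) (k : 'I_p)
    (A : finType) (pr : A -> A) (thA : A -> R) (alA : A -> R[i]) (a : A) :
  (forall l, thA (iter l pr a) = theta (ord_sub k l)) ->
  (forall l, alA (iter l pr a) = alpha (ord_sub k l)) ->
  (forall x, (fun L => complex.Re (PP N m0 pr thA alA L a x)) @ \oo -->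
     complex.Re (phiA N m0 pr thA alA a x)) ->
  (forall x, (fun L => complex.Im (PP N m0 pr thA alA L a x)) @ \oo -->
     complex.Im (phiA N m0 pr thA alA a x)) ->
  phi_hat N m0 alpha theta k = phiA N m0 pr thA alA a.
Proof.
move=> ht ha c1 c2; apply/funext => x; rewrite /phi_hat.
have -> : (fun L => \prod_(1 <= l < L.+1) ((alpha (ord_sub k l))^* *
    unroll m0 (x / N%:R ^+ l + theta (ord_sub k l)) / sqrtN N)) =
    (fun L => PP N m0 pr thA alA L a x).
  apply/funext => L; rewrite PP_prod; apply: eq_big_nat => l _.
  by rewrite /fac ht ha NconjE.
exact: (cvg_lim (@norm_hausdorff _ (R[i]^o)) (complex_cvg (c1 x) (c2 x))).
Qed.

End PhiHat.

Lemma val_iter_ordS (q : nat) (k : 'I_q) (j : nat) : iter j (@ordS q) k = ((k + j) %% q)%N :> nat.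
Proof.
elim: j => [|j IH]; first by rewrite addn0 modn_small.
by rewrite iterS /= IH addnS -[in LHS]addn1 modnDml addn1.
Qed.

Lemma iter_ordS_onto (q : nat) (k l : 'I_q) : exists j, iter j (@ordS q) k = l.
Proof.
exists (l + q - k)%N; apply: val_inj; rewrite /= val_iter_ordS.
have := ltn_ord k; have := ltn_ord l => lq kq.
have -> : (k + (l + q - k) = l + q)%N by lia.
by rewrite modnDr modn_small.
Qed.

Section CycleTriple.
Context {R : realType} (N : nat) (N2 : (2 <= N)%N) (q : nat).
Context (z : 'I_q -> circle R) (alpha : 'I_q -> R[i]).
Local Notation MR := (measurableTypeR R).
Local Notation C := (cycle_triple N z alpha).

Lemma cycle_triple_semi_inner : semi_inner (@dot R C).
Proof.
have hd := @L2_semi_inner R; split=> [c u v w|u v|u].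
- rewrite /dot /= mulr_sumr -big_split /=; apply: eq_bigr => k _.
  exact: (dotP hd).
- by rewrite /dot /= rmorph_sum; apply: eq_bigr => k _; exact: (dotC hd).
- rewrite /sqnorm /dot /= Re_sum sumr_ge0// => k _; exact: (sqnorm_ge0 hd).
Qed.

Lemma cycle_triple_opU0 : @opU R C 0 = 0.
Proof.
by apply/funext => k; rewrite /= (U00 (ltnW N2)) scaler0.
Qed.

Lemma cycle_triple_opPi0 f : cmeas (unroll f : MR -> R[i]) -> @opPi R C f 0 = 0.
Proof.
move=> mf; apply/funext => k; rewrite /=; apply: pi00.
have [t ->] := cis_surj (z k).
have := cmeas_affine 1 (- t) mf; congr cmeas; apply/funext => x.
by rewrite /unroll mul1r -cisD_circle; congr (f (cis _)); ring.
Qed.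

End CycleTriple.

Theorem mainTheorem4 (R : realType) (N : nat) (m0 : circle R -> R[i])
  (hN : (2 <= N)%N)
  (m0_lipschitz : lipschitz_circle m0)
  (m0_transfer : transfer N m0 (fun=> 1) = (fun=> 1))
  (m0_zeros : finite_set [set z | m0 z = 0])
  (m0_cycle : exists (q : nat) (w : 'I_q -> circle R), is_filter_cycle N m0 w)
  (* the cycles C_i, for i < m *)
  (m : nat) (p : nat -> nat) (z : forall i, 'I_(p i) -> circle R)
  (z_cycle : forall i, (i < m)%N -> is_filter_cycle N m0 (z i))
  (z_distinct : forall i i', (i < m)%N -> (i' < m)%N ->
    range (z i) = range (z i') -> i = i')
  (z_all : forall (q : nat) (w : 'I_q -> circle R), is_filter_cycle N m0 w ->
    exists2 i, (i < m)%N & range w = range (z i))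
  (theta : forall i, 'I_(p i) -> R)
  (z_theta : forall i k, (i < m)%N -> z i k = cis (- theta i k))
  (* the filters m_0, ..., m_(N-1) *)
  (mf : nat -> circle R -> R[i])
  (mf0 : mf 0%N = m0)
  (mf_Linf : forall i, (0 < i < N)%N -> Linf_circle (mf i))
  (mf_unitary : {ae @lebesgue_measure R, forall t,
    (\matrix_(i < N, j < N)
       ((sqrtN N)^-1 * mf i (cis (2 * pi / N%:R) ^+ j * cis (- t))%g))
    \is unitarymx})
  (n : nat) (hn : (1 <= n)%N) (hnm : (n < m)%N) :
  let alpha i (k : 'I_(p i)) : R[i] := m0 (z i k) / sqrtN N in
  let phi i := phi_cycle N m0 (alpha i) (theta i) in
  let C i := cycle_triple N (z i) (alpha i) in
  let HH := dsum C m in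
  let H := dsum C n in
  let incl : H -> HH := @dsum_incl R C n m in
  let P : HH -> HH := orth_proj (@dot R HH) (range incl) in
  let phi_m : HH := fun i : 'I_m => phi i in
  let phi_n : H := fun i : 'I_n => phi i in
  (* for i : 'I_N.-1, the filter number i.+1 ranges over 1, ..., N - 1 *)
  let Psi (i : 'I_N.-1) : HH := op_inv (@opU R HH) (opPi (mf i.+1) phi_m) in
  let psi (i : 'I_N.-1) : H := op_inv (@opU R H) (opPi (mf i.+1) phi_n) in
  let Basis (x : 'I_N.-1 * int * int) : HH := let: (i, j, k) := x in
    op_pow (@opU R HH) j (op_pow (opPi (@cval R)) k (Psi i)) in
  let Frame (x : 'I_N.-1 * int * int) : H := let: (i, j, k) := x in
    op_pow (@opU R H) j (op_pow (opPi (@cval R)) k (psi i)) in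
  [/\ orthonormal_basis (@dot R HH) Basis,
      (forall v, P (opU v) = opU (P v)) /\
      (forall f, Linf_circle f -> forall v, P (opPi f v) = opPi f (P v)),
      forall i, P (Psi i) = incl (psi i),
      normalized_tight_frame (@dot R H) Frame &
      forall x, P (Basis x) = incl (Frame x)].
Proof.
move=> alpha phi C HH H incl P phi_m phi_n Psi psi Basis Frame.
pose tau : R := 2 * pi.
have N0 : (0 < N)%N by exact: ltnW.
have m_gt0 : (0 < m)%N by exact: leq_ltn_trans hnm.
have nm := ltnW hnm.
have [K K0 Mlip] := lipschitz_unroll m0_lipschitz.
have qmf := transfer_qmf hN m0_transfer.
have alpha_unit i k : (i < m)%N -> nsq (alpha i k) = 1.
  move=> im; have [_ /(_ k) h] := z_cycle i im.
  rewrite /alpha nsqM nsqV nsq_sqrtN.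
  have -> : nsq (m0 (z i k)) = N%:R.
    apply: (can_inj (fun x => erefl : complex.Re x%:C = x)).
    by rewrite nsqE h expr2 sqrtN_sqr rmorph_nat.
  by rewrite mulfV// pnatr_eq0 -lt0n.
pose A := {i : 'I_m & 'I_(p i)}.
pose thA := @thetaA R p theta m; pose alA := @alphaA R p alpha m.
pose sA := @succA p m; pose pA := @predA p m.
have sK := @succAK p m; have prK := @predAK p m.
have zth (a : A) : z (tag a) (tagged a) = cis (- thA a) by apply: z_theta; exact: ltn_ord.
have theta_s (a : A) : exists k : int, N%:R * thA a = thA (sA a) + k%:~R * tau.
  have [[_ _ /(_ (tagged a)) h] _] := z_cycle (tag a) (ltn_ord _).
  move: h; rewrite !(z_theta _ _ (ltn_ord _)) cis_circleX => /cis_eq[k e].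
  exists (- k); rewrite rmorphN mulNr /thA /thetaA /=; move: e; rewrite mulrN.
  by rewrite /tau; lra.
have M_theta (a : A) : unroll m0 (thA a) = alA a * sqrtN N.
  rewrite /alA /alphaA /alpha mulfVK; last exact: sqrtN_neq0.
  by rewrite /unroll -zth.
have al1 (a : A) : nsq (alA a) = 1 by apply: alpha_unit; exact: ltn_ord.
(* Two cycles sharing a point coincide as sets, since the successor map runs through each of them
   entirely; distinctness of the cycles and injectivity on each then force a = b. *)
have theta_inj (a b : A) (k : int) : thA a = thA b + k%:~R * tau -> a = b.
  move=> e; have zab : z (tag a) (tagged a) = z (tag b) (tagged b).
    rewrite !zth e opprD -mulNr -rmorphN; exact: cis_2pi.
  have orb (i i' : 'I_m) (l : 'I_(p i)) (l' : 'I_(p i')) j : z i l = z i' l' ->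
      z i (iter j (@ordS _) l) = z i' (iter j (@ordS _) l').
    move=> h; elim: j => [//|j IH].
    have [[_ _ c1] _] := z_cycle i (ltn_ord i); have [[_ _ c2] _] := z_cycle i' (ltn_ord i').
    by rewrite !iterS -c1 -c2 IH.
  have sub (i i' : 'I_m) (l : 'I_(p i)) (l' : 'I_(p i')) : z i l = z i' l' ->
      range (z i) `<=` range (z i').
    move=> h _ [l2 _ <-]; have [j <-] := iter_ordS_onto l l2.
    by rewrite (orb _ _ _ _ j h); exists (iter j (@ordS _) l').
  move: a b zab {e} => [i l] [i' l'] /= zab.
  have ii : i = i'.
    apply: val_inj; apply: z_distinct; rewrite ?ltn_ord//.
    by apply/seteqP; split; [exact: (sub _ _ _ _ zab)|exact: (sub _ _ _ _ (esym zab))].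
  move: zab; rewrite -ii in l' * => zab.
  by have [[_ inj _] _] := z_cycle i (ltn_ord i); rewrite (inj _ _ zab).
have [a0 _] : exists a : A, True.
  have [[p0 _ _] _] := z_cycle 0%N m_gt0.
  by exists (Tagged (fun i : 'I_m => 'I_(p i)) (i := Ordinal m_gt0) (Ordinal p0)).
have complete (q : nat) (w : 'I_q -> circle R) : is_filter_cycle N m0 w ->
    exists k a, w k = cis (- thA a).
  move=> hw; have [i im e] := z_all q w hw; have [[q0 _ _] _] := hw.
  have : range w (w (Ordinal q0)) by exists (Ordinal q0).
  rewrite e => -[l _ h]; exists (Ordinal q0).
  exists (Tagged (fun i : 'I_m => 'I_(p i)) (i := Ordinal im) l).
  by rewrite -h -zth.
pose ph (a : A) : measurableTypeR R -> R[i] := phiA N m0 pA thA alA a.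
have cvA a x := phiA_cvg hN Mlip qmf pA M_theta al1 a x.
have mf_meas i : (i < N)%N -> cmeas (unroll (mf i) : measurableTypeR R -> R[i]).
  case: i => [_|i iN]; first by rewrite mf0; exact: (cmeas_mask Mlip).
  exact: Linf_cmeas (mf_Linf i.+1 iN).
pose F := bounded_filter N mf.
(* For m0 the bound |m0|^2 <= N holds at every point, so its truncation is m0 itself and the
   refinement equation stays exact. *)
have F0 t : F 0%N t = unroll m0 t.
  by rewrite /F /bounded_filter mf0 (nsq_mask_le hN qmf).
have ph_meas a : cmeas (ph a) by exact: (cmeas_phiA hN Mlip qmf pA M_theta al1 a).
have ph_le a x : nsq (ph a x) <= 1 by exact: (nsq_phiA_le1 hN Mlip qmf pA M_theta al1 a x).
have ph_refine a x : ph (sA a) (N%:R * x) =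
    ((alA a)^*)%C * F 0%N (x + thA a) / sqrtN N * ph a x.
  by rewrite /ph (phiA_refine hN Mlip qmf sK M_theta al1) F0.
have [d d0 sep] := separated hN theta_inj.
have ph_near a x : 1 - 2 * K * `|x| <= nsq (ph a x).
  exact: (nsq_phiA_near hN Mlip qmf pA M_theta al1 a x).
have ph_tile t : tilesum thA (fun a x => nsq (ph a x)) t = 1%E.
  exact: (hsum_eq1 hN Mlip qmf sK prK theta_s M_theta al1 theta_inj a0 m0_zeros complete t).
have sqi_ph a : sqi (@lebesgue_measure R) (ph a).
  by apply: (sqi_tilesum (theta := thA)) => // t; rewrite ph_tile.
have ph_rep : rep (phi_m : HH) ph.
  move=> a; rewrite /comp /phi_m /phi /phi_cycle fourier_op_invK.
  have -> : phi_hat N m0 (alpha (tag a)) (theta (tag a)) (tagged a) = ph a.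
    have it l : iter l pA a = Tagged (fun i : 'I_m => 'I_(p i)) (ord_sub (tagged a) l).
      by elim: l => [|l IH]; [case: (a)|rewrite iterS IH].
    apply: phi_hat_phiA => [l|l|x|x]; [by rewrite it|by rewrite it| |].
      by have [] := cvA a x.
    by have [] := cvA a x.
  exact: to_L2E.
have BE : Basis = basis_vec mf (phi_m : HH) by apply/funext => -[[i j] k].
have hHH := @dsum_semi_inner R N p z alpha m.
have hH := @dsum_semi_inner R N p z alpha n.
have hd i := cycle_triple_semi_inner N (z i) (alpha i).
have df := @dsum_dot_eq0 R N p z alpha n.
have PE v : P v = incl (restr nm v) by exact: (orth_proj_incl nm hd hH hHH df v).
have zth_n i k : (i < n)%N -> z i k = cis (- theta i k).
  by move=> h; apply: z_theta; exact: ltn_trans h hnm.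
have al_n i k : (i < n)%N -> nsq (alpha i k) = 1.
  by move=> h; apply: alpha_unit; exact: ltn_trans h hnm.
have rU v : restr nm (op_inv (@opU R HH) v) = op_inv (@opU R H) (restr nm v).
  exact: (restr_op_inv (opUK hN alpha_unit) (opUiK hN alpha_unit) (opUK hN al_n) (opUiK hN al_n)).
have rPi v : restr nm (op_inv (@opPi R HH (@cval R)) v) = op_inv (@opPi R H (@cval R)) (restr nm v).
  exact: (restr_op_inv (opPi_cvalK z_theta) (opPi_cvalJK z_theta) (opPi_cvalK zth_n) (opPi_cvalJK zth_n)).
have restr_Psi i : restr nm (Psi i) = psi i by rewrite /Psi rU.
have restr_Basis x : restr nm (Basis x) = Frame x.
  case: x => -[i j] k; rewrite /Basis /Frame.
  rewrite (restr_op_pow (f := @opU R HH) (f' := @opU R H))//.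
  rewrite (restr_op_pow (f := @opPi R HH (@cval R)) (f' := @opPi R H (@cval R)))//.
  by rewrite restr_Psi.
have F_unitary := bounded_filter_unitary hN mf_unitary.
have par := basis_parseval hN z_theta alpha_unit (cmeas_bounded_filter mf_meas)
  (fun i t _ => bounded_filter_le N mf i t) (bounded_filter_per N mf) F_unitary theta_s
  ph_meas ph_le ph_refine d0 K0 sep ph_near ph_tile mf_meas
  (fun i => bounded_filter_ae hN mf_unitary (i := i)) ph_rep.
split.
- rewrite BE; exact: (basis_orthonormal hN z_theta alpha_unit (cmeas_bounded_filter mf_meas)
    (fun i t _ => bounded_filter_le N mf i t) (bounded_filter_per N mf) F_unitary
    (bounded_filter_norm hN mf_meas mf_unitary) theta_s
    ph_meas ph_le ph_refine d0 K0 sep ph_near ph_tile mf_meas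
    (fun i => bounded_filter_ae hN mf_unitary (i := i)) ph_rep).
(* Both operators act summand by summand and send 0 to 0, so they commute with extension by zero. *)
- split=> [v|f hf v]; rewrite !PE.
    apply/esym/(incl_morph nm (f := fun i => @opU R (C i))) => i.
    exact: cycle_triple_opU0.
  apply/esym/(incl_morph nm (f := fun i => @opPi R (C i) f)) => i.
  by apply: cycle_triple_opPi0; exact: Linf_cmeas.
- by move=> i; rewrite PE restr_Psi.
(* The inclusion is isometric, and the coefficients of [incl v] against the basis are those of [v]
   against its restrictions, the frame vectors. *)
- apply: parseval_tight_frame => v.
  have sv : sqnorm (@dot R H) v = sqnorm (@dot R HH) (incl v).
    by rewrite /sqnorm (dot_incl nm hd) restr_incl.
  rewrite sv -(par (incl v)) -BE; apply: eq_esum => x _.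
  by rewrite (dot_incl nm hd) restr_Basis.
- by move=> x; rewrite PE restr_Basis.
Qed.
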